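(* Let $n\ge 1$, and assume that $p=0$ or $p>n$, and that $\delta\neq 0$ if $n$ is even. Let $\lambda,\mu\in\Lambda(m,n)$ and put $\omega=|\lambda|=(|\lambda^0|,\ldots,|\lambda^{m-1}|)$. Then: (i) $\operatorname{Hom}_{B^m_n}(\Delta_n(\lambda),\Delta_n(\mu))$ is isomorphic to $$\operatorname{Hom}_{B(\omega_0,\overline{\delta}_0)}(\Delta_B(\lambda^0),\Delta_B(\mu^0))\otimes\bigotimes_{0<r<m/2}\operatorname{Hom}_{WB(\omega_r,\omega_{m-r},\overline{\delta}_r)}(\Delta_{WB}(\lambda^r,\lambda^{m-r}),\Delta_{WB}(\mu^r,\mu^{m-r}))\otimes\operatorname{Hom}_{B(\omega_{m/2},\overline{\delta}_{m/2})}(\Delta_B(\lambda^{m/2}),\Delta_B(\mu^{m/2})).$$ (ii) The decomposition numbers factorise as $$[\Delta_n(\mu):L_n(\lambda)]=[\Delta_B(\mu^0):L_B(\lambda^0)]\times\prod_{0<r<m/2}[\Delta_{WB}(\mu^r,\mu^{m-r}):L_{WB}(\lambda^r,\lambda^{m-r})]\times[\Delta_B(\mu^{m/2}):L_B(\lambda^{m/2})],$$ with the modules on the right-hand side taken over the same Brauer and walled Brauer algebras as in (i). In (i) and (ii) the last factor (indexed by $m/2$) is omitted when $m$ is odd.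
   Context: $k$ is an algebraically closed field of characteristic $p\ge 0$, $m\ge 1$ is an integer invertible in $k$, $\xi\in k$ is a fixed primitive $m$-th root of unity, and $\delta=(\delta_0,\ldots,\delta_{m-1})\in k^m$. Cyclotomic Brauer algebra $B_n^m=B_n^m(\delta)$. A reduced $(m,n)$-diagram is a perfect matching of $n$ northern nodes $1,\ldots,n$ and $n$ southern nodes $\bar1,\ldots,\bar n$, each strand being oriented and labelled by an element of $\mathbb Z/m\mathbb Z$; reversing the orientation of a strand replaces its label by the negative, and diagrams equal up to such changes are identified. Strands joining a northern to a southern node are through strands, the others are arcs. $B_n^m$ has $k$-basis the reduced $(m,n)$-diagrams. The product $x\cdot y$ is obtained by placing $x$ above $y$, identifying southern nodes of $x$ with northern nodes of $y$, choosing compatible orientations, and adding labels along each new strand; each closed loop is oriented so that it points downwards at its leftmost central node, and if its total label is then $i$ it is replaced by the scalar $\delta_i$. $B_0^m=k$. $t_i$ denotes the diagram with through strands $l\to\bar l$, the strand at $i$ (oriented downwards) labelled $1$ and all others labelled $0$. The span of the diagrams without arcs is the subalgebra $H_n^m\cong k((\mathbb Z/m\mathbb Z)\wr\Sigma_n)$. Specht modules. An $m$-partition of $N$ is a tuple $\lambda=(\lambda^0,\ldots,\lambda^{m-1})$ of partitions with $\sum|\lambda^i|=N$. For a $k\Sigma_a$-module $M$, $M^{(r)}$ is the $H_a^m$-module that equals $M$ over $\Sigma_a$ and on which every $t_i$ acts by $\xi^{r}$. $S(\cdot)$ denotes the Specht modules of symmetric groups, and $\mathbf S(\lambda)$ is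 the $H_N^m$-module induced from $S(\lambda^0)^{(0)}\otimes\cdots\otimes S(\lambda^{m-1})^{(m-1)}$ over the subalgebra $k((\mathbb Z/m\mathbb Z)\wr(\Sigma_{|\lambda^0|}\times\cdots\times\Sigma_{|\lambda^{m-1}|}))$. Cell (standard) modules. $\Lambda(m,n)$ is the set of $m$-partitions of $n-2l$, $0\le l\le\lfloor n/2\rfloor$. An $(m,n,l)$-dangle is a partition of $\{1,\ldots,n\}$ into $l$ pairs (arcs), each labelled by an element of $\mathbb Z/m\mathbb Z$ and oriented left to right, and $n-2l$ singletons (free nodes, drawn as downward lines). $V(m,n,l)$ is the $k$-span of these. For an $m$-partition $\lambda$ of $n-2l$, $\Delta_n(\lambda)=V(m,n,l)\otimes\mathbf S(\lambda)$, where a diagram $X$ acts on $d\otimes x$ as follows: place $X$ above $d$, choose compatible orientations and concatenate (labels added and closed loops replaced by scalars as in the product of $B_n^m$), giving an $(m,n,l+t)$-dangle $Xd$ and an element $\sigma\in H^m_{n-2(l+t)}$ acting on the free nodes; if $t>0$ then $X(d\otimes x)=0$, otherwise $X(d\otimes x)=(Xd)\otimes\sigma x$. Under the stated assumptions $B_n^m$ is quasi-hereditary, with standard modules $\Delta_n(\lambda)$; $\Delta_n(\lambda)$ has simple head $L_n(\lambda)$, and these are all the simple modules. $[M:L]$ is composition multiplicity. $\overline{\delta}_r=\frac1m\sum_{i=0}^{m-1}\xi^{ir}\delta_i$. $B(a,d)$ is the classical Brauer algebra on $a$ strands with loop parameter $d$ ($B(0,d)=k$). Its standard (cell) modules $\Delta_B(\nu)$,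 for $\nu$ a partition of $a-2l$, $0\le l\le\lfloor a/2\rfloor$, are the inflations $V(1,a,l)\otimes S(\nu)$ (that is, the modules $\Delta_a(\nu)$ above in the case $m=1$, $\delta_0=d$). $WB(a,b,d)$ is the walled Brauer algebra: the subalgebra of $B(a+b,d)$ spanned by diagrams in which, with a wall after the first $a$ northern and southern nodes, every arc crosses the wall and no through strand does. Its standard (cell) modules $\Delta_{WB}(\nu,\tau)$, for $\nu\vdash a-l$, $\tau\vdash b-l$, $0\le l\le\min(a,b)$, are obtained by inflating $S(\nu)\otimes S(\tau)$ along the span of dangles with $l$ arcs all crossing the wall. $L_B(\nu)$, $L_{WB}(\nu,\tau)$ are the simple heads (here only needed when $l=0$). A standard module $\Delta_B(\nu)$ or $\Delta_{WB}(\nu,\tau)$ whose label is not in the index set of the algebra concerned is interpreted as $0$.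
   Formalization: It is assumed in addition that the product of B_n^m(δ) is associative; for n ≥ 2 this forces δ_i = δ_{-i} for all i, and without it B_n^m(δ) with the stated loop convention is not an algebra (for n = 1 nothing is assumed). *)

(* Defs.v *)
From HB Require Import structures.
From mathcomp Require Import all_boot all_order fingroup perm all_algebra.
From mathcomp Require Import boolp classical_sets.

Set Implicit Arguments.
Unset Strict Implicit.
Unset Printing Implicit Defensive.

Import GRing.Theory.
Local Open Scope ring_scope.

(* Labelled diagrams with a northern and b southern nodes.  A diagram maps each
   node v to the other end of its strand together with the label this strand
   has when it is oriented away from v; the opposite orientation carries the
   opposite label, so diagrams that differ by changes of orientation are equal.
   The reduced (m, n)-diagrams are the elements of diag 'I_m n n. *)
Section Diagrams.
Variable Z : finZmodType.

Definition is_diag a b (f : {ffun 'I_a + 'I_b -> ('I_a + 'I_b) * Z}) :=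
  [forall v, [&& (f v).1 != v, (f (f v).1).1 == v & (f (f v).1).2 == - (f v).2]].

Definition diag a b := {f : {ffun 'I_a + 'I_b -> ('I_a + 'I_b) * Z} | is_diag f}.

Definition mate a b (d : diag a b) (v : 'I_a + 'I_b) : 'I_a + 'I_b := (val d v).1.
Definition lab a b (d : diag a b) (v : 'I_a + 'I_b) : Z := (val d v).2.

Lemma mate_neq a b (d : diag a b) v : mate d v != v.
Proof. by have /forallP/(_ v)/and3P[] := valP d. Qed.

Lemma mateK a b (d : diag a b) : involutive (mate d).
Proof. by move=> v; have /forallP/(_ v)/and3P[_ /eqP] := valP d. Qed.

Lemma lab_mate a b (d : diag a b) v : lab d (mate d v) = - lab d v.
Proof. by have /forallP/(_ v)/and3P[_ _ /eqP] := valP d. Qed.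

(* The stacking of x above y.  Being at a state means standing at that node,
   about to traverse its strand; cnext traverses the strand and passes from
   the southern nodes of x to the northern nodes of y or conversely. *)
Section Composition.
Variables (a b c : nat) (x : diag a b) (y : diag b c).

Notation state := (('I_a + 'I_b) + ('I_b + 'I_c))%type.

Definition across (s : state) : state :=
  match s with inl u => inl (mate x u) | inr u => inr (mate y u) end.

Definition slab (s : state) : Z :=
  match s with inl u => lab x u | inr u => lab y u end.

Definition glue (s : state) : state :=
  match s with
  | inl (inr j) => inr (inl j)
  | inr (inl j) => inl (inr j)
  | _ => s
  end.

Definition cnext (s : state) : state := glue (across s).

Definition inner (v : 'I_a + 'I_c) : state :=
  match v with inl i => inl (inl i) | inr j => inr (inr j) end.

Definition outer (s : state) : option ('I_a + 'I_c) :=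
  match s with
  | inl (inl i) => Some (inl i)
  | inr (inr j) => Some (inr j)
  | _ => None
  end.

Definition clen (v : 'I_a + 'I_c) : nat :=
  find (fun s => isSome (outer (across s))) (fingraph.orbit cnext (inner v)).

Definition comp_fun (v : 'I_a + 'I_c) : ('I_a + 'I_c) * Z :=
  (odflt v (outer (across (iter (clen v) cnext (inner v)))),
   \sum_(i < (clen v).+1) slab (iter i cnext (inner v))).

Lemma acrossK : involutive across.
Proof. by case=> u /=; rewrite mateK. Qed.

Lemma across_neq s : across s != s.
Proof.
by case: s => u; apply/negP => /eqP[] /eqP; rewrite (negPf (mate_neq _ _)).
Qed.

Lemma slab_across s : slab (across s) = - slab s.
Proof. by case: s => u /=; rewrite lab_mate. Qed.

Lemma glueK : involutive glue. Proof. by case=> -[]. Qed.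

Lemma outer_glue s : outer (glue s) = outer s. Proof. by case: s => -[]. Qed.

Lemma glue_outer s : outer s = None <-> glue s != s.
Proof. by case: s => -[] i //=; split=> //; rewrite eqxx. Qed.

Lemma innerK v : outer (inner v) = Some v. Proof. by case: v. Qed.

Lemma outerK s v : outer s = Some v -> s = inner v.
Proof. by case: s => -[] i //= [<-]. Qed.

Lemma cnext_inj : injective cnext.
Proof. by move=> s t /(can_inj glueK)/(can_inj acrossK). Qed.

Lemma across_cnext i s :
  across (iter i cnext (across (iter i cnext s))) = s.
Proof.
elim: i s => [|i IHi] s; first exact: acrossK.
rewrite iterSr [in X in iter i cnext X]iterS /cnext acrossK glueK.
exact: IHi.
Qed.

Lemma clenP v :
  [/\ outer (across (iter (clen v) cnext (inner v))) != None
    & forall i, (i < clen v)%N -> outer (across (iter i cnext (inner v))) = None].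
Proof.
pose p s := isSome (outer (across s)).
have orb i : (i < fingraph.order cnext (inner v))%N ->
    nth (inner v) (fingraph.orbit cnext (inner v)) i = iter i cnext (inner v).
  by move=> lti; rewrite /fingraph.orbit nth_traject.
have hasp : has p (fingraph.orbit cnext (inner v)).
  apply/hasP; exists (iter (fingraph.order cnext (inner v)).-1 cnext (inner v)).
    by rewrite -fconnect_orbit fconnect_iter.
  rewrite /p; have := iter_order cnext_inj (inner v).
  rewrite -(orderSpred cnext (inner v)) iterS /= => /(congr1 outer).
  by rewrite outer_glue innerK => ->.
have lt_o : (clen v < fingraph.order cnext (inner v))%N.
  by rewrite -(size_orbit cnext (inner v)) -has_find.
split.
  by have := nth_find (inner v) hasp; rewrite orb // /p; case: outer.
move=> i lti; have := before_find (inner v) lti.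
by rewrite orb ?(ltn_trans lti lt_o) //; case: outer.
Qed.

Lemma comp_is_diag : is_diag [ffun v => comp_fun v].
Proof.
apply/forallP=> v; rewrite !ffunE.
have [] := clenP v; set k := clen v.
case Dw: (outer _) => [w|] // _ minv.
have Ew := outerK Dw.
have Ev i : (i <= k)%N ->
    iter i cnext (inner w) = across (iter (k - i) cnext (inner v)).
  move=> leik; rewrite -{1}(subnK leik) in Ew.
  rewrite addnC iterD in Ew.
  by rewrite -[LHS]acrossK -Ew across_cnext.
have Dk : clen w = k.
  have [] := clenP w; set k' := clen w => outw minw.
  apply/eqP; rewrite eqn_leq; apply/andP; split; rewrite leqNgt; apply/negP=> lt.
    have := minw k lt; rewrite Ev // subnn acrossK /=.
    by rewrite innerK.
  move: outw; rewrite Ev ?(ltnW lt) // acrossK.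
  have -> : (k - k' = (k - k'.+1).+1)%N by rewrite subnSK.
  rewrite iterS outer_glue minv //.
  by rewrite -subSn // subSS leq_subr.
have E1 : (comp_fun v).1 = w by rewrite /comp_fun /= -/k Dw.
rewrite E1.
have E2 : (comp_fun w).1 = v.
  by rewrite /comp_fun /= Dk Ev // subnn acrossK innerK.
rewrite E2 eqxx /=; apply/andP; split.
- apply/eqP=> wv; rewrite wv in Ev.
  have kE := odd_double_half k; rewrite -addnn in kE.
  set h := k./2 in kE; have leh : (h <= k)%N by rewrite -kE addnC -addnA leq_addr.
  have := Ev h leh; case: (odd k) kE => kE.
    have lth : (h < k)%N by rewrite -kE add1n ltnS leq_addr.
    rewrite -{1}kE addnA addnK add1n iterS => E.
    have := minv h lth => /glue_outer/eqP; apply.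
    by rewrite -[LHS]acrossK -[glue _]/(cnext _) -E.
  rewrite -{1}kE add0n addnK => E.
  by have := across_neq (iter h cnext (inner v)); rewrite -E eqxx.
- apply/eqP; rewrite /comp_fun /= Dk -/k -sumrN.
  rewrite (reindex_inj rev_ord_inj) /=; apply: eq_bigr => i _.
  by rewrite subSS Ev ?leq_subr // subKn ?leq_ord // slab_across.
Qed.

Definition comp : diag a c := Sub _ comp_is_diag.

(* The orbit under cnext of the state "at the northern node j of y" is the
   walk that goes downwards at the central node j; it is a closed loop exactly
   when it does not meet an outer node. *)
Definition loop_root (j : 'I_b) : bool :=
  let o := fingraph.orbit cnext (inr (inl j)) in
  all (fun s => outer s == None) o &&
  [forall j' : 'I_b, ((inr (inl j') \in o) || (inl (inr j') \in o)) ==> (j <= j')%N].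

Definition loop_label (j : 'I_b) : Z :=
  \sum_(s <- fingraph.orbit cnext (inr (inl j))) slab s.

Definition loops (k : pzSemiRingType) (delta : Z -> k) : k :=
  \prod_(j < b | loop_root j) delta (loop_label j).

End Composition.

(* Dangles on n nodes with b free nodes, drawn as diagrams whose southern nodes
   are joined to the free nodes by non-crossing lines labelled 0.  The number
   of arcs is (n - b) / 2; there is no dangle unless b <= n and n - b is even. *)
Definition is_dangle n b (d : diag n b) :=
  [forall j : 'I_b, [exists i : 'I_n, (mate d (inr j) == inl i) && (lab d (inr j) == 0)]]
  && [forall j1 : 'I_b, forall j2 : 'I_b, forall i1 : 'I_n, forall i2 : 'I_n,
       [&& (j1 < j2)%N, mate d (inr j1) == inl i1 & mate d (inr j2) == inl i2]
       ==> (i1 < i2)%N].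

(* Walls after the first a northern and the first c southern nodes: a strand
   crosses the wall if and only if it is an arc. *)
Definition walled a c n b (d : diag n b) :=
  let north (v : 'I_n + 'I_b) := if v is inl _ then true else false in
  let left (v : 'I_n + 'I_b) :=
    match v with inl i => (i < a)%N | inr j => (j < c)%N end in
  [forall v, (north v == north (mate d v)) == (left v != left (mate d v))].

(* The wreath product of Z with the symmetric group.  (l, s) stands for the
   diagram whose strand at the northern node i goes down to s i with label l i. *)
Definition wreath N := ({ffun 'I_N -> Z} * 'S_N)%type.

Definition wmul N (g h : wreath N) : wreath N :=
  ([ffun i => g.1 i + h.1 (g.2 i)], (g.2 * h.2)%g).

Definition wdiag_fun N (g : wreath N) (v : 'I_N + 'I_N) : ('I_N + 'I_N) * Z :=
  match v with
  | inl i => (inr (g.2 i), g.1 i)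
  | inr j => (inl ((g.2^-1)%g j), - g.1 ((g.2^-1)%g j))
  end.

Lemma wdiag_is_diag N (g : wreath N) : is_diag [ffun v => wdiag_fun g v].
Proof.
by apply/forallP=> -[] i; rewrite !ffunE /= ?permK ?permKV ?opprK !eqxx.
Qed.

Definition wdiag N (g : wreath N) : diag N N := Sub _ (wdiag_is_diag g).

End Diagrams.

(* The algebra with basis the diagrams in diag Z n n and parameters delta; for
   Z = 'I_m this is B_n^m(delta).  For n >= 2 this product is associative only if
   delta i = delta (- i) for all i: stack an arc labelled i above a crossing
   above an unlabelled arc. *)
Definition dmul (k : pzSemiRingType) (Z : finZmodType) (delta : Z -> k) n
    (f g : {ffun diag Z n n -> k}) : {ffun diag Z n n -> k} :=
  [ffun z => \sum_(x : diag Z n n) \sum_(y : diag Z n n | comp x y == z)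
               loops x y delta * f x * g y].

Section Modules.
Variable k : fieldType.

(* U (x) V for finite-dimensional U and V, modelled as Hom(U^*, V). *)
Definition tensv (U V : vectType k) : vectType k := 'Hom('Hom(U, k^o), V).

Definition unitv : vectType k := k^o.

Definition pure_tensv (U V : vectType k) (u : U) (v : V) : tensv U V :=
  linfun (fun phi : 'Hom(U, k^o) => (phi u : k) *: v).

Definition tens_map (U V : vectType k) (f : 'End(U)) (g : 'End(V)) :
    'End(tensv U V) :=
  linfun (fun t : tensv U V =>
            (g \o t \o linfun (fun phi : 'Hom(U, k^o) => phi \o f))%VF).

Definition isov (U V : vectType k) := exists f : 'Hom(U, V), bijective f.

(* A module over an algebra with k-basis D, given by the action of the basis;
   homomorphisms, submodules and subquotients only depend on this action. *)
Record rep (D : finType) := Rep { car :> vectType k; act : D -> 'End(car) }.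

Definition pull (D E : finType) (f : E -> D) (M : rep D) : rep E :=
  @Rep E M (fun x => act M (f x)).

Definition triv_rep (D : finType) : rep D := @Rep D k^o (fun=> \1%VF).

Definition tens_rep (D : finType) (M N : rep D) : rep D :=
  @Rep D (tensv M N) (fun x => tens_map (act M x) (act N x)).

Section Theory.
Variable D : finType.
Implicit Types M N : rep D.

Definition homv M N : {vspace 'Hom(M, N)} :=
  (\bigcap_(x : D) lker (linfun (fun f : 'Hom(M, N) =>
                                   (act N x \o f)%VF - (f \o act M x)%VF)))%VS.

Lemma homvP M N (f : 'Hom(M, N)) :
  reflect (forall x v, f (act M x v) = act N x (f v)) (f \in homv M N).
Proof.
have E x : (f \in lker (linfun (fun f : 'Hom(M, N) =>
     (act N x \o f)%VF - (f \o act M x)%VF)))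
   = ((act N x \o f)%VF == (f \o act M x)%VF).
  pose h (f : 'Hom(M, N)) := (act N x \o f)%VF - (f \o act M x)%VF.
  have lin_h : linear h.
    move=> c u v; rewrite /h comp_lfunDr comp_lfunDl -comp_lfunZr -comp_lfunZl.
    by rewrite scalerBr opprD addrACA.
  pose hL := HB.pack_for {linear 'Hom(M, N) -> 'Hom(M, N)} h
     (GRing.isLinear.Build _ _ _ _ h lin_h).
  by rewrite memv_ker (lfunE hL) /= subr_eq0.
apply: (iffP idP) => [hf x v|hf].
  have : f \in lker (linfun (fun f : 'Hom(M, N) =>
     (act N x \o f)%VF - (f \o act M x)%VF)).
    by apply: subvP hf; exact: bigcapv_inf.
  by rewrite E => /eqP/lfunP/(_ v); rewrite !comp_lfunE => ->.
rewrite memvE; apply/subv_bigcapP=> x _; rewrite -memvE E.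
by apply/eqP/lfunP=> v; rewrite !comp_lfunE hf.
Qed.

Definition Hom_rep M N : vectType k := subvs_of (homv M N).

Definition isor M N := exists2 f : 'Hom(M, N), f \in homv M N & bijective f.

Definition submod M (U : {vspace M}) := [forall x : D, (act M x @: U <= U)%VS].

(* The subquotient V / U, carried by a complement of U in V. *)
Definition subquot M (U V : {vspace M}) : rep D :=
  @Rep D (subvs_of (V :\: U)%VS)
    (fun x => (linfun (vsproj (V :\: U)%VS) \o addv_pi1 V U \o act M x
               \o linfun (@vsval k M (V :\: U)%VS))%VF).

Definition simple M :=
  {:M}%VS != 0%VS
  /\ forall U : {vspace M}, submod U -> U = 0%VS \/ U = {:M}%VS.

Definition max_submod M (W : {vspace M}) :=
  [/\ submod W, W <> {:M}%VS
    & forall U : {vspace M}, submod U -> (W <= U)%VS -> U = W \/ U = {:M}%VS].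

Definition radical M : {vspace M} :=
  xget 0%VS (fun U : {vspace M} =>
    forall v : M, v \in U <-> (forall W, max_submod W -> v \in W)).

Definition rep_head M : rep D := subquot (radical M) {:M}%VS.

(* s lists the non-zero terms of the series, in increasing order. *)
Definition comp_factor M (s : seq {vspace M}) i : rep D :=
  subquot (nth 0%VS (0%VS :: s) i) (nth 0%VS s i).

Definition comp_series M (s : seq {vspace M}) :=
  last 0%VS s = {:M}%VS
  /\ forall i, (i < size s)%N ->
       [/\ submod (nth 0%VS s i),
           (nth 0%VS (0%VS :: s) i <= nth 0%VS s i)%VS
         & simple (comp_factor s i)].

Definition mult M (L : rep D) : nat :=
  let s := xget [::] (@comp_series M) in
  (\sum_(i < size s) `[< isor (comp_factor s i) L >])%N.

End Theory.

(* k[D] (x) W is modelled by {ffun D -> W}; this is d (x) w. *)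
Definition dtens (D : finType) (W : vectType k) (d : D) (w : W) : {ffun D -> W} :=
  [ffun d' => if d' == d then w else 0].

(* H (x)_K W, the quotient of H (x)_k W by all h i(g) (x) w - h (x) g w, for
   algebras with multiplicative bases H and K and an embedding i of K in H. *)
Section Induction.
Variables (H K : finType) (mulH : H -> H -> H) (i : K -> H) (W : rep K).

Definition free_rep : rep H :=
  @Rep H {ffun H -> W} (fun h =>
    linfun (fun f : {ffun H -> W} => \sum_(h' : H) dtens (mulH h h') (f h'))).

Definition ind_rel : {vspace free_rep} :=
  <<[seq dtens (mulH hg.1 (i hg.2)) w - dtens hg.1 (act W hg.2 w)
       | hg <- enum (predT : pred (H * K)), w <- vbasis {:W}%VS]>>%VS.

Definition induce : rep H := subquot ind_rel {:free_rep}%VS.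

End Induction.

(* The inflation of M along the dangles E: x (d (x) u) = delta-factor times
   d' (x) g u where x d = d' g, and 0 if x d has no such factorisation (that
   is, if some free nodes of d get joined); d' and g are unique. *)
Section Inflation.
Variables (Z : finZmodType) (delta : Z -> k) (n b : nat).
Variables (D E G : finType) (ofD : D -> diag Z n n) (ofE : E -> diag Z n b).
Variables (ofG : G -> diag Z b b) (M : rep G).

Definition inflate : rep D :=
  @Rep D {ffun E -> M} (fun x => linfun (fun f : {ffun E -> M} =>
    \sum_(d : E)
      \sum_(eg : E * G | comp (ofE eg.1) (ofG eg.2) == comp (ofD x) (ofE d))
        loops (ofD x) (ofE d) delta *: dtens eg.1 (act M eg.2 (f d)))).

End Inflation.

(* Specht modules.  The cells of the Young diagram of nu are numbered row by
   row by 'I_(sumn nu); a tableau is a permutation, sending cells to entries, and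
   a tabloid is recorded by the function sending an entry to its row. *)
Section Specht.
Variable nu : seq nat.
Notation N := (sumn nu).

Definition cell_row (c : 'I_N) : 'I_(size nu) := Ordinal (reshape_indexP (ltn_ord c)).
Definition cell_col (c : 'I_N) : nat := reshape_offset nu c.

Definition tabloid_of (t : 'S_N) : {ffun 'I_N -> 'I_(size nu)} :=
  [ffun e => cell_row ((t^-1)%g e)].

Definition polytabloid (t : 'S_N) : {ffun {ffun 'I_N -> 'I_(size nu)} -> k^o} :=
  \sum_(q : 'S_N | [forall c, cell_col (q c) == cell_col c])
     (-1) ^+ q *: dtens (tabloid_of (q * t)%g) (1 : k^o).

Definition spechtv : {vspace {ffun {ffun 'I_N -> 'I_(size nu)} -> k^o}} :=
  <<[seq polytabloid t | t : 'S_N]>>%VS.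

(* A permutation g is read as the diagram with strands from the northern node e
   to the southern node g e, so it moves the entry g e to the entry e. *)
Definition tabloid_act (g : 'S_N) (f : {ffun {ffun 'I_N -> 'I_(size nu)} -> k^o}) :=
  \sum_(T : {ffun 'I_N -> 'I_(size nu)}) dtens [ffun e => T (g e)] (f T).

Definition specht : rep 'S_N :=
  @Rep 'S_N (subvs_of spechtv)
    (fun g => linfun (fun v : subvs_of spechtv =>
                vsproj spechtv (tabloid_act g (vsval v)))).

End Specht.

Section Cyclotomic.
Variables (m' : nat) (xi : k).
Notation m := m'.+1.

(* M^(r): the labels act through the scalar xi ^ r for each unit of label. *)
Definition twist (r : nat) a (M : rep 'S_a) : rep (wreath 'I_m a) :=
  @Rep (wreath 'I_m a) M (fun g => xi ^+ (r * \sum_(i < a) g.1 i) *: act M g.2).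

Section Block.
Variable a : 'I_m -> nat.
Notation N := (\sum_(r < m) a r)%N.

Definition young : finType :=
  ({ffun 'I_N -> 'I_m} * {dffun forall r : 'I_m, 'S_(a r)})%type.

Definition block_fun (s : {dffun forall r : 'I_m, 'S_(a r)}) (i : 'I_N) : 'I_N :=
  tagnat.Rank (tagnat.sig1 i) (s (tagnat.sig1 i) (tagnat.sig2 i)).

Lemma block_fun_inj s : injective (block_fun s).
Proof.
move=> i j; rewrite /block_fun /tagnat.Rank => /tagnat.rank_inj.
rewrite -[in X in _ -> X](tagnat.sigK i) -[in X in _ -> X](tagnat.sigK j).
rewrite /tagnat.sig1 /tagnat.sig2.
case: (tagnat.sig i) => r u; case: (tagnat.sig j) => r' u' /= E.
have Er : r = r' := congr1 tag E.
by subst r'; move/eqP: E; rewrite eq_Tagged /= => /eqP/perm_inj->.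
Qed.

Definition young_in (g : young) : wreath 'I_m N := (g.1, perm (@block_fun_inj g.2)).

Definition young_block (r : 'I_m) (g : young) : wreath 'I_m (a r) :=
  ([ffun j : 'I_(a r) => g.1 (tagnat.Rank r j)], g.2 r).

End Block.

Definition msize (lam : 'I_m -> seq nat) : nat := (\sum_(r < m) sumn (lam r))%N.

Definition mspecht (lam : 'I_m -> seq nat) : rep (wreath 'I_m (msize lam)) :=
  induce (@wmul 'I_m (msize lam)) (@young_in (fun r => sumn (lam r)))
    (\big[@tens_rep _/triv_rep _]_(r < m)
        pull (@young_block (fun r => sumn (lam r)) r) (twist r (specht (lam r)))).

Definition cell (delta : 'I_m -> k) (n : nat) (lam : 'I_m -> seq nat) :
    rep (diag 'I_m n n) :=
  inflate delta id
    (fun d : {d : diag 'I_m n (msize lam) | is_dangle d} => val d)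
    (@wdiag 'I_m (msize lam)) (mspecht lam).

Definition dbar (delta : 'I_m -> k) (r : nat) : k :=
  m%:R^-1 * \sum_(i < m) xi ^+ (i * r) * delta i.

End Cyclotomic.

(* The cell module of B(a, d) labelled by nu; it is 0 if there is no dangle with
   sumn nu free nodes. *)
Definition brauer_cell (a : nat) (d : k) (nu : seq nat) : rep (diag 'I_1 a a) :=
  cell 1 (fun=> d) a (fun=> nu).

Section Walled.
Variables (a b : nat) (d : k) (nu tau : seq nat).

Definition wb_diag : finType := {x : diag 'I_1 (a + b) (a + b) | walled a a x}.

Definition wb_dangle : finType :=
  {x : diag 'I_1 (a + b) (sumn nu + sumn tau) | is_dangle x && walled a (sumn nu) x}.

Definition sum_fun p q (g : 'S_p * 'S_q) (i : 'I_(p + q)) : 'I_(p + q) :=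
  match split i with inl j => lshift q (g.1 j) | inr j => rshift p (g.2 j) end.

Lemma sum_fun_inj p q (g : 'S_p * 'S_q) : injective (sum_fun g).
Proof.
move=> i j; rewrite /sum_fun -{2}(splitK i) -{2}(splitK j).
case: (split i) => u; case: (split j) => v /= /eqP;
  rewrite ?eq_shift // => /eqP/perm_inj-> //.
Qed.

Definition sum_in p q (g : 'S_p * 'S_q) : diag 'I_1 (p + q) (p + q) :=
  wdiag ([ffun=> 0], perm (@sum_fun_inj p q g)).

(* The cell module of WB(a, b, d) labelled by (nu, tau); it is 0 if there is no
   walled dangle with sumn nu and sumn tau free nodes on the two sides. *)
Definition wb_cell : rep wb_diag :=
  inflate (fun=> d) (fun x : wb_diag => val x) (fun e : wb_dangle => val e)
    (@sum_in (sumn nu) (sumn tau))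
    (tens_rep (pull fst (specht nu)) (pull snd (specht tau))).

End Walled.

End Modules.

Definition is_part (s : seq nat) : bool := sorted geq s && (0%N \notin s).

Definition Lambda (m' n : nat) (lam : 'I_m'.+1 -> seq nat) : bool :=
  [&& [forall r, is_part (lam r)], (msize lam <= n)%N & ~~ odd (n - msize lam)].

(* Main.v *)
From HB Require Import structures.
From mathcomp Require Import all_boot all_order fingroup perm all_algebra.
From mathcomp Require Import boolp zify.
Require Import Defs.

Set Implicit Arguments.
Unset Strict Implicit.
Unset Printing Implicit Defensive.

Import GRing.Theory.
Local Open Scope ring_scope.

(* Let N = |lam| and n = N + 2t.  There are diagrams u from n to N nodes and v
   from N to n nodes whose stacking v u is the identity up to a non-zero scalar,
   so c^-1 u v is an idempotent cutting B_n down to B_N.  In B_N the label group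
   (Z/m)^N acts semisimply, and cutting further by the idempotent e_om of the
   weight om = (0^{|lam^0|}, 1^{|lam^1|}, ...) forces every strand of a diagram
   to join colours c and c (through strands) or c and - c (arcs); summing over
   labels around a closed loop of colour c turns its parameter into dbar_c.
   Hence e_om B_N e_om acts on e_om Delta_N(mu) as the tensor product, over the
   classes {r, - r} of colours, of Brauer algebras (r = - r) and walled Brauer
   algebras (r <> - r), and e_om Delta_N(mu) is the tensor product of their cell
   modules.  Multiplicities of heads of modules generated by their corner pass to the
   corner; homomorphisms do because a vector of weight om killed in the corner
   by the diagrams with arcs is killed by these diagrams altogether.  In the
   corner of lam the module Delta_N(lam) becomes the outer tensor product of the
   Specht modules, which is simple by the assumption on the characteristic. *)

(** The diagrams [u] and [v] change the number of nodes, so no single algebra contains them. Cell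
    modules are therefore presented by generators, one for every diagram from n to N nodes and every
    vector, on which diagrams of any rectangular shape act by composition. Algebras are not formed
    either: a module and its corner are compared through structure constants common to all modules
    considered. Composition and loop scalars come from walks on stacked diagrams. Associativity of
    stacking, and the cocycle identity of the loop scalars, say that both bracketings see the same
    walk on three layers. The cocycle identity uses delta (- i) = delta i. For n >= 2 this follows
    from associativity of the algebra; for n <= 1 there are no closed loops and delta may be
    replaced by the constant 1. The condition delta <> 0 enters when N = 0: cutting 2 nodes down to
    0 must close a loop. The identification of the weight space with a tensor product is a
    surjection together with a bound on dimensions. Homomorphism spaces are compared by dimension,
    after showing that restriction to the corner is bijective. *)

(** * Orbits of injective maps and first-return walks *)

Lemma iter_order_min (T : finType) (f : T -> T) x i :
  (i < fingraph.order f x)%N -> iter i f x = x -> i = 0%N.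
Proof.
move=> lt_io e.
have u := orbit_uniq f x; rewrite /fingraph.orbit in u.
apply/eqP; rewrite -(nth_uniq x _ _ u) ?size_traject ?orderSpred //.
by rewrite !nth_traject // ?e ?fingraph.order_gt0.
Qed.

Lemma big_traject (R : nmodType) (T : Type) (f : T -> T) x n (F : T -> R) :
  \sum_(s <- traject f x n) F s = \sum_(i < n) F (iter i f x).
Proof.
rewrite (big_nth x) size_traject big_mkord; apply: eq_bigr => i _.
by rewrite nth_traject.
Qed.

Section FirstReturn.
Variables (S S' : finType) (Z : zmodType) (phi : S -> S) (phi' : S' -> S').
Variables (lab : S -> Z) (lab' : S' -> Z) (io : S' -> S).

(** The map [phi'] is the first-return map of [phi] to the image of [io], and [lab'] collects the
    labels met on the way. A composite of two diagrams and a partial composite inside a stack of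
    three are both of this kind. *)
Definition induced := injective io /\ forall s, exists k,
  [/\ iter k.+1 phi (io s) = io (phi' s),
      forall i t, (0 < i <= k)%N -> iter i phi (io s) <> io t
    & lab' s = \sum_(i < k.+1) lab (iter i phi (io s))].

Hypothesis ind : induced.

(** Returns are chained one at a time. The last clause traces every visit to the image of [io]
    before time [t] back to an iterate of [phi'] before [j]; its implication keeps visits at
    positive times at positive iterates, which is what comparing periods and composing returns
    requires. *)
Lemma induced_hit j s : exists t,
  [/\ (j <= t)%N, iter t phi (io s) = io (iter j phi' s),
      \sum_(i < t) lab (iter i phi (io s)) = \sum_(i < j) lab' (iter i phi' s)
    & forall i u, (i < t)%N -> iter i phi (io s) = io u ->
        exists2 j', (j' < j)%N && ((0 < i) ==> (0 < j'))%N & iter j' phi' s = u].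
Proof.
elim: j s => [|j IHj] s; first by exists 0%N; rewrite !big_ord0; split.
have [io_inj /(_ s)[k [Ek Nk Lk]]] := ind.
have [t [le_jt Et Lt Nt]] := IHj (phi' s).
have split_it i : iter (i + k.+1) phi (io s) = iter i phi (io (phi' s)).
  by rewrite iterD Ek.
exists (t + k.+1)%N; split.
- by rewrite addnS ltnS (leq_trans le_jt) ?leq_addr.
- by rewrite split_it Et iterSr.
- rewrite addnC big_split_ord /= -Lk big_ord_recl /=; congr (_ + _).
  transitivity (\sum_(i < t) lab (iter i phi (io (phi' s)))).
    by apply: eq_bigr => i _; rewrite -split_it addnS (addnC i).
  by rewrite Lt; apply: eq_bigr => i _; rewrite -iterSr.
- move=> i u lt_it Ei; case: i lt_it Ei => [|i] lt_it Ei.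
    by exists 0%N => //; apply: io_inj; rewrite -Ei.
  have [le_ik|lt_ki] := leqP i.+1 k; first by case: (Nk i.+1 u).
  have [] := Nt (i.+1 - k.+1)%N u.
  + by rewrite -(ltn_add2r k.+1) subnK.
  + by rewrite -split_it subnK.
  move=> j' /andP[lt_j _] Ej; exists j'.+1; last by rewrite iterSr.
  by rewrite ltnS lt_j implybT.
Qed.

(** The time that completes one period of [phi'] is one period of [phi]: an earlier return to [io s]
    would be an earlier return of [phi'] to [s]. So closed walks keep their labels and their
    classes. *)
Lemma induced_order s : injective phi -> injective phi' ->
  [/\ \sum_(i <- fingraph.orbit phi (io s)) lab i
        = \sum_(i <- fingraph.orbit phi' s) lab' i
    & forall t, fconnect phi (io s) (io t) = fconnect phi' s t].
Proof.
move=> phi_inj phi'_inj.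
have [t [le_t Et Lt Nt]] := induced_hit (fingraph.order phi' s) s.
have o't := fingraph.order_gt0 phi' s; have ot := fingraph.order_gt0 phi (io s).
have Dt : t = fingraph.order phi (io s).
  apply/eqP; rewrite eqn_leq; apply/andP; split; rewrite leqNgt; apply/negP=> lt.
    have [] := Nt _ s lt; first by rewrite iter_order.
    move=> j /andP[ltj]; rewrite ot /= => j_gt0 /(iter_order_min ltj) j0.
    by rewrite j0 in j_gt0.
  have := iter_order_min lt; rewrite Et iter_order // => /(_ erefl) t0.
  by rewrite t0 leqNgt o't in le_t.
split; first by rewrite /fingraph.orbit !big_traject -Dt.
move=> u; apply/idP/idP.
  move=> /[dup] /findex_max lt_f /iter_findex Ef.
  rewrite -Dt in lt_f; have [j _ <-] := Nt _ _ lt_f Ef.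
  exact: fconnect_iter.
move=> /iter_findex Ef.
have [t' [_ Et' _ _]] := induced_hit (findex phi' s u) s.
by rewrite -Ef -Et' fconnect_iter.
Qed.

End FirstReturn.

(** The return time is the least positive time spent in the image of [io], hence determined. Two
    composites of diagrams are proved equal by exhibiting both as returns of the same walk. *)
Lemma induced_unique (S S' : finType) (Z : zmodType) phi lab io
    (p1 p2 : S' -> S') (l1 l2 : S' -> Z) :
  @induced S S' Z phi p1 lab l1 io -> induced phi p2 lab l2 io ->
  p1 =1 p2 /\ l1 =1 l2.
Proof.
move=> [io_inj i1] [_ i2]; suff H s : p1 s = p2 s /\ l1 s = l2 s.
  by split=> s; case: (H s).
have [k1 [E1 N1 L1]] := i1 s; have [k2 [E2 N2 L2]] := i2 s.
have D : k1 = k2.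
  apply/eqP; rewrite eqn_leq; apply/andP; split; rewrite leqNgt; apply/negP=> lt.
    by case: (N1 k2.+1 (p2 s)).
  by case: (N2 k1.+1 (p1 s)).
by rewrite L1 L2 D; split=> //; apply: io_inj; rewrite -E1 -E2 D.
Qed.

Lemma induced_trans (S S' S'' : finType) (Z : zmodType) phi phi' phi''
    (lab : S -> Z) (lab' : S' -> Z) (lab'' : S'' -> Z) io io' :
  induced phi phi' lab lab' io -> induced phi' phi'' lab' lab'' io' ->
  induced phi phi'' lab lab'' (io \o io').
Proof.
move=> i1 [io'_inj i2]; split=> [|s]; first exact: inj_comp (proj1 i1) io'_inj.
have [k [Ek Nk Lk]] := i2 s.
have [t [le_t Et Lt Nt]] := induced_hit i1 k.+1 (io' s).
case: t le_t Et Lt Nt => // t le_t Et Lt Nt.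
exists t; split=> [|i u /andP[i_gt0 le_i] Ei|].
- by rewrite Et Ek.
- have [j /andP[lt_j]] := Nt i _ le_i Ei.
  by rewrite i_gt0 /= => j_gt0; apply: Nk; rewrite j_gt0.
- by rewrite Lk Lt.
Qed.

(* Both products run over the classes related by [R]. *)
Lemma big_classes (K : comPzSemiRingType) (I J : finType) (P : pred I)
    (Q : pred J) (F : I -> K) (G : J -> K) (R : I -> J -> bool) :
  (forall i, P i -> exists2 j, Q j & R i j) ->
  (forall j, Q j -> exists2 i, P i & R i j) ->
  (forall i j j', P i -> Q j -> Q j' -> R i j -> R i j' -> j = j') ->
  (forall i i' j, P i -> P i' -> Q j -> R i j -> R i' j -> i = i') ->
  (forall i j, P i -> Q j -> R i j -> F i = G j) ->
  \prod_(i | P i) F i = \prod_(j | Q j) G j.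
Proof.
move=> exQ exP uQ uP FG.
transitivity (\prod_(i | P i) \prod_(j | Q j && R i j) G j).
  apply: eq_bigr => i Pi; have [j Qj Rij] := exQ i Pi.
  rewrite (big_pred1 j) ?(FG i j) // => j' /=.
  apply/andP/eqP=> [[Qj' Rij']|-> //]; exact: (uQ i).
rewrite (exchange_big_dep Q) /=; last by move=> i j _ /andP[].
apply: eq_bigr => j Qj; have [i Pi Rij] := exP j Qj.
rewrite (big_pred1 i) // => i' /=; rewrite Qj /=.
apply/andP/eqP=> [[Pi' Ri'j]|-> //]; exact: (uP _ _ j).
Qed.

(** * Stacking of two diagrams as a first-return walk *)

Section Diag.
Variable Z : finZmodType.

Lemma diag_eq a b (d d' : diag Z a b) :
  mate d =1 mate d' -> lab d =1 lab d' -> d = d'.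
Proof.
move=> em el; apply/val_inj/ffunP => v.
by rewrite [val d v]surjective_pairing [val d' v]surjective_pairing;
  rewrite -/(mate d v) -/(mate d' v) -/(lab d v) -/(lab d' v) em el.
Qed.

Section Pair.
Variables (a b c : nat) (x : diag Z a b) (y : diag Z b c).

(** The fixed points of [glue] are the outer nodes, so a walk that reaches the end of a strand of
    the composite stands on an outer node again, and it meets none in between. *)
Lemma comp_induced :
  induced (cnext x y) (mate (comp x y)) (slab x y) (lab (comp x y)) (@inner a b c).
Proof.
split=> [v w /(congr1 (@outer a b c))|v]; first by rewrite !innerK => -[].
have [] := clenP x y v; set k := clen x y v => outk mink.
have Ew : across x y (iter k (cnext x y) (inner b v)) = inner b (mate (comp x y) v).
  rewrite /mate /= ffunE /= /comp_fun /= -/k.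
  by case E: outer outk => [w|//] _; rewrite (outerK E).
exists k; split.
- by rewrite iterS /cnext Ew; case: (mate (comp x y) v).
- move=> [//|i] t /andP[_ le_ik] /(congr1 (@outer a b c)).
  by rewrite iterS /cnext outer_glue mink // innerK.
- by rewrite /lab /= ffunE.
Qed.

Lemma compE k v w :
  across x y (iter k (cnext x y) (inner b v)) = inner b w ->
  (forall i, (i < k)%N -> outer (across x y (iter i (cnext x y) (inner b v))) = None) ->
  mate (comp x y) v = w /\ lab (comp x y) v = \sum_(i < k.+1) slab x y (iter i (cnext x y) (inner b v)).
Proof.
move=> Ek mink; have [io_inj /(_ v)[k' [Ek' Nk' ->]]] := comp_induced.
have E1 : iter k.+1 (cnext x y) (inner b v) = inner b w.
  by rewrite iterS /cnext Ek; case: w {Ek}.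
have D : k' = k.
  apply/eqP; rewrite eqn_leq; apply/andP; split; rewrite leqNgt; apply/negP=> lt.
    by case: (Nk' k.+1 w).
  have := mink _ lt; rewrite -outer_glue -[glue _]/(cnext x y _) -iterS Ek'.
  by rewrite innerK.
by split; [apply: io_inj; rewrite -Ek' D | rewrite D].
Qed.

(** This is the reversal law [phig] of the walks treated below, with [glue] as the reversal: turning
    round after a step and walking on undoes the step. *)
Lemma cnext_glue s : cnext x y (glue (cnext x y s)) = glue s.
Proof. by rewrite /cnext glueK acrossK. Qed.

Lemma glue_across s : glue (cnext x y s) = across x y s.
Proof. by rewrite /cnext glueK. Qed.

End Pair.
End Diag.

(* A walk [phi] with a reversal [g]: going along [phi] after reversing undoes
   [phi], and [lab] changes sign; the fixed points of [g] are the ends. *)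
Section Reversal.
Variables (S : finType) (Z : zmodType) (phi g : S -> S) (lab : S -> Z).
Hypotheses (phi_inj : injective phi) (gK : involutive g).
Hypothesis phig : forall s, phi (g (phi s)) = g s.
Hypothesis labg : forall s, lab (g (phi s)) = - lab s.

Definition closed_at s := forall t, fconnect phi s t -> g t != t.
Definition same_loop s t := fconnect phi s t || fconnect phi s (g t).
Definition walk_label s := \sum_(t <- fingraph.orbit phi s) lab t.

Let fsym := fconnect_sym phi_inj.

Lemma walk_labelE s : walk_label s = \sum_(t | fconnect phi s t) lab t.
Proof.
rewrite /walk_label (big_uniq _ (orbit_uniq phi s)) /=.
by apply: eq_bigl => t; rewrite -fconnect_orbit.
Qed.

Lemma connect_g1 s t : fconnect phi s t -> fconnect phi (g t) (g s).
Proof.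
move=> /iter_findex <-; elim: (findex _ _ _) => [|i IHi] //=.
apply: connect_trans IHi; rewrite -[in X in _ X _]phig /=.
have /= := fconnect1 phi (g (phi (iter i phi s))).
by rewrite phig => h; rewrite [phi (g _)]phig.
Qed.

Lemma connect_g s t : fconnect phi (g s) (g t) = fconnect phi s t.
Proof.
apply/idP/idP=> /connect_g1; last by rewrite fsym.
by rewrite !gK fsym.
Qed.

Lemma same_loop_sym s t : same_loop s t = same_loop t s.
Proof. by rewrite /same_loop fsym -[fconnect phi s (g t)]connect_g gK (fsym (g s)). Qed.

Lemma same_loop_trans s t u : same_loop s t -> same_loop t u -> same_loop s u.
Proof.
rewrite /same_loop => /orP[st|st] /orP[tu|tu]; apply/orP.
- by left; apply: connect_trans tu.
- by right; apply: connect_trans tu.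
- by right; apply: connect_trans st _; rewrite connect_g.
- by left; apply: connect_trans st _; rewrite -[u]gK connect_g.
Qed.

Lemma walk_label_connect s t : fconnect phi s t -> walk_label s = walk_label t.
Proof.
move=> st; rewrite !walk_labelE; apply: eq_bigl => u.
by rewrite (same_connect fsym st).
Qed.

Lemma walk_labelg s : walk_label (g s) = - walk_label s.
Proof.
rewrite !walk_labelE -sumrN.
have gphi_inj : injective (fun s => g (phi s)).
  by move=> u v /(can_inj gK)/phi_inj.
rewrite (reindex_inj gphi_inj) /=; apply: eq_big => [t|t _]; last exact: labg.
by rewrite connect_g -(same_connect_r fsym (fconnect1 phi t)).
Qed.

Lemma walk_label_same (T : Type) (d : Z -> T) s t :
  (forall z, d (- z) = d z) -> same_loop s t -> d (walk_label s) = d (walk_label t).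
Proof.
move=> dN /orP[/walk_label_connect -> //|/walk_label_connect ->].
by rewrite walk_labelg dN.
Qed.

Lemma closed_connect s t : fconnect phi s t -> closed_at s -> closed_at t.
Proof. by move=> st cs u tu; apply: cs; apply: connect_trans tu. Qed.

Lemma closed_g s : closed_at s -> closed_at (g s).
Proof.
move=> cs u; rewrite -[u]gK connect_g => /cs; rewrite !gK.
by rewrite eq_sym.
Qed.

Lemma closed_same s t : same_loop s t -> closed_at s -> closed_at t.
Proof.
case/orP=> st cs; first exact: closed_connect cs.
by rewrite -[t]gK; apply: closed_g; apply: closed_connect cs.
Qed.

(* Were [g (phi s)] ahead of [s], the walk would turn round half-way. *)
Lemma closed_turn s : (forall t, g (phi t) != t) -> closed_at s ->
  ~~ fconnect phi s (g (phi s)).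
Proof.
move=> noturn cs; apply/negP=> /iter_findex; move: (findex _ _ _) => i Ei.
have rev j t : iter j phi (g (phi (iter j phi t))) = g (phi t).
  by elim: j t => [|j IHj] t //; rewrite iterSr phig iterS IHj.
have iter_inj j : injective (iter j phi).
  by elim: j => [|j IHj] u v //= /phi_inj/IHj.
have iE := odd_double_half i; rewrite -addnn in iE.
set h := i./2 in iE; have := rev h s; rewrite -Ei -iE.
case: (odd i); rewrite ?add1n ?add0n -?addnS iterD => /iter_inj E.
  have := cs (phi (iter h phi s)); rewrite -iterS fconnect_iter => /(_ isT).
  by rewrite [X in g X]iterS E eqxx.
by have := noturn (iter h phi s); rewrite E eqxx.
Qed.

End Reversal.

(** * Closed loops of a stack and their leftmost nodes *)

Section LoopRoots.
Variables (Z : finZmodType) (a b c : nat) (x : diag Z a b) (y : diag Z b c).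
Notation phi := (cnext x y).
Notation state := (('I_a + 'I_b) + ('I_b + 'I_c))%type.
Notation dn j := (inr (inl j) : state).

Definition sl_sym := same_loop_sym (@cnext_inj _ _ _ _ x y) (@glueK _ _ _) (@cnext_glue _ _ _ _ x y).
Definition sl_trans := same_loop_trans (@cnext_inj _ _ _ _ x y) (@glueK _ _ _) (@cnext_glue _ _ _ _ x y).
Definition sl_closed := closed_same (@cnext_inj _ _ _ _ x y) (@glueK _ _ _) (@cnext_glue _ _ _ _ x y).

Lemma loop_rootP j :
  reflect (closed_at phi (@glue a b c) (dn j) /\
           forall j', same_loop phi (@glue a b c) (dn j) (dn j') -> (j <= j')%N)
          (loop_root x y j).
Proof.
apply: (iffP andP) => -[cl mn]; split.
- move=> t; rewrite fconnect_orbit => /(allP cl)/eqP out; exact/glue_outer.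
- move=> j'; rewrite /same_loop !fconnect_orbit => h.
  by have /forallP/(_ j')/implyP := mn; apply.
- by apply/allP=> t; rewrite -fconnect_orbit => /cl/glue_outer->.
- apply/forallP=> j'; apply/implyP=> h; apply: mn.
  by rewrite /same_loop !fconnect_orbit.
Qed.

(** A closed walk consists of central states only. The leftmost central node among those met in
    either direction is the root. *)
Lemma loop_root_ex s : closed_at phi (@glue a b c) s ->
  exists2 j, loop_root x y j & same_loop phi (@glue a b c) (dn j) s.
Proof.
move=> cs.
have [j0 Ej0] : exists j, same_loop phi (@glue a b c) (dn j) s.
  have /glue_outer := cs s (connect0 _ _).
  by case: (s) => -[] j //= _; exists j; rewrite /same_loop connect0 ?orbT.
case: (@arg_minnP _ j0 (fun j => same_loop phi (@glue a b c) (dn j) s) val Ej0) => j Ej mnj.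
exists j => //; apply/loop_rootP; split.
  by apply: sl_closed cs; rewrite sl_sym.
move=> j' jj'; apply: mnj; rewrite sl_sym in jj'; exact: sl_trans Ej.
Qed.

Lemma loop_root_inj j j' : loop_root x y j -> loop_root x y j' ->
  same_loop phi (@glue a b c) (dn j) (dn j') -> j = j'.
Proof.
move=> /loop_rootP[_ m1] /loop_rootP[_ m2] h; apply/val_inj/eqP.
by rewrite eqn_leq m1 //= m2 // sl_sym.
Qed.

Lemma loop_labelE j : loop_label x y j = walk_label phi (slab x y) (dn j).
Proof. by []. Qed.

Lemma not_loop_root j i : outer (iter i phi (dn j)) <> None -> loop_root x y j = false.
Proof.
move=> h; apply/negP=> /loop_rootP[/(_ _ (fconnect_iter _ i _))/glue_outer h' _].
by apply: h.
Qed.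

End LoopRoots.

(* A walk on three stacked diagrams, two of which ([x] and [y]) have been
   composed: [S3] are the states of the triple, [C] those of the pair formed by
   [comp x y] and the remaining diagram. *)
Section TwoStage.
Variables (Z : finZmodType) (a b c : nat) (x : diag Z a b) (y : diag Z b c).
Variables (S3 C : finType) (al3 g3 : S3 -> S3) (lab3 : S3 -> Z).
Variables (alC gC : C -> C) (labC : C -> Z).
Notation B := (('I_a + 'I_b) + ('I_b + 'I_c))%type.
Variables (iB : B -> S3) (iC : C -> S3).
Notation p3 := (fun s => g3 (al3 s)).
Notation pB := (cnext x y).
Notation pC := (fun s => gC (alC s)).
Notation gB := (@glue a b c).
Hypotheses (iB_inj : injective iB) (iC_inj : injective iC).
Hypotheses (g3K : involutive g3) (al3K : involutive al3).
Hypotheses (gCK : involutive gC) (alCK : involutive alC).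
Hypothesis lab3N : forall s, lab3 (al3 s) = - lab3 s.
Hypothesis H1 : forall s, al3 (iB s) = iB (across x y s).
Hypothesis H1l : forall s, lab3 (iB s) = slab x y s.
Hypothesis H2 : forall s, outer s = None -> g3 (iB s) = iB (gB s).
Hypothesis H3 : forall u, g3 (iC u) = iC (gC u).
Hypothesis H4 : forall u,
  (exists v, [/\ iC u = iB (inner b v), iC (alC u) = iB (inner b (mate (comp x y) v))
               & labC u = lab (comp x y) v])
  \/ (al3 (iC u) = iC (alC u) /\ labC u = lab3 (iC u)).
Hypothesis H5 : forall t, (exists u, t = iC u) \/ (exists2 s, outer s = None & t = iB s).
Hypothesis H6 : forall s u, outer s = None -> iB s <> iC u.

Let p3_inj : injective p3. Proof. exact: inj_comp (can_inj g3K) (can_inj al3K). Qed.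
Let pC_inj : injective pC. Proof. exact: inj_comp (can_inj gCK) (can_inj alCK). Qed.
Let p3g s : p3 (g3 (p3 s)) = g3 s. Proof. by rewrite /= g3K al3K. Qed.
Let pCg s : pC (gC (pC s)) = gC s. Proof. by rewrite /= gCK alCK. Qed.
Let lab3g s : lab3 (g3 (p3 s)) = - lab3 s. Proof. by rewrite /= g3K lab3N. Qed.

Lemma iB_step s : outer (across x y s) = None -> p3 (iB s) = iB (pB s).
Proof. by move=> h; rewrite /= H1 H2. Qed.

Lemma iB_iter i s : (forall j, (j < i)%N -> outer (iter j.+1 pB s) = None) ->
  iter i p3 (iB s) = iB (iter i pB s).
Proof.
elim: i => [//|i IHi] h; rewrite iterS IHi; last by move=> j ltj; apply/h/ltnW.
by rewrite iB_step //; have := h i (ltnSn i); rewrite /= outer_glue.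
Qed.

Lemma stage_induced : induced p3 pC lab3 labC iC.
Proof.
split=> // u; have [[v [Eu Eu' ->]]|[Eu ->]] := H4 u; last first.
  exists 0%N; split; [by rewrite /= Eu H3|by case|].
  by rewrite big_ord1.
have [io_inj /(_ v)[k [Ek Nk Lk]]] := comp_induced x y.
have nout i : (0 < i <= k)%N -> outer (iter i pB (inner b v)) = None.
  by move=> /Nk N; case E: outer => [w|//]; case: (N w); apply: outerK.
have Ei i : (i <= k)%N -> iter i p3 (iC u) = iB (iter i pB (inner b v)).
  by move=> lei; rewrite Eu iB_iter // => j ltj; apply: nout; rewrite /= (leq_trans ltj).
exists k; split.
- rewrite iterS Ei //= H1.
  have -> : across x y (iter k pB (inner b v)) = inner b (mate (comp x y) v).
    by rewrite -glue_across -iterS Ek; case: (mate _ _).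
  by rewrite -Eu' H3.
- by move=> i w /andP[i_gt0 le_ik]; rewrite Ei //; apply/H6/nout; rewrite i_gt0.
- by rewrite Lk; apply: eq_bigr => i _; rewrite Ei ?leq_ord // H1l.
Qed.

Lemma stage_connectC u t : fconnect p3 (iC u) (iC t) = fconnect pC u t.
Proof. by have [_ ->] := induced_order stage_induced u p3_inj pC_inj. Qed.

Lemma stage_labelC u : walk_label p3 lab3 (iC u) = walk_label pC labC u.
Proof. by have [] := induced_order stage_induced u p3_inj pC_inj. Qed.

Lemma stage_sameC u t : same_loop p3 g3 (iC u) (iC t) = same_loop pC gC u t.
Proof. by rewrite /same_loop H3 !stage_connectC. Qed.

Lemma stage_closedC u : closed_at p3 g3 (iC u) <-> closed_at pC gC u.
Proof.
split=> cl t.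
  by rewrite -stage_connectC => /cl; rewrite H3 (inj_eq iC_inj).
move=> ut; have [[t' Et]|[s out Et]] := H5 t.
  rewrite Et stage_connectC in ut *; rewrite H3 (inj_eq iC_inj); exact: cl.
rewrite Et H2 // (inj_eq iB_inj); exact/glue_outer.
Qed.

Let Bout s : closed_at pB gB s -> forall i, outer (iter i pB s) = None.
Proof. by move=> cl i; apply/glue_outer/cl/fconnect_iter. Qed.

Lemma stage_iterB s : closed_at pB gB s -> forall i, iter i p3 (iB s) = iB (iter i pB s).
Proof. by move=> cl i; apply: iB_iter => j _; apply: Bout. Qed.

Lemma stage_inducedB s : closed_at pB gB s ->
  (forall t, fconnect p3 (iB s) t -> exists2 t', fconnect pB s t' & t = iB t').
Proof.
move=> cl t /iter_findex <-; rewrite stage_iterB //.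
by exists (iter (findex p3 (iB s) t) pB s) => //; apply: fconnect_iter.
Qed.

Lemma stage_connectB s t : closed_at pB gB s ->
  fconnect p3 (iB s) (iB t) = fconnect pB s t.
Proof.
move=> cl; apply/idP/idP=> [/(stage_inducedB cl)[t' st' /iB_inj-> //]|].
by move=> /iter_findex <-; rewrite -stage_iterB // fconnect_iter.
Qed.

Lemma stage_labelB s : closed_at pB gB s ->
  walk_label p3 lab3 (iB s) = walk_label pB (slab x y) s.
Proof.
move=> cl; rewrite !walk_labelE.
rewrite (eq_bigl (fun t => t \in [set iB t' | t' in fconnect pB s])); last first.
  move=> t; apply/idP/imsetP=> [/(stage_inducedB cl)[t' st' ->]|[t' st' ->]].
    by exists t'.
  by rewrite stage_connectB.
rewrite big_imset /=; last by move=> ? ? _ _; apply: iB_inj.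
by apply: eq_bigr.
Qed.

Lemma stage_sameB s t : closed_at pB gB s -> closed_at pB gB t ->
  same_loop p3 g3 (iB s) (iB t) = same_loop pB gB s t.
Proof.
move=> cls clt; rewrite /same_loop H2 ?stage_connectB //.
by apply/glue_outer/clt/connect0.
Qed.

Lemma stage_closedB s : closed_at pB gB s -> closed_at p3 g3 (iB s).
Proof.
move=> cl t /(stage_inducedB cl)[t' /cl h ->].
by rewrite H2 ?(inj_eq iB_inj) //; apply/glue_outer.
Qed.

Lemma stage_sameBC s u : closed_at pB gB s -> ~~ same_loop p3 g3 (iB s) (iC u).
Proof.
move=> cl; rewrite /same_loop H3 negb_or.
apply/andP; split; apply/negP=> /(stage_inducedB cl)[t' /cl/glue_outer out].
  by move=> /esym/H6; apply.
by move=> /esym/H6; apply.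
Qed.

(** A closed loop of the triple stack either meets a state of the pair, and is then a loop of that
    pair, or it never leaves the nodes between [x] and [y] and is a loop already closed by stacking
    these two. *)
Lemma stage_closed_ex t : closed_at p3 g3 t ->
  (exists2 u, closed_at pC gC u & same_loop p3 g3 (iC u) t) \/
  (exists2 s, closed_at pB gB s & same_loop p3 g3 (iB s) t).
Proof.
move=> clt.
have [/existsP[u ut]|] := boolP [exists u, fconnect p3 t (iC u)].
  left; exists u; last by rewrite /same_loop (fconnect_sym p3_inj) ut.
  by apply/stage_closedC; apply: closed_connect clt.
rewrite negb_exists => /forallP noC; right.
have [[u Et]|[s out Et]] := H5 t; first by have := noC u; rewrite Et connect0.
exists s; last by rewrite Et /same_loop connect0.
have step i : iter i p3 t = iB (iter i pB s) /\ outer (iter i pB s) = None.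
  elim: i => [//|i [IHi out_i]]; have ti := fconnect_iter p3 i.+1 t.
  have E1 : iter i.+1 p3 t = g3 (iB (across x y (iter i pB s))).
    by rewrite iterS IHi /= H1.
  have o1 : outer (across x y (iter i pB s)) = None.
    have [[u E]|[s' out' E]] := H5 (iter i.+1 p3 t).
      by have := noC u; rewrite -E ti.
    have := congr1 g3 E; rewrite E1 g3K H2 // => /iB_inj ->.
    by rewrite outer_glue.
  by rewrite E1 H2 // /= outer_glue o1.
move=> t' /iter_findex <-; apply/glue_outer.
by have [] := step (findex pB s t').
Qed.

End TwoStage.

(** * Associativity of stacking and the cocycle identity of the loop scalars *)

Section Assoc.
Variables (Z : finZmodType) (a b c d : nat).
Variables (x : diag Z a b) (y : diag Z b c) (z : diag Z c d).
Notation S3 := (('I_a + 'I_b) + (('I_b + 'I_c) + ('I_c + 'I_d)))%type.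

Definition al3 (s : S3) : S3 := match s with
  | inl u => inl (mate x u) | inr (inl u) => inr (inl (mate y u))
  | inr (inr u) => inr (inr (mate z u)) end.
Definition lab3 (s : S3) : Z := match s with
  | inl u => lab x u | inr (inl u) => lab y u | inr (inr u) => lab z u end.
Definition g3 (s : S3) : S3 := match s with
  | inl (inr j) => inr (inl (inl j)) | inr (inl (inl j)) => inl (inr j)
  | inr (inl (inr l)) => inr (inr (inl l)) | inr (inr (inl l)) => inr (inl (inr l))
  | _ => s end.

(** The suffix l belongs to the bracketing (x y) z and r to x (y z). In each, [iB] embeds the states
    of the two diagrams stacked first, and [iC] those of the pair in which they are replaced by
    their composite. *)
Definition iBl (s : ('I_a + 'I_b) + ('I_b + 'I_c)) : S3 :=
  match s with inl u => inl u | inr u => inr (inl u) end.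
Definition iCl (s : ('I_a + 'I_c) + ('I_c + 'I_d)) : S3 :=
  match s with inl (inl i) => inl (inl i) | inl (inr l) => inr (inl (inr l))
  | inr u => inr (inr u) end.
Definition iBr (s : ('I_b + 'I_c) + ('I_c + 'I_d)) : S3 := inr s.
Definition iCr (s : ('I_a + 'I_b) + ('I_b + 'I_d)) : S3 :=
  match s with inl u => inl u | inr (inl j) => inr (inl (inl j))
  | inr (inr h) => inr (inr (inr h)) end.

Lemma al3K : involutive al3. Proof. by case=> [u|[u|u]] /=; rewrite mateK. Qed.
Lemma g3K : involutive g3. Proof. by case=> [[u|u]|[[u|u]|[u|u]]]. Qed.
Lemma lab3N s : lab3 (al3 s) = - lab3 s.
Proof. by case: s => [u|[u|u]] /=; rewrite lab_mate. Qed.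
Lemma iBl_inj : injective iBl. Proof. by move=> [u|u] [v|v] //= [->]. Qed.
Lemma iBr_inj : injective iBr. Proof. by move=> u v []. Qed.
Lemma iCl_inj : injective iCl.
Proof. by move=> [[u|u]|u] [[v|v]|v] //= [->]. Qed.
Lemma iCr_inj : injective iCr.
Proof. by move=> [u|[u|u]] [v|[v|v]] //= [->]. Qed.

Lemma stageH4l u :
  (exists v, [/\ iCl u = iBl (inner b v),
      iCl (across (comp x y) z u) = iBl (inner b (mate (comp x y) v))
      & slab (comp x y) z u = lab (comp x y) v])
  \/ (al3 (iCl u) = iCl (across (comp x y) z u) /\ slab (comp x y) z u = lab3 (iCl u)).
Proof.
case: u => [v|v]; last by right.
left; exists v; split=> //=; first by case: v.
by case: (mate _ v).
Qed.

Lemma stageH4r u :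
  (exists v, [/\ iCr u = iBr (inner c v),
      iCr (across x (comp y z) u) = iBr (inner c (mate (comp y z) v))
      & slab x (comp y z) u = lab (comp y z) v])
  \/ (al3 (iCr u) = iCr (across x (comp y z) u) /\ slab x (comp y z) u = lab3 (iCr u)).
Proof.
case: u => [v|v]; first by right.
left; exists v; split=> //=; first by case: v.
by case: (mate _ v).
Qed.

Lemma stageH5l t : (exists u, t = iCl u) \/ (exists2 s, outer s = None & t = iBl s).
Proof.
case: t => [[i|j]|[[j|l]|u]].
- by left; exists (inl (inl i)).
- by right; exists (inl (inr j)).
- by right; exists (inr (inl j)).
- by left; exists (inl (inr l)).
- by left; exists (inr u).
Qed.

Lemma stageH5r t : (exists u, t = iCr u) \/ (exists2 s, outer s = None & t = iBr s).
Proof.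
case: t => [u|[[j|l]|[l|h]]].
- by left; exists (inl u).
- by left; exists (inr (inl j)).
- by right; exists (inl (inr l)).
- by right; exists (inr (inl l)).
- by left; exists (inr (inr h)).
Qed.

Lemma stageH2l s : outer s = None -> g3 (iBl s) = iBl (glue s).
Proof. by case: s => -[]. Qed.
Lemma stageH2r s : outer s = None -> g3 (iBr s) = iBr (glue s).
Proof. by case: s => -[]. Qed.
Lemma stageH3l u : g3 (iCl u) = iCl (glue u). Proof. by case: u => -[]. Qed.
Lemma stageH3r u : g3 (iCr u) = iCr (glue u). Proof. by case: u => -[]. Qed.
Lemma stageH6l s u : outer s = None -> iBl s <> iCl u.
Proof. by case: s => -[i|i] //= _; case: u => -[]. Qed.
Lemma stageH6r s u : outer s = None -> iBr s <> iCr u.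
Proof. by case: s => -[i|i] //= _; case: u => -[]. Qed.
Lemma stageH1l s : al3 (iBl s) = iBl (across x y s). Proof. by case: s. Qed.
Lemma stageH1ll s : lab3 (iBl s) = slab x y s. Proof. by case: s. Qed.
Lemma stageH1r s : al3 (iBr s) = iBr (across y z s). Proof. by case: s. Qed.
Lemma stageH1lr s : lab3 (iBr s) = slab y z s. Proof. by case: s. Qed.

(** Both bracketings are first returns, to the same outer nodes, of one walk on the triple stack. *)
Lemma comp_assoc : comp (comp x y) z = comp x (comp y z).
Proof.
have il := stage_induced iCl_inj stageH1l stageH1ll stageH2l stageH3l stageH4l stageH6l.
have ir := stage_induced iCr_inj stageH1r stageH1lr stageH2r stageH3r stageH4r stageH6r.
have tl := induced_trans il (comp_induced (comp x y) z).
have tr := induced_trans ir (comp_induced x (comp y z)).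
have Ei : iCl \o @inner a c d =1 iCr \o @inner a b d by case.
have {}tl : induced (fun s => g3 (al3 s)) (mate (comp (comp x y) z)) lab3
    (lab (comp (comp x y) z)) (iCr \o @inner a b d).
  have [inj h] := tl; split=> [u v|s]; first by rewrite -!Ei => /inj.
  have [k [Ek Nk Lk]] := h s; exists k; split=> [|i t|]; rewrite -!Ei //.
  exact: Nk.
have [em el] := induced_unique tl tr; exact: diag_eq.
Qed.

Variables (k : fieldType) (delta : Z -> k).
Hypothesis deltaN : forall i, delta (- i) = delta i.
Notation p3 := (fun s => g3 (al3 s)).

Let dl (i : 'I_b + 'I_c) : S3 :=
  match i with inl j => inr (inl (inl j)) | inr l => inr (inr (inl l)) end.
Let rootl (i : 'I_b + 'I_c) :=
  match i with inl j => loop_root x y j | inr l => loop_root (comp x y) z l end.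
Let rootr (i : 'I_b + 'I_c) :=
  match i with inl j => loop_root x (comp y z) j | inr l => loop_root y z l end.
Let wl (i : 'I_b + 'I_c) := match i with
  | inl j => delta (loop_label x y j) | inr l => delta (loop_label (comp x y) z l) end.
Let wr (i : 'I_b + 'I_c) := match i with
  | inl j => delta (loop_label x (comp y z) j) | inr l => delta (loop_label y z l) end.
Let R i j := same_loop p3 g3 (dl i) (dl j).

Let p3_inj : injective p3. Proof. exact: inj_comp (can_inj g3K) (can_inj al3K). Qed.
Let p3g s : p3 (g3 (p3 s)) = g3 s. Proof. by rewrite /= g3K al3K. Qed.
Let lab3g s : lab3 (g3 (p3 s)) = - lab3 s. Proof. by rewrite /= g3K lab3N. Qed.
Let Rsym i j : R i j = R j i. Proof. exact: same_loop_sym p3_inj g3K p3g _ _. Qed.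
Let slt := same_loop_trans p3_inj g3K p3g.

Let closedl i : rootl i -> closed_at p3 g3 (dl i).
Proof.
case: i => j /loop_rootP[cl _].
  exact: (stage_closedB iBl_inj stageH1l stageH2l cl).
have /= := stage_closedC iBl_inj iCl_inj g3K al3K (@glueK _ _ _)
  (acrossK (comp x y) z) stageH1l stageH1ll stageH2l stageH3l stageH4l stageH5l
  stageH6l (inr (inl j)).
by case=> _ h; apply: h.
Qed.

Let closedr i : rootr i -> closed_at p3 g3 (dl i).
Proof.
case: i => j /loop_rootP[cl _]; last first.
  exact: (stage_closedB iBr_inj stageH1r stageH2r cl).
have /= := stage_closedC iBr_inj iCr_inj g3K al3K (@glueK _ _ _)
  (acrossK x (comp y z)) stageH1r stageH1lr stageH2r stageH3r stageH4r stageH5r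
  stageH6r (inr (inl j)).
by case=> _ h; apply: h.
Qed.

Let labell i : rootl i -> wl i = delta (walk_label p3 lab3 (dl i)).
Proof.
case: i => j /loop_rootP[cl _]; congr delta; rewrite /= loop_labelE; symmetry.
  exact: (stage_labelB iBl_inj stageH1l stageH1ll stageH2l cl).
exact: (stage_labelC iCl_inj g3K al3K (@glueK _ _ _)
  (acrossK (comp x y) z) stageH1l stageH1ll stageH2l stageH3l stageH4l
  stageH6l (inr (inl j))).
Qed.

Let labelr i : rootr i -> wr i = delta (walk_label p3 lab3 (dl i)).
Proof.
case: i => j /loop_rootP[cl _]; congr delta; rewrite /= loop_labelE; symmetry; last first.
  exact: (stage_labelB iBr_inj stageH1r stageH1lr stageH2r cl).
exact: (stage_labelC iCr_inj g3K al3K (@glueK _ _ _)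
  (acrossK x (comp y z)) stageH1r stageH1lr stageH2r stageH3r stageH4r
  stageH6r (inr (inl j))).
Qed.

Let exl t : closed_at p3 g3 t -> exists2 i, rootl i & same_loop p3 g3 (dl i) t.
Proof.
case/(stage_closed_ex iBl_inj iCl_inj g3K al3K (@glueK _ _ _)
  (acrossK (comp x y) z) stageH1l stageH1ll stageH2l stageH3l stageH4l stageH5l
  stageH6l) => [[u clu ut]|[s cls st]].
  have [l rl lu] := loop_root_ex clu; exists (inr l) => //.
  apply: slt ut; rewrite -(stage_sameC iCl_inj g3K al3K (@glueK _ _ _)
   (acrossK (comp x y) z) stageH1l stageH1ll stageH2l stageH3l stageH4l
   stageH6l) in lu; exact: lu.
have [j rj js] := loop_root_ex cls; exists (inl j) => //.
apply: slt st; have [clj _] := loop_rootP _ _ _ rj.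
rewrite -(stage_sameB iBl_inj stageH1l stageH2l clj cls) in js; exact: js.
Qed.

Let exr t : closed_at p3 g3 t -> exists2 i, rootr i & same_loop p3 g3 (dl i) t.
Proof.
case/(stage_closed_ex iBr_inj iCr_inj g3K al3K (@glueK _ _ _)
  (acrossK x (comp y z)) stageH1r stageH1lr stageH2r stageH3r stageH4r stageH5r
  stageH6r) => [[u clu ut]|[s cls st]].
  have [l rl lu] := loop_root_ex clu; exists (inl l) => //.
  apply: slt ut; rewrite -(stage_sameC iCr_inj g3K al3K (@glueK _ _ _)
   (acrossK x (comp y z)) stageH1r stageH1lr stageH2r stageH3r stageH4r
   stageH6r) in lu; exact: lu.
have [j rj js] := loop_root_ex cls; exists (inr j) => //.
apply: slt st; have [clj _] := loop_rootP _ _ _ rj.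
rewrite -(stage_sameB iBr_inj stageH1r stageH2r clj cls) in js; exact: js.
Qed.

Let uniql i i' : rootl i -> rootl i' -> R i i' -> i = i'.
Proof.
have BC j l : rootl (inl j) -> R (inl j) (inr l) -> False.
  move=> /loop_rootP[clj _].
  have := stage_sameBC stageH1l stageH2l stageH3l stageH6l (inr (inl l)) clj.
  by move/negP.
case: i => j; case: i' => j' rj rj'.
- have [clj _] := loop_rootP _ _ _ rj; have [clj' _] := loop_rootP _ _ _ rj'.
  rewrite /R [same_loop _ _ _ _](stage_sameB iBl_inj stageH1l stageH2l clj clj').
  by move=> /(loop_root_inj rj rj')->.
- by move=> /(BC _ _ rj).
- by rewrite Rsym => /(BC _ _ rj').
- rewrite /R [same_loop _ _ _ _](stage_sameC iCl_inj g3K al3K (@glueK _ _ _)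
   (acrossK (comp x y) z) stageH1l stageH1ll stageH2l stageH3l stageH4l
   stageH6l (inr (inl j)) (inr (inl j'))).
  by move=> /(loop_root_inj rj rj')->.
Qed.

Let uniqr i i' : rootr i -> rootr i' -> R i i' -> i = i'.
Proof.
have BC j l : rootr (inr j) -> R (inr j) (inl l) -> False.
  move=> /loop_rootP[clj _].
  have := stage_sameBC stageH1r stageH2r stageH3r stageH6r (inr (inl l)) clj.
  by move/negP.
case: i => j; case: i' => j' rj rj'.
- rewrite /R [same_loop _ _ _ _](stage_sameC iCr_inj g3K al3K (@glueK _ _ _)
   (acrossK x (comp y z)) stageH1r stageH1lr stageH2r stageH3r stageH4r
   stageH6r (inr (inl j)) (inr (inl j'))).
  by move=> /(loop_root_inj rj rj')->.
- by rewrite Rsym => /(BC _ _ rj').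
- by move=> /(BC _ _ rj).
- have [clj _] := loop_rootP _ _ _ rj; have [clj' _] := loop_rootP _ _ _ rj'.
  rewrite /R [same_loop _ _ _ _](stage_sameB iBr_inj stageH1r stageH2r clj clj').
  by move=> /(loop_root_inj rj rj')->.
Qed.

(** The closed loops of the triple stack are counted in two ways: by those closed when the first two
    diagrams meet, or by those closed when the last two meet. A loop may get different roots and
    directions in the two counts; [deltaN] makes its scalar independent of the direction. *)
Lemma loops_assoc :
  loops x y delta * loops (comp x y) z delta = loops y z delta * loops x (comp y z) delta.
Proof.
transitivity (\prod_(i | rootl i) wl i); first by rewrite big_sumType.
rewrite mulrC; transitivity (\prod_(i | rootr i) wr i); last by rewrite big_sumType.
(* The relation [R] pairs roots of the two bracketings that lie on one loop of the triple stack. *)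
apply: (@big_classes _ _ _ _ _ _ _ R).
- by move=> i /closedl/exr[j rj ij]; exists j; rewrite // Rsym.
- by move=> j /closedr/exl[i ri ij]; exists i.
- move=> i j j' _ rj rj' ij ij'; apply: uniqr => //.
  by rewrite Rsym in ij; apply: slt ij'.
- move=> i i' j ri ri' _ ij ij'; apply: uniql => //.
  by rewrite Rsym in ij'; apply: slt ij'.
- move=> i j ri rj ij; rewrite labell // labelr //.
  exact: (walk_label_same p3_inj g3K p3g lab3g).
Qed.

End Assoc.

(** * Step-by-step evaluation of composites *)

Section Walk.
Variables (Z : finZmodType) (a b c : nat) (x : diag Z a b) (y : diag Z b c).
Notation state := (('I_a + 'I_b) + ('I_b + 'I_c))%type.

(** A certificate that the walk from [s] ends at the outer node [w] with total label [l]. Composites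
    with explicit diagrams are evaluated by giving such a certificate strand by strand. *)
Inductive walk_to : state -> 'I_a + 'I_c -> Z -> Prop :=
| WalkEnd s w : across x y s = inner b w -> walk_to s w (slab x y s)
| WalkStep s w l : outer (across x y s) = None -> walk_to (cnext x y s) w l ->
    walk_to s w (slab x y s + l).

Lemma walk_comp v w l : walk_to (inner b v) w l ->
  mate (comp x y) v = w /\ lab (comp x y) v = l.
Proof.
move Es: (inner b v) => s W.
suff [k [Ek mink ->]] : exists k,
    [/\ across x y (iter k (cnext x y) s) = inner b w,
        forall i, (i < k)%N -> outer (across x y (iter i (cnext x y) s)) = None
      & l = \sum_(i < k.+1) slab x y (iter i (cnext x y) s)].
  by rewrite -Es; apply: compE; rewrite Es.
elim: W {Es} => {s w l} [s w E|s w l out _ [k [Ek mink El]]].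
  by exists 0%N; split=> //; rewrite big_ord1.
exists k.+1; split=> [|[|i] lti|]; rewrite ?iterSr //.
  exact: mink.
by rewrite El [RHS]big_ord_recl; congr (_ + _); apply: eq_bigr => i _; rewrite -iterSr.
Qed.

(** A closed loop has no exit in either direction, so a single exit, downwards or upwards, shows
    that a central node is not a root. *)
Lemma loops1 (k : pzSemiRingType) (delta : Z -> k) :
  (forall j : 'I_b, exists i, outer (iter i (cnext x y) (inr (inl j))) <> None \/
     outer (iter i (cnext x y) (inl (inr j))) <> None) ->
  loops x y delta = 1.
Proof.
move=> h; rewrite /loops big_pred0 // => j; have [i [hi|hi]] := h j.
  exact: not_loop_root hi.
apply/negP=> /loop_rootP[cl _].
have := closed_g (@cnext_inj _ _ _ _ x y) (@glueK _ _ _) (@cnext_glue _ _ _ _ x y) cl.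
by move=> /(_ _ (fconnect_iter _ i _))/glue_outer.
Qed.

End Walk.

(** * Products with wreath elements; dangles and their factorisations *)

Section WreathComp.
Variable Z : finZmodType.

Definition wpr a b (g : wreath Z b) (v : 'I_a + 'I_b) : 'I_a + 'I_b :=
  match v with inl i => inl i | inr j => inr (g.2 j) end.
Definition wpl b c (g : wreath Z b) (v : 'I_b + 'I_c) : 'I_b + 'I_c :=
  match v with inl i => inl ((g.2^-1)%g i) | inr j => inr j end.
Definition wsr a b (g : wreath Z b) (v : 'I_a + 'I_b) : Z :=
  match v with inl i => 0 | inr j => g.1 j end.
Definition wsl b c (g : wreath Z b) (v : 'I_b + 'I_c) : Z :=
  match v with inl i => g.1 ((g.2^-1)%g i) | inr j => 0 end.

Lemma mate_wdl N (g : wreath Z N) i : mate (wdiag g) (inl i) = inr (g.2 i).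
Proof. by rewrite /mate /= ffunE. Qed.
Lemma mate_wdr N (g : wreath Z N) j : mate (wdiag g) (inr j) = inl ((g.2^-1)%g j).
Proof. by rewrite /mate /= ffunE. Qed.
Lemma lab_wdl N (g : wreath Z N) i : lab (wdiag g) (inl i) = g.1 i.
Proof. by rewrite /lab /= ffunE. Qed.
Lemma lab_wdr N (g : wreath Z N) j : lab (wdiag g) (inr j) = - g.1 ((g.2^-1)%g j).
Proof. by rewrite /lab /= ffunE. Qed.

(** Apart from the renumbering [wpr], a wreath element changes the labels by a coboundary, the
    difference of [wsr] at the two ends of a strand. This form is the source of all later gauge
    arguments. *)
Lemma comp_wdiagr a b (x : diag Z a b) (g : wreath Z b) v :
  mate (comp x (wdiag g)) (wpr g v) = wpr g (mate x v) /\
  lab (comp x (wdiag g)) (wpr g v) = lab x v + wsr g (mate x v) - wsr g v.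
Proof.
apply: walk_comp; case: v => [i|j] /=.
  rewrite subr0; case E: (mate x (inl i)) => [i'|j] /=.
    by rewrite addr0; apply: WalkEnd; rewrite /= E.
  apply: (WalkStep (l := g.1 j)); rewrite /= ?E //.
  have /= := @WalkEnd _ _ _ _ x (wdiag g) (inr (inl j)) (inr (g.2 j)).
  by rewrite lab_wdl mate_wdl /cnext /= E /=; apply.
have -> : lab x (inr j) + wsr g (mate x (inr j)) - g.1 j
   = - g.1 j + (lab x (inr j) + wsr g (mate x (inr j))) by rewrite addrC.
have := @WalkStep _ _ _ _ x (wdiag g) (inr (inr (g.2 j))).
rewrite /cnext /= mate_wdr lab_wdr permK /=; apply=> //.
case E: (mate x (inr j)) => [i|j'] /=.
  by rewrite addr0; apply: WalkEnd; rewrite /= E.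
apply: (WalkStep (l := g.1 j')); rewrite /cnext /= ?E //=.
have /= := @WalkEnd _ _ _ _ x (wdiag g) (inr (inl j')) (inr (g.2 j')).
by rewrite lab_wdl mate_wdl /=; apply.
Qed.

Lemma comp_wdiagl b c (y : diag Z b c) (g : wreath Z b) v :
  mate (comp (wdiag g) y) (wpl g v) = wpl g (mate y v) /\
  lab (comp (wdiag g) y) (wpl g v) = lab y v + wsl g v - wsl g (mate y v).
Proof.
apply: walk_comp; case: v => [i|j] /=; last first.
  rewrite addr0; case E: (mate y (inr j)) => [i|j'] /=; last first.
    by rewrite subr0; apply: WalkEnd; rewrite /= E.
  apply: (WalkStep (l := - g.1 ((g.2^-1)%g i))); rewrite /= ?E //.
  have /= := @WalkEnd _ _ _ _ (wdiag g) y (inl (inr i)) (inl ((g.2^-1)%g i)).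
  by rewrite lab_wdr mate_wdr /cnext /= E /=; apply.
have -> : lab y (inl i) + g.1 ((g.2^-1)%g i) - wsl g (mate y (inl i))
   = g.1 ((g.2^-1)%g i) + (lab y (inl i) - wsl g (mate y (inl i))).
  by rewrite (addrC (lab _ _)) addrA.
have := @WalkStep _ _ _ _ (wdiag g) y (inl (inl ((g.2^-1)%g i))).
rewrite /cnext /= mate_wdl lab_wdl permKV /=; apply=> //.
case E: (mate y (inl i)) => [i'|j'] /=; last first.
  by rewrite subr0; apply: WalkEnd; rewrite /= E.
apply: (WalkStep (l := - g.1 ((g.2^-1)%g i'))); rewrite /cnext /= ?E //=.
have /= := @WalkEnd _ _ _ _ (wdiag g) y (inl (inr i')) (inl ((g.2^-1)%g i')).
by rewrite lab_wdr mate_wdr /=; apply.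
Qed.

Lemma wprK a b (g : wreath Z b) (v : 'I_a + 'I_b) :
  exists u, v = wpr g u.
Proof.
case: v => [i|j]; first by exists (inl i).
by exists (inr ((g.2^-1)%g j)); rewrite /= permKV.
Qed.

Lemma loops_wdiagr (k : pzSemiRingType) (delta : Z -> k) a b (x : diag Z a b)
  (g : wreath Z b) : loops x (wdiag g) delta = 1.
Proof.
apply: loops1 => j; exists 1%N; left.
by rewrite /= /cnext /= mate_wdl.
Qed.

Lemma loops_wdiagl (k : pzSemiRingType) (delta : Z -> k) b c (y : diag Z b c)
  (g : wreath Z b) : loops (wdiag g) y delta = 1.
Proof.
apply: loops1 => j; exists 1%N; right.
by rewrite /= /cnext /= mate_wdr.
Qed.

Definition wone N : wreath Z N := ([ffun=> 0], 1%g).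
Definition idd N : diag Z N N := wdiag (wone N).

Lemma comp_idr a b (x : diag Z a b) : comp x (idd b) = x.
Proof.
have E v : wpr (wone b) v = v :> 'I_a + 'I_b by case: v => j //=; rewrite perm1.
have E0 (v : 'I_a + 'I_b) : wsr (wone b) v = 0 by case: v => j //=; rewrite ffunE.
apply: diag_eq => v; have [] := comp_wdiagr x (wone b) v; rewrite !E // => _ ->.
by rewrite !E0 addr0 subr0.
Qed.

Lemma comp_idl b c (y : diag Z b c) : comp (idd b) y = y.
Proof.
have E v : wpl (wone b) v = v :> 'I_b + 'I_c by case: v => j //=; rewrite invg1 perm1.
have E0 (v : 'I_b + 'I_c) : wsl (wone b) v = 0 by case: v => j //=; rewrite ffunE.
apply: diag_eq => v; have [] := comp_wdiagl y (wone b) v; rewrite !E // => _ ->.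
by rewrite !E0 addr0 subr0.
Qed.

Lemma comp_wdiag N (g h : wreath Z N) : comp (wdiag g) (wdiag h) = wdiag (wmul g h).
Proof.
apply: diag_eq => v; have [u ->] := wprK h v;
  have [Em El] := comp_wdiagr (wdiag g) h u.
  rewrite Em; case: u {Em El} => i /=; rewrite ?mate_wdl ?mate_wdr /= ?permM //.
  by rewrite invMg permM permK.
rewrite El; case: u {Em El} => i /=; rewrite ?mate_wdl ?mate_wdr ?lab_wdl ?lab_wdr /=.
  by rewrite ffunE subr0.
by rewrite addr0 ffunE invMg permM permK permKV opprD.
Qed.

Definition winv N (g : wreath Z N) : wreath Z N :=
  ([ffun i => - g.1 ((g.2^-1)%g i)], (g.2^-1)%g).

Lemma wmulVr N (g : wreath Z N) : wmul g (winv g) = wone N.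
Proof.
by congr (_, _); rewrite ?mulgV //; apply/ffunP=> i; rewrite !ffunE /= permK subrr.
Qed.

Lemma wmulVl N (g : wreath Z N) : wmul (winv g) g = wone N.
Proof.
by congr (_, _); rewrite ?mulVg //; apply/ffunP=> i; rewrite !ffunE /= addNr.
Qed.

Lemma wmul1 N (g : wreath Z N) : wmul g (wone N) = g.
Proof.
case: g => l s; congr (_, _); rewrite /= ?mulg1 //.
by apply/ffunP=> i; rewrite !ffunE /= addr0.
Qed.

Lemma w1mul N (g : wreath Z N) : wmul (wone N) g = g.
Proof.
case: g => l s; congr (_, _); rewrite /= ?mul1g //.
by apply/ffunP=> i; rewrite !ffunE /= add0r perm1.
Qed.

Lemma wmulA N : associative (@wmul Z N).
Proof.
move=> g h l; congr (_, _); rewrite /= ?mulgA //.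
by apply/ffunP=> i; rewrite !ffunE /= permM addrA.
Qed.

Definition isnorth a b (v : 'I_a + 'I_b) := if v is inl _ then true else false.

(** No southern arcs. These are the diagrams with a factorisation into a dangle and a wreath
    element, hence the ones giving non-zero vectors of a cell module. *)
Definition full a b (d : diag Z a b) := [forall j, isnorth (mate d (inr j))].

Lemma fullP a b (d : diag Z a b) :
  reflect (forall j, exists i, mate d (inr j) = inl i) (full d).
Proof.
apply: (iffP forallP) => h j; have := h j; first by case: mate => // i _; exists i.
by case=> i ->.
Qed.

Lemma full_comp_wdiagr a b (d : diag Z a b) g : full (comp d (wdiag g)) = full d.
Proof.
have E j : mate (comp d (wdiag g)) (inr (g.2 j)) = wpr g (mate d (inr j)).
  by have [] := comp_wdiagr d g (inr j).
apply/forallP/forallP => h j.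
  by have := h (g.2 j); rewrite E; case: (mate d _).
by have := h ((g.2^-1)%g j); rewrite -{2}(permKV g.2 j) E; case: (mate d _).
Qed.

Lemma full_comp_wdiagl a b (d : diag Z a b) g : full (comp (wdiag g) d) = full d.
Proof.
have E j : mate (comp (wdiag g) d) (inr j) = wpl g (mate d (inr j)).
  by have [] := comp_wdiagl d g (inr j).
by apply/forallP/forallP => h j; have := h j; rewrite E; case: (mate d _).
Qed.

Lemma full_dangle a b (d : diag Z a b) : is_dangle d -> full d.
Proof.
case/andP=> /forallP h _; apply/fullP => j.
by have /existsP[i /andP[/eqP]] := h j; exists i.
Qed.

Lemma dangle_lab a b (d : diag Z a b) j : is_dangle d -> lab d (inr j) = 0.
Proof. by case/andP=> /forallP/(_ j)/existsP[i /andP[_ /eqP]]. Qed.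

Lemma dangle_mono a b (d : diag Z a b) (j j' : 'I_b) i i' : is_dangle d ->
  mate d (inr j) = inl i -> mate d (inr j') = inl i' -> (j < j')%N -> (i < i')%N.
Proof.
case/andP=> _ /forallP/(_ j)/forallP/(_ j')/forallP/(_ i)/forallP/(_ i')/implyP h.
by move=> Ei Ei' lt; apply: h; rewrite lt Ei Ei' !eqxx.
Qed.

(** A monotone permutation preserves the number of elements below a given one, and this number is
    the element itself. *)
Lemma perm_mono1 b (s : 'S_b) : (forall i j : 'I_b, (i < j)%N -> (s i < s j)%N) -> s = 1%g.
Proof.
move=> mono; apply/permP=> j; rewrite perm1; apply/val_inj => /=.
have card_lt (k : 'I_b) : #|[pred i : 'I_b | (i < k)%N]| = k.
  rewrite -sum1_card (eq_bigl (fun i : 'I_b => (i < k)%N)); last by move=> i; rewrite inE.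
  by rewrite (big_ord_narrow (ltnW (ltn_ord k))) /= sum1_card card_ord.
rewrite -[LHS]card_lt -[RHS]card_lt -[RHS](card_image (@perm_inj _ s)).
apply: eq_card => i.
apply/idP/fintype.imageP => [lt|[i' lt ->]].
  rewrite inE in lt.
  exists ((s^-1)%g i); last by rewrite permKV.
  rewrite inE ltnNge leq_eqVlt; apply/negP=> /orP[/eqP/val_inj E|/mono].
    by move: lt; rewrite E permKV ltnn.
  by rewrite permKV ltnNge (ltnW lt).
by rewrite inE in lt; rewrite inE; apply: mono.
Qed.

(** The quotient [h] of the two wreath parts carries one dangle to another. Non-crossing free lines
    force its permutation to be monotone, hence trivial, and the vanishing labels of the free lines
    force its labels to be 0. *)
Lemma dangle_uniq a b (e e' : diag Z a b) g g' : is_dangle e -> is_dangle e' ->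
  comp e (wdiag g) = comp e' (wdiag g') -> e = e' /\ g = g'.
Proof.
move=> de de' E.
have {}E : comp e (wdiag (wmul g (winv g'))) = e'.
  by rewrite -comp_wdiag -comp_assoc E comp_assoc comp_wdiag wmulVr comp_idr.
set h := wmul _ _ in E.
have h1 : h = wone b.
  have Em j := proj1 (comp_wdiagr e h (inr j)).
  have El j := proj2 (comp_wdiagr e h (inr j)).
  have h2 : h.2 = 1%g.
    apply: perm_mono1 => i j lt; rewrite ltnNge leq_eqVlt; apply/negP.
    have [[ii Ei] [jj Ej]] := (fullP _ (full_dangle de) i, fullP _ (full_dangle de) j).
    have := Em i; have := Em j; rewrite E /= Ei Ej /= => Ej' Ei'.
    case/orP=> [/eqP/val_inj/perm_inj e_ij|lt']; first by rewrite e_ij ltnn in lt.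
    have := dangle_mono de' Ej' Ei' lt'.
    by rewrite ltnNge (ltnW (dangle_mono de Ei Ej lt)).
  rewrite [h]surjective_pairing h2; congr (_, _); apply/ffunP=> j; rewrite [RHS]ffunE.
  have := El j; rewrite E /= (dangle_lab _ de') (dangle_lab _ de) add0r.
  have [i ->] := fullP _ (full_dangle de) j.
  by rewrite /= sub0r => /eqP; rewrite eq_sym oppr_eq0 => /eqP.
split; first by rewrite -E h1 comp_idr.
by rewrite -[g]wmul1 -(wmulVl g') wmulA -/h h1 w1mul.
Qed.

(* The south nodes are renumbered by the rank of their north ends. *)
Lemma dangle_factor a b (d : diag Z a b) : full d ->
  exists e g, is_dangle e /\ comp e (wdiag g) = d.
Proof.
move=> fd; have /fin_all_exists[f Ef] := fullP _ fd.
have f_inj : injective f.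
  move=> j j' E; have := congr1 (mate d) (Ef j); rewrite E -Ef !mateK.
  by case.
pose rk (j : 'I_b) := #|[pred j' | (f j' < f j)%N]|.
have rk_lt j : (rk j < b)%N.
  rewrite -[X in (_ < X)%N](card_ord b); apply: proper_card.
  by apply/properP; split; [apply/subsetP|exists j; rewrite // inE ltnn].
have rk_mono j j' : (f j < f j')%N -> (rk j < rk j')%N.
  move=> lt; apply: proper_card; apply/properP; split.
    by apply/subsetP=> i; rewrite !inE => /ltn_trans; apply.
  by exists j; rewrite !inE ?lt // ltnn.
move: rk rk_lt rk_mono => rk rk_lt rk_mono.
have rk_inj : injective (fun j => Ordinal (rk_lt j)).
  move=> j j' /(congr1 val) /= E; apply: f_inj; apply: ord_inj.
  by case: (ltngtP (f j) (f j')) => // /rk_mono; rewrite E ltnn.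
pose h : wreath Z b := ([ffun j => lab d (inr j)], perm rk_inj).
exists (comp d (wdiag h)), (winv h).
rewrite comp_assoc comp_wdiag wmulVr comp_idr; split=> //.
have Em j : mate (comp d (wdiag h)) (inr (h.2 j)) = inl (f j).
  by have [/= -> _] := comp_wdiagr d h (inr j); rewrite Ef.
apply/andP; split.
  apply/forallP=> j; rewrite -[j](permKV h.2); move: ((h.2^-1)%g j) => {}j.
  apply/existsP; exists (f j); rewrite Em eqxx /=.
  by have [_ /= ->] := comp_wdiagr d h (inr j); rewrite Ef /= addr0 ffunE subrr.
apply/forallP=> j; apply/forallP=> j'; apply/forallP=> i; apply/forallP=> i'.
rewrite -[j](permKV h.2) -[j'](permKV h.2).
move: ((h.2^-1)%g j) ((h.2^-1)%g j') => {}j {}j'.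
rewrite !Em; apply/implyP=> /and3P[lt /eqP[<-] /eqP[<-]].
move: lt; rewrite /= !permE /= ltnNge; apply: contraR; rewrite -leqNgt leq_eqVlt.
case/orP=> [/eqP e|/rk_mono/ltnW //].
by rewrite (f_inj _ _ (ord_inj e)).
Qed.

End WreathComp.

(** * Modules, subquotients and the Jordan-Hoelder theorem *)

Lemma bij_lker0 (k : fieldType) (U V : vectType k) (f : 'Hom(U, V)) :
  injective f -> (forall v, exists u, f u = v) -> bijective f.
Proof.
move=> f_inj f_surj; exists (f^-1)%VF.
  by apply: lker0_lfunK; apply/lker0P.
move=> v; apply: limg_lfunVK; have [u <-] := f_surj v.
by rewrite memv_img ?memvf.
Qed.

Lemma bij_dim (k : fieldType) (U V : vectType k) (f : 'Hom(U, V)) :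
  bijective f -> dim U = dim V.
Proof.
move=> f_bij; have k0 : (fullv :&: lker f = 0)%VS.
  have /eqP-> : lker f == 0%VS by apply/lker0P/bij_inj.
  by rewrite capv0.
rewrite -!dimvf -(limg_dim_eq k0); congr (\dim _); apply/vspaceP=> v.
case: f_bij => g _ gK; rewrite memvf.
by have := memv_img f (memvf (g v)); rewrite gK.
Qed.

Section RepTheory.
Variables (k : fieldType) (D : finType).
Implicit Types M N L : rep k D.

Lemma isorP M N : isor M N <-> exists f : 'Hom(M, N),
  [/\ forall x v, f (act M x v) = act N x (f v), injective f
    & forall v, exists u, f u = v].
Proof.
split=> [[f /homvP hf fb]|[f [hf f_inj f_surj]]].
  exists f; split=> //; first exact: bij_inj.
  by move=> v; case: fb => g _ gK; exists (g v).
by exists f; [apply/homvP|apply: bij_lker0].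
Qed.

Lemma isor_refl M : isor M M.
Proof.
apply/isorP; exists \1%VF; split=> [x v|u v|v]; rewrite ?id_lfunE //.
by exists v; rewrite id_lfunE.
Qed.

Lemma isor_sym M N : isor M N -> isor N M.
Proof.
case/isorP=> f [hf f_inj f_surj]; have k0 : lker f == 0%VS by apply/lker0P.
have fK := lker0_lfunK k0.
have fVK v : f ((f^-1)%VF v) = v.
  by have [u <-] := f_surj v; rewrite fK.
apply/isorP; exists (f^-1)%VF; split=> [x v|u v e|v].
- by apply: f_inj; rewrite hf !fVK.
- by rewrite -(fVK u) e fVK.
- by exists (f v).
Qed.

Lemma isor_trans M N L : isor M N -> isor N L -> isor M L.
Proof.
case/isorP=> f [hf f_inj f_surj] /isorP[g [hg g_inj g_surj]].
apply/isorP; exists (g \o f)%VF; split=> [x v|u v|v]; rewrite ?comp_lfunE.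
- by rewrite hf hg.
- by move=> /g_inj/f_inj.
- by have [w <-] := g_surj v; have [u <-] := f_surj w; exists u; rewrite comp_lfunE.
Qed.

Lemma submodP M (U : {vspace M}) :
  reflect (forall x v, v \in U -> act M x v \in U) (submod U).
Proof.
apply: (iffP forallP) => h x; first by move=> v vU; apply: subvP (h x) _ (memv_img _ vU).
by apply/subvP=> w /memv_imgP[v vU ->]; apply: h.
Qed.

Lemma submod0 M : submod (0%VS : {vspace M}).
Proof. by apply/submodP=> x v; rewrite !memv0 => /eqP->; rewrite linear0. Qed.

Lemma submodf M : submod ({:M}%VS : {vspace M}).
Proof. by apply/submodP=> x v _; rewrite memvf. Qed.

Lemma submod_add M (U W : {vspace M}) : submod U -> submod W -> submod (U + W)%VS.
Proof.
move=> /submodP sU /submodP sW; apply/submodP=> x v /memv_addP[u uU [w wW ->]].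
by rewrite linearD memv_add ?sU ?sW.
Qed.

Lemma submod_cap M (U W : {vspace M}) : submod U -> submod W -> submod (U :&: W)%VS.
Proof.
move=> /submodP sU /submodP sW; apply/submodP=> x v; rewrite !memv_cap => /andP[? ?].
by rewrite sU ?sW.
Qed.

Section Subquotient.
Variables (M : rep k D) (U V : {vspace M}).

Definition sqpi : 'Hom(M, subquot U V) :=
  (linfun (vsproj (V :\: U)%VS) \o addv_pi1 V U)%VF.
Definition sqval : 'Hom(subquot U V, M) := linfun (@vsval k M (V :\: U)%VS).

Lemma sqact x s : act (subquot U V) x s = sqpi (act M x (sqval s)).
Proof. by do 2![rewrite comp_lfunE]. Qed.

Lemma sqvalE s : sqval s = vsval s. Proof. by rewrite lfunE. Qed.

Lemma sqval_in s : sqval s \in V.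
Proof. by rewrite sqvalE; apply: subvP (diffvSl _ _) _ (subvsP _). Qed.

Lemma sqval_pi v : sqval (sqpi v) = addv_pi1 V U v.
Proof.
rewrite sqvalE comp_lfunE lfunE /= vsprojK //; exact: memv_pi.
Qed.

Lemma sqvalK s : sqpi (sqval s) = s.
Proof.
apply: subvs_inj; rewrite -!sqvalE sqval_pi sqvalE.
by apply: daddv_pi_id (subvsP s); apply: capv_diff.
Qed.

Hypothesis UV : (U <= V)%VS.

Lemma sqpi_sub v : v \in V -> v - sqval (sqpi v) \in U.
Proof.
move=> vV; rewrite sqval_pi -{1}[v](@addv_pi1_pi2 _ _ V U) ?(addv_idPl UV) //.
by rewrite addrAC subrr add0r memv_pi2.
Qed.

Lemma sqpi_eq0 v : v \in V -> (sqpi v == 0) = (v \in U).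
Proof.
move=> vV; apply/eqP/idP=> [e0|vU].
  by have := sqpi_sub vV; rewrite e0 linear0 subr0.
have : sqval (sqpi v) \in ((V :\: U) :&: U)%VS.
  rewrite memv_cap {1}sqvalE subvsP /=.
  by rewrite -[sqval _](subKr v) memvB // sqpi_sub.
rewrite capv_diff memv0 => /eqP e0; apply: subvs_inj.
by rewrite -sqvalE e0 linear0.
Qed.

Lemma sqpi_eq u v : u \in V -> v \in V -> (sqpi u == sqpi v) = (u - v \in U).
Proof. move=> uV vV; rewrite -subr_eq0 -linearB sqpi_eq0 //; exact: memvB. Qed.

Hypotheses (sU : submod U) (sV : submod V).

Lemma sqpi_act x v : v \in V -> sqpi (act M x v) = act (subquot U V) x (sqpi v).
Proof.
move=> vV; rewrite sqact; apply/eqP.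
rewrite sqpi_eq ?(submodP _ sV) ?sqval_in // -linearB.
by apply: (submodP _ sU); apply: sqpi_sub.
Qed.

End Subquotient.

(** What is needed of a linear map [f] to induce an isomorphism from V / U to V' / U'. It need be
    compatible with the action only on [V] and modulo [U']. *)
Definition sec_iso M N (U V : {vspace M}) (U' V' : {vspace N}) (f : 'Hom(M, N)) :=
  [/\ forall v, v \in V -> f v \in V',
      forall v, v \in V -> (f v \in U') = (v \in U),
      forall v', v' \in V' -> exists2 v, v \in V & v' - f v \in U'
    & forall x v, v \in V -> f (act M x v) - act N x (f v) \in U'].

Lemma isor_subquot M N (U V : {vspace M}) (U' V' : {vspace N}) f :
  (U <= V)%VS -> submod U -> submod V -> (U' <= V')%VS -> submod U' -> submod V' ->
  sec_iso U V U' V' f -> isor (subquot U V) (subquot U' V').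
Proof.
move=> UV sU sV UV' sU' sV' [fV fU fsurj fact].
pose h := (sqpi U' V' \o f \o sqval U V)%VF.
have hE s : h s = sqpi U' V' (f (sqval U V s)) by do 2![rewrite comp_lfunE].
apply/isorP; exists h; split=> [x s|s t|t]; rewrite ?hE.
- rewrite sqact -sqpi_act ?fV ?sqval_in //.
  set v := sqval U V s; have vV : v \in V := sqval_in s.
  have xvV : act M x v \in V by apply: (submodP _ sV).
  apply/eqP; rewrite sqpi_eq ?fV ?sqval_in ?(submodP _ sV') ?fV //.
  rewrite -[X in X - _](subrK (f (act M x v))) -addrA memvD ?fact //.
  rewrite -linearB fU; last by rewrite memvB ?sqval_in.
  by rewrite -opprB memvN sqpi_sub.
- move/eqP; rewrite sqpi_eq ?fV ?sqval_in // -linearB.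
  rewrite fU => [e|]; last by rewrite memvB ?sqval_in.
  by rewrite -(sqvalK s) -(sqvalK t); apply/eqP; rewrite sqpi_eq ?sqval_in.
- have [v vV e] := fsurj _ (sqval_in t); exists (sqpi U V v).
  rewrite hE -[RHS]sqvalK; apply/eqP; rewrite sqpi_eq ?fV ?sqval_in //.
  set w := f _; have -> : w - sqval U' V' t = (w - f v) - (sqval U' V' t - f v).
    by rewrite opprB addrA subrK.
  apply: memvB => //.
  rewrite -linearB fU; last by rewrite memvB ?sqval_in.
  by rewrite -opprB memvN sqpi_sub.
Qed.

Lemma subquot_full M : isor (subquot 0%VS {:M}%VS) M.
Proof.
have h (v : M) : v \in {:M}%VS by rewrite memvf.
apply/isor_sym/isorP; exists (sqpi 0 {:M}%VS); split=> [x v|u v /eqP|s].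
- by rewrite sqpi_act ?sub0v ?submod0 ?submodf.
- by rewrite sqpi_eq ?sub0v // memv0 subr_eq0 => /eqP.
- by exists (sqval 0 {:M}%VS s); rewrite sqvalK.
Qed.

Lemma dim_subquot M (U V : {vspace M}) : (U <= V)%VS ->
  dim (subquot U V) = (\dim V - \dim U)%N.
Proof.
move=> UV; rewrite -(dimv_cap_compl V U) (capv_idPr UV) addKn.
by [].
Qed.

Lemma simple_iso M N : isor M N -> simple M -> simple N.
Proof.
case/isorP=> f [hf f_inj f_surj] [M0 sM].
have kf0 : lker f == 0%VS by apply/lker0P.
split=> [|U /submodP sU].
  apply: contraNneq M0 => N0; rewrite -subv0; apply/subvP=> v _.
  rewrite memv0; apply/eqP/f_inj; rewrite linear0; apply/eqP.
  by rewrite -memv0 -N0 memvf.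
have sP : submod (f @^-1: U)%VS.
  by apply/submodP=> x v; rewrite -!memv_preim hf => /sU.
have [E|E] := sM _ sP; [left|right]; apply/vspaceP=> w; have [v <-] := f_surj w.
  rewrite memv_preim E !memv0; apply/eqP/eqP=> [->|e]; first by rewrite linear0.
  by apply: f_inj; rewrite linear0.
by rewrite memv_preim E !memvf.
Qed.

Lemma simple_subquotP M (U V : {vspace M}) : (U <= V)%VS -> submod U -> submod V ->
  simple (subquot U V) <->
  (U <> V /\ forall W, submod W -> (U <= W)%VS -> (W <= V)%VS -> W = U \/ W = V).
Proof.
move=> UV sU sV; split=> [[Q0 sQ]|[nUV h]].
  split=> [E|W sW UW WV].
    case/eqP: Q0; apply/vspaceP=> s; rewrite memvf; symmetry; rewrite memv0.
    rewrite -(sqvalK s) sqpi_eq0 ?sqval_in //.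
    have VU : (V <= U)%VS by rewrite E.
    exact: subvP VU _ (sqval_in s).
  have mem v : v \in V -> (sqpi U V v \in (sqpi U V @: W)%VS) = (v \in W).
    move=> vV; apply/idP/idP=> [/memv_imgP[w wW] e|]; last exact: memv_img.
    have wV := subvP WV _ wW; move/eqP: e; rewrite sqpi_eq // => e.
    by rewrite -(subrK w v) memvD // (subvP UW).
  have sQW : submod (sqpi U V @: W)%VS.
    apply/submodP=> x s /memv_imgP[w wW ->]; have wV := subvP WV _ wW.
    by rewrite -sqpi_act // memv_img // (submodP _ sW).
  have [E|E] := sQ _ sQW; [left|right]; apply/vspaceP=> v.
    apply/idP/idP=> vW; last exact: subvP UW _ vW.
    have vV := subvP WV _ vW.
    by rewrite -(sqpi_eq0 UV) // -memv0 -E mem.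
  apply/idP/idP=> vW; first exact: subvP WV _ vW.
  by rewrite -mem // E memvf.
split=> [|T /submodP sT].
  apply/eqP=> Q0; apply: nUV; apply/eqP; rewrite eqEsubv UV; apply/subvP=> v vV.
  by rewrite -(sqpi_eq0 UV) // -memv0 -Q0 memvf.
pose W := (sqpi U V @^-1: T :&: V)%VS.
have memW v : (v \in W) = (sqpi U V v \in T) && (v \in V) by rewrite memv_cap -memv_preim.
have [|||E|E] := h W.
- apply/submodP=> x v; rewrite !memW => /andP[vT vV].
  by rewrite sqpi_act // sT // (submodP _ sV).
- apply/subvP=> v vU; have vV := subvP UV _ vU; rewrite memW vV andbT.
  by move: vU; rewrite -(sqpi_eq0 UV) // => /eqP->; rewrite mem0v.
- by apply/subvP=> v; rewrite memW => /andP[].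
- have EU v : (v \in U) = (sqpi U V v \in T) && (v \in V) by rewrite -memW E.
  left; apply/vspaceP=> s; rewrite memv0 -(sqvalK s) sqpi_eq0 ?sqval_in // EU.
  by rewrite sqval_in andbT.
- have EV v : (v \in V) = (sqpi U V v \in T) && (v \in V) by rewrite -memW E.
  right; apply/vspaceP=> s; rewrite memvf -(sqvalK s).
  by have := sqval_in s; rewrite EV => /andP[].
Qed.

Section Chains.
Variables (L : rep k D).
Hypothesis L_simple : simple L.
Variable M : rep k D.
Implicit Types A B W X Y : {vspace M}.

Definition sec X Y : nat := `[< isor (subquot X Y) L >].

(** Repeated terms are allowed, so that intersecting a chain with a submodule, or adding the
    submodule to all its terms, gives a chain again. *)
Fixpoint chain A (s : seq {vspace M}) : Prop :=
  if s is Y :: s' then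
    [/\ submod Y, (A <= Y)%VS, A = Y \/ simple (subquot A Y) & chain Y s']
  else True.

Fixpoint cnt A (s : seq {vspace M}) : nat :=
  if s is Y :: s' then (sec A Y + cnt Y s')%N else 0%N.

Lemma sec0 X : submod X -> sec X X = 0%N.
Proof.
move=> sX; rewrite /sec; case: asboolP => //= /isor_sym/simple_iso/(_ L_simple).
by case/simple_subquotP=> // /(_ erefl).
Qed.

Lemma sec_eq N (X Y : {vspace M}) (X' Y' : {vspace N}) :
  isor (subquot X Y) (subquot X' Y') ->
  sec X Y = `[< isor (subquot X' Y') L >].
Proof.
move=> i; congr nat_of_bool; apply/asboolP/asboolP=> h; last exact: isor_trans h.
exact: isor_trans (isor_sym i) h.
Qed.

(** If Y / X is simple, X + (Y :&: W) is [X] or [Y]. In the first case the intersections with [W]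
    agree and Y / X survives in the sums; in the second the sums agree and it survives in the
    intersections. *)
Lemma sec_split X Y W : submod X -> submod Y -> submod W -> (X <= Y)%VS ->
  X = Y \/ simple (subquot X Y) ->
  [/\ ((X :&: W)%VS = (Y :&: W)%VS \/ simple (subquot (X :&: W)%VS (Y :&: W)%VS)),
      ((X + W)%VS = (Y + W)%VS \/ simple (subquot (X + W)%VS (Y + W)%VS))
    & sec X Y = (sec (X :&: W)%VS (Y :&: W)%VS + sec (X + W)%VS (Y + W)%VS)%N].
Proof.
move=> sX sY sW XY [->|simp].
  by rewrite !sec0 ?submod_cap ?submod_add //; split; auto.
have [sXc sYc sXa sYa] : [/\ submod (X :&: W)%VS, submod (Y :&: W)%VS,
  submod (X + W)%VS & submod (Y + W)%VS] by rewrite !submod_cap ?submod_add.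
have XYc : (X :&: W <= Y :&: W)%VS by rewrite capvS.
have XYa : (X + W <= Y + W)%VS by rewrite addvS.
have idE (v : M) : (\1%VF : 'End(M)) v = v by rewrite id_lfunE.
have [_ /(_ (X + (Y :&: W))%VS)] := (simple_subquotP XY sX sY).1 simp.
case.
- by rewrite submod_add // submod_cap.
- exact: addvSl.
- by rewrite subv_add XY capvSl.
- move=> E; have YWX : (Y :&: W <= X)%VS by rewrite -E addvSr.
  have Ec : (X :&: W)%VS = (Y :&: W)%VS.
    apply/eqP; rewrite eqEsubv XYc; apply/subvP=> v vYW; rewrite memv_cap.
    by rewrite (subvP YWX) //; move: vYW; rewrite memv_cap => /andP[].
  have i : isor (subquot X Y) (subquot (X + W)%VS (Y + W)%VS).
    apply: (@isor_subquot _ _ _ _ _ _ \1%VF) => //; split=> [v vY|v vY|v|x v vY].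
    + by rewrite idE; apply: subvP vY; apply: addvSl.
    + rewrite idE; apply/idP/idP=> [/memv_addP[u uX [w wW e]]|].
        rewrite e memvD // (subvP YWX) // memv_cap wW andbT.
        by rewrite -(addKr u w) -e addrC memvB // (subvP XY).
      by apply: subvP; apply: addvSl.
    + case/memv_addP=> [y yY [w wW ->]]; exists y; rewrite // idE addrAC subrr add0r.
      by apply: subvP wW; apply: addvSr.
    + by rewrite !idE subrr mem0v.
  split; [by left|by right; apply: simple_iso simp|].
  by rewrite Ec sec0 // (sec_eq i).
- move=> E.
  have Ea : (X + W)%VS = (Y + W)%VS.
    apply/eqP; rewrite eqEsubv XYa subv_add addvSr andbT -{1}E subv_add addvSl.
    exact: subv_trans (capvSr _ _) (addvSr _ _).
  have i : isor (subquot (X :&: W)%VS (Y :&: W)%VS) (subquot X Y).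
    apply: (@isor_subquot _ _ _ _ _ _ \1%VF) => //; split=> [v|v|v|x v vY].
    + by rewrite idE memv_cap => /andP[].
    + by rewrite idE !memv_cap => /andP[_ ->]; rewrite andbT.
    + rewrite -{1}E => /memv_addP[u uX [w wW ->]]; exists w => //.
      by rewrite idE addrK.
    + by rewrite !idE subrr mem0v.
  split; [by right; apply: simple_iso (isor_sym i) simp|by left|].
  by rewrite -Ea sec0 // addn0 (sec_eq (isor_sym i)).
Qed.

Lemma chain_split A s W : submod A -> submod W -> chain A s ->
  let sI := map (fun X => X :&: W)%VS s in let sU := map (fun X => X + W)%VS s in
  [/\ chain (A :&: W)%VS sI, chain (A + W)%VS sU
    & cnt A s = (cnt (A :&: W)%VS sI + cnt (A + W)%VS sU)%N].
Proof.
move=> + sW; elim: s A => [|Y s IHs] A sA //= [sY AY simp cs].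
have [cI cU ->] := IHs _ sY cs; have [sI sU ->] := sec_split sA sY sW AY simp.
split; [split=> //|split=> //|by rewrite addnACA].
- exact: submod_cap.
- exact: capvS.
- exact: submod_add.
- exact: addvS.
Qed.

Lemma chain_last A s : submod A -> chain A s -> submod (last A s) /\ (A <= last A s)%VS.
Proof.
elim: s A => [|Y s IHs] A sA //= [sY AY _ cs]; have [h1 h2] := IHs _ sY cs.
by split=> //; apply: subv_trans h2.
Qed.

Lemma cnt_stay A s : submod A -> chain A s -> last A s = A -> cnt A s = 0%N.
Proof.
elim: s => [|Y s IHs] //= sA [sY AY _ cs] E.
have [_ YA] := chain_last sY cs; rewrite E in YA.
have EY : Y = A by apply/eqP; rewrite eqEsubv YA AY.
by rewrite EY in cs E *; rewrite sec0 // IHs.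
Qed.

Lemma cnt_simple A B s : submod A -> chain A s -> last A s = B ->
  simple (subquot A B) -> cnt A s = sec A B.
Proof.
move=> + + + simp; elim: s => [|Y s IHs] /= sA cs E.
  by rewrite -E in simp *; rewrite sec0.
have [sY AY _ cs'] := cs; have [sB YB] := chain_last sY cs'; rewrite E in sB YB.
have [_ h] := (simple_subquotP (subv_trans AY YB) sA sB).1 simp.
have [EY|EY] := h Y sY AY YB.
  by rewrite EY in cs' E *; rewrite sec0 // IHs.
by rewrite EY in cs' E *; rewrite cnt_stay // addn0.
Qed.

(** Induction on the dimension between the two ends. If there is a proper intermediate submodule
    [W], both chains are split into their parts below and above [W], and these are compared
    separately; otherwise the section is simple or zero and the count is forced. *)
Lemma cnt_unique A s s' : submod A -> chain A s -> chain A s' ->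
  last A s = last A s' -> cnt A s = cnt A s'.
Proof.
move: {2}(\dim (last A s) - \dim A)%N (leqnn (\dim (last A s) - \dim A)) => n.
elim: n A s s' => [|n IHn] A s s' le_n sA cs cs' E.
  have [sB AB] := chain_last sA cs.
  have EA : last A s = A.
    by symmetry; apply/eqP; rewrite eqEdim AB -subn_eq0 -leqn0.
  by rewrite !cnt_stay // -E.
have [sB AB] := chain_last sA cs; set B := last A s in sB AB E le_n.
have [EA|nAB] := eqVneq A B; first by rewrite !cnt_stay // -?E.
have [simp|nsimp] := pselect (simple (subquot A B)).
  by rewrite !(cnt_simple (B := B)).
have [W [sW AW WB nWA nWB]] : exists W, [/\ submod W, (A <= W)%VS, (W <= B)%VS, W <> A & W <> B].
  apply: contrapT => noW; apply: nsimp; apply/simple_subquotP => //.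
  split=> [|W sW AW WB]; first exact/eqP.
  have [->|nWA] := eqVneq W A; [by left|right].
  by apply: contrapT => nWB; apply: noW; exists W; split=> //; apply/eqP.
have [cI cU ->] := chain_split sA sW cs; have [cI' cU' ->] := chain_split sA sW cs'.
have lastI t X : last (X :&: W)%VS [seq Y :&: W | Y <- t]%VS = (last X t :&: W)%VS.
  by rewrite (last_map (fun Y => Y :&: W)%VS).
have lastU t X : last (X + W)%VS [seq Y + W | Y <- t]%VS = (last X t + W)%VS.
  by rewrite (last_map (fun Y => Y + W)%VS).
have ltAW : (\dim A < \dim W)%N.
  by rewrite ltn_neqAle dimvS // andbT; apply/eqP=> e; case: nWA; apply/esym/eqP; rewrite eqEdim AW e /=.
have ltWB : (\dim W < \dim B)%N.
  by rewrite ltn_neqAle dimvS // andbT; apply/eqP=> e; case: nWB; apply/eqP; rewrite eqEdim WB e /=.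
congr (_ + _)%N; apply: IHn; rewrite ?lastI ?lastU -?E //; last first.
- exact: submod_add.
- by rewrite -/B (addv_idPl WB) (addv_idPr AW) -ltnS (leq_trans _ le_n) // ltn_sub2l // (leq_trans ltAW) // ltnW.
- exact: submod_cap.
- rewrite -/B (capv_idPr WB) (capv_idPl AW) -ltnS (leq_trans _ le_n) //.
  by rewrite ltn_sub2r // (ltn_trans ltAW).
Qed.

(** A submodule strictly above [A], inside [B] and of least dimension gives a simple first step. *)
Lemma chain_ex A B : submod A -> submod B -> (A <= B)%VS ->
  exists s, [/\ chain A s, last A s = B
    & forall i, (i < size s)%N -> simple (subquot (nth 0%VS (A :: s) i) (nth 0%VS s i))].
Proof.
move: {2}(\dim B - \dim A)%N (leqnn (\dim B - \dim A)) => n.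
elim: n A => [|n IHn] A le_n sA sB AB.
  exists [::]; split=> //=; apply/eqP; rewrite eqEdim AB -subn_eq0 -leqn0 //.
have [->|nAB] := eqVneq A B; first by exists [::].
pose P d := `[< exists Y, [/\ submod Y, (A <= Y)%VS, (Y <= B)%VS, A <> Y & \dim Y = d] >].
have exP : exists d, P d by exists (\dim B); apply/asboolP; exists B; split=> //; apply/eqP.
case: (ex_minnP exP) => d /asboolP[Y [sY AY YB nAY dY]] mind.
have simp : simple (subquot A Y).
  apply/simple_subquotP=> //; split=> // W sW AW WY.
  have [->|nWA] := eqVneq W A; [by left|right].
  apply/eqP; rewrite eqEdim WY dY; apply: mind; apply/asboolP; exists W.
  by split=> //; [apply: subv_trans YB|apply/eqP; rewrite eq_sym].
have ltAY : (\dim A < \dim Y)%N.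
  by rewrite ltn_neqAle dimvS // andbT; apply/eqP=> e; case: nAY; apply/eqP; rewrite eqEdim AY e /=.
have [|//|//|//|s [cs Es hs]] := IHn Y.
  rewrite -ltnS (leq_trans _ le_n) // ltn_sub2l // (leq_trans ltAY) //; exact: dimvS.
exists (Y :: s); split=> //=; first by split=> //; right.
by case=> [//|i]; rewrite ltnS => /hs.
Qed.

Lemma comp_series_chain s : comp_series s ->
  chain 0%VS s /\ (\sum_(i < size s) `[< isor (comp_factor s i) L >])%N = cnt 0%VS s.
Proof.
case=> _; rewrite /comp_factor => h.
suff H A : (forall i, (i < size s)%N -> [/\ submod (nth 0%VS s i),
      (nth 0%VS (A :: s) i <= nth 0%VS s i)%VS
    & simple (subquot (nth 0%VS (A :: s) i) (nth 0%VS s i))]) ->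
    chain A s /\ (\sum_(i < size s)
      `[< isor (subquot (nth 0%VS (A :: s) i) (nth 0%VS s i)) L >])%N = cnt A s.
  exact: H.
elim: s A {h} => [|Y s IHs] A h; first by rewrite big_ord0.
have [sY AY simp] := h 0%N isT.
have [i lti|cs Es] := IHs Y; first exact: (h i.+1).
split; first by split=> //; right.
by rewrite big_ord_recl [RHS]/= -Es.
Qed.

(** The series inside [mult] is an arbitrary choice made by [xget]. Existence of a series and
    uniqueness of counts allow any chain, repetitions included, to compute the multiplicity. *)
Lemma multE s : chain 0%VS s -> last 0%VS s = fullv -> mult M L = cnt 0%VS s.
Proof.
move=> cs Es; rewrite /mult.
have ex : exists s, @comp_series k D M s.
  have [t [ct Et ht]] := chain_ex (submod0 M) (submodf M) (sub0v _).
  exists t; split=> // i lti; have := ht i lti; rewrite -/(comp_factor t i).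
  suff [h1 h2] : submod (nth 0%VS t i) /\ (nth 0%VS (0%VS :: t) i <= nth 0%VS t i)%VS by [].
  suff H A : chain A t -> submod (nth 0%VS t i) /\ (nth 0%VS (A :: t) i <= nth 0%VS t i)%VS.
    exact: H.
  elim: t i A lti {Et ht ct} => [|Y t IHt] // [|i] A lti [sY AY _ ct] //=.
  exact: IHt.
have := classical_sets.xgetPex [::] ex.
set t := classical_sets.xget _ _ => ct; have [Et _] := ct.
have [c't ->] := comp_series_chain ct.
by apply: cnt_unique; rewrite ?submod0 ?Et ?Es.
Qed.

End Chains.

(** The images under [f] of a chain of [A], followed by the preimages under [g] of a chain of [C],
    form a chain of [M] with the same sections. *)
Lemma mult_exact L (A M C : rep k D) (f : 'Hom(A, M)) (g : 'Hom(M, C)) : simple L ->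
  (forall x v, f (act A x v) = act M x (f v)) ->
  (forall x v, g (act M x v) = act C x (g v)) ->
  injective f -> (forall w, exists v, g v = w) ->
  (forall v, g v = 0 <-> exists u, f u = v) ->
  mult M L = (mult A L + mult C L)%N.
Proof.
move=> sL hf hg f_inj g_surj fg.
have [s [cs Es _]] := chain_ex (submod0 A) (submodf A) (sub0v _).
have [t [ct Et _]] := chain_ex (submod0 C) (submodf C) (sub0v _).
pose F X := (f @: X)%VS; pose G X := (g @^-1: X)%VS.
have memF u X : (f u \in F X) = (u \in X).
  by apply/memv_imgP/idP=> [[v vX /f_inj->]|uX] //; exists u.
have memG v X : (v \in G X) = (g v \in X) by rewrite memv_preim.
have sF X : submod X -> submod (F X).
  move=> /submodP sX; apply/submodP=> x w /memv_imgP[v vX ->].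
  by rewrite -hf memF sX.
have sG X : submod X -> submod (G X).
  by move=> /submodP sX; apply/submodP=> x w; rewrite !memG hg => /sX.
have isoF X Y : submod X -> submod Y -> (X <= Y)%VS ->
    isor (subquot X Y) (subquot (F X) (F Y)).
  move=> sX sY XY; apply: (isor_subquot (f := f)); rewrite ?sF ?limgS //.
  split=> [v vY|v vY|w /memv_imgP[v vY ->]|x v vY]; rewrite ?memF //.
    by exists v; rewrite // subrr mem0v.
  by rewrite hf subrr mem0v.
have isoG X Y : submod X -> submod Y -> (X <= Y)%VS ->
    isor (subquot (G X) (G Y)) (subquot X Y).
  move=> sX sY XY; apply: (isor_subquot (f := g)); rewrite ?sG ?lpreimS //.
  split=> [v|v|w wY|x v vY]; rewrite ?memG //.
    by have [v Ev] := g_surj w; exists v; rewrite ?memG Ev // subrr mem0v.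
  by rewrite hg subrr mem0v.
have chF X (s' : seq {vspace A}) : submod X -> chain X s' ->
    chain (F X) (map F s') /\ cnt L (F X) (map F s') = cnt L X s'.
  elim: s' X => [|Y s' IHs] X sX //= [sY XY simp c].
  have [c' ->] := IHs _ sY c; have i := isoF _ _ sX sY XY.
  split; last by rewrite (sec_eq _ i).
  split; rewrite ?sF ?limgS //; case: simp => [->|simp]; [by left|right].
  exact: simple_iso simp.
have chG X (s' : seq {vspace C}) : submod X -> chain X s' ->
    chain (G X) (map G s') /\ cnt L (G X) (map G s') = cnt L X s'.
  elim: s' X => [|Y s' IHs] X sX //= [sY XY simp c].
  have [c' ->] := IHs _ sY c; have i := isoG _ _ sX sY XY.
  split; last by rewrite (sec_eq _ i).
  split; rewrite ?sG ?lpreimS //; case: simp => [->|simp]; [by left|right].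
  exact: simple_iso (isor_sym i) simp.
have [c1 n1] := chF _ _ (submod0 A) cs; have [c2 n2] := chG _ _ (submod0 C) ct.
have F0 : F 0%VS = 0%VS by rewrite /F limg0.
have E1 : last 0%VS (map F s) = G 0%VS.
  rewrite -F0 (last_map F) Es; apply/vspaceP=> v; rewrite memG memv0.
  apply/memv_imgP/eqP=> [[u _ ->]|/fg[u <-]]; first by apply/fg; exists u.
  by exists u; rewrite ?memvf.
have E2 : last (G 0%VS) (map G t) = fullv.
  by rewrite (last_map G) Et; apply/vspaceP=> v; rewrite memG !memvf.
have chcat (s1 s2 : seq {vspace M}) X : chain X s1 -> chain (last X s1) s2 ->
    chain X (s1 ++ s2) /\ cnt L X (s1 ++ s2) = (cnt L X s1 + cnt L (last X s1) s2)%N.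
  elim: s1 X => [|Y s1 IHs] X //= [sY XY simp c] c'.
  by have [h1 ->] := IHs Y c c'; rewrite addnA.
rewrite F0 in c1 n1; rewrite -E1 in c2 n2 E2.
have [c n] := chcat _ _ _ c1 c2.
rewrite (multE sL cs Es) (multE sL ct Et) (multE sL c) ?last_cat ?E2 //.
by rewrite n n1 n2.
Qed.

Lemma mult0 M L : simple L -> dim M = 0%N -> mult M L = 0%N.
Proof.
move=> sL M0; rewrite (@multE L sL M [::]) //=; apply/esym/eqP.
by rewrite -dimv_eq0 dimvf M0.
Qed.

Lemma mult_isoL M L L' : simple L -> isor L L' -> mult M L = mult M L'.
Proof.
move=> sL i; have sL' := simple_iso i sL.
have [s [cs Es _]] := chain_ex (submod0 M) (submodf M) (sub0v _).
rewrite (multE sL cs Es) (multE sL' cs Es); elim: s {cs Es} 0%VS => //= Y s IHs A.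
rewrite IHs; congr (nat_of_bool _ + _)%N.
apply/asboolP/asboolP=> h; first exact: isor_trans i.
exact: isor_trans (isor_sym i).
Qed.

Lemma mult_simple M L : simple L -> simple M -> mult M L = `[< isor M L >].
Proof.
move=> sL sM; have i := subquot_full M.
rewrite (@multE L sL M [:: fullv]) //=; last first.
  by split; rewrite ?submodf ?sub0v //; right; apply: simple_iso (isor_sym i) sM.
rewrite addn0; congr nat_of_bool; apply/asboolP/asboolP; apply: isor_trans => //.
exact: isor_sym.
Qed.

Lemma mult_sub M L (U : {vspace M}) : simple L -> submod U ->
  mult M L = (mult (subquot 0%VS U) L + mult (subquot U {:M}%VS) L)%N.
Proof.
move=> sL sU; have UV := subvf U; have fM (v : M) : v \in {:M}%VS by rewrite memvf.
apply: (@mult_exact L _ _ _ (sqval 0%VS U) (sqpi U {:M}%VS)) => //.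
- move=> x s; have h := sqval_in s.
  rewrite sqact; apply/eqP; rewrite eq_sym -subr_eq0 -memv0.
  apply: sqpi_sub; rewrite ?sub0v //; exact: (submodP _ sU).
- by move=> x v; rewrite sqpi_act ?submodf.
- by move=> s t; rewrite !sqvalE => /subvs_inj.
- by move=> s; exists (sqval U {:M}%VS s); rewrite sqvalK.
- move=> v; split=> [/eqP|[s <-]]; last by apply/eqP; rewrite sqpi_eq0 // sqval_in.
  rewrite sqpi_eq0 // => vU; exists (sqpi 0 U v); apply/eqP.
  by rewrite eq_sym -subr_eq0 -memv0 sqpi_sub ?sub0v.
Qed.

Lemma rep_ind_simple (P : rep k D -> Prop) :
  (forall M, dim M = 0%N -> P M) -> (forall M, simple M -> P M) ->
  (forall M (U : {vspace M}), submod U -> U <> 0%VS -> U <> fullv ->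
     P (subquot 0%VS U) -> P (subquot U {:M}%VS) -> P M) ->
  forall M, P M.
Proof.
move=> P0 Ps Pe M; move: {2}(dim M) (leqnn (dim M)) => n.
elim: n M => [|n IHn] M le_n; first by apply: P0; apply/eqP; rewrite -leqn0.
have [M0|nM0] := eqVneq (dim M) 0%N; first exact: P0.
have [sM|nsM] := pselect (simple M); first exact: Ps.
have [U [sU U0 UM]] : exists U : {vspace M}, [/\ submod U, U <> 0%VS & U <> fullv].
  apply: contrapT => noU; apply: nsM; split.
    by apply: contraNneq nM0 => M0; rewrite -dimvf M0 dimv0.
  move=> U sU; have [->|U0] := eqVneq U 0%VS; [by left|right].
  by apply: contrapT => UM; apply: noU; exists U; split=> //; apply/eqP.
have dU : (0 < \dim U < dim M)%N.
  rewrite lt0n dimv_eq0; apply/andP; split; first exact/eqP.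
  rewrite ltn_neqAle -dimvf dimvS ?subvf // andbT; apply/eqP=> e; apply: UM.
  by apply/eqP; rewrite eqEdim subvf e /=.
case/andP: dU => dU dU'.
apply: (Pe M U) => //; apply: IHn; rewrite dim_subquot ?sub0v ?subvf //.
  by rewrite dimv0 subn0 -ltnS (leq_trans dU').
by rewrite dimvf -ltnS (leq_trans _ le_n) // -subn_gt0 subKn // ltnW.
Qed.

End RepTheory.

Section LinOf.
Variables (k : fieldType) (U V : vectType k).

Definition lin_of (h : U -> V) (hl : linear h) : 'Hom(U, V) :=
  linfun (HB.pack_for {linear U -> V} h (GRing.isLinear.Build _ _ _ _ h hl)).

Lemma lin_ofE h hl u : @lin_of h hl u = h u.
Proof. by rewrite /lin_of lfunE. Qed.

End LinOf.

(** * Passage to the corner of an idempotent *)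

Section Corner.
Variables (k : fieldType) (D D' : finType).
Variables (kap : D -> D' -> k) (cy : D' -> D -> k) (st : D -> D -> D -> k) (y1 : D').

(* For an idempotent e of an algebra B, these are the relations between a
   B-module M and the eBe-module N = eM, the inclusion i and the projection p;
   kap, cy and st are structure constants, the same for all pairs (M, N). *)
Definition corner (M : rep k D) (N : rep k D') (i : 'Hom(N, M)) (p : 'Hom(M, N)) :=
  [/\ forall n, p (i n) = n,
      forall x n, p (act M x (i n)) = \sum_y kap x y *: act N y n,
      forall y v, i (act N y (p v)) = \sum_x cy y x *: act M x v,
      forall x x' v, act M x (act M x' v) = \sum_z st x x' z *: act M z v
    & forall n, act N y1 n = n].

Section OnePair.
Variables (M : rep k D) (N : rep k D') (i : 'Hom(N, M)) (p : 'Hom(M, N)).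
Hypothesis C : corner i p.

Let pi n : p (i n) = n. Proof. by case: C. Qed.
Let pxi x n : p (act M x (i n)) = \sum_y kap x y *: act N y n. Proof. by case: C. Qed.
Let iyp y v : i (act N y (p v)) = \sum_x cy y x *: act M x v. Proof. by case: C. Qed.
Let mm x x' v : act M x (act M x' v) = \sum_z st x x' z *: act M z v. Proof. by case: C. Qed.

(** The composite of [p] and [i] is the action of the idempotent e: as [y1] acts as the identity of
    the corner, the coefficients of e are [cy y1]. *)
Lemma corner_e v : i (p v) = \sum_x cy y1 x *: act M x v.
Proof. by rewrite -iyp; case: C => _ _ _ _ ->. Qed.

Lemma corner_iy y n : i (act N y n) = \sum_x cy y x *: act M x (i n).
Proof. by rewrite -iyp pi. Qed.

(** A submodule is stable under e, so eU is the intersection of U with eM. *)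
Lemma corner_img (U : {vspace M}) n : submod U -> (n \in (p @: U)%VS) = (i n \in U).
Proof.
move=> /submodP sU; apply/memv_imgP/idP=> [[u uU ->]|inU]; last by exists (i n); rewrite ?pi.
by rewrite corner_e memv_suml // => x _; rewrite memvZ ?sU.
Qed.

Lemma corner_submod (U : {vspace M}) : submod U -> submod (p @: U)%VS.
Proof.
move=> sU; apply/submodP=> y n; rewrite !corner_img // => inU.
by rewrite corner_iy memv_suml // => x _; rewrite memvZ ?(submodP _ sU).
Qed.

Lemma corner_full : (p @: fullv)%VS = fullv.
Proof. by apply/vspaceP=> n; rewrite corner_img ?submodf // !memvf. Qed.

(** Exactness of the corner functor. Since the structure constants remain the same, inductions along
    submodules stay among corners. *)
Lemma corner_subquot (U V : {vspace M}) : submod U -> submod V -> (U <= V)%VS ->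
  corner (M := subquot U V) (N := subquot (p @: U)%VS (p @: V)%VS)
    (sqpi U V \o i \o sqval _ _)%VF (sqpi _ _ \o p \o sqval U V)%VF.
Proof.
move=> sU sV UV; have UV' : (p @: U <= p @: V)%VS by rewrite limgS.
have [sU' sV'] := (corner_submod sU, corner_submod sV).
set i' := (_ \o i \o _)%VF; set p' := (_ \o p \o _)%VF.
have iE s : i' s = sqpi U V (i (sqval _ _ s)) by do 2![rewrite comp_lfunE].
have pE s : p' s = sqpi _ _ (p (sqval U V s)) by do 2![rewrite comp_lfunE].
have iV s : i (sqval (p @: U)%VS (p @: V)%VS s) \in V.
  by rewrite -corner_img // sqval_in.
have pV v : v \in V -> p v \in (p @: V)%VS by apply: memv_img.
have p'E v : v \in V -> p' (sqpi U V v) = sqpi _ _ (p v).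
  move=> vV; rewrite pE; apply/eqP; rewrite sqpi_eq ?pV ?sqval_in // -linearB memv_img //.
  by rewrite -opprB memvN sqpi_sub.
have i'E n : n \in (p @: V)%VS -> i' (sqpi _ _ n) = sqpi _ _ (i n).
  move=> nV; rewrite iE; apply/eqP; rewrite sqpi_eq //; last by rewrite -corner_img.
  by rewrite -linearB -corner_img // -opprB memvN sqpi_sub.
have sum_in (W : {vspace M}) (I : finType) (c : I -> k) (h : I -> D) v : submod W -> v \in W ->
    \sum_z c z *: act M (h z) v \in W.
  by move=> /submodP sW vW; rewrite memv_suml // => z _; rewrite memvZ ?sW.
split=> [s|x s|y s|x x' s|s].
- by rewrite iE p'E // pi sqvalK.
- rewrite iE -sqpi_act // p'E ?(submodP _ sV) // pxi linear_sum /=.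
  apply: eq_bigr => y _; rewrite linearZ /= sqpi_act ?sqval_in //.
  by rewrite sqvalK.
- rewrite pE -sqpi_act ?pV ?sqval_in // i'E ?(submodP _ sV') ?pV ?sqval_in //.
  rewrite iyp linear_sum /=; apply: eq_bigr => x _; rewrite linearZ /=.
  by rewrite sqpi_act ?sqval_in // sqvalK.
- rewrite -{1}(sqvalK s) -!sqpi_act ?(submodP _ sV) ?sqval_in // mm linear_sum /=.
  by apply: eq_bigr => z _; rewrite linearZ /= sqpi_act ?sqval_in // sqvalK.
- by rewrite -{1}(sqvalK s) -sqpi_act ?sqval_in //; case: C => _ _ _ _ ->; rewrite sqvalK.
Qed.

Definition corner_gen := forall U : {vspace M}, submod U -> (forall n, i n \in U) -> U = fullv.

(** The submodule B T generated by a subspace T of eM. When T is a submodule of the corner, e B T is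
    T again, so simplicity descends from M to eM. *)
Definition corner_span (T : {vspace N}) : {vspace M} :=
  (\sum_x act M x @: (i @: T))%VS.

Lemma mem_corner_span (T : {vspace N}) w : w \in corner_span T ->
  exists c : D -> N, (forall x, c x \in T) /\ w = \sum_x act M x (i (c x)).
Proof.
case/memv_sumP=> v vP ->.
have /fin_all_exists[c Ec] x : exists n, n \in T /\ v x = act M x (i n).
  by have /memv_imgP[_ /memv_imgP[n nT ->] ->] := vP x isT; exists n.
by exists c; split=> [x|]; [case: (Ec x)|apply: eq_bigr => x _; case: (Ec x)].
Qed.

Lemma corner_spanI (T : {vspace N}) x n : n \in T -> act M x (i n) \in corner_span T.
Proof.
move=> nT; rewrite /corner_span (bigD1 x) //=; apply: subvP (addvSl _ _) _ _.
by rewrite !memv_img.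
Qed.

Lemma corner_span_sub (T : {vspace N}) : submod (corner_span T).
Proof.
apply/submodP=> x w /mem_corner_span[c [cT ->]]; rewrite linear_sum memv_suml // => z _.
by rewrite /= mm memv_suml // => z' _; rewrite memvZ ?corner_spanI.
Qed.

Lemma corner_span_i (T : {vspace N}) n : n \in T -> i n \in corner_span T.
Proof.
move=> nT; rewrite -(pi n) corner_e memv_suml // => x _.
by rewrite memvZ ?corner_spanI.
Qed.

Lemma corner_span_p (T : {vspace N}) : submod T -> (p @: corner_span T)%VS = T.
Proof.
move=> /submodP sT; apply/vspaceP=> n; rewrite corner_img ?corner_span_sub //.
apply/idP/idP=> [/mem_corner_span[c [cT E]]|]; last exact: corner_span_i.
rewrite -(pi n) E linear_sum memv_suml // => x _; rewrite /= pxi memv_suml // => y _.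
by rewrite memvZ ?sT.
Qed.

Lemma corner_simple : simple M -> dim N <> 0%N -> simple N.
Proof.
move=> [M0 sM] N0; split; first by apply/eqP=> e; apply: N0; rewrite -dimvf e dimv0.
move=> T sT; have [E|E] := sM _ (corner_span_sub T); rewrite -(corner_span_p sT) E.
  by left; rewrite limg0.
by right; rewrite corner_full.
Qed.

End OnePair.

Section TwoPairs.
Variables (M : rep k D) (N : rep k D') (i : 'Hom(N, M)) (p : 'Hom(M, N)).
Variables (L : rep k D) (L' : rep k D') (j : 'Hom(L', L)) (q : 'Hom(L, L')).
Hypotheses (C : corner i p) (C' : corner j q).

Let pi n : p (i n) = n. Proof. by case: C. Qed.
Let qj n : q (j n) = n. Proof. by case: C'. Qed.

Lemma corner_hom_e (f : 'Hom(M, L)) : (forall x v, f (act M x v) = act L x (f v)) ->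
  forall v, f (i (p v)) = j (q (f v)).
Proof.
move=> hf v; rewrite (corner_e C) (corner_e C') linear_sum; apply: eq_bigr => x _.
by rewrite linearZ /= hf.
Qed.

Lemma corner_hom_res (f : 'Hom(M, L)) : (forall x v, f (act M x v) = act L x (f v)) ->
  forall y n, q (f (i (act N y n))) = act L' y (q (f (i n))).
Proof.
move=> hf y n; rewrite -[RHS]qj; congr (q _); rewrite (corner_iy C) linear_sum.
rewrite -[n]pi (corner_hom_e hf) qj (corner_iy C') /=; apply: eq_bigr => x _.
by rewrite linearZ /= hf -(corner_hom_e hf) pi.
Qed.

Lemma corner_iso_res : isor M L -> isor N L'.
Proof.
case/isorP=> f [hf f_inj f_surj]; have fe := corner_hom_e hf.
pose g := (q \o f \o i)%VF; have gE n : g n = q (f (i n)) by rewrite !comp_lfunE.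
apply/isorP; exists g; split=> [y n|u v|n]; rewrite ?gE.
- exact: corner_hom_res.
- move/(congr1 j); rewrite -!fe !pi => /f_inj/(congr1 p); rewrite !pi //.
- by have [m Em] := f_surj (j n); exists (p m); rewrite gE fe Em qj qj.
Qed.

(** The vectors of [L] whose whole orbit is killed by [q] form the submodule [W], which is 0 because
    [L] is simple with non-zero corner. Membership in [W] is tested after projecting to the corner,
    and there [th] carries the relation over from [M]. *)
Lemma corner_rel (th : 'Hom(N, L')) n0 (c : D -> k) : simple L -> dim L' <> 0%N ->
  (forall y n, th (act N y n) = act L' y (th n)) ->
  \sum_x c x *: act M x (i n0) = 0 -> \sum_x c x *: act L x (j (th n0)) = 0.
Proof.
move=> [_ sL] L'0 hth E.
pose W := (\bigcap_(x : D) lker (q \o act L x))%VS.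
have memW v : reflect (forall x, q (act L x v) = 0) (v \in W).
  apply: (iffP idP) => [vW x|h].
    have /subvP/(_ v vW) : (W <= lker (q \o act L x))%VS by apply: bigcapv_inf.
    by rewrite memv_ker comp_lfunE => /eqP.
  rewrite memvE; apply/subv_bigcapP=> x _.
  by rewrite -memvE memv_ker comp_lfunE h.
have [_ _ _ mmL _] := C'.
have sW : submod W.
  apply/submodP=> x v /memW h; apply/memW=> z; rewrite mmL linear_sum /=.
  by apply: big1 => z' _; rewrite linearZ /= h scaler0.
have qW v : v \in W -> q v = 0.
  move=> /memW h; rewrite -[LHS]qj (corner_e C') linear_sum /=.
  by apply: big1 => x _; rewrite linearZ /= h scaler0.
have W0 : W = 0%VS.
  have [//|WL] := sL W sW; case: L'0; rewrite -dimvf; apply/eqP; rewrite dimv_eq0 -subv0.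
  by apply/subvP=> n _; rewrite memv0 -[n]qj qW // WL memvf.
apply/eqP; rewrite -memv0 -W0; apply/memW=> z.
have [_ pxi _ mmM _] := C; have [_ qxj _ _ _] := C'.
transitivity (th (p (act M z (\sum_x c x *: act M x (i n0))))); last first.
  by rewrite E !linear0.
rewrite !linear_sum /=; apply: eq_bigr => x _; rewrite !linearZ /=; congr (_ *: _).
rewrite mmL mmM !linear_sum /=; apply: eq_bigr => z' _; rewrite !linearZ /=.
congr (_ *: _); rewrite pxi qxj linear_sum /=; apply: eq_bigr => y _.
by rewrite linearZ /= hth.
Qed.

End TwoPairs.

Section TwoPairs2.
Variables (M : rep k D) (N : rep k D') (i : 'Hom(N, M)) (p : 'Hom(M, N)).
Variables (L : rep k D) (L' : rep k D') (j : 'Hom(L', L)) (q : 'Hom(L, L')).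
Hypotheses (C : corner i p) (C' : corner j q).

(** Both modules are generated by one corner vector, [n0] and its image [l0]. By [corner_rel], used
    in both directions, these two vectors satisfy the same linear relations, so sending one to the
    other extends to an isomorphism. *)
Lemma corner_iso_ext : simple M -> simple L -> isor N L' -> dim L' <> 0%N -> isor M L.
Proof.
move=> sM sL iso L'0; have [th [hth th_inj th_surj]] := (isorP N L').1 iso.
have [th' [hth' th'_inj th'_surj]] := (isorP L' N).1 (isor_sym iso).
have N0 : dim N <> 0%N.
  move=> N0; apply: L'0; apply/eqP; rewrite -dimvf dimv_eq0 -subv0.
  apply/subvP=> w _; have [n <-] := th_surj w; rewrite memv0.
  suff -> : n = 0 by rewrite linear0.
  apply/eqP; rewrite -memv0; suff <- : ({:N} = 0)%VS by rewrite memvf.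
  by apply/eqP; rewrite -dimv_eq0 dimvf N0.
have [n0 n00] : exists n0 : N, n0 != 0.
  have /subvPn[n _ nn] : ~~ ({:N} <= 0)%VS by rewrite subv0 -dimv_eq0 dimvf; apply/eqP.
  by exists n; rewrite -memv0.
set l0 := th n0; have l00 : l0 != 0 by rewrite -(linear0 th) (inj_eq th_inj).
(* Coefficient functions on the basis [D] stand for the free module of rank 1: [ph] and [ps] are the
   evaluations at the two generators. *)
have linP (P : rep k D) (v : P) :
    linear (fun c : {ffun D -> k^o} => \sum_x (c x : k) *: act P x v).
  move=> a c c'; rewrite scaler_sumr -big_split /=; apply: eq_bigr => x _.
  by rewrite !ffunE scalerDl scalerA.
pose ph := lin_of (linP M (i n0)); pose ps := lin_of (linP L (j l0)).
have phE c : ph c = \sum_x (c x : k) *: act M x (i n0) by rewrite lin_ofE.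
have psE c : ps c = \sum_x (c x : k) *: act L x (j l0) by rewrite lin_ofE.
(* Left multiplication by [x] on coefficient functions, read off from the structure constants
   [st]. *)
pose xc x (c : {ffun D -> k^o}) : {ffun D -> k^o} :=
  [ffun z => \sum_x' (c x' : k) * st x x' z].
have xcP (P : rep k D) (v : P) x (c : {ffun D -> k^o}) : (forall x x' v, act P x (act P x' v) = \sum_z st x x' z *: act P z v) ->
    act P x (\sum_x' (c x' : k) *: act P x' v) = \sum_z (xc x c z : k) *: act P z v.
  move=> mm; rewrite linear_sum /=.
  under eq_bigr do rewrite linearZ /= mm scaler_sumr.
  rewrite exchange_big /=; apply: eq_bigr => z _; rewrite ffunE scaler_suml.
  by apply: eq_bigr => x' _; rewrite scalerA.
have [pi _ _ mmM actM1] := C; have [qj _ _ mmL actL1] := C'.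
have surj (P : rep k D) (Q : rep k D') (ii : 'Hom(Q, P)) pp (n : Q) (f : 'Hom({ffun D -> k^o}, P)) :
    corner ii pp -> simple P -> n != 0 -> (forall c, f c = \sum_x (c x : k) *: act P x (ii n)) ->
    forall v, exists c, f c = v.
  move=> CP [_ sP] nn fE v; have [ppi _ _ mm _] := CP.
  have sI : submod (limg f).
    apply/submodP=> x w /memv_imgP[c _ ->]; rewrite fE xcP // -fE.
    by rewrite memv_img ?memvf.
  have inI : ii n \in limg f.
    rewrite -(ppi n) (corner_e CP).
    have -> : \sum_x cy y1 x *: act P x (ii n) = f [ffun x => cy y1 x].
      by rewrite fE; apply: eq_bigr => x _; rewrite ffunE.
    by rewrite memv_img ?memvf.
  have [E|E] := sP _ sI.
    move: inI; rewrite E memv0 => /eqP e; move: nn.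
    by rewrite -(ppi n) e linear0 eqxx.
  by have := memvf v; rewrite -E => /memv_imgP[c _ ->]; exists c.
have phS := surj _ _ _ _ _ ph C sM n00 phE; have psS := surj _ _ _ _ _ ps C' sL l00 psE.
have k1 c : ph c = 0 -> ps c = 0.
  by rewrite phE psE; apply: (corner_rel (th := th) C C').
have [g Eg] : exists g : 'Hom(L', N), (forall y n, g (act L' y n) = act N y (g n)) /\ g l0 = n0.
  exists (th^-1)%VF; have k0 : lker th == 0%VS by apply/lker0P.
  split=> [y n|]; last by rewrite /l0 lker0_lfunK.
  have [n' <-] := th_surj n; rewrite -hth !lker0_lfunK //.
have k2 c : ps c = 0 -> ph c = 0.
  rewrite phE psE -Eg.2; apply: (corner_rel C' C) => //; exact: Eg.1.
pose f := (ps \o ph^-1)%VF.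
have fE c : f (ph c) = ps c.
  rewrite comp_lfunE; apply/eqP; rewrite -subr_eq0 -linearB; apply/eqP/k1.
  by rewrite linearB /= limg_lfunVK ?subrr // memv_img ?memvf.
apply/isorP; exists f; split=> [x v|u v|w].
- have [c <-] := phS v; rewrite fE {1}phE xcP // -phE fE psE -xcP //.
  by rewrite -psE.
- have [c <-] := phS u; have [c' <-] := phS v; rewrite !fE => /eqP.
  rewrite -subr_eq0 -linearB => /eqP/k2/eqP; rewrite linearB subr_eq0.
  by move/eqP.
- by have [c <-] := psS w; exists (ph c).
Qed.

End TwoPairs2.

(** Both sides are additive on short exact sequences, so only simple [M] matter. There the corner is
    zero or simple, and since the corner of [L] is simple, [M] is isomorphic to [L] exactly when
    their corners are isomorphic. *)
Theorem corner_mult (M : rep k D) (N : rep k D') (i : 'Hom(N, M)) (p : 'Hom(M, N))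
    (L : rep k D) (L' : rep k D') (j : 'Hom(L', L)) (q : 'Hom(L, L')) :
  corner i p -> corner j q -> simple L -> simple L' -> mult M L = mult N L'.
Proof.
move=> + C' sL sL'; have L'0 : dim L' <> 0%N.
  by move=> e; case: sL' => /eqP[]; apply/eqP; rewrite -dimv_eq0 dimvf e.
elim/rep_ind_simple: M N i p => [M M0|M sM|M U sU U0 UM IH1 IH2] N i p C.
- rewrite !mult0 //; have pi n : p (i n) = n by case: C.
  apply/eqP; rewrite -dimvf dimv_eq0 -subv0; apply/subvP=> n _.
  rewrite memv0 -[n]pi; suff -> : i n = 0 by rewrite linear0.
  apply/eqP; rewrite -memv0; suff <- : ({:M} = 0)%VS by rewrite memvf.
  by apply/eqP; rewrite -dimv_eq0 dimvf M0.
- rewrite mult_simple //; have [N0|N0] := pselect (dim N = 0%N).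
    rewrite mult0 //; case: asboolP => // /(corner_iso_res C C')/isorP[f [_ _ f_surj]].
    case: L'0; apply/eqP; rewrite -dimvf dimv_eq0 -subv0; apply/subvP=> w _.
    have [n <-] := f_surj w; rewrite memv0; suff -> : n = 0 by rewrite linear0.
    apply/eqP; rewrite -memv0; suff <- : ({:N} = 0)%VS by rewrite memvf.
    by apply/eqP; rewrite -dimv_eq0 dimvf N0.
  rewrite mult_simple //; last exact: corner_simple C sM N0.
  congr nat_of_bool; apply/asboolP/asboolP; first exact: corner_iso_res C C'.
  by move=> h; apply: (corner_iso_ext C C').
- rewrite (mult_sub sL sU) (mult_sub sL' (corner_submod C sU)).
  have := corner_subquot C (submod0 M) sU (sub0v U); rewrite limg0 => /IH1->.
  have := corner_subquot C sU (submodf M) (subvf U).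
  by rewrite (corner_full C) => /IH2->.
Qed.

Section Head.
Variables (M : rep k D) (N : rep k D') (i : 'Hom(N, M)) (p : 'Hom(M, N)).
Hypotheses (C : corner i p) (gen : corner_gen i) (sN : simple N).

(** A unique maximal submodule determines the choice made by [xget] in [radical]. *)
Lemma radical_eq (E : finType) (X : rep k E) (R : {vspace X}) :
  (forall W, max_submod W <-> W = R) -> radical X = R.
Proof.
move=> h; rewrite /radical; set P := (fun U : {vspace X} => _).
have PR : P R by move=> v; split=> [vR W /h->|]; [|apply; apply/h].
have := classical_sets.xgetI 0%VS PR; set U := classical_sets.xget _ _ => PU.
by apply/vspaceP=> v; apply/idP/idP=> [/PU/PR|/PR/PU].
Qed.

(** Let [R] be the largest submodule with zero corner. The corner of a proper submodule is a proper
    submodule of the simple module [N], since [N] generates [M]; hence it is 0 and the submodule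
    lies in [R]. Thus [R] is the unique maximal submodule. *)
Lemma corner_head : exists R : {vspace M},
  [/\ submod R, radical M = R, simple (subquot R {:M}%VS) & (p @: R)%VS = 0%VS].
Proof.
pose R := (\bigcap_(x : D) lker (p \o act M x))%VS.
have memR v : reflect (forall x, p (act M x v) = 0) (v \in R).
  apply: (iffP idP) => [vR x|h].
    have /subvP/(_ v vR) : (R <= lker (p \o act M x))%VS by apply: bigcapv_inf.
    by rewrite memv_ker comp_lfunE => /eqP.
  rewrite memvE; apply/subv_bigcapP=> x _.
  by rewrite -memvE memv_ker comp_lfunE h.
have [pi _ _ mm _] := C; have [N0 hN] := sN.
have sR : submod R.
  apply/submodP=> x v /memR h; apply/memR=> z; rewrite mm linear_sum /=.
  by apply: big1 => z' _; rewrite linearZ /= h scaler0.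
have pR : (p @: R)%VS = 0%VS.
  apply/eqP; rewrite -subv0; apply/subvP=> _ /memv_imgP[v /memR h ->].
  rewrite memv0 -[p v]pi (corner_e C) linear_sum /=; apply/eqP.
  by apply: big1 => x _; rewrite linearZ /= h scaler0.
have RM : R <> fullv.
  by move=> E; move/eqP: N0; apply; rewrite -(corner_full C) -E pR.
have maxR U : submod U -> U <> fullv -> (U <= R)%VS.
  move=> sU UM; have [E|E] := hN _ (corner_submod C sU); last first.
    by case: UM; apply: gen => // n; rewrite -(corner_img C) // E memvf.
  apply/subvP=> v vU; apply/memR=> x; apply/eqP; rewrite -memv0 -E.
  by rewrite memv_img // (submodP _ sU).
exists R; split=> //.
  apply: radical_eq => W; split=> [[sW WM hW]|->].
    by have [//|] := hW R sR (maxR W sW WM).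
  split=> // U sU RU; have [->|UM] := eqVneq U fullv; [by right|left].
  by apply/eqP; rewrite eqEsubv RU maxR //; apply/eqP.
apply/simple_subquotP; rewrite ?subvf ?submodf //; split=> // W sW RW _.
have [->|WM] := eqVneq W fullv; [by right|left].
by apply/eqP; rewrite eqEsubv RW maxR //; apply/eqP.
Qed.

Lemma corner_mult_head (X : rep k D) (Y : rep k D') (j : 'Hom(Y, X)) (q : 'Hom(X, Y)) :
  corner j q -> simple (rep_head M) /\ mult X (rep_head M) = mult Y N.
Proof.
move=> Cq; have [R [sR rR hR pR]] := corner_head; rewrite /rep_head rR; split=> //.
have := corner_subquot C sR (submodf M) (subvf R).
rewrite pR (corner_full C) => CR; have iN := subquot_full N.
have sN' := simple_iso (isor_sym iN) sN.
by rewrite (corner_mult Cq CR hR sN') (mult_isoL _ sN' iN).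
Qed.

(** Restriction to the corner is injective because the corner generates [M], and surjective by the
    extension hypothesis. *)
Lemma corner_Hom (X : rep k D) (Y : rep k D') (j : 'Hom(Y, X)) (q : 'Hom(X, Y)) :
  corner j q ->
  (forall g : 'Hom(N, Y), (forall y n, g (act N y n) = act Y y (g n)) ->
    exists2 f : 'Hom(M, X), (forall x v, f (act M x v) = act X x (f v))
      & forall n, q (f (i n)) = g n) ->
  dim (Hom_rep M X) = dim (Hom_rep N Y).
Proof.
move=> Cq ext; have [pi _ _ _ _] := C; have [qj _ _ _ _] := Cq.
have linR : linear (fun f : 'Hom(M, X) => (q \o f \o i)%VF).
  by move=> a f f'; rewrite comp_lfunDr comp_lfunDl -comp_lfunZr -comp_lfunZl.
pose Res := lin_of linR.
have ResE f n : Res f n = q (f (i n)) by rewrite lin_ofE !comp_lfunE.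
transitivity (\dim (homv M X)); first by [].
transitivity (\dim (homv N Y)); last by [].
rewrite -(limg_dim_eq (f := Res)); last first.
  apply/eqP; rewrite -subv0; apply/subvP=> f; rewrite memv_cap memv_ker.
  case/andP=> /homvP hf /eqP f0; rewrite memv0; apply/eqP/lfunP=> v; rewrite lfunE /=.
  have fi n : f (i n) = 0.
    rewrite -[i n](congr1 i (pi n)) (corner_hom_e C Cq hf).
    by rewrite -ResE f0 lfunE /= linear0.
  have sK : submod (lker f).
    by apply/submodP=> x w; rewrite !memv_ker hf => /eqP->; rewrite linear0.
  have KM : lker f = fullv by apply: gen => // n; rewrite memv_ker fi.
  by apply/eqP; rewrite -memv_ker KM memvf.
congr (\dim _); apply/vspaceP=> g; apply/memv_imgP/homvP=> [[f /homvP hf ->] y n|hg].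
  by rewrite !ResE (corner_hom_res C Cq hf).
have [f hf Ef] := ext g hg; exists f; first exact/homvP.
by apply/lfunP=> n; rewrite ResE Ef.
Qed.

End Head.
End Corner.

Lemma head_simple (k : fieldType) (D : finType) (M : rep k D) :
  simple M -> isor (rep_head M) M.
Proof.
move=> [M0 sM]; rewrite /rep_head (_ : radical M = 0%VS); first exact: subquot_full.
apply: radical_eq => W; split=> [[sW WM _]|->]; first by case: (sM W sW).
split; [exact: submod0|by apply/eqP; rewrite eq_sym|].
by move=> U sU _; apply: sM.
Qed.

(** * Tensor products over a field and homomorphisms between them *)

Lemma linfun_lin (k : fieldType) (U V : vectType k) (h : U -> V) :
  linear h -> forall u, linfun h u = h u.
Proof. exact: lin_ofE. Qed.

Lemma dim_ffun (k : fieldType) (I : finType) (V : vectType k) :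
  dim {ffun I -> V} = (#|I| * dim V)%N.
Proof. by []. Qed.

Section Coordinates.
Variables (k : fieldType) (U : vectType k).

Definition bvec (j : 'I_(\dim {:U})) : U := (vbasis {:U})`_j.
Fact coord_lin j : linear (fun u : U => coord (vbasis {:U}) j u : k^o).
Proof. by move=> a u v; rewrite linearP. Qed.

Definition cvec (j : 'I_(\dim {:U})) : 'Hom(U, k^o) := lin_of (coord_lin j).

Lemma bvec_sum u : u = \sum_j (cvec j u : k) *: bvec j.
Proof.
rewrite {1}(coord_vbasis (memvf u)); apply: eq_bigr => j _.
by rewrite /cvec lin_ofE.
Qed.

Lemma cvec_bvec i j : cvec i (bvec j) = (j == i)%:R.
Proof.
rewrite /cvec lin_ofE coord_free ?[i == j]eq_sym //.
exact: basis_free (vbasisP _).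
Qed.

Lemma functional_sum (phi : 'Hom(U, k^o)) : phi = \sum_j (phi (bvec j) : k) *: cvec j.
Proof.
apply/lfunP=> u; rewrite sum_lfunE {1}(bvec_sum u) linear_sum.
apply: eq_bigr => j _; rewrite linearZ scale_lfunE.
exact: mulrC.
Qed.

Lemma functional_sep u : (forall phi : 'Hom(U, k^o), phi u = 0) -> u = 0.
Proof.
move=> h; rewrite [u]bvec_sum big1 // => j _.
by rewrite h scale0r.
Qed.

End Coordinates.

Section Tens.
Variable k : fieldType.

Section Pure.
Variables U V : vectType k.

Lemma pureE (u : U) (v : V) phi : pure_tensv u v phi = (phi u : k) *: v.
Proof.
rewrite /pure_tensv linfun_lin // => a p q.
by rewrite add_lfunE scale_lfunE scalerDl scalerA.
Qed.

Lemma tens_eq (t t' : tensv U V) : (forall phi, t phi = t' phi) -> t = t'.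
Proof. by move=> h; apply/lfunP. Qed.

Lemma pure_linl v : linear (fun u => pure_tensv u v : tensv U V).
Proof.
move=> a u u'; apply: tens_eq => phi; rewrite add_lfunE scale_lfunE !pureE.
by rewrite linearP scalerDl scalerA.
Qed.

Lemma pure_linr u : linear (fun v => pure_tensv u v : tensv U V).
Proof.
move=> a v v'; apply: tens_eq => phi; rewrite add_lfunE scale_lfunE !pureE.
by rewrite scalerDr !scalerA mulrC.
Qed.

Lemma tens_sum (t : tensv U V) : t = \sum_j pure_tensv (bvec j) (t (cvec j)).
Proof.
apply: tens_eq => phi; rewrite {1}(functional_sum phi) linear_sum sum_lfunE.
by apply: eq_bigr => j _; rewrite linearZ pureE.
Qed.

Lemma tens_eqc (t t' : tensv U V) : (forall j, t (cvec j) = t' (cvec j)) -> t = t'.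
Proof. by move=> h; rewrite (tens_sum t) (tens_sum t'); apply: eq_bigr => j _; rewrite h. Qed.

Lemma dim_tensv : dim (tensv U V) = (dim U * dim V)%N.
Proof.
transitivity (dim U * dim k^o * dim V)%N; first by [].
by congr (_ * _)%N; exact: muln1.
Qed.

End Pure.

Definition tmap (U V U' V' : vectType k) (f : 'Hom(U, U')) (g : 'Hom(V, V')) :
    'Hom(tensv U V, tensv U' V') :=
  linfun (fun t : tensv U V =>
            (g \o t \o linfun (fun phi : 'Hom(U', k^o) => phi \o f))%VF).

Section Tmap.
Variables (U V U' V' : vectType k) (f : 'Hom(U, U')) (g : 'Hom(V, V')).

Lemma tmapE t phi : tmap f g t phi = g (t (phi \o f)%VF).
Proof.
have l1 : linear (fun phi : 'Hom(U', k^o) => (phi \o f)%VF).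
  by move=> a p q; rewrite comp_lfunDl -comp_lfunZl.
rewrite /tmap linfun_lin; last by move=> a p q;
  rewrite comp_lfunDr comp_lfunDl -comp_lfunZr -comp_lfunZl.
by rewrite !comp_lfunE linfun_lin.
Qed.

Lemma tmap_pure u v : tmap f g (pure_tensv u v) = pure_tensv (f u) (g v).
Proof. by apply: tens_eq => phi; rewrite tmapE !pureE linearZ comp_lfunE. Qed.

End Tmap.

Lemma tmap_id (U V : vectType k) (t : tensv U V) : tmap \1%VF \1%VF t = t.
Proof. by apply: tens_eq => phi; rewrite tmapE id_lfunE comp_lfun1r. Qed.

Lemma tmap_comp (U V U' V' U'' V'' : vectType k) (f : 'Hom(U, U')) (g : 'Hom(V, V'))
  (f' : 'Hom(U', U'')) (g' : 'Hom(V', V'')) t :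
  tmap f' g' (tmap f g t) = tmap (f' \o f)%VF (g' \o g)%VF t.
Proof. by apply: tens_eq => phi; rewrite !tmapE comp_lfunE comp_lfunA. Qed.

Lemma tmap_addl (U V U' V' : vectType k) (f f' : 'Hom(U, U')) (g : 'Hom(V, V')) t :
  tmap (f + f') g t = tmap f g t + tmap f' g t.
Proof. by apply: tens_eq => phi; rewrite lfunE /= !tmapE comp_lfunDr !linearD. Qed.

Lemma tmap_addr (U V U' V' : vectType k) (f : 'Hom(U, U')) (g g' : 'Hom(V, V')) t :
  tmap f (g + g') t = tmap f g t + tmap f g' t.
Proof. by apply: tens_eq => phi; rewrite lfunE /= !tmapE lfunE. Qed.

Lemma exact_split (A M C : vectType k) (f : 'Hom(A, M)) (g : 'Hom(M, C)) :
  injective f -> (forall w, exists v, g v = w) ->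
  (forall v, g v = 0 <-> exists u, f u = v) ->
  exists (r : 'Hom(M, A)) (s : 'Hom(C, M)),
    [/\ (r \o f = \1)%VF, (g \o s = \1)%VF, (g \o f = 0)%VF & ((f \o r) + (s \o g) = \1)%VF].
Proof.
move=> f_inj g_surj fg; have k0 : lker f == 0%VS by apply/lker0P.
pose s := (g^-1)%VF; pose r := (f^-1 \o (\1 - (s \o g)))%VF.
have gs w : g (s w) = w.
  by apply: limg_lfunVK; have [v <-] := g_surj w; rewrite memv_img ?memvf.
have gf u : g (f u) = 0 by apply/fg; exists u.
have rE v : r v = (f^-1)%VF (v - s (g v)).
  by rewrite comp_lfunE add_lfunE opp_lfunE comp_lfunE id_lfunE.
move: r rE => r rE.
have gs0 v : g (v - s (g v)) = 0 by rewrite linearB /= gs subrr.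
exists r, s; split; apply/lfunP=> v; rewrite ?add_lfunE !(comp_lfunE, id_lfunE).
- by rewrite rE gf linear0 subr0 lker0_lfunK.
- exact: gs.
- by rewrite gf zero_lfunE.
- rewrite rE; have [u Eu] := (fg _).1 (gs0 v).
  by rewrite -Eu lker0_lfunK // Eu subrK.
Qed.

Section Binary.
Variables (D : finType).
Implicit Types (U V L : rep k D).

Lemma tens_actE U V x t : act (tens_rep U V) x t = tmap (act U x) (act V x) t.
Proof. by []. Qed.

Lemma tens_act_pure U V x u v :
  act (tens_rep U V) x (pure_tensv u v) = pure_tensv (act U x u) (act V x v).
Proof. by rewrite tens_actE tmap_pure. Qed.

Lemma tens_iso U V U' V' : isor U U' -> isor V V' -> isor (tens_rep U V) (tens_rep U' V').
Proof.
move=> /isorP[f [hf f_inj f_surj]] /isorP[g [hg g_inj g_surj]].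
have kf : lker f == 0%VS by apply/lker0P.
have kg : lker g == 0%VS by apply/lker0P.
have ff : (f \o f^-1 = \1)%VF.
  by apply/lfunP=> v; rewrite comp_lfunE id_lfunE limg_lfunVK //;
    have [u <-] := f_surj v; rewrite memv_img ?memvf.
have gg : (g \o g^-1 = \1)%VF.
  by apply/lfunP=> v; rewrite comp_lfunE id_lfunE limg_lfunVK //;
    have [u <-] := g_surj v; rewrite memv_img ?memvf.
apply/isorP; exists (tmap f g); split=> [x t|t t' e|t].
- rewrite !tens_actE !tmap_comp; congr (tmap _ _ _); apply/lfunP=> v;
  by rewrite !comp_lfunE ?hf ?hg.
- have := congr1 (tmap f^-1%VF g^-1%VF) e.
  by rewrite !tmap_comp !lker0_compVf // !tmap_id.
- by exists (tmap f^-1%VF g^-1%VF t); rewrite tmap_comp ff gg tmap_id.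
Qed.

Lemma mult_tensl U V L (S : {vspace U}) : simple L -> submod S ->
  mult (tens_rep U V) L =
  (mult (tens_rep (subquot 0%VS S) V) L + mult (tens_rep (subquot S {:U}%VS) V) L)%N.
Proof.
move=> sL sS; have fM (v : U) : v \in {:U}%VS by rewrite memvf.
pose f := sqval 0%VS S; pose g := sqpi S {:U}%VS.
have hf x s : f (act (subquot 0%VS S) x s) = act U x (f s).
  rewrite sqact; apply/eqP; rewrite eq_sym -subr_eq0 -memv0.
  by apply: sqpi_sub; rewrite ?sub0v //; apply: (submodP _ sS); apply: sqval_in.
have hg x v : g (act U x v) = act (subquot S {:U}%VS) x (g v).
  by rewrite /g sqpi_act ?submodf ?subvf.
have f_inj : injective f by move=> s t; rewrite /f !sqvalE => /subvs_inj.
have g_surj s : exists v, g v = s by exists (sqval S {:U}%VS s); rewrite /g sqvalK.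
have fg v : g v = 0 <-> exists u, f u = v.
  split=> [/eqP|[s <-]]; last by apply/eqP; rewrite /g sqpi_eq0 ?subvf // sqval_in.
  rewrite /g sqpi_eq0 ?subvf // => vU; exists (sqpi 0 S v); apply/eqP.
  by rewrite eq_sym -subr_eq0 -memv0 sqpi_sub ?sub0v.
clearbody f g.
have [r [s [rf gs gf frsg]]] := exact_split f_inj g_surj fg.
apply: (@mult_exact _ _ L (tens_rep (subquot 0%VS S) V) (tens_rep U V)
  (tens_rep (subquot S {:U}%VS) V) (tmap f \1%VF) (tmap g \1%VF)) => //.
- move=> x t; rewrite !tens_actE !tmap_comp; congr (tmap _ _ _); last by rewrite comp_lfun1l comp_lfun1r.
  by apply/lfunP=> v; rewrite [LHS]comp_lfunE [RHS]comp_lfunE hf.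
- move=> x t; rewrite !tens_actE !tmap_comp; congr (tmap _ _ _); last by rewrite comp_lfun1l comp_lfun1r.
  by apply/lfunP=> v; rewrite [LHS]comp_lfunE [RHS]comp_lfunE hg.
- by move=> t t' /(congr1 (tmap r \1%VF)); rewrite !tmap_comp rf comp_lfun1l !tmap_id.
- by move=> t; exists (tmap s \1%VF t); rewrite tmap_comp gs comp_lfun1l tmap_id.
- move=> t; split=> [e|[u <-]]; last first.
    rewrite tmap_comp gf; apply: tens_eq => phi.
    by rewrite tmapE comp_lfun0r linear0 linear0 lfunE.
  exists (tmap r \1%VF t); rewrite tmap_comp comp_lfun1l.
  rewrite -[RHS]tmap_id -frsg tmap_addl.
  have -> : tmap (s \o g) \1%VF t = tmap s \1%VF (tmap g \1%VF t).
    by rewrite tmap_comp comp_lfun1l.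
  by rewrite e linear0 addr0.
Qed.

Lemma mult_tensr U V L (S : {vspace V}) : simple L -> submod S ->
  mult (tens_rep U V) L =
  (mult (tens_rep U (subquot 0%VS S)) L + mult (tens_rep U (subquot S {:V}%VS)) L)%N.
Proof.
move=> sL sS; have fM (v : V) : v \in {:V}%VS by rewrite memvf.
pose f := sqval 0%VS S; pose g := sqpi S {:V}%VS.
have hf x s : f (act (subquot 0%VS S) x s) = act V x (f s).
  rewrite sqact; apply/eqP; rewrite eq_sym -subr_eq0 -memv0.
  by apply: sqpi_sub; rewrite ?sub0v //; apply: (submodP _ sS); apply: sqval_in.
have hg x v : g (act V x v) = act (subquot S {:V}%VS) x (g v).
  by rewrite /g sqpi_act ?submodf ?subvf.
have f_inj : injective f by move=> s t; rewrite /f !sqvalE => /subvs_inj.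
have g_surj s : exists v, g v = s by exists (sqval S {:V}%VS s); rewrite /g sqvalK.
have fg v : g v = 0 <-> exists u, f u = v.
  split=> [/eqP|[s <-]]; last by apply/eqP; rewrite /g sqpi_eq0 ?subvf // sqval_in.
  rewrite /g sqpi_eq0 ?subvf // => vU; exists (sqpi 0 S v); apply/eqP.
  by rewrite eq_sym -subr_eq0 -memv0 sqpi_sub ?sub0v.
clearbody f g.
have [r [s [rf gs gf frsg]]] := exact_split f_inj g_surj fg.
apply: (@mult_exact _ _ L (tens_rep U (subquot 0%VS S)) (tens_rep U V)
  (tens_rep U (subquot S {:V}%VS)) (tmap \1%VF f) (tmap \1%VF g)) => //.
- move=> x t; rewrite !tens_actE !tmap_comp; congr (tmap _ _ _); first by rewrite comp_lfun1l comp_lfun1r.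
  by apply/lfunP=> v; rewrite [LHS]comp_lfunE [RHS]comp_lfunE hf.
- move=> x t; rewrite !tens_actE !tmap_comp; congr (tmap _ _ _); first by rewrite comp_lfun1l comp_lfun1r.
  by apply/lfunP=> v; rewrite [LHS]comp_lfunE [RHS]comp_lfunE hg.
- by move=> t t' /(congr1 (tmap \1%VF r)); rewrite !tmap_comp rf comp_lfun1l !tmap_id.
- by move=> t; exists (tmap \1%VF s t); rewrite tmap_comp gs comp_lfun1l tmap_id.
- move=> t; split=> [e|[u <-]]; last first.
    by rewrite tmap_comp gf; apply: tens_eq => phi; rewrite tmapE !lfunE.
  exists (tmap \1%VF r t); rewrite tmap_comp comp_lfun1l.
  rewrite -[RHS]tmap_id -frsg tmap_addr.
  have -> : tmap \1%VF (s \o g) t = tmap \1%VF s (tmap \1%VF g t).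
    by rewrite tmap_comp comp_lfun1l.
  by rewrite e linear0 addr0.
Qed.

Lemma simple_hom_iso U V (f : 'Hom(U, V)) : simple U -> simple V ->
  (forall x v, f (act U x v) = act V x (f v)) -> (exists u, f u <> 0) -> isor U V.
Proof.
move=> [_ sU] [_ sV] hf [u fu]; apply/isorP; exists f; split=> //.
  apply/lker0P; have [|->//|E] := sU (lker f).
    by apply/submodP=> x v; rewrite !memv_ker hf => /eqP->; rewrite linear0.
  by case: fu; apply/eqP; rewrite -memv_ker E memvf.
have [|E|E] := sV (limg f).
- by apply/submodP=> x _ /memv_imgP[v _ ->]; rewrite -hf memv_img ?memvf.
- by case: fu; apply/eqP; rewrite -memv0 -E memv_img ?memvf.
- by move=> v; have := memvf v; rewrite -E => /memv_imgP[w _ ->]; exists w.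
Qed.

(* p1 x acts as x on U and trivially on V; p2 x the other way round. *)
Definition indep U V (p1 p2 : D -> D) := forall x,
  [/\ act U (p1 x) = act U x, act V (p1 x) = \1%VF, act U (p2 x) = \1%VF
    & act V (p2 x) = act V x].

Lemma subquot_act_eq U (S T : {vspace U}) x y : act U x = act U y ->
  act (subquot S T) x = act (subquot S T) y.
Proof. by move=> e; apply/lfunP=> s; rewrite !sqact e. Qed.

Lemma subquot_act_id U (S T : {vspace U}) x : act U x = \1%VF ->
  act (subquot S T) x = \1%VF.
Proof. by move=> e; apply/lfunP=> s; rewrite sqact e !id_lfunE sqvalK. Qed.

Lemma indep_subl U V p1 p2 (S T : {vspace U}) :
  indep U V p1 p2 -> indep (subquot S T) V p1 p2.
Proof.
move=> ind x; have [h1 h2 h3 h4] := ind x.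
by split=> //; [apply: subquot_act_eq|apply: subquot_act_id].
Qed.

Lemma indep_subr U V p1 p2 (S T : {vspace V}) :
  indep U V p1 p2 -> indep U (subquot S T) p1 p2.
Proof.
move=> ind x; have [h1 h2 h3 h4] := ind x.
by split=> //; [apply: subquot_act_id|apply: subquot_act_eq].
Qed.

Section Indep.
Variables (p1 p2 : D -> D).

Lemma tens_act1 U V x t phi : indep U V p1 p2 ->
  act (tens_rep U V) (p1 x) t phi = t (phi \o act U x)%VF.
Proof. by move=> /(_ x)[h1 h2 _ _]; rewrite tens_actE tmapE h1 h2 id_lfunE. Qed.

Lemma tens_act2 U V x t phi : indep U V p1 p2 ->
  act (tens_rep U V) (p2 x) t phi = act V x (t phi).
Proof. by move=> /(_ x)[_ _ h1 h2]; rewrite tens_actE tmapE h1 h2 comp_lfun1r. Qed.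

(** The map id (x) psi applied to [t]. The basis formula is needed because a tensor is a map out of
    the dual of [U]; [contractE] characterises the result. *)
Definition contract (U V : vectType k) (psi : 'Hom(V, k^o)) (t : tensv U V) : U :=
  \sum_j (psi (t (cvec j)) : k) *: bvec j.

Lemma contractE (U V : vectType k) (psi : 'Hom(V, k^o)) (t : tensv U V)
    (phi : 'Hom(U, k^o)) : phi (contract psi t) = psi (t phi).
Proof.
rewrite {2}(functional_sum phi) !linear_sum; apply: eq_bigr => j _.
rewrite !linearZ; exact: mulrC.
Qed.

Lemma contract_lin (U V : vectType k) (psi : 'Hom(V, k^o)) :
  linear (@contract U V psi).
Proof.
move=> a t t'; apply/eqP; rewrite -subr_eq0; apply/eqP/functional_sep => phi.
by rewrite linearB linearP /= !contractE add_lfunE scale_lfunE linearP /= subrr.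
Qed.

(** Fix a vector of one factor and evaluate the image by a functional on the corresponding factor of
    the target. With suitable choices this is a non-zero map between the other factors; it is
    equivariant because [p1] and [p2] act on one factor at a time. Simplicity makes it an
    isomorphism. *)
Lemma tens_iso_inv U V U' V' : simple U -> simple V -> simple U' -> simple V' ->
  indep U V p1 p2 -> indep U' V' p1 p2 ->
  isor (tens_rep U V) (tens_rep U' V') -> isor U U' /\ isor V V'.
Proof.
move=> sU sV sU' sV' ind ind' /isorP[F [hF F_inj F_surj]].
have nz (W : rep k D) : simple W -> exists w : W, w <> 0.
  case=> /eqP W0 _; apply: contrapT => h; apply: W0; apply/eqP.
  rewrite -subv0; apply/subvP=> w _; rewrite memv0; apply/eqP; apply: contrapT => w0.
  by apply: h; exists w.
have [[u0 u00] [v0 v00]] := (nz _ sU, nz _ sV).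
have F0 : F (pure_tensv u0 v0) <> 0.
  rewrite -(linear0 F) => /F_inj e; apply: v00.
  have [phi phi0] : exists phi : 'Hom(U, k^o), phi u0 <> 0.
    by apply: contrapT => h; apply: u00; apply: functional_sep => phi;
      apply: contrapT => e'; apply: h; exists phi.
  have /lfunP/(_ phi) := e; rewrite pureE lfunE /= => /eqP.
  by rewrite scaler_eq0 => /orP[/eqP|/eqP].
have [phi Fphi] : exists phi, F (pure_tensv u0 v0) phi <> 0.
  by apply: contrapT => h; apply: F0; apply: tens_eq => phi; rewrite [RHS]lfunE /=;
    apply: contrapT => e; apply: h; exists phi.
split.
  have [psi psiF] : exists psi : 'Hom(V', k^o), psi (F (pure_tensv u0 v0) phi) <> 0.
    by apply: contrapT => h; apply: Fphi; apply: functional_sep => psi;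
      apply: contrapT => e'; apply: h; exists psi.
  have lg : linear (fun u : U => contract psi (F (pure_tensv u v0))).
    by move=> a u u'; rewrite (pure_linl v0) linearP /= contract_lin.
  apply: (simple_hom_iso (f := lin_of lg)) => // [x u|]; rewrite ?lin_ofE; last first.
    by exists u0; rewrite lin_ofE => /(congr1 phi); rewrite contractE linear0.
  apply/eqP; rewrite -subr_eq0; apply/eqP/functional_sep => xi.
  have -> : pure_tensv (act U x u) v0 = act (tens_rep U V) (p1 x) (pure_tensv u v0).
    by apply: tens_eq => z; rewrite tens_act1 // !pureE comp_lfunE.
  rewrite linearB /= hF contractE tens_act1 //.
  by rewrite -[xi (act _ _ _)]comp_lfunE contractE subrr.
have lg : linear (fun v : V => F (pure_tensv u0 v) phi).
  by move=> a v v'; rewrite (pure_linr u0) linearP /= add_lfunE scale_lfunE.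
apply: (simple_hom_iso (f := lin_of lg)) => // [x v|]; rewrite ?lin_ofE; last first.
  by exists v0; rewrite lin_ofE.
have -> : pure_tensv u0 (act V x v) = act (tens_rep U V) (p2 x) (pure_tensv u0 v).
  by apply: tens_eq => z; rewrite tens_act2 // !pureE linearZ.
by rewrite hF tens_act2.
Qed.

Lemma tens_full U V (T : {vspace tens_rep U V}) :
  (forall u v, (pure_tensv u v : tens_rep U V) \in T) -> T = fullv.
Proof.
move=> h; apply/vspaceP=> t; rewrite memvf.
by rewrite [t](@tens_sum U V) memv_suml // => j _; apply: h.
Qed.

(** The natural map from Hom(U, U') (x) Hom(V, V') is bijective. For surjectivity, an equivariant
    [F] restricted to u (x) V and composed with a functional [phi] on U' lies in Hom(V, V'); its
    coordinates there are linear in [u] and in [phi], hence are homomorphisms from U to U'. *)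
Lemma dim_hom_tens U V U' V' : indep U V p1 p2 -> indep U' V' p1 p2 ->
  dim (Hom_rep (tens_rep U V) (tens_rep U' V')) =
  (dim (Hom_rep U U') * dim (Hom_rep V V'))%N.
Proof.
move=> ind ind'; pose HV := homv V V'; pose m := \dim HV.
pose h (a : 'I_m) : 'Hom(V, V') := (vbasis HV)`_a.
have hH a : h a \in HV.
  by apply: vbasis_mem; apply: mem_nth; rewrite size_tuple.
have hfree : free (vbasis HV) := basis_free (vbasisP HV).
pose Phi0 (f : {ffun 'I_m -> Hom_rep U U'}) : 'Hom(tens_rep U V, tens_rep U' V') :=
  \sum_a tmap (vsval (f a)) (h a).
have Phi0P f u v : Phi0 f (pure_tensv u v) = \sum_a pure_tensv (vsval (f a) u) (h a v).
  by rewrite sum_lfunE; apply: eq_bigr => a _; rewrite tmap_pure.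
have pureq (F G : 'Hom(tens_rep U V, tens_rep U' V')) :
    (forall u v, F (pure_tensv u v) = G (pure_tensv u v)) -> F = G.
  move=> e; apply/lfunP=> t; rewrite [t](@tens_sum U V) !linear_sum.
  by apply: eq_bigr => j _; apply: e.
have Phi0_lin : linear Phi0.
  move=> c f f'; apply: pureq => u v; rewrite add_lfunE scale_lfunE !Phi0P.
  rewrite scaler_sumr -big_split /=; apply: eq_bigr => a _.
  by rewrite !ffunE linearP /= add_lfunE scale_lfunE (pure_linl (h a v)).
have Phi0H f : Phi0 f \in homv (tens_rep U V) (tens_rep U' V').
  apply/homvP=> x t; rewrite [t](@tens_sum U V) !linear_sum; apply: eq_bigr => j _.
  rewrite /= tens_act_pure !Phi0P linear_sum; apply: eq_bigr => a _ /=.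
  have /homvP ha := hH a; have /homvP hfa := subvsP (f a).
  by rewrite tens_act_pure ha hfa.
have Phi_lin : linear (fun f => vsproj (homv (tens_rep U V) (tens_rep U' V')) (Phi0 f)).
  by move=> c f f'; rewrite Phi0_lin linearP.
pose Phi := lin_of Phi_lin.
have PhiE f : vsval (Phi f) = Phi0 f by rewrite lin_ofE vsprojK.
rewrite -(bij_dim (f := Phi)); first by rewrite dim_ffun card_ord mulnC.
apply: bij_lker0.
  apply/lker0P; rewrite -subv0; apply/subvP=> f; rewrite memv_ker memv0 => /eqP e.
  have {}e : Phi0 f = 0 by rewrite -PhiE e.
  apply/eqP/ffunP=> a; rewrite [RHS]ffunE; apply: subvs_inj; apply/lfunP=> u.
  rewrite [RHS]lfunE /=; apply: functional_sep => phi.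
  have : \sum_a (phi (vsval (f a) u) : k) *: h a = 0.
    apply/lfunP=> v; have := Phi0P f u v; rewrite e [in LHS]lfunE /=.
    move/lfunP/(_ phi); rewrite !lfunE /= sum_lfunE => /esym E.
    rewrite sum_lfunE -[RHS]E; apply: eq_bigr => b _.
    by rewrite scale_lfunE pureE.
  move/freeP: hfree => /(_ (fun a => phi (vsval (f a) u))) fr E.
  by apply: fr.
move=> G; pose F := vsval G; have /homvP hF : F \in homv _ _ := subvsP G.
have linF u phi : linear (fun v : V => F (pure_tensv u v) phi).
  by move=> c v v'; rewrite (pure_linr u) linearP /= add_lfunE scale_lfunE.
pose Fu u phi := lin_of (linF u phi).
have FuE u phi v : Fu u phi v = F (pure_tensv u v) phi by rewrite lin_ofE.
have FuH u phi : Fu u phi \in HV.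
  apply/homvP=> x v; rewrite !FuE.
  have -> : pure_tensv u (act V x v) = act (tens_rep U V) (p2 x) (pure_tensv u v).
    by apply: tens_eq => z; rewrite tens_act2 // !pureE linearZ.
  by rewrite hF tens_act2.
pose co a u phi : k := coord (vbasis HV) a (Fu u phi).
have coE u phi v : F (pure_tensv u v) phi = \sum_a co a u phi *: h a v.
  rewrite -FuE {1}(coord_vbasis (FuH u phi)) sum_lfunE.
  by apply: eq_bigr => a _; rewrite scale_lfunE.
have co_linu a phi : linear (fun u => co a u phi : k^o).
  move=> c u u'; rewrite /co.
  have -> : Fu (c *: u + u') phi = c *: Fu u phi + Fu u' phi; last by rewrite linearP.
  apply/lfunP=> v.
  by rewrite add_lfunE scale_lfunE !FuE (pure_linl v) linearP /= add_lfunE scale_lfunE.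
have co_linphi a u : linear (fun phi => co a u phi : k^o).
  move=> c phi phi'; rewrite /co.
  have -> : Fu u (c *: phi + phi') = c *: Fu u phi + Fu u phi'; last by rewrite linearP.
  apply/lfunP=> v.
  by rewrite add_lfunE scale_lfunE !FuE linearP.
(* Biduality: [f0 a u] is the vector of U' that represents the functional sending [phi] to
   [co a u phi]. *)
pose f0 a u : U' := \sum_j (co a u (cvec j)) *: bvec j.
have f0E a u (phi : 'Hom(U', k^o)) : phi (f0 a u) = co a u phi.
  transitivity (lin_of (co_linphi a u) phi); last by rewrite lin_ofE.
  rewrite [in RHS](functional_sum phi) !linear_sum; apply: eq_bigr => j _.
  rewrite [LHS]linearZ [RHS]linearZ /= lin_ofE; exact: mulrC.
have f0_lin a : linear (f0 a).
  move=> c u u'; apply/eqP; rewrite -subr_eq0; apply/eqP/functional_sep => phi.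
  rewrite linearB linearP /= !f0E; apply/eqP; rewrite subr_eq0; apply/eqP.
  exact: (co_linu a phi c u u').
have f0H a : lin_of (f0_lin a) \in homv U U'.
  apply/homvP=> x u; rewrite !lin_ofE; apply/eqP; rewrite -subr_eq0.
  apply/eqP/functional_sep => phi; rewrite linearB /= -[phi (act _ _ _)]comp_lfunE !f0E.
  suff E : Fu (act U x u) phi = Fu u (phi \o act U' x)%VF by rewrite /co E subrr.
  apply/lfunP=> v; rewrite !FuE.
  have -> : pure_tensv (act U x u) v = act (tens_rep U V) (p1 x) (pure_tensv u v).
    by apply: tens_eq => z; rewrite tens_act1 // !pureE comp_lfunE.
  by rewrite hF tens_act1.
exists [ffun a => vsproj (homv U U') (lin_of (f0_lin a))]; apply: subvs_inj.
rewrite PhiE -/F; apply: pureq => u v; rewrite Phi0P; apply: tens_eq => phi.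
rewrite coE sum_lfunE; apply: eq_bigr => a _; rewrite ffunE vsprojK // pureE.
by rewrite lin_ofE f0E.
Qed.

End Indep.
End Binary.
End Tens.

(** * Simple tensor products over an algebraically closed field *)

Section ClosedTens.
Variables (k : closedFieldType) (D : finType).
Implicit Types (U V L : rep k D).

Lemma eigen_ex (V : vectType k) (f : 'End(V)) : (0 < dim V)%N ->
  exists c v, v != 0 /\ f v = c *: v.
Proof.
move=> V0; pose A := \matrix_(i, j) (cvec j (f (bvec i)) : k) : 'M[k]_(\dim {:V}).
have sz : size (char_poly A) != 1%N by rewrite size_char_poly dimvf eqSS -lt0n.
have /closed_rootP[c] := sz; rewrite -eigenvalue_root_char => /eigenvalueP[r rA r0].
pose v := \sum_i r 0 i *: bvec i; exists c, v.
have cv j : cvec j v = r 0 j.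
  rewrite /v linear_sum (bigD1 j) //= linearZ /= cvec_bvec eqxx big1 ?addr0 => [|i ij].
    exact: mulr1.
  by rewrite linearZ /= cvec_bvec (negPf ij); apply: mulr0.
split.
  apply: contraNneq r0 => v0; apply/eqP/rowP=> j; rewrite -cv v0 linear0 mxE //.
rewrite [f v]bvec_sum [in RHS](bvec_sum v) scaler_sumr; apply: eq_bigr => j _.
rewrite scalerA cv; congr (_ *: _).
have := congr1 (fun M : 'rV_(\dim {:V}) => M 0 j) rA; rewrite !mxE => <-.
rewrite /v !linear_sum; apply: eq_bigr => i _; rewrite !linearZ /= mxE //.
Qed.

Lemma schur V (f : 'End(V)) : simple V ->
  (forall x v, f (act V x v) = act V x (f v)) -> exists c, forall v, f v = c *: v.
Proof.
move=> [V0 sV] hf; have dV : (0 < dim V)%N by rewrite -dimvf lt0n dimv_eq0.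
have [c [v [v0 fv]]] := eigen_ex f dV; exists c.
have memK w : (w \in lker (f - c *: \1%VF)) = (f w == c *: w).
  by rewrite memv_ker add_lfunE opp_lfunE scale_lfunE id_lfunE subr_eq0.
have [|E|E] := sV (lker (f - c *: \1%VF)).
- by apply/submodP=> x w; rewrite !memK hf => /eqP->; rewrite linearZ.
- by case/eqP: v0; apply/eqP; rewrite -memv0 -E memK fv.
- by move=> w; apply/eqP; rewrite -memK E memvf.
Qed.

Lemma dim_tens_rep U V : dim (tens_rep U V) = (dim U * dim V)%N.
Proof. exact: dim_tensv. Qed.

Section Indep.
Variables (p1 p2 : D -> D).

(** Take a non-zero tensor of a submodule [T] with the fewest non-zero coordinates along U. The
    tensors of [T] supported there project isomorphically to V in one coordinate, by minimality and
    by simplicity of V. By Schur's lemma the other coordinates are scalar multiples of it, so these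
    tensors are u0 (x) v with one fixed u0. *)
Lemma simple_tens U V : indep U V p1 p2 -> simple U -> simple V -> simple (tens_rep U V).
Proof.
move=> ind sU sV.
have act1 x t phi := tens_act1 x t phi ind.
have act2 x t phi := tens_act2 x t phi ind.
have [[U0 hU] [V0 hV]] := (sU, sV).
have dim0 (W : vectType k) : ({:W} == 0)%VS = (dim W == 0%N) by rewrite -dimv_eq0 dimvf.
split; first by rewrite dim0 dim_tensv muln_eq0 negb_or -!dim0 U0.
move=> T sT; have [->|T0] := eqVneq T 0%VS; [by left|right].
pose supp (t : tensv U V) := [set j | t (cvec j) != 0].
have [t [tT t0 mint]] : exists t : tens_rep U V, [/\ t \in T, t != 0
    & forall t' : tens_rep U V, t' \in T -> t' != 0 -> (#|supp t| <= #|supp t'|)%N].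
  pose P d := `[< exists t : tens_rep U V, [/\ t \in T, t != 0 & #|supp t| = d] >].
  have exP : exists d, P d.
    have /subvPn[t tT t0] : ~~ (T <= 0)%VS by rewrite subv0.
    by exists #|supp t|; apply/asboolP; exists t; rewrite -memv0.
  case: (ex_minnP exP) => d /asboolP[t [tT t0 <-]] mind; exists t; split=> // t' t'T t'0.
  by apply: mind; apply/asboolP; exists t'.
have [j0 j0s] : exists j, j \in supp t.
  apply: contrapT => h; case/eqP: t0; apply: tens_eqc => j; rewrite [RHS]lfunE /=.
  by apply: contrapT => e; apply: h; exists j; rewrite inE; apply/eqP.
have evl j : linear (fun t : tens_rep U V => (t : tensv U V) (cvec j)).
  by move=> c a b; rewrite add_lfunE scale_lfunE.
pose ev j := lin_of (evl j).
have evE j a : ev j a = (a : tensv U V) (cvec j) by rewrite lin_ofE.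
pose E := (T :&: \bigcap_(j | j \notin supp t) lker (ev j))%VS.
have memE a : reflect (a \in T /\ forall j, j \notin supp t -> ev j a = 0) (a \in E).
  rewrite memv_cap; apply: (iffP andP) => -[aT h]; split=> //.
    move=> j js; apply/eqP; rewrite -memv_ker; move: h; apply/subvP.
    exact: (@bigcapv_inf _ _ _ j (fun j => j \notin supp t) (fun j => lker (ev j))).
  rewrite memvE; apply/subv_bigcapP=> j js; rewrite -memvE memv_ker.
  by rewrite h.
have E_inj a : a \in E -> ev j0 a = 0 -> a = 0.
  case/memE=> aT h e; apply: contrapT => a0.
  have := mint a aT (introN eqP a0); rewrite leqNgt => /negP; apply.
  apply: proper_card; apply/properP; split; last first.
    by exists j0; rewrite // inE -evE e eqxx.
  apply/subsetP=> j; apply: contraTT => js; rewrite inE -evE h // eqxx.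
  by [].
have E_act x a : a \in E -> act (tens_rep U V) (p2 x) a \in E.
  case/memE=> aT h; apply/memE; split; first exact: (submodP _ sT).
  by move=> j /h; rewrite !evE act2 => ->; rewrite linear0.
have tE : t \in E by apply/memE; split=> // j; rewrite inE negbK evE => /eqP.
have EV : (ev j0 @: E)%VS = fullv.
  have [|e|//] := hV (ev j0 @: E)%VS.
    apply/submodP=> x _ /memv_imgP[a aE ->]; rewrite evE -act2.
    by rewrite -evE memv_img ?E_act.
  have := memv_img (ev j0) tE; rewrite e memv0 evE => /eqP e0.
  by move: j0s; rewrite inE e0 eqxx.
pose e := (ev j0 \o linfun (@vsval k _ E))%VF.
have eE a : e a = ev j0 (vsval a) by rewrite comp_lfunE (lfunE (@vsval k _ E)).
have ke : lker e == 0%VS.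
  rewrite -subv0; apply/subvP=> a; rewrite memv_ker memv0 eE => /eqP h.
  by apply/eqP/subvs_inj; apply: E_inj h; apply: subvsP.
pose s := (linfun (@vsval k _ E) \o e^-1)%VF.
have sD v : s v = vsval ((e^-1)%VF v) by rewrite comp_lfunE (lfunE (@vsval k _ E)).
have sE v : s v \in E by rewrite sD subvsP.
have sK v : ev j0 (s v) = v.
  have [a aE ->] : exists2 a, a \in E & v = ev j0 a.
    by have := memvf v; rewrite -EV => /memv_imgP.
  have -> : ev j0 a = e (vsproj E a) by rewrite eE vsprojK.
  by rewrite sD -eE lker0_lfunK.
clearbody s ev.
have s_uniq v a : a \in E -> ev j0 a = v -> a = s v.
  move=> aE av; apply/eqP; rewrite -subr_eq0; apply/eqP/E_inj; first by rewrite memvB.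
  by rewrite linearB /= sK av subrr.
have s_act x v : s (act V x v) = act (tens_rep U V) (p2 x) (s v).
  apply/esym/s_uniq; first exact: E_act.
  by rewrite evE act2 -evE sK.
have /fin_all_exists[c cP] j : exists c : k, forall v, ev j (s v) = c *: v.
  have [x v|c h] := schur (f := (ev j \o s)%VF) sV; last first.
    by exists c => v; rewrite -h comp_lfunE.
  by rewrite !comp_lfunE s_act !evE act2.
pose u0 := \sum_j c j *: bvec j.
have sPure v : s v = pure_tensv u0 v.
  apply: tens_eqc => j; rewrite -evE cP pureE /u0 linear_sum (bigD1 j) //= big1.
    rewrite addr0 linearZ /= cvec_bvec eqxx; congr (_ *: _).
    by apply/esym; apply: mulr1.
  by move=> i ij; rewrite linearZ /= cvec_bvec (negPf ij); apply: mulr0.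
have [v0 v00] : exists v : V, v != 0.
  have /subvPn[v _ vn] : ~~ ({:V} <= 0)%VS by rewrite subv0.
  by exists v; rewrite -memv0.
have u00 : u0 != 0.
  apply: contraNneq v00 => u00; rewrite -(sK v0) sPure u00 evE pureE linear0.
  by rewrite scale0r.
(* The vectors u with u (x) V inside [T]. They form a submodule of U that contains u0, hence all of
   U. *)
pose S := (\bigcap_(i < \dim {:V}) (lin_of (@pure_linl k U V (bvec i)) @^-1: T))%VS.
have memS u : reflect (forall v, (pure_tensv u v : tens_rep U V) \in T) (u \in S).
  apply: (iffP idP) => [uS v|h].
    have -> : pure_tensv u v = \sum_i (cvec i v : k) *: (pure_tensv u (bvec i) : tensv U V).
      transitivity (lin_of (@pure_linr k U V u) v); first by rewrite lin_ofE.
      rewrite {1}(bvec_sum v) linear_sum; apply: eq_bigr => i _.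
      by rewrite linearZ /= lin_ofE.
    rewrite memv_suml // => i _; rewrite memvZ //.
    have : u \in (lin_of (@pure_linl k U V (bvec i)) @^-1: T)%VS.
      by move: uS; apply/subvP; apply: (bigcapv_inf i).
    by rewrite -memv_preim lin_ofE.
  rewrite memvE; apply/subv_bigcapP=> i _; rewrite -memvE -memv_preim lin_ofE.
  exact: h.
have [|S0|SU] := hU S.
- apply/submodP=> x u /memS h; apply/memS=> v.
  have -> : pure_tensv (act U x u) v = act (tens_rep U V) (p1 x) (pure_tensv u v).
    by apply: tens_eq => z; rewrite act1 !pureE comp_lfunE.
  exact: (submodP _ sT).
- case/eqP: u00; apply/eqP; rewrite -memv0 -S0; apply/memS=> v; rewrite -sPure.
  by have /memE[] := sE v.
- by apply: tens_full => u v; have := memvf u; rewrite -SU => /memS.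
Qed.

Lemma mult_tens U V L L' : simple L -> simple L' ->
  indep U V p1 p2 -> indep L L' p1 p2 ->
  mult (tens_rep U V) (tens_rep L L') = (mult U L * mult V L')%N.
Proof.
move=> sL sL' + iL; have sLL := simple_tens iL sL sL'.
elim/rep_ind_simple: U => [U U0|U sU|U S sS _ _ IH1 IH2] ind.
- by rewrite (mult0 sL U0) mult0 // dim_tens_rep U0.
- elim/rep_ind_simple: V ind => [V V0|V sV|V S sS _ _ IH1 IH2] ind.
  + by rewrite (mult0 sL' V0) muln0 mult0 // dim_tens_rep V0 muln0.
  + rewrite !mult_simple //; last exact: simple_tens.
    rewrite mulnb; congr nat_of_bool; apply/asboolP/andP=> [h|[/asboolP h1 /asboolP h2]].
      by have [h1 h2] := tens_iso_inv sU sV sL sL' ind iL h; split; apply/asboolP.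
    exact: tens_iso.
  + rewrite (mult_tensr _ sLL sS) IH1 ?IH2 ?(mult_sub (U := S) sL' sS) ?mulnDr //;
      exact: indep_subr.
- rewrite (mult_tensl _ sLL sS) IH1 ?IH2 ?(mult_sub (U := S) sL sS) ?mulnDl //;
    exact: indep_subl.
Qed.

End Indep.
End ClosedTens.

(** * Tensor products over a family and their universal property *)

Section BigTens.
Variables (k : closedFieldType) (D R : finType) (keep kill : R -> D -> D).

(** The element [keep r x] acts as [x] on the factor [r] alone, and [kill r x] acts as [x] on all
    the others. For the factor algebras both arise by inserting identity diagrams. *)
Definition indep_family (V : R -> rep k D) := forall r x,
  [/\ act (V r) (keep r x) = act (V r) x, act (V r) (kill r x) = \1%VF
    & forall r', r' != r -> act (V r') (keep r x) = \1%VF /\ act (V r') (kill r x) = act (V r') x].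

Definition bigtens (V : R -> rep k D) s := \big[@tens_rep k D/triv_rep k D]_(r <- s) V r.

Lemma bigtens_act_eq V s x y : {in s, forall r, act (V r) x = act (V r) y} ->
  act (bigtens V s) x = act (bigtens V s) y.
Proof.
rewrite /bigtens; elim: s => [|r s IHs] h; first by rewrite big_nil.
rewrite big_cons; apply/lfunP=> t; rewrite !tens_actE h ?mem_head // IHs // => r' r's.
by rewrite h // inE r's orbT.
Qed.

Lemma bigtens_act_id V s x : {in s, forall r, act (V r) x = \1%VF} ->
  act (bigtens V s) x = \1%VF.
Proof.
rewrite /bigtens; elim: s => [|r s IHs] h; first by rewrite big_nil.
rewrite big_cons; apply/lfunP=> t; rewrite tens_actE h ?mem_head // IHs.
  by rewrite tmap_id id_lfunE.
by move=> r' r's; rewrite h // inE r's orbT.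
Qed.

Lemma indep_big V r s : indep_family V -> r \notin s ->
  indep (V r) (bigtens V s) (keep r) (kill r).
Proof.
move=> ind rs x; have [h1 h2 h3] := ind r x; split=> //.
  by apply: bigtens_act_id => r' r's; case: (h3 r') => //; apply: contraNneq rs => <-.
by apply: bigtens_act_eq => r' r's; case: (h3 r') => //; apply: contraNneq rs => <-.
Qed.

Lemma triv_simple : simple (triv_rep k D).
Proof.
have d1 : dim (triv_rep k D) = 1%N by [].
split; first by rewrite -dimv_eq0 dimvf d1.
move=> U _; have := dimvS (subvf U); rewrite dimvf d1.
case E: (\dim U) => [|[|//]] _; [left|right]; apply/eqP; first by rewrite -dimv_eq0 E.
by rewrite eqEdim subvf dimvf d1 E.
Qed.

Lemma simple_big V s : indep_family V -> uniq s -> {in s, forall r, simple (V r)} ->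
  simple (bigtens V s).
Proof.
move=> ind; elim: s => [|r s IHs] /=; first by rewrite /bigtens big_nil => _ _; apply: triv_simple.
case/andP=> rs us h; have := indep_big ind rs; rewrite /bigtens big_cons => i.
apply: (simple_tens i); first by apply: h; rewrite mem_head.
by apply: IHs => // r' r's; apply: h; rewrite inE r's orbT.
Qed.

Lemma mult_big V L s : indep_family V -> indep_family L -> uniq s ->
  {in s, forall r, simple (L r)} ->
  mult (bigtens V s) (bigtens L s) = (\prod_(r <- s) mult (V r) (L r))%N.
Proof.
move=> indV indL; elim: s => [|r s IHs] /=.
  rewrite /bigtens !big_nil => _ _; have st := triv_simple.
  by rewrite mult_simple //; case: asboolP => // -[]; apply: isor_refl.
case/andP=> rs us h; have iV := indep_big indV rs; have iL := indep_big indL rs.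
have h' : {in s, forall r, simple (L r)} by move=> r' r's; apply: h; rewrite inE r's orbT.
have sB := simple_big indL us h'; have sr : simple (L r) by apply: h; rewrite mem_head.
rewrite {1 2}/bigtens !big_cons (mult_tens sr sB iV iL) IHs //.
Qed.

Lemma dim_hom_triv : dim (Hom_rep (triv_rep k D) (triv_rep k D)) = 1%N.
Proof.
have h : homv (triv_rep k D) (triv_rep k D) = fullv.
  by apply/vspaceP=> f; rewrite memvf; apply/homvP=> x v; rewrite !id_lfunE.
transitivity (\dim (homv (triv_rep k D) (triv_rep k D))); first by [].
by rewrite h dimvf.
Qed.

Lemma dim_hom_big V L s : indep_family V -> indep_family L -> uniq s ->
  dim (Hom_rep (bigtens L s) (bigtens V s)) = (\prod_(r <- s) dim (Hom_rep (L r) (V r)))%N.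
Proof.
move=> indV indL; elim: s => [|r s IHs] /=.
  by rewrite /bigtens !big_nil dim_hom_triv.
case/andP=> rs us; have iV := indep_big indV rs; have iL := indep_big indL rs.
by rewrite {1 2}/bigtens !big_cons (dim_hom_tens iL iV) IHs.
Qed.

Lemma dim_big (V : R -> rep k D) s : dim (bigtens V s) = (\prod_(r <- s) dim (V r))%N.
Proof.
rewrite /bigtens; elim: s => [|r s IHs]; first by rewrite !big_nil.
by rewrite !big_cons -IHs; apply: dim_tensv.
Qed.

End BigTens.

Section MultiTens.
Variables (k : fieldType) (D I : finType) (V : I -> rep k D).
Notation T s := (\big[@tens_rep k D/triv_rep k D]_(r <- s) V r).
Notation vec := (forall r, V r).

Definition multilin (X : vectType k) (s : seq I) (f : vec -> X) :=
  (forall v v' : vec, {in s, forall r, v r = v' r} -> f v = f v') /\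
  (forall (v : vec) r, r \in s -> linear (fun u : V r => f (dfwith v u))).

Definition spans (W : vectType k) (G : W -> Prop) :=
  forall U : {vspace W}, (forall u, G u -> u \in U) -> U = fullv.

(** Through these four properties the iterated tensor product is used as a multilinear universal
    object, and its nested form need not be unfolded. Spanning is stated for arbitrary spanning sets
    of the factors, as cell modules are known through generators. *)
Record is_pure (s : seq I) (W : rep k D) (p : vec -> W) := IsPure {
  pure_multilin : multilin s p;
  pure_act : forall x v, act W x (p v) = p (fun r => act (V r) x (v r));
  pure_span : forall G : forall r, V r -> Prop, (forall r, spans (G r)) ->
    forall U : {vspace W}, (forall v, {in s, forall r, G r (v r)} -> p v \in U) -> U = fullv;
  pure_univ : forall (X : vectType k) (f : vec -> X), multilin s f ->
    exists h : 'Hom(W, X), forall v, h (p v) = f v }.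

Lemma dfwith_id (v : vec) r : forall r', dfwith v (v r) r' = v r'.
Proof. by move=> r'; have [<-|ne] := eqVneq r r'; [rewrite dfwith_in|rewrite dfwith_out]. Qed.

(** For the universal property the first argument is expanded in a basis; each basis vector, once
    fixed, leaves a multilinear function of the remaining arguments. *)
Lemma pure_ex s : uniq s -> exists p : vec -> T s, is_pure s p.
Proof.
elim: s => [_|r s IHs /= /andP[rs us]].
  rewrite big_nil; exists (fun=> (1 : k^o)); split=> //.
  - by move=> x v; rewrite id_lfunE.
  - move=> G _ U h; apply/vspaceP=> c; rewrite memvf.
    have h1 : (1 : k^o) \in U by apply: (h (fun=> 0)).
    have -> : c = (c : k) *: (1 : k^o) by apply/esym; apply: mulr1.
    by rewrite memvZ.
  - move=> X f [fext _].
    have l : linear (fun c : k^o => (c : k) *: f (fun=> 0)).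
      by move=> a c c'; rewrite scalerDl scalerA.
    exists (lin_of l) => v; rewrite lin_ofE scale1r; exact: fext.
have [p [[pext plin] pact psp puniv]] := IHs us; rewrite big_cons.
have s_ne r' : r' \in s -> r != r' by apply: contraTneq => <-.
exists (fun v => pure_tensv (v r) (p v)); split.
- split=> [v v' h|v r' r's].
    rewrite (h r) ?mem_head // (pext v v') // => r' r's.
    by rewrite h // inE r's orbT.
  have [E|ne] := eqVneq r r'.
    case: r' / E r's => _ a u u'; rewrite !dfwith_in.
    have e (w : V r) : p (dfwith v w) = p v.
      by apply: pext => r' r's; rewrite dfwith_out ?s_ne.
    by rewrite !e (pure_linl (p v)).
  have {}r's : r' \in s by move: r's; rewrite inE eq_sym (negPf ne).
  move=> a u u'; rewrite !dfwith_out 1?eq_sym // plin // (pure_linr (v r)).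
  by [].
- by move=> x v; rewrite tens_act_pure pact.
- move=> G spG U h; apply: (@tens_full _ D) => u t.
  have stepl u' : G r u' -> forall t', (pure_tensv u' t' : tens_rep (V r) (T s)) \in U.
    move=> Gu t'; pose f := lin_of (@pure_linr k (V r) (T s) u').
    suff E : (f @^-1: U)%VS = fullv by have := memvf t'; rewrite -E -memv_preim lin_ofE.
    apply: (psp G spG) => v Gv; rewrite -memv_preim lin_ofE.
    have e : p (dfwith v u') = p v by apply: pext => r' r's; rewrite dfwith_out ?s_ne.
    have := h (dfwith v u'); rewrite dfwith_in e; apply=> r'.
    rewrite inE => /orP[/eqP->|r's]; first by rewrite dfwith_in.
    by rewrite dfwith_out ?s_ne //; apply: Gv.
  pose f := lin_of (@pure_linl k (V r) (T s) t).
  suff E : (f @^-1: U)%VS = fullv by have := memvf u; rewrite -E -memv_preim lin_ofE.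
  by apply: spG => u' Gu'; rewrite -memv_preim lin_ofE stepl.
- move=> X f [fext flin].
  have /fin_all_exists[h hP] j : exists h : 'Hom(T s, X), forall v, h (p v) = f (dfwith v (@bvec k (V r) j)).
    apply: puniv; split=> [v v' e|v r' r's].
      apply: fext => r'; rewrite inE => /orP[/eqP->|r's]; first by rewrite !dfwith_in.
      by rewrite !dfwith_out ?s_ne // e.
    have ne := s_ne _ r's; move=> a u u'.
    have sw (w : V r') : f (dfwith (dfwith v w) (@bvec k (V r) j)) = f (dfwith (dfwith v (@bvec k (V r) j)) w).
      apply: fext => r'' _; have [<-|ne1] := eqVneq r r''.
        by rewrite dfwith_in dfwith_out 1?eq_sym // dfwith_in.
      have [<-|ne2] := eqVneq r' r''; first by rewrite dfwith_out // !dfwith_in.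
      by rewrite !dfwith_out.
    by rewrite !sw flin // inE r's orbT.
  have evl j : linear (fun t : tensv (V r) (T s) => t (cvec j)).
    by move=> a t t'; rewrite add_lfunE scale_lfunE.
  pose hh : 'Hom(tens_rep (V r) (T s), X) := \sum_j (h j \o lin_of (evl j))%VF.
  exists hh => v; rewrite sum_lfunE.
  transitivity (lin_of (flin v r (mem_head _ _)) (v r)); last first.
    by rewrite lin_ofE; apply: fext => r' _; rewrite dfwith_id.
  rewrite [in RHS](bvec_sum (v r)) linear_sum; apply: eq_bigr => j _.
  by rewrite comp_lfunE lin_ofE pureE !linearZ /= lin_ofE hP.
Qed.

End MultiTens.

Definition purev (k : fieldType) (D I : finType) (V : I -> rep k D) :=
  cid (pure_ex V (index_enum_uniq I)).

Section Dtens.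
Variables (k : fieldType) (E : finType) (W : vectType k).

Lemma dtensE (d d' : E) (w : W) : dtens d w d' = if d' == d then w else 0.
Proof. by rewrite ffunE. Qed.

Lemma dtens_lin d : linear (dtens d : W -> {ffun E -> W}).
Proof.
move=> a u v; apply/ffunP=> d'; rewrite !ffunE.
by case: eqP => // _; rewrite scaler0 addr0.
Qed.

Lemma dtens_sum (f : {ffun E -> W}) : f = \sum_d dtens d (f d).
Proof.
apply/ffunP=> d; rewrite sum_ffunE (bigD1 d) //= dtensE eqxx big1 ?addr0 // => d' nd.
by rewrite dtensE eq_sym (negPf nd).
Qed.

Lemma dtens0 d : dtens d 0 = 0 :> {ffun E -> W}.
Proof. by apply/ffunP=> d'; rewrite dtensE ffunE; case: eqP. Qed.

End Dtens.

(** * Simplicity of Specht modules in characteristic 0 or p > N *)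

Lemma prime_dvd_fact p n : prime p -> (p %| n`!)%N -> (p <= n)%N.
Proof.
move=> pr; elim: n => [|n IHn]; first by rewrite dvdn1 => /eqP e; rewrite e in pr.
rewrite factS Euclid_dvdM // => /orP[/dvdn_leq|/IHn/leqW]; exact.
Qed.

Section SpechtSimple.
Variables (k : fieldType) (nu : seq nat).
Notation N := (sumn nu).
Notation tabloid := {ffun 'I_N -> 'I_(size nu)}.
Notation P := {ffun tabloid -> k^o}.

Definition tabr (T : tabloid) (g : 'S_N) : tabloid := [ffun e => T (g e)].

Lemma tabr1 T : tabr T 1%g = T. Proof. by apply/ffunP=> e; rewrite ffunE perm1. Qed.
Lemma tabrM T g h : tabr T (g * h)%g = tabr (tabr T h) g.
Proof. by apply/ffunP=> e; rewrite !ffunE permM. Qed.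

Lemma tabloid_actE g f : tabloid_act g f = [ffun T => f (tabr T (g^-1)%g)] :> P.
Proof.
apply/ffunP=> T; rewrite sum_ffunE ffunE (bigD1 (tabr T (g^-1)%g)) //= dtensE.
rewrite -/(tabr _ _) -tabrM mulgV tabr1 eqxx big1 ?addr0 // => T' nT.
rewrite dtensE -/(tabr _ _); case: eqP => // e; case/eqP: nT.
by rewrite e -tabrM mulVg tabr1.
Qed.

Lemma tabloid_act_lin g : linear (tabloid_act g : P -> P).
Proof. by move=> a f f'; rewrite !tabloid_actE; apply/ffunP=> T; rewrite !ffunE. Qed.

Definition tact g : 'End(P) := lin_of (tabloid_act_lin g).

Lemma tactE g f : tact g f = tabloid_act g f. Proof. exact: lin_ofE. Qed.

Lemma tact1 f : tact 1%g f = f.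
Proof. by rewrite tactE tabloid_actE; apply/ffunP=> T; rewrite ffunE invg1 tabr1. Qed.

Lemma tactM g h f : tact (g * h)%g f = tact g (tact h f).
Proof.
rewrite !tactE !tabloid_actE; apply/ffunP=> T; rewrite !ffunE.
by rewrite invMg tabrM.
Qed.

Lemma tact_dtens g T (c : k^o) : tact g (dtens T c) = dtens (tabr T g) c.
Proof.
rewrite tactE tabloid_actE; apply/ffunP=> T'; rewrite ffunE !dtensE.
congr (if _ then _ else _); apply/eqP/eqP=> [<-|->]; rewrite -tabrM ?mulVg ?mulgV tabr1 //.
Qed.

Lemma tabr_of g (t : 'S_N) : tabr (tabloid_of t) g = tabloid_of (t * g^-1)%g.
Proof. by apply/ffunP=> e; rewrite !ffunE invMg invgK permM. Qed.

Definition colgrp (q : 'S_N) := [forall c, cell_col (q c) == cell_col c].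

Lemma colgrpP (q : 'S_N) : reflect (forall c, cell_col (q c) = cell_col c) (colgrp q).
Proof. exact: 'forall_eqP. Qed.

Lemma colgrpM (q q' : 'S_N) : colgrp q -> colgrp q' -> colgrp (q * q')%g.
Proof. by move=> /colgrpP h /colgrpP h'; apply/colgrpP=> c; rewrite permM h' h. Qed.

Lemma colgrpV (q : 'S_N) : colgrp q -> colgrp (q^-1)%g.
Proof. by move=> /colgrpP h; apply/colgrpP=> c; rewrite -h permKV. Qed.

Lemma colgrpMl (q q' : 'S_N) : colgrp q -> colgrp (q * q')%g = colgrp q'.
Proof.
move=> h; apply/idP/idP=> h'; last exact: colgrpM.
by rewrite -[q'](mulKg q) colgrpM // colgrpV.
Qed.

Lemma polytabloidE t : polytabloid k t =
  \sum_(q | colgrp q) (-1) ^+ q *: dtens (tabloid_of (q * t)%g) (1 : k^o).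
Proof. by []. Qed.

Lemma tact_poly g t : tact g (polytabloid k t) = polytabloid k (t * g^-1)%g.
Proof.
rewrite !polytabloidE linear_sum; apply: eq_bigr => q _.
by rewrite linearZ /= tact_dtens tabr_of mulgA.
Qed.

Lemma poly_in t : polytabloid k t \in spechtv k nu.
Proof. by rewrite memv_span //; apply/imageP; exists t. Qed.

Lemma specht_sub (U : {vspace P}) :
  (forall t, polytabloid k t \in U) -> (spechtv k nu <= U)%VS.
Proof. by move=> h; apply/span_subvP=> f /imageP[t _ ->]. Qed.

Lemma tact_specht g f : f \in spechtv k nu -> tact g f \in spechtv k nu.
Proof.
have h : (spechtv k nu <= tact g @^-1: spechtv k nu)%VS.
  by apply: specht_sub => t; rewrite -memv_preim tact_poly poly_in.
by move/(subvP h); rewrite -memv_preim.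
Qed.

Lemma specht_actE g v : vsval (act (specht k nu) g v) = tact g (vsval v).
Proof.
rewrite /= linfun_lin => [|a u w]; last first.
  by rewrite linearP /= -!tactE linearP /= linearP.
by rewrite -tactE vsprojK // tact_specht // subvsP.
Qed.

Lemma specht_act1 v : act (specht k nu) 1%g v = v.
Proof. by apply: subvs_inj; rewrite specht_actE tact1. Qed.

Lemma specht_actM g h v :
  act (specht k nu) (g * h)%g v = act (specht k nu) g (act (specht k nu) h v).
Proof. by apply: subvs_inj; rewrite !specht_actE tactM. Qed.

Hypothesis part_nu : is_part nu.

Lemma part_geq i j : (i <= j)%N -> (nth 0%N nu j <= nth 0%N nu i)%N.
Proof.
move=> le_ij; have /andP[so _] := part_nu.
have [lt_j|ge_j] := ltnP j (size nu); last by rewrite nth_default.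
have tr : transitive geq by move=> a b c /= h1 h2; apply: leq_trans h2 h1.
by apply: (sorted_leq_nth tr (leqnn : reflexive geq) 0%N so); rewrite ?inE // (leq_ltn_trans le_ij).
Qed.

Lemma cell_inj (c c' : 'I_N) : cell_row c = cell_row c' -> cell_col c = cell_col c' -> c = c'.
Proof.
move=> /(congr1 val) /= er ec; apply: ord_inj.
by rewrite -(reshape_indexK nu c) -(reshape_indexK nu c') er /cell_col in ec *; rewrite ec.
Qed.

Lemma cell_colP (c : 'I_N) : (cell_col c < nth 0 nu (cell_row c))%N.
Proof. exact: reshape_offsetP. Qed.

Lemma cell_ex (i : 'I_(size nu)) j : (j < nth 0 nu i)%N ->
  exists c : 'I_N, cell_row c = i /\ cell_col c = j.
Proof.
move=> lt_j; have lt := flatten_indexP lt_j; exists (Ordinal lt); split.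
  by apply: val_inj; rewrite /= flatten_indexKl.
by rewrite /cell_col /= flatten_indexKr.
Qed.

(** Compare, column by column, the number of cells which [T] sends to the first i rows with the
    number of cells lying in those rows. The first is at most the second because [T] is injective on
    columns; the totals over all columns agree, so every column gives equality, and [T] permutes
    each column. *)
Lemma col_transversal (T : tabloid) :
  (forall i, #|[pred c : 'I_N | (T c < i)%N]| = #|[pred c : 'I_N | (cell_row c < i)%N]|) ->
  (forall c c' : 'I_N, cell_col c = cell_col c' -> T c = T c' -> c = c') ->
  exists2 q, colgrp q & T = tabloid_of q.
Proof.
move=> cont inj.
pose A j i := [pred c : 'I_N | (cell_col c == j) && (T c < i)%N].
pose B j i := [pred c : 'I_N | (cell_col c == j) && (cell_row c < i)%N].
have leAB j i : (#|A j i| <= #|B j i|)%N.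
  have [/existsP[c0 /andP[/eqP cj le_i]]|] :=
      boolP [exists c0 : 'I_N, (cell_col c0 == j) && (i <= cell_row c0)%N]; last first.
    rewrite negb_exists => /forallP h; apply/subset_leq_card/subsetP=> c.
    rewrite !inE => /andP[/eqP cj _]; rewrite cj eqxx /= ltnNge.
    by have := h c; rewrite cj eqxx.
  have ltis : (i <= size nu)%N by rewrite (leq_trans le_i) // ltnW.
  (* A column reaching row i or below has a cell in each of the first i rows, and [T] takes at most
     i values there. *)
  apply: (@leq_trans i).
    rewrite -(card_in_image (f := T) (A := A j i)); last first.
      by move=> c c'; rewrite !inE => /andP[/eqP e _] /andP[/eqP e' _]; apply: inj; rewrite e e'.
    rewrite -[X in (_ <= X)%N]card_ord -(card_image (f := widen_ord ltis)); last first.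
      by move=> a b /(congr1 val) /= e; apply: ord_inj.
    apply/subset_leq_card/subsetP=> r /imageP[c]; rewrite inE => /andP[_ lt] ->.
    by apply/imageP; exists (Ordinal lt) => //; apply: ord_inj.
  rewrite -[X in (X <= _)%N]card_ord.
  have /fin_all_exists[f fP] (r : 'I_i) : exists c : 'I_N, cell_row c = widen_ord ltis r /\ cell_col c = j.
    apply: cell_ex; rewrite /= -cj (leq_trans (cell_colP c0)) // part_geq //.
    exact: leq_trans (ltnW (ltn_ord r)) le_i.
  rewrite -(card_image (f := f)); last first.
    move=> r r' e; have [e1 _] := fP r; have [e2 _] := fP r'; apply: ord_inj.
    by have := congr1 val e1; rewrite e e2.
  apply/subset_leq_card/subsetP=> c /imageP[r _ ->]; rewrite inE.
  by have [-> ->] := fP r; rewrite eqxx /=.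
have col_lt (c : 'I_N) : (cell_col c < N)%N.
  by apply: leq_ltn_trans (ltn_ord c); rewrite -[X in (_ <= X)%N](reshape_indexK nu c) leq_addl.
have sumE (Q : pred 'I_N) : #|Q| = (\sum_(j < N) #|[pred c : 'I_N | (cell_col c == j) && Q c]|)%N.
  rewrite -sum1_card (partition_big (fun c => Ordinal (col_lt c)) xpredT) //=.
  apply: eq_bigr => j _; rewrite -sum1_card; apply: eq_bigl => c.
  by rewrite inE andbC -val_eqE.
have eqAB j i : #|A j i| = #|B j i|.
  have [lt_jN|ge_j] := ltnP j N; last first.
    by rewrite !eq_card0 // => c; rewrite inE; apply/negP=> /andP[/eqP cj _];
      have := col_lt c; rewrite cj ltnNge ge_j.
  have : (\sum_(j < N) #|A j i| == \sum_(j < N) #|B j i|)%N.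
    by have := cont i; rewrite sumE [in RHS]sumE => ->.
  have /leqif_sum h : forall j : 'I_N, true -> (#|A j i| <= #|B j i| ?= iff (#|A j i| == #|B j i|))%N.
    by move=> j' _; split.
  by rewrite (h : leqif _ _ _).2 => /forallP/(_ (Ordinal lt_jN))/eqP.
have /fin_all_exists[q0 q0P] (c : 'I_N) : exists c' : 'I_N, cell_col c' = cell_col c /\ T c' = cell_row c.
  pose j := cell_col c; pose i : nat := cell_row c.
  have AB : [pred c' | c' \in A j i] \proper [pred c' | c' \in A j i.+1].
    rewrite properE; apply/andP; split.
      by apply/subsetP=> c'; rewrite !inE => /andP[-> /ltnW].
    apply/negP=> /subset_leq_card; rewrite leqNgt => /negP; apply.
    rewrite (eq_card (B := A j i)) // [X in (_ < X)%N](eq_card (B := A j i.+1)) //.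
    rewrite !eqAB; apply: proper_card; apply/properP; split.
      by apply/subsetP=> c'; rewrite !inE => /andP[-> /ltnW].
    by exists c; rewrite !inE eqxx /= ?ltnn.
  have /properP[_ [c']] := AB; rewrite !inE => /andP[/eqP e1 lt] n2.
  exists c'; split=> //; apply: ord_inj; apply/eqP; rewrite eqn_leq -ltnS lt /= leqNgt.
  by move: n2; rewrite e1 eqxx.
have q0_inj : injective q0.
  move=> c c' e; have [e1 e2] := q0P c; have [e3 e4] := q0P c'.
  by apply: cell_inj; rewrite -?e2 -?e4 -?e1 -?e3 e.
exists (perm q0_inj); first by apply/colgrpP=> c; rewrite permE; case: (q0P c).
apply/ffunP=> e; rewrite ffunE; set c := ((perm q0_inj)^-1)%g e.
by rewrite -(permKV (perm q0_inj) e) -/c permE; case: (q0P c).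
Qed.

Hypothesis chark : forall p : nat, p \in [pchar k] -> (N < p)%N.

Lemma fact_neq0 n : (n <= N)%N -> n`!%:R != 0 :> k.
Proof.
move=> le_n; apply/negP=> e; have [p pch] := natf0_pchar (fact_gt0 n) e.
have pr := pcharf_prime pch; have := dvdn_pcharf pch n`!; rewrite e.
by move/(prime_dvd_fact pr); rewrite leqNgt (leq_ltn_trans le_n) // chark.
Qed.

(** The signed column sum. The inverse compensates for [tact g] sending the tabloid of [t] to that
    of t g^-1, so that [kappa] carries the tabloid of 1 to its polytabloid. *)
Definition kappa : 'End(P) := \sum_(q | colgrp q) (-1) ^+ q *: tact (q^-1)%g.

Lemma kappaE f : kappa f = \sum_(q | colgrp q) (-1) ^+ q *: tact (q^-1)%g f.
Proof. by rewrite sum_lfunE; apply: eq_bigr => q _; rewrite scale_lfunE. Qed.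

Lemma kappa1 : kappa (dtens (tabloid_of 1%g) (1 : k^o)) = polytabloid k 1%g.
Proof.
rewrite kappaE; apply: eq_bigr => q _.
by rewrite tact_dtens tabr_of invgK mul1g mulg1.
Qed.

(** If two entries of a column share a row, their transposition fixes the tabloid and changes the
    sign of [kappa], so the value is 0 because 2 is invertible. Otherwise the tabloid is the
    standard one moved by a column permutation, and the value is the polytabloid up to sign. *)
Lemma kappa_tabloid t : exists c : k,
  kappa (dtens (tabloid_of t) (1 : k^o)) = c *: polytabloid k 1%g.
Proof.
set T := tabloid_of t.
have [[c [c' [ec eT ncc]]]|h] := pselect (exists c c' : 'I_N, [/\ cell_col c = cell_col c', T c = T c' & c <> c']).
  exists 0; rewrite scale0r; pose s := tperm c c'.
  have sT : tabr T s = T.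
    by apply/ffunP=> e; rewrite ffunE; case: tpermP => // ->.
  have cs : colgrp s by apply/colgrpP=> e; rewrite /s; case: tpermP => [->|->|].
  have E : kappa (dtens T (1 : k^o)) = - kappa (dtens T (1 : k^o)).
    rewrite {1}kappaE kappaE -sumrN (reindex_inj (mulgI s)) /=.
    apply: eq_big => [q|q _]; first exact: colgrpMl.
    rewrite odd_mul_tperm invMg tactM tact_dtens.
    have -> : tabr T (s^-1)%g = T by rewrite tpermV.
    have /eqP -> := ncc; rewrite signr_addb expr1 mulN1r scaleNr //.
  have two : 2%:R != 0 :> k.
    apply: (@fact_neq0 2); have := ltn_ord c; have := ltn_ord c'.
    by case: (N) c c' ncc {ec eT s sT cs E T} => [|[|//]] [[|//] lt1] [[|//] lt2] [] //; apply: ord_inj.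
  apply/eqP; move/eqP: E; rewrite -subr_eq0 opprK -mulr2n -scaler_nat scaler_eq0.
  by rewrite (negPf two).
have [||q cq ET] := @col_transversal T.
- move=> i; rewrite -[RHS](card_image (@perm_inj _ t)).
  apply: eq_card => e; rewrite inE; apply/idP/imageP=> [lt|[c lt ->]].
    by exists ((t^-1)%g e); rewrite ?permKV // inE; move: lt; rewrite /T ffunE.
  by rewrite /T ffunE permK.
- by move=> c c' ec eT; apply: contrapT => ncc; apply: h; exists c, c'.
exists ((-1) ^+ q); rewrite ET kappaE polytabloidE scaler_sumr.
rewrite (reindex_inj (mulgI (q^-1)%g)) /=; apply: eq_big => [q'|q' _].
  by rewrite colgrpMl // colgrpV.
rewrite tact_dtens tabr_of invgK mulgA mulgV mul1g mulg1 odd_permM odd_permV.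
by rewrite signr_addb scalerA.
Qed.

Lemma kappa_specht f : f \in spechtv k nu -> exists c : k, kappa f = c *: polytabloid k 1%g.
Proof.
have h : (spechtv k nu <= kappa @^-1: <[polytabloid k 1%g]>)%VS.
  apply: specht_sub => t; rewrite -memv_preim polytabloidE linear_sum memv_suml // => q _.
  rewrite linearZ memvZ //=; have [c ->] := kappa_tabloid (q * t)%g.
  by rewrite memvZ ?memv_line.
by move/(subvP h); rewrite -memv_preim => /vlineP.
Qed.

Lemma kappa_stable (U : {vspace P}) f : (forall g h, h \in U -> tact g h \in U) ->
  f \in U -> kappa f \in U.
Proof. by move=> sU fU; rewrite kappaE memv_suml // => q _; rewrite memvZ ?sU. Qed.

(** If [kappa] does not vanish on [U], then [U] contains the generating polytabloid. If it does, the
    averaged projection onto [U] kills the polytabloids, since it commutes with [kappa], and then it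
    kills [U] itself, where it is the identity. *)
Lemma specht_irr (U : {vspace P}) : (U <= spechtv k nu)%VS ->
  (forall g f, f \in U -> tact g f \in U) -> U = 0%VS \/ U = spechtv k nu.
Proof.
move=> US sU; have [kU|nkU] := pselect (forall f, f \in U -> kappa f = 0); last first.
  have [f [fU kf]] : exists f, f \in U /\ kappa f <> 0.
    apply: contrapT => h; apply: nkU => f fU; apply: contrapT => kf.
    by apply: h; exists f.
  have [c Ec] := kappa_specht (subvP US _ fU).
  have c0 : c != 0 by apply/eqP=> c0; apply: kf; rewrite Ec c0 scale0r.
  have e1U : polytabloid k 1%g \in U.
    by rewrite -(scalerK c0 (polytabloid k 1%g)) -Ec memvZ // kappa_stable.
  right; apply/eqP; rewrite eqEsubv US; apply: specht_sub => t.
  have -> : polytabloid k t = tact (t^-1)%g (polytabloid k 1%g).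
    by rewrite tact_poly invgK mul1g.
  exact: sU.
(* Maschke's projection onto [U], available because N! is invertible. It takes the place of an
   invariant bilinear form. *)
left; pose pr : 'End(P) := (N`!%:R)^-1 *: \sum_(g : 'S_N) (tact g \o projv U \o tact (g^-1)%g)%VF.
have prE f : pr f = (N`!%:R)^-1 *: \sum_(g : 'S_N) tact g (projv U (tact (g^-1)%g f)).
  rewrite scale_lfunE sum_lfunE; congr (_ *: _); apply: eq_bigr => g _.
  by rewrite !comp_lfunE.
have prU f : pr f \in U.
  by rewrite prE memvZ // memv_suml // => g _; rewrite sU // memv_proj.
have pr_id f : f \in U -> pr f = f.
  move=> fU; rewrite prE (eq_bigr (fun=> f)) => [|g _]; last first.
    by rewrite projv_id ?sU // -tactM mulgV tact1.
  rewrite sumr_const card_Sn -scaler_nat scalerA mulVf ?scale1r //.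
  exact: fact_neq0.
have pr_act h f : pr (tact h f) = tact h (pr f).
  rewrite !prE [RHS]linearZ; congr (_ *: _); rewrite [RHS]linear_sum.
  rewrite (reindex_inj (mulgI h)) /=; apply: eq_bigr => g _.
  by rewrite [LHS]tactM invMg -[tact _ (tact h f)]tactM mulgKV.
have pr_kappa f : pr (kappa f) = kappa (pr f).
  by rewrite !kappaE linear_sum; apply: eq_bigr => q _; rewrite linearZ /= pr_act.
have pr0 : (spechtv k nu <= lker pr)%VS.
  apply: specht_sub => t; rewrite memv_ker.
  have -> : polytabloid k t = tact (t^-1)%g (polytabloid k 1%g).
    by rewrite tact_poly invgK mul1g.
  by rewrite pr_act -kappa1 pr_kappa kU // linear0.
apply/eqP; rewrite -subv0; apply/subvP=> f fU; rewrite memv0 -(pr_id f fU).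
by rewrite -memv_ker (subvP pr0) // (subvP US).
Qed.

(** A column permutation preserving all rows is the identity, so the standard tabloid occurs with
    coefficient 1. *)
Lemma poly_neq0 : polytabloid k 1%g != 0 :> P.
Proof.
apply/eqP=> /(congr1 (fun f : P => f (tabloid_of 1%g))).
rewrite polytabloidE sum_ffunE (bigD1 1%g) /=; last first.
  by apply/colgrpP=> c; rewrite perm1.
rewrite !ffunE mulg1 eqxx odd_perm1 expr0 scale1r big1 ?addr0 => [/eqP|q].
  by rewrite oner_eq0.
case/andP=> /colgrpP cq nq; rewrite !ffunE mulg1; case: eqP => [e|_]; last exact: mulr0.
case/eqP: nq; apply/permP=> c; rewrite perm1; apply: cell_inj => //.
have := congr1 (fun T : tabloid => T (q c)) e; rewrite !ffunE permK invg1 perm1.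
by [].
Qed.

Theorem specht_simple : simple (specht k nu).
Proof.
split.
  apply/eqP=> e; case/eqP: poly_neq0; have := memvf (vsproj (spechtv k nu) (polytabloid k 1%g)).
  rewrite e memv0 => /eqP/(congr1 vsval); rewrite vsprojK ?poly_in //.
move=> U /submodP sU; pose io := linfun (@vsval k _ (spechtv k nu)).
have ioE v : io v = vsval v by rewrite (lfunE (@vsval k _ (spechtv k nu))).
have mem v : (vsval v \in (io @: U)%VS) = (v \in U).
  apply/memv_imgP/idP=> [[u uU]|vU]; last by exists v; rewrite ?ioE.
  by rewrite ioE => /subvs_inj->.
have [||E|E] := @specht_irr (io @: U)%VS.
- by apply/subvP=> f /memv_imgP[v _ ->]; rewrite ioE subvsP.
- move=> g f /memv_imgP[v vU ->]; rewrite ioE -specht_actE mem; exact: sU.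
- left; apply/vspaceP=> v; rewrite -mem E !memv0.
  by apply/eqP/eqP=> [e|->//]; apply: subvs_inj.
- by right; apply/vspaceP=> v; rewrite -mem E memvf subvsP.
Qed.

End SpechtSimple.

(** * Inflations and induced modules by generators and relations *)

Section InflateGen.
Variables (k : fieldType) (Z : finZmodType) (delta : Z -> k) (b : nat) (G : finType).
Variables (ofG : G -> diag Z b b) (M : rep k G).

Section Gen.
Variables (n : nat) (E : finType) (ofE : E -> diag Z n b).

(** The vector d (x) m for an arbitrary diagram: e (x) g m when d factors as a dangle e and a group
    part g, and 0 when there is no such factorisation. It makes the action on generators plain
    composition. *)
Definition igen (d : diag Z n b) (m : M) : {ffun E -> M} :=
  \sum_(eg : E * G | comp (ofE eg.1) (ofG eg.2) == d) dtens eg.1 (act M eg.2 m).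

Definition factors (d : diag Z n b) := exists e g, comp (ofE e) (ofG g) = d.

Lemma igen_lin d : linear (igen d).
Proof.
move=> a u v; rewrite /igen scaler_sumr -big_split; apply: eq_bigr => eg _ /=.
by rewrite linearP dtens_lin.
Qed.

Lemma igenm0 d : igen d 0 = 0.
Proof. by apply: big1 => eg _; rewrite linear0 dtens0. Qed.

Lemma igen0 d m : ~ factors d -> igen d m = 0.
Proof.
move=> nf; apply: big1 => -[e g] /= /eqP h; case: nf.
by exists e, g.
Qed.

Definition fac_uniq := forall e e' g g',
  comp (ofE e) (ofG g) = comp (ofE e') (ofG g') -> e = e' /\ g = g'.

Hypothesis uniq : fac_uniq.

Lemma igen_fac e g m : igen (comp (ofE e) (ofG g)) m = dtens e (act M g m).
Proof.
rewrite /igen (big_pred1 (e, g)) // => -[e' g'] /=; apply/eqP/eqP=> [/uniq[-> ->] //|[-> ->]].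
by [].
Qed.

End Gen.

Variables (mulG : G -> G -> G) (oneG : G) (invG : G -> G).
Hypothesis ofGM : forall g h, comp (ofG g) (ofG h) = ofG (mulG g h).
Hypothesis ofG1 : ofG oneG = idd Z b.
Hypothesis mulV : forall g, mulG g (invG g) = oneG.
Hypothesis actM : forall g h m, act M (mulG g h) m = act M g (act M h m).
Hypothesis act1 : forall m, act M oneG m = m.
Hypothesis ofGw : forall g, exists w, ofG g = wdiag w.

Section OneE.
Variables (n : nat) (E : finType) (ofE : E -> diag Z n b).
Hypothesis uniq : fac_uniq ofE.

Lemma igen_e e m : igen ofE (ofE e) m = dtens e m.
Proof. by rewrite -{1}[ofE e]comp_idr -ofG1 igen_fac // act1. Qed.

Lemma factors_g d g : factors ofE (comp d (ofG g)) -> factors ofE d.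
Proof.
case=> e [h Eh]; exists e, (mulG h (invG g)).
by rewrite -ofGM -comp_assoc Eh comp_assoc ofGM mulV ofG1 comp_idr.
Qed.

Lemma igen_g d g m : igen ofE (comp d (ofG g)) m = igen ofE d (act M g m).
Proof.
have [[e [h <-]]|nf] := pselect (factors ofE d).
  by rewrite comp_assoc ofGM !igen_fac // actM.
by rewrite !igen0 // => /factors_g.
Qed.

Lemma igen_span (U : {vspace {ffun E -> M}}) :
  (forall e m, igen ofE (ofE e) m \in U) -> U = fullv.
Proof.
move=> h; apply/vspaceP=> F; rewrite memvf [F]dtens_sum memv_suml // => e _.
by rewrite -igen_e.
Qed.

Lemma igen_univ (X : vectType k) (beta : diag Z n b -> 'Hom(M, X)) :
  (forall d g m, factors ofE d -> beta (comp d (ofG g)) m = beta d (act M g m)) ->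
  exists f : 'Hom({ffun E -> M}, X),
    forall d m, factors ofE d -> f (igen ofE d m) = beta d m.
Proof.
move=> hb.
have l : linear (fun F : {ffun E -> M} => \sum_e beta (ofE e) (F e)).
  move=> a F F'; rewrite scaler_sumr -big_split; apply: eq_bigr => e _ /=.
  by rewrite !ffunE linearP.
exists (lin_of l) => _ m [e [g <-]]; rewrite igen_fac // lin_ofE (bigD1 e) //=.
rewrite dtensE eqxx big1 ?addr0 => [|e' ne]; last by rewrite dtensE (negPf ne) linear0.
rewrite hb //; exists e, oneG.
by rewrite ofG1 comp_idr.
Qed.

End OneE.

Section TwoE.
Variables (a n : nat) (Ea En : finType).
Variables (ofEa : Ea -> diag Z a b) (ofEn : En -> diag Z n b).
Hypotheses (uniqa : fac_uniq ofEa) (uniqn : fac_uniq ofEn).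
Hypothesis deltaN : forall i, delta (- i) = delta i.

Definition iact0 (x : diag Z a n) (F : {ffun En -> M}) : {ffun Ea -> M} :=
  \sum_(d : En)
      \sum_(eg : Ea * G | comp (ofEa eg.1) (ofG eg.2) == comp x (ofEn d))
        loops x (ofEn d) delta *: dtens eg.1 (act M eg.2 (F d)).

Lemma iact0E x F : iact0 x F =
  \sum_(d : En) loops x (ofEn d) delta *: igen ofEa (comp x (ofEn d)) (F d).
Proof. by apply: eq_bigr => d _; rewrite scaler_sumr. Qed.

Lemma iact_lin x : linear (iact0 x).
Proof.
move=> c F F'; rewrite !iact0E scaler_sumr -big_split; apply: eq_bigr => d _ /=.
by rewrite !ffunE igen_lin scalerDr !scalerA mulrC.
Qed.

Definition iact (x : diag Z a n) : 'Hom({ffun En -> M}, {ffun Ea -> M}) := linfun (iact0 x).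

Lemma iactE x F : iact x F =
  \sum_(d : En) loops x (ofEn d) delta *: igen ofEa (comp x (ofEn d)) (F d).
Proof. by rewrite /iact linfun_lin ?iact0E //; apply: iact_lin. Qed.

(** The group part passes through the stacking and closes no loop, being a wreath element, so the
    loop scalar depends on the dangle alone. *)
Lemma iact_gen x d m : factors ofEn d ->
  iact x (igen ofEn d m) = loops x d delta *: igen ofEa (comp x d) m.
Proof.
case=> e [g <-]; rewrite iactE igen_fac // (bigD1 e) //= dtensE eqxx.
rewrite big1 ?addr0 => [|e' ne]; last first.
  by rewrite dtensE (negPf ne) igenm0 scaler0.
rewrite -igen_g // -comp_assoc; congr (_ *: _); have [w Ew] := ofGw g.
have := loops_assoc x (ofEn e) (ofG g) deltaN; rewrite Ew !loops_wdiagr mulr1 mul1r.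
by [].
Qed.

End TwoE.
End InflateGen.

Section InduceGen.
Variables (k : fieldType) (H K : finType) (mulH : H -> H -> H) (io : K -> H) (W : rep k K).
Variable (oneH : H).
Hypothesis mulA : associative mulH.
Hypotheses (mul1 : forall h, mulH oneH h = h) (mulr1 : forall h, mulH h oneH = h).

Local Notation F := (free_rep mulH W).
Local Notation IR := (ind_rel mulH io W).
Local Notation I := (induce mulH io W).

Lemma free_actE h (f : F) : act F h f = \sum_(h' : H) dtens (mulH h h') ((f : {ffun H -> W}) h').
Proof.
rewrite /= linfun_lin // => a u v; rewrite scaler_sumr -big_split; apply: eq_bigr => h' _ /=.
by rewrite !ffunE dtens_lin.
Qed.

Lemma free_act_dtens h h' w : act F h (dtens h' w : F) = dtens (mulH h h') w.
Proof.
rewrite free_actE (bigD1 h') //= dtensE eqxx big1 ?addr0 // => h'' ne.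
by rewrite dtensE (negPf ne) dtens0.
Qed.

Lemma ind_rel_mem h g w :
  (dtens (mulH h (io g)) w - dtens h (act W g w) : F) \in IR.
Proof.
pose b := vbasis {:W}%VS.
have base i : (dtens (mulH h (io g)) b`_i - dtens h (act W g b`_i) : F) \in IR.
  have [lt|ge] := ltnP i (size b).
    apply: memv_span; apply/allpairsP; exists ((h, g), b`_i); split=> //=.
      by rewrite mem_enum.
    exact: mem_nth.
  by rewrite nth_default // linear0 !dtens0 subr0 mem0v.
have -> : (dtens (mulH h (io g)) w - dtens h (act W g w) : F) =
    \sum_i coord b i w *: (dtens (mulH h (io g)) b`_i - dtens h (act W g b`_i) : F).
  pose f : 'Hom(W, F) := lin_of (dtens_lin (mulH h (io g))).
  pose f' : 'Hom(W, F) := (lin_of (dtens_lin h) \o act W g)%VF.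
  have fE v : (f - f') v = (dtens (mulH h (io g)) v - dtens h (act W g v) : F).
    by rewrite add_lfunE opp_lfunE comp_lfunE !lin_ofE.
  rewrite -fE {1}(coord_vbasis (memvf w)) linear_sum; apply: eq_bigr => i _.
  by rewrite linearZ /= fE.
by rewrite memv_suml // => i _; rewrite memvZ.
Qed.

Lemma ind_rel_sub : submod (IR : {vspace F}).
Proof.
apply/submodP=> h v; have hsub : (IR <= act F h @^-1: IR)%VS.
  apply/span_subvP=> u /allpairsP[[[h' g] w] [_ _ ->]] /=; rewrite -memv_preim linearB.
  have e1 : act F h (dtens (mulH h' (io g)) w : F) = dtens (mulH (mulH h h') (io g)) w.
    by rewrite free_act_dtens mulA.
  have e2 : act F h (dtens h' (act W g w) : F) = dtens (mulH h h') (act W g w).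
    exact: free_act_dtens.
  by rewrite -[X in X \in _]/(act F h _ - act F h _) e1 e2 ind_rel_mem.
by move/(subvP hsub); rewrite -memv_preim.
Qed.

Definition ipi : 'Hom(F, I) := sqpi IR {:F}%VS.
Definition ivec (w : W) : I := ipi (dtens oneH w).

Lemma ivec_lin : linear ivec.
Proof. by move=> a u v; rewrite /ivec dtens_lin linearP. Qed.

Lemma ipi_act h f : ipi (act F h f) = act I h (ipi f).
Proof.
by rewrite /ipi (@sqpi_act _ _ F IR {:F}%VS) ?subvf ?ind_rel_sub ?submodf ?memvf.
Qed.

Lemma ind_act h w : act I h (ivec w) = ipi (dtens h w).
Proof. by rewrite /ivec -ipi_act free_act_dtens mulr1. Qed.

Lemma ind_rel_eq h g w : ipi (dtens (mulH h (io g)) w) = ipi (dtens h (act W g w)).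
Proof. by apply/eqP; rewrite sqpi_eq ?subvf ?memvf // ind_rel_mem. Qed.

Lemma ind_io g w : act I (io g) (ivec w) = ivec (act W g w).
Proof. by rewrite ind_act -[io g]mul1 ind_rel_eq. Qed.

Lemma ind_actM h h' v : act I (mulH h h') v = act I h (act I h' v).
Proof.
have [f ->] : exists f, v = ipi f by exists (sqval _ _ v); rewrite /ipi sqvalK.
rewrite -!ipi_act; congr (ipi _).
rewrite [f](@dtens_sum k H W) !linear_sum; apply: eq_bigr => h'' _.
by rewrite /= !free_act_dtens mulA.
Qed.

Lemma ind_act1 v : act I oneH v = v.
Proof.
have [f ->] : exists f, v = ipi f by exists (sqval _ _ v); rewrite /ipi sqvalK.
rewrite -ipi_act; congr (ipi _).
rewrite {2}[f](@dtens_sum k H W) [f in LHS](@dtens_sum k H W) linear_sum; apply: eq_bigr => h'' _.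
by rewrite /= free_act_dtens mul1.
Qed.

Lemma ind_span (U : {vspace I}) : (forall h w, act I h (ivec w) \in U) -> U = fullv.
Proof.
move=> h; apply/vspaceP=> v; rewrite memvf -(sqvalK v).
set f := sqval _ _ v; rewrite [f](@dtens_sum k H W) linear_sum memv_suml // => h' _.
by have := h h' (f h'); rewrite ind_act.
Qed.

Lemma ind_univ (X : vectType k) (beta : H -> 'Hom(W, X)) :
  (forall h g w, beta (mulH h (io g)) w = beta h (act W g w)) ->
  exists f : 'Hom(I, X), forall h w, f (act I h (ivec w)) = beta h w.
Proof.
move=> hb.
have l : linear (fun f : F => \sum_h beta h ((f : {ffun H -> W}) h)).
  move=> a u v; rewrite scaler_sumr -big_split; apply: eq_bigr => h _ /=.
  by rewrite !ffunE linearP.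
pose Phi := lin_of l.
have PhiE h w : Phi (dtens h w) = beta h w.
  rewrite lin_ofE (bigD1 h) //= dtensE eqxx big1 ?addr0 // => h' ne.
  by rewrite dtensE (negPf ne) linear0.
have kP : (IR <= lker Phi)%VS.
  apply/span_subvP=> u /allpairsP[[[h g] w] [_ _ ->]] /=; rewrite memv_ker linearB /=.
  by rewrite !PhiE hb subrr.
exists (Phi \o sqval IR {:F}%VS)%VF => h w; rewrite ind_act comp_lfunE.
rewrite -PhiE; apply/eqP; rewrite eq_sym -subr_eq0 -linearB -memv_ker.
by apply: (subvP kP); apply: sqpi_sub; rewrite ?subvf ?memvf.
Qed.

End InduceGen.

Lemma prod_Rank (R : comPzSemiRingType) m (a : 'I_m -> nat) (F : 'I_(\sum_r a r) -> R) :
  \prod_(r < m) \prod_(i < a r) F (tagnat.Rank r i) = \prod_j F j.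
Proof.
rewrite sig_big_dep /= [RHS](reindex tagnat.rank); last exact: onW_bij tagnat.rank_bij.
by apply: eq_big => -[r i].
Qed.

(** A southern arc of the lower diagram stays a southern arc of the composite. *)
Lemma full_comp (Z : finZmodType) a b c (x : diag Z a b) (d : diag Z b c) :
  full (comp x d) -> full d.
Proof.
move=> /fullP h; apply/fullP=> j; case E: (mate d (inr j)) => [i|j']; first by exists i.
have [i] := h j; have [-> _ //] : mate (comp x d) (inr j) = inr j' /\ lab (comp x d) (inr j) = lab d (inr j).
have /= := @walk_comp _ _ _ _ x d (inr j) (inr j') (slab x d (inr (inr j))).
by apply; apply: WalkEnd; rewrite /= E.
Qed.

(** * Generators of the cyclotomic cell modules *)

Section CellGen.
Variables (k : fieldType) (m' : nat) (xi : k) (delta : 'I_m'.+1 -> k).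
Notation m := m'.+1.
Hypothesis deltaN : forall i, delta (- i) = delta i.

Section OneLam.
Variable lam : 'I_m -> seq nat.
Notation b := (msize lam).

Definition ysz (r : 'I_m) := sumn (lam r).
Definition Yrep (r : 'I_m) : rep k (young ysz) :=
  pull (@young_block m' ysz r) (twist m' xi r (specht k (lam r))).
Definition Tl : rep k (young ysz) := \big[@tens_rep k _/triv_rep k _]_(r < m) Yrep r.
Definition yin (y : young ysz) : wreath 'I_m b := @young_in m' ysz y.

Definition mvec (t : Tl) : mspecht xi lam := ivec (@wmul 'I_m b) yin (wone _ b) t.

Lemma mact1 v : act (mspecht xi lam) (wone _ b) v = v.
Proof. exact: (ind_act1 (@wmulA 'I_m b) (@w1mul _ b) (io := yin) (W := Tl)). Qed.

Lemma mactM g h v : act (mspecht xi lam) (wmul g h) v =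
  act (mspecht xi lam) g (act (mspecht xi lam) h v).
Proof. exact: (ind_actM (@wmulA 'I_m b) (io := yin) (W := Tl)). Qed.

Lemma mvec_lin : linear mvec.
Proof. exact: ivec_lin. Qed.

Lemma mspecht_span (U : {vspace mspecht xi lam}) :
  (forall g t, act (mspecht xi lam) g (mvec t) \in U) -> U = fullv.
Proof. exact: (ind_span (oneH := wone _ b) (@wmulA 'I_m b) (@wmul1 _ b)). Qed.

Lemma mspecht_univ (X : vectType k) (beta : wreath 'I_m b -> 'Hom(Tl, X)) :
  (forall g y t, beta (wmul g (yin y)) t = beta g (act Tl y t)) ->
  exists f : 'Hom(mspecht xi lam, X),
    forall g t, f (act (mspecht xi lam) g (mvec t)) = beta g t.
Proof. exact: (ind_univ (oneH := wone _ b) (@wmulA 'I_m b) (@wmul1 _ b)). Qed.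

Lemma mact_yin y t : act (mspecht xi lam) (yin y) (mvec t) = mvec (act Tl y t).
Proof. by apply: ind_io; [exact: wmulA|exact: w1mul|exact: wmul1]. Qed.

Lemma mspecht_ext (X : vectType k) (f g : 'Hom(mspecht xi lam, X)) :
  (forall h t, f (act (mspecht xi lam) h (mvec t)) = g (act (mspecht xi lam) h (mvec t))) ->
  f = g.
Proof.
move=> h; apply/lfunP=> v; apply/eqP; rewrite -subr_eq0.
have <- : (f - g) v = f v - g v by rewrite add_lfunE opp_lfunE.
rewrite -memv_ker (@mspecht_span (lker (f - g))) ?memvf // => u t.
by rewrite memv_ker add_lfunE opp_lfunE h subrr.
Qed.

Definition cdangle n : finType := {d : diag 'I_m n b | is_dangle d}.

Lemma cdangle_uniq n : fac_uniq (@wdiag 'I_m b) (fun d : cdangle n => val d).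
Proof. by move=> e e' g g' /(dangle_uniq (valP e) (valP e'))[/val_inj-> ->]. Qed.

Lemma cfactors n (d : diag 'I_m n b) :
  factors (@wdiag 'I_m b) (fun d : cdangle n => val d) d <-> full d.
Proof.
split=> [[e [g <-]]|/dangle_factor[e [g [de <-]]]].
  by rewrite full_comp_wdiagr full_dangle // (valP e).
by exists (Sub e de), g.
Qed.

Definition cgen n (d : diag 'I_m n b) (t : Tl) : cell xi delta n lam :=
  igen (M := mspecht xi lam) (@wdiag 'I_m b) (fun d : cdangle n => val d) d (mvec t).

(** The square case is the module action. The rectangular cases connect cell modules with the same
    label but different numbers of nodes. *)
Definition cact a n (x : diag 'I_m a n) : 'Hom(cell xi delta n lam, cell xi delta a lam) :=
  iact delta (@wdiag 'I_m b) (mspecht xi lam)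
    (fun d : cdangle a => val d) (fun d : cdangle n => val d) x.

Lemma cgen_lin n (d : diag 'I_m n b) : linear (cgen d).
Proof. by move=> a t t'; rewrite /cgen mvec_lin igen_lin. Qed.

Definition clin n (d : diag 'I_m n b) : 'Hom(Tl, cell xi delta n lam) := lin_of (cgen_lin d).
Lemma clinE n (d : diag 'I_m n b) t : clin d t = cgen d t. Proof. exact: lin_ofE. Qed.

Let igen_gM n := @igen_g k 'I_m b _ (@wdiag 'I_m b) (mspecht xi lam) (@wmul _ b)
  (wone _ b) (@winv _ b) (@comp_wdiag _ b) erefl (@wmulVr _ b) mactM
  n _ _ (@cdangle_uniq n).

Lemma cgen_g n (d : diag 'I_m n b) y t :
  cgen (comp d (wdiag (yin y))) t = cgen d (act Tl y t).
Proof. by rewrite /cgen igen_gM mact_yin. Qed.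

Lemma cgen_nf n (d : diag 'I_m n b) t : ~~ full d -> cgen d t = 0.
Proof. by move=> nf; apply: igen0; rewrite cfactors; apply/negP. Qed.

Lemma cact_gen a n (x : diag 'I_m a n) d t :
  cact x (cgen d t) = loops x d delta *: cgen (comp x d) t.
Proof.
have [fd|nf] := boolP (full d); last first.
  rewrite !cgen_nf ?linear0 ?scaler0 //; apply: contra nf; exact: full_comp.
rewrite /cact /cgen (iact_gen (mulG := @wmul 'I_m b) (oneG := wone _ b) (invG := @winv _ b)) //.
- exact: comp_wdiag.
- exact: wmulVr.
- exact: mactM.
- by move=> g; exists g.
- exact: cdangle_uniq.
- exact: cdangle_uniq.
- exact/cfactors.
Qed.

Lemma cell_span n (U : {vspace cell xi delta n lam}) :
  (forall d t, full d -> cgen d t \in U) -> U = fullv.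
Proof.
move=> h; apply: (igen_span (ofG := @wdiag 'I_m b) (oneG := wone _ b) erefl mact1
  (@cdangle_uniq n)).
move=> e v; have de := full_dangle (valP e).
pose f := lin_of (igen_lin (M := mspecht xi lam) (@wdiag 'I_m b) (fun d : cdangle n => val d) (val e)).
suff EU : (f @^-1: U)%VS = fullv.
  by have := memvf v; rewrite -EU -memv_preim lin_ofE.
apply: mspecht_span => g t.
rewrite -memv_preim lin_ofE -igen_gM.
by apply: h; rewrite full_comp_wdiagr.
Qed.

Lemma cell_ext n (X : vectType k) (f g : 'Hom(cell xi delta n lam, X)) :
  (forall d t, full d -> f (cgen d t) = g (cgen d t)) -> f = g.
Proof.
move=> h; apply/lfunP=> v; apply/eqP; rewrite -subr_eq0.
have <- : (f - g) v = f v - g v by rewrite add_lfunE opp_lfunE.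
rewrite -memv_ker (@cell_span _ (lker (f - g))) ?memvf // => d t fd.
by rewrite memv_ker add_lfunE opp_lfunE h ?subrr.
Qed.

(** Universal properties of induction and of inflation combined: for a fixed diagram, the induced
    module receives the wreath elements written behind it, and the resulting maps are compatible
    with the factorisation into dangles. *)
Lemma cell_univ n (X : vectType k) (beta : diag 'I_m n b -> 'Hom(Tl, X)) :
  (forall d y t, full d -> beta (comp d (wdiag (yin y))) t = beta d (act Tl y t)) ->
  exists f : 'Hom(cell xi delta n lam, X), forall d t, full d -> f (cgen d t) = beta d t.
Proof.
move=> hb.
have /fin_all_exists[F FP] (d : diag 'I_m n b) : exists f : 'Hom(mspecht xi lam, X),
    full d -> forall g t, f (act (mspecht xi lam) g (mvec t)) = beta (comp d (wdiag g)) t.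
  have [fd|nf] := boolP (full d); last by exists 0.
  have [|f fP] := @mspecht_univ X (fun g => beta (comp d (wdiag g))); last by exists f.
  by move=> g y t; rewrite -comp_wdiag -comp_assoc hb // full_comp_wdiagr.
have [|f fP] := igen_univ (ofG := @wdiag 'I_m b) (oneG := wone _ b) (M := mspecht xi lam)
   (ofE := fun d : cdangle n => val d) erefl (@cdangle_uniq n) (X := X) (beta := F).
  move=> d g v /cfactors fd.
  suff -> : F (comp d (wdiag g)) = (F d \o act (mspecht xi lam) g)%VF.
    by rewrite [LHS]comp_lfunE.
  apply: mspecht_ext => h t.
  transitivity (F d (act (mspecht xi lam) (wmul g h) (mvec t))); last first.
    rewrite [RHS]comp_lfunE; exact: (congr1 (fun w => F d w) (mactM g h (mvec t))).
  have fdg : full (comp d (wdiag g)) by rewrite full_comp_wdiagr.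
  rewrite (FP _ fdg) (FP _ fd) comp_assoc; congr (beta _ t).
  by rewrite comp_wdiag.
exists f => d t fd; rewrite /cgen fP; last exact/cfactors.
by have := FP d fd (wone _ b) t; rewrite mact1 -/(idd _ _) comp_idr.
Qed.

Opaque cact cgen cell.

Lemma cactM a n c (x : diag 'I_m a n) (y : diag 'I_m n c) v :
  cact x (cact y v) = loops x y delta *: cact (comp x y) v.
Proof.
suff : (cact x \o cact y)%VF = loops x y delta *: cact (comp x y).
  by move=> /lfunP/(_ v); rewrite scale_lfunE => <-; rewrite comp_lfunE.
apply: cell_ext => d t fd; rewrite scale_lfunE comp_lfunE !cact_gen linearZ /= cact_gen.
by rewrite !scalerA comp_assoc -loops_assoc // mulrC.
Qed.

Lemma cact_id n v : cact (idd _ n) v = v.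
Proof.
suff -> : cact (idd _ n) = \1%VF by rewrite id_lfunE.
apply: cell_ext => d t fd.
by rewrite cact_gen id_lfunE /idd loops_wdiagl scale1r -/(idd _ n) comp_idl.
Qed.

Lemma tens_scale (U V : vectType k) (f : 'End(U)) (g : 'End(V)) (c c' : k) :
  tens_map (c *: f) (c' *: g) = (c * c') *: tens_map f g.
Proof.
apply/lfunP=> t; apply: tens_eq => phi; rewrite -[tens_map _ _]/(tmap _ _).
rewrite [in RHS]scale_lfunE [RHS]scale_lfunE !tmapE -comp_lfunZr linearZ.
by rewrite scale_lfunE linearZ scalerA mulrC.
Qed.

Lemma bigtens_scale (D : finType) (I : Type) (s : seq I) (V : I -> rep k D) (c : I -> k) x y :
  (forall i, act (V i) x = c i *: act (V i) y) ->
  act (\big[@tens_rep k D/triv_rep k D]_(i <- s) V i) x =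
  (\prod_(i <- s) c i) *: act (\big[@tens_rep k D/triv_rep k D]_(i <- s) V i) y.
Proof.
move=> h; elim: s => [|i s IHs]; first by rewrite !big_nil scale1r.
rewrite [\prod_(j <- _) _]big_cons.
rewrite (big_cons (triv_rep k D) (@tens_rep k D)).
transitivity (tens_map (act (V i) x) (act (\big[@tens_rep k D/triv_rep k D]_(i <- s) V i) x)).
  by [].
by rewrite h IHs tens_scale.
Qed.

Definition ycol (j : 'I_b) : 'I_m := tagnat.sig1 (p_ := ysz) j.

(** The label group acts on [Tl] by scalars: a label on a strand in block r contributes xi^r for
    each unit. *)
Lemma Tl_label (l : {ffun 'I_b -> 'I_m}) s :
  act Tl ((l, s) : young ysz) =
  (\prod_(j < b) xi ^+ (ycol j * l j)) *: act Tl (([ffun=> 0], s) : young ysz).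
Proof.
rewrite /Tl (bigtens_scale _ (c := fun r : 'I_m => xi ^+ (r * \sum_(i < ysz r) l (tagnat.Rank r i))) (y := ([ffun=> 0], s))); last first.
  move=> r; transitivity (xi ^+ (r * \sum_(i < ysz r) l (tagnat.Rank r i)) *:
      act (specht k (lam r)) (s r)).
    by congr (_ ^+ (_ * _) *: _); apply: eq_bigr => i _; rewrite ffunE.
  congr (_ *: _); rewrite /= (eq_bigr (fun=> 0%N)) ?big1 ?muln0 ?expr0 ?scale1r //.
  by move=> i _; rewrite !ffunE.
congr (_ *: _); rewrite -(prod_Rank (fun j : 'I_(\sum_r ysz r) => xi ^+ (ycol j * l j))).
apply: eq_bigr => r _; rewrite big_distrr /= -prodrXr.
by apply: eq_bigr => i _; rewrite /ycol tagnat.Rank1K.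
Qed.

End OneLam.
End CellGen.

(** * Characters of the label group *)

Section Zeta.
Variables (k : fieldType) (m' : nat) (xi : k).
Notation m := m'.+1.
Hypothesis xi_prim : m.-primitive_root xi.

(** The perfect pairing of Z/m with itself: the colour [c] stands for the character sending l to
    xi^(c l). *)
Definition zeta (c l : 'I_m) : k := xi ^+ (c * l).

Lemma zetaC c l : zeta c l = zeta l c. Proof. by rewrite /zeta mulnC. Qed.

Lemma zetaDr c l l' : zeta c (l + l') = zeta c l * zeta c l'.
Proof.
rewrite /zeta -exprD -mulnDr !(mulnC c) !exprM; apply/eqP.
rewrite -!exprM !(mulnC _ c) !exprM -!(exprM xi).
rewrite (eq_prim_root_expr xi_prim); apply/eqP.
by rewrite /= -modnMmr modn_mod modnMmr.
Qed.

Lemma zetaDl c c' l : zeta (c + c') l = zeta c l * zeta c' l.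
Proof. by rewrite !(zetaC _ l) zetaDr. Qed.

Lemma zeta0r c : zeta c 0 = 1. Proof. by rewrite /zeta muln0. Qed.
Lemma zeta0l l : zeta 0 l = 1. Proof. by rewrite /zeta mul0n. Qed.

Lemma zetaVr c l : zeta c (- l) * zeta c l = 1.
Proof. by rewrite -zetaDr addNr zeta0r. Qed.

Lemma zeta_neq0 c l : zeta c l != 0.
Proof. by apply/eqP=> e; have := zetaVr c l; rewrite e mulr0 => /eqP; rewrite eq_sym oner_eq0. Qed.

Lemma zetaNr c l : zeta c (- l) = (zeta c l)^-1.
Proof. by rewrite -[LHS](mulfK (zeta_neq0 c l)) zetaVr mul1r. Qed.

Lemma zetaNN c l : zeta (- c) (- l) = zeta c l.
Proof. by rewrite zetaNr zetaC zetaNr zetaC invrK. Qed.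

Lemma zetaNlr c l : zeta (- c) l = zeta c (- l).
Proof. by rewrite -[l in LHS]opprK zetaNN. Qed.

Lemma zeta_inj c c' : (forall l, zeta c l = zeta c' l) -> c = c'.
Proof.
move=> h; have := h (inord 1); rewrite /zeta.
(* For m = 1 the test element [inord 1] is 0, but then there is only one colour. *)
have [m0|m0] := posnP m'.
  have v0 (u : 'I_m) : val u = 0%N.
    by have := ltn_ord u; rewrite /=; move: (nat_of_ord u) => i; rewrite m0; case: i.
  by move=> _; apply: val_inj; rewrite !v0.
rewrite inordK // !muln1 => /eqP; rewrite (eq_prim_root_expr xi_prim) !modn_small //.
by move/eqP/ord_inj.
Qed.

Section Chi.
Variables (n : nat) (c : 'I_n -> 'I_m).

Definition chi (l : {ffun 'I_n -> 'I_m}) : k := \prod_j zeta (c j) (l j).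

Lemma chiD l l' : chi (l + l') = chi l * chi l'.
Proof. by rewrite /chi -big_split; apply: eq_bigr => j _; rewrite ffunE zetaDr. Qed.

Lemma chi0 : chi 0 = 1.
Proof. by apply: big1 => j _; rewrite ffunE zeta0r. Qed.

Lemma chiN l : chi (- l) * chi l = 1. Proof. by rewrite -chiD addNr chi0. Qed.

Lemma chi_neq0 l : chi l != 0.
Proof. by apply/eqP=> e; have := chiN l; rewrite e mulr0 => /eqP; rewrite eq_sym oner_eq0. Qed.

Definition sng (i : 'I_n) (a : 'I_m) : {ffun 'I_n -> 'I_m} := [ffun j => if j == i then a else 0].

Lemma sngN i a : sng i (- a) = - sng i a.
Proof. by apply/ffunP=> j; rewrite !ffunE; case: eqP => // _; rewrite oppr0. Qed.

Lemma sng_sum (l : {ffun 'I_n -> 'I_m}) : l = \sum_i sng i (l i).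
Proof.
apply/ffunP=> j; rewrite sum_ffunE (bigD1 j) //= ffunE eqxx big1 ?addr0 // => i ij.
by rewrite ffunE eq_sym (negPf ij).
Qed.

End Chi.
End Zeta.

(** * The label torus and diagrams compatible with colours *)

Section Torus.
Variables (m' : nat).
Notation m := m'.+1.

Definition tl n (l : {ffun 'I_n -> 'I_m}) : diag 'I_m n n := wdiag (l, 1%g).

Definition tnorth n b (l : {ffun 'I_n -> 'I_m}) (v : 'I_n + 'I_b) : 'I_m :=
  if v is inl i then l i else 0.
Definition tsouth n b (l : {ffun 'I_b -> 'I_m}) (v : 'I_n + 'I_b) : 'I_m :=
  if v is inr j then l j else 0.

Lemma mate_tl n b (d : diag 'I_m n b) l v : mate (comp (tl l) d) v = mate d v.
Proof.
have E u : wpl ((l, 1%g) : wreath 'I_m n) u = u :> 'I_n + 'I_b.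
  by case: u => i //=; rewrite invg1 perm1.
by have [] := comp_wdiagl d (l, 1%g) v; rewrite !E.
Qed.

Lemma lab_tl n b (d : diag 'I_m n b) l v :
  lab (comp (tl l) d) v = lab d v + tnorth l v - tnorth l (mate d v).
Proof.
have E u : wpl ((l, 1%g) : wreath 'I_m n) u = u :> 'I_n + 'I_b.
  by case: u => i //=; rewrite invg1 perm1.
have E' u : wsl ((l, 1%g) : wreath 'I_m n) u = tnorth l u :> 'I_m.
  by move: u => [i|j] //=; rewrite invg1 perm1.
by have [_] := comp_wdiagl d (l, 1%g) v; rewrite !E !E'.
Qed.

Lemma mate_tr n b (d : diag 'I_m n b) l v : mate (comp d (tl l)) v = mate d v.
Proof.
have E u : wpr ((l, 1%g) : wreath 'I_m b) u = u :> 'I_n + 'I_b.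
  by case: u => i //=; rewrite perm1.
by have [] := comp_wdiagr d (l, 1%g) v; rewrite !E.
Qed.

Lemma lab_tr n b (d : diag 'I_m n b) l v :
  lab (comp d (tl l)) v = lab d v + tsouth l (mate d v) - tsouth l v.
Proof.
have E u : wpr ((l, 1%g) : wreath 'I_m b) u = u :> 'I_n + 'I_b.
  by case: u => i //=; rewrite perm1.
have [_] := comp_wdiagr d (l, 1%g) v; rewrite !E => ->.
by [].
Qed.

Lemma tlD n (l l' : {ffun 'I_n -> 'I_m}) : comp (tl l) (tl l') = tl (l + l').
Proof.
rewrite /tl comp_wdiag /wmul mulg1; congr (wdiag (_, _)).
by apply/ffunP=> i; rewrite !ffunE /= perm1.
Qed.

Lemma tl0 n : tl (0 : {ffun 'I_n -> 'I_m}) = idd _ n.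
Proof. by congr (wdiag (_, _)); apply/ffunP=> i; rewrite !ffunE. Qed.

(** Southern nodes get the opposite colour. A single condition, opposite values at the two ends,
    then says that through strands join equal colours and that arcs join opposite ones. *)
Definition colour n b (c : 'I_n -> 'I_m) (c' : 'I_b -> 'I_m) (v : 'I_n + 'I_b) : 'I_m :=
  match v with inl i => c i | inr j => - c' j end.

Definition compat (Z : finZmodType) n b c c' (d : diag Z n b) :=
  [forall v, colour c c' (mate d v) == - colour c c' v].

Lemma compatP (Z : finZmodType) n b (c : 'I_n -> 'I_m) (c' : 'I_b -> 'I_m) (d : diag Z n b) :
  reflect (forall v, colour c c' (mate d v) = - colour c c' v) (compat c c' d).
Proof. exact: 'forall_eqP. Qed.

Definition unl n b (d : diag 'I_m n b) := [forall v, lab d v == 0].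

Lemma unlP n b (d : diag 'I_m n b) : reflect (forall v, lab d v = 0) (unl d).
Proof. exact: 'forall_eqP. Qed.

Lemma compat_mate (Z Z' : finZmodType) n b c c' (d : diag Z n b) (d' : diag Z' n b) :
  mate d =1 mate d' -> compat c c' d = compat c c' d'.
Proof. by move=> e; apply: eq_forallb => v; rewrite e. Qed.

Lemma unl_comp a b e (x : diag 'I_m a b) (y : diag 'I_m b e) : unl x -> unl y -> unl (comp x y).
Proof.
move=> /unlP ux /unlP uy; apply/unlP=> v.
have [_ /(_ v)[i [_ _ ->]]] := comp_induced x y; apply: big1 => j _.
by case: (iter _ _ _) => u /=.
Qed.

Section Comp.
Variable Z : finZmodType.
Variables (a b e : nat) (ca : 'I_a -> 'I_m) (cb : 'I_b -> 'I_m) (ce : 'I_e -> 'I_m).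
Variables (x : diag Z a b) (y : diag Z b e).

Definition scol (s : ('I_a + 'I_b) + ('I_b + 'I_e)) : 'I_m :=
  match s with inl u => colour ca cb u | inr u => colour cb ce u end.

Hypotheses (cx : compat ca cb x) (cy : compat cb ce y).

Lemma scol_across s : scol (across x y s) = - scol s.
Proof. by case: s => u /=; [apply: (compatP _ _ _ cx)|apply: (compatP _ _ _ cy)]. Qed.

Lemma scol_glue s : outer s = None -> scol (glue s) = - scol s.
Proof. by case: s => -[] j //= _; rewrite opprK. Qed.

Lemma scol_next s : outer (across x y s) = None -> scol (cnext x y s) = scol s.
Proof. by move=> h; rewrite /cnext scol_glue // scol_across opprK. Qed.

(** Crossing a strand and gluing each change the sign of the colour, so it is constant at the states
    of the walk and changes sign only in the last crossing. *)
Lemma compat_comp : compat ca ce (comp x y).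
Proof.
apply/compatP=> v; have [_ /(_ v)[i [Ei Ni _]]] := comp_induced x y.
have ko u : scol (inner b u) = colour ca ce u by case: u.
have Sj j : (j <= i)%N -> scol (iter j (cnext x y) (inner b v)) = scol (inner b v).
  elim: j => // j IHj lej; rewrite iterS scol_next ?IHj 1?ltnW //.
  case E: outer => [w|//]; case: (Ni j.+1 w); first by rewrite /= lej.
  by rewrite iterS /cnext (outerK E); case: (w).
rewrite -ko -ko -(Sj i) // -scol_across; congr scol.
by rewrite -glue_across -iterS Ei; case: (mate _ _).
Qed.

End Comp.
End Torus.

(** * Removal of labels by gauge transformations *)

Section Gauge.
Variables (k : fieldType) (m' : nat) (xi : k).
Notation m := m'.+1.
Hypothesis xi_prim : m.-primitive_root xi.

Section Relab.
Variables (Z Z' : finZmodType) (a b : nat) (d : diag Z a b).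

Lemma relab_is_diag : @is_diag Z' a b [ffun v => (mate d v, 0)].
Proof.
by apply/forallP=> v; rewrite !ffunE /= mate_neq mateK oppr0 !eqxx.
Qed.
Definition relab : diag Z' a b := Sub _ relab_is_diag.
Lemma mate_relab v : mate relab v = mate d v. Proof. by rewrite /mate /= ffunE. Qed.
Lemma lab_relab v : lab relab v = 0. Proof. by rewrite /lab /= ffunE. Qed.

Definition lead (v : 'I_a + 'I_b) := (enum_rank v < enum_rank (mate d v))%N.

Lemma lead_mate v : lead (mate d v) = ~~ lead v.
Proof.
rewrite /lead mateK; case: ltngtP => // /ord_inj/enum_rank_inj e.
by have := mate_neq d v; rewrite e eqxx.
Qed.

Lemma prod_mate (K : comPzRingType) (F : 'I_a + 'I_b -> K) :
  (forall v, F v * F (mate d v) = 1) -> \prod_v F v = 1.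
Proof.
move=> F1; rewrite (bigID lead) /= [X in _ * X](reindex_inj (can_inj (mateK d))) /=.
rewrite [X in _ * X](eq_bigl lead); last by move=> v; rewrite lead_mate negbK.
by rewrite -big_split big1 // => v _; exact: F1.
Qed.

(** A potential whose coboundary is the labelling. Of the two ends of a strand, the one earlier in
    the enumeration carries the label. *)
Definition pot v := if lead v then lab d v else 0.

Lemma potE v : lab d v = pot v - pot (mate d v).
Proof.
rewrite /pot lead_mate; case: (lead v) => /=; first by rewrite subr0.
by rewrite lab_mate sub0r opprK.
Qed.

End Relab.

Section Fac.
Variables (a b : nat) (ca : 'I_a -> 'I_m) (cb : 'I_b -> 'I_m).
Implicit Types (d : diag 'I_m a b) (g : 'I_a + 'I_b -> 'I_m).

(** The scalar produced by the label vectors [gN g] and [gS g] on vectors of weights [ca] and [cb].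
    The sign in [gS] and the sign in the southern colours cancel. *)
Definition gfac g := \prod_v zeta xi (colour ca cb v) (g v).
Definition gN g : {ffun 'I_a -> 'I_m} := [ffun i => g (inl i)].
Definition gS g : {ffun 'I_b -> 'I_m} := [ffun j => - g (inr j)].

Lemma gfacE g : gfac g = chi xi ca (gN g) * chi xi cb (gS g).
Proof.
rewrite /gfac big_sumType /=; congr (_ * _); apply: eq_bigr => i _; rewrite ffunE //.
by rewrite zetaNlr.
Qed.

Lemma gfacD g g' : gfac (fun v => g v + g' v) = gfac g * gfac g'.
Proof. by rewrite /gfac -big_split; apply: eq_bigr => v _; rewrite zetaDr. Qed.

Lemma gauge d g v : lab (comp (tl (gN g)) (comp d (tl (gS g)))) v
  = lab d v + g v - g (mate d v).
Proof.
have E u : tnorth (gN g) u - tsouth (gS g) u = g u.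
  by case: u => i /=; rewrite ffunE ?subr0 ?sub0r ?opprK.
rewrite lab_tl mate_tr lab_tr -[g v]E -[g (mate d v)]E.
by rewrite opprB !addrA [LHS](ACl (1*4*3*2*5)).
Qed.

Lemma gauge_mate d l l' v : mate (comp (tl l) (comp d (tl l'))) v = mate d v.
Proof. by rewrite mate_tl mate_tr. Qed.

Lemma gauge_sym d g : (forall v, g (mate d v) = g v) ->
  comp (tl (gN g)) (comp d (tl (gS g))) = d.
Proof.
move=> h; apply: diag_eq => v; first by rewrite gauge_mate.
by rewrite gauge h addrK.
Qed.

(** On a compatible diagram the two ends of each strand have opposite colours, so their
    contributions cancel. *)
Lemma gfac_sym d g : compat ca cb d -> (forall v, g (mate d v) = g v) -> gfac g = 1.
Proof.
move=> /compatP cd h; apply: (prod_mate (d := d)) => v; rewrite h cd.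
by rewrite -zetaDl // addrN zeta0l.
Qed.

Definition pairf d (v : 'I_a + 'I_b) (z : 'I_m) u :=
  if (u == v) || (u == mate d v) then z else 0.

Lemma pairf_mate d v z u : pairf d v z (mate d u) = pairf d v z u.
Proof.
by rewrite /pairf orbC (inj_eq (can_inj (mateK d))) (can2_eq (mateK d) (mateK d)).
Qed.

Lemma gfac_pairf d v z :
  gfac (pairf d v z) = zeta xi (colour ca cb (mate d v) + colour ca cb v) z.
Proof.
rewrite /gfac (bigD1 v) //= (bigD1 (mate d v)) ?mate_neq //= big1 ?mulr1 => [|u /andP[n1 n2]].
  by rewrite /pairf !eqxx orbT zetaDl // mulrC.
by rewrite /pairf (negPf n1) (negPf n2) zeta0r.
Qed.

(** A strand whose ends do not have opposite colours, given the same value at both ends, yields a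
    non-trivial scalar by non-degeneracy of the pairing. The diagram itself is unchanged by this
    gauge, so it must act as 0 on weight vectors. *)
Lemma not_compat d : ~~ compat ca cb d -> exists2 g,
  forall v, g (mate d v) = g v & gfac g != 1.
Proof.
rewrite negb_forall => /existsP[v nv].
have [z nz] : exists z, zeta xi (colour ca cb (mate d v) + colour ca cb v) z != 1.
  apply/existsP; apply: contraR nv => /existsPn h; rewrite -addr_eq0; apply/eqP.
  apply: (zeta_inj xi_prim) => l; rewrite zeta0l.
  by have := h l; rewrite negbK => /eqP.
by exists (pairf d v z); [apply: pairf_mate|rewrite gfac_pairf].
Qed.

Lemma gauge_pot d : comp (tl (gN (pot d))) (comp (relab 'I_m d) (tl (gS (pot d)))) = d.
Proof.
apply: diag_eq => v; first by rewrite gauge_mate mate_relab.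
by rewrite gauge lab_relab mate_relab add0r -potE.
Qed.

Definition wt d := gfac (pot d).

(** Two potentials of one labelling differ by a function constant on strands, on which [gfac] is 1.
    So [wt] does not depend on the potential chosen. *)
Lemma wtE d g : compat ca cb d -> (forall v, lab d v = g v - g (mate d v)) -> wt d = gfac g.
Proof.
move=> cd h; have -> : gfac g = gfac (fun v => pot d v + (g v - pot d v)).
  by apply: eq_bigr => v _; rewrite addrCA subrr addr0.
rewrite gfacD [X in _ * X](gfac_sym cd) ?mulr1 // => v.
have := potE d v; rewrite h => /eqP; rewrite subr_eq => /eqP->.
by rewrite [RHS](ACl ((3*2)*(1*4))) /= subrr addr0.
Qed.

Lemma wt_gauge d g : compat ca cb d ->
  wt (comp (tl (gN g)) (comp d (tl (gS g)))) = gfac g * wt d.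
Proof.
move=> cd; rewrite mulrC -gfacD; apply: wtE.
  by rewrite (compat_mate ca cb (gauge_mate d _ _)).
by move=> v; rewrite gauge gauge_mate [lab d v]potE opprD [RHS]addrACA addrA.
Qed.

Lemma wt_unl d : unl d -> wt d = 1.
Proof.
move=> /unlP u; apply: big1 => v _; rewrite /pot u; case: (lead d v); exact: zeta0r.
Qed.

End Fac.

Lemma wt_tl a b ca cb (d : diag 'I_m a b) l : compat ca cb d ->
  wt ca cb (comp (tl l) d) = chi xi ca l * wt ca cb d.
Proof.
move=> cd; pose g (v : 'I_a + 'I_b) := if v is inl i then l i else 0.
have eN : gN g = l by apply/ffunP=> i; rewrite ffunE.
have eS : gS g = 0 by apply/ffunP=> i; rewrite !ffunE oppr0.
have := wt_gauge g cd; rewrite gfacE eN eS tl0 comp_idr => ->.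
by rewrite chi0 mulr1.
Qed.

Lemma wt_tr a b ca cb (d : diag 'I_m a b) l : compat ca cb d ->
  wt ca cb (comp d (tl l)) = chi xi cb l * wt ca cb d.
Proof.
move=> cd; pose g (v : 'I_a + 'I_b) := if v is inr i then - l i else 0.
have eN : gN g = 0 by apply/ffunP=> i; rewrite !ffunE.
have eS : gS g = l by apply/ffunP=> i; rewrite !ffunE opprK.
have := wt_gauge g cd; rewrite gfacE eN eS tl0 comp_idl => ->.
by rewrite chi0 mul1r.
Qed.

End Gauge.

(** * Cell modules through their universal property *)

Section Abstract.
Variables (k : fieldType) (m' : nat) (xi : k) (delta : 'I_m'.+1 -> k).
Notation m := m'.+1.

Section Sizes.
Variable sz : 'I_m -> nat.
Notation b := (\sum_(r < m) sz r)%N.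

Definition bcol (j : 'I_b) : 'I_m := tagnat.sig1 (p_ := sz) j.
Definition bperm (s : {dffun forall r : 'I_m, 'S_(sz r)}) : 'S_b := perm (@block_fun_inj m' sz s).
Definition pdiag (s : {dffun forall r : 'I_m, 'S_(sz r)}) : diag 'I_m b b :=
  wdiag ([ffun=> 0], bperm s).

Definition mlin (S : 'I_m -> vectType k) (X : vectType k) (f : (forall r, S r) -> X) :=
  forall (v : forall r, S r) r, linear (fun u : S r => f (dfwith v u)).

Variable S : forall r, rep k 'S_(sz r).

Definition svec (s : {dffun forall r : 'I_m, 'S_(sz r)}) (v : forall r, S r) :
  forall r, S r := fun r => act (S r) (s r) (v r).

(* What the proof uses of the cell modules [dC n], [n] varying: generators
   [dgen d t] labelled by all diagrams, among them the dangles; the diagrams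
   act on them by composition, also when this changes [n]. *)
Record dcell := Dcell {
  dC :> nat -> vectType k;
  dT : vectType k;
  dgen : forall n, diag 'I_m n b -> dT -> dC n;
  dact : forall a n, diag 'I_m a n -> 'Hom(dC n, dC a);
  dpure : (forall r, S r) -> dT;
  dgen_lin : forall n (d : diag 'I_m n b), linear (dgen d);
  dgen_tr : forall n (d : diag 'I_m n b) l t,
    dgen (comp d (tl l)) t = chi xi bcol l *: dgen d t;
  dgen_s : forall n (d : diag 'I_m n b) s v,
    dgen (comp d (pdiag s)) (dpure v) = dgen d (dpure (svec s v));
  dgen_nf : forall n (d : diag 'I_m n b) t, ~~ full d -> dgen d t = 0;
  dact_gen : forall a n (x : diag 'I_m a n) d t,
    dact x (dgen d t) = loops x d delta *: dgen (comp x d) t;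
  dactM : forall a n c (x : diag 'I_m a n) (y : diag 'I_m n c) v,
    dact x (dact y v) = loops x y delta *: dact (comp x y) v;
  dact_id : forall n v, dact (idd _ n) v = v;
  d_span : forall n (U : {vspace dC n}),
    (forall d v, full d -> dgen d (dpure v) \in U) -> U = fullv;
  d_univ : forall n (X : vectType k) (beta : diag 'I_m n b -> (forall r, S r) -> X),
    (forall d, mlin (beta d)) ->
    (forall d l v, full d -> beta (comp d (tl l)) v = chi xi bcol l *: beta d v) ->
    (forall d s v, full d -> beta (comp d (pdiag s)) v = beta d (svec s v)) ->
    exists f : 'Hom(dC n, X), forall d v, full d -> f (dgen d (dpure v)) = beta d v;
  dpure_span : forall U : {vspace dT}, (forall v, dpure v \in U) -> U = fullv;
  dpure_lin : mlin dpure;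
  dim_dT : dim dT = (\prod_(r < m) dim (S r))%N }.

Definition drep (C : dcell) n : rep k (diag 'I_m n n) := Rep (@dact C n n).

End Sizes.
End Abstract.

Section CellInstance.
Variables (k : closedFieldType) (m' : nat) (xi : k) (delta : 'I_m'.+1 -> k).
Notation m := m'.+1.
Hypothesis deltaN : forall i, delta (- i) = delta i.
Variable mu : 'I_m -> seq nat.
Notation b := (msize mu).
Notation S := (fun r => specht k (mu r)).
Notation V := (Yrep xi mu).

Definition cpure : (forall r, specht k (mu r)) -> Tl xi mu := sval (purev V).
Let cpureP : @is_pure k _ _ V (index_enum 'I_m) (Tl xi mu) cpure := svalP (purev V).

Lemma yin_pair (l : {ffun 'I_b -> 'I_m}) s :
  wdiag (yin ((l, s) : young (ysz mu))) = comp (tl l) (pdiag (sz := ysz mu) s).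
Proof.
rewrite /tl /pdiag comp_wdiag; congr (wdiag (_, _)); last by rewrite mul1g.
by apply/ffunP=> x; rewrite !ffunE addr0.
Qed.

Lemma Tl_pure l s v : act (Tl xi mu) ((l, s) : young (ysz mu)) (cpure v) =
  chi xi (bcol (sz := ysz mu)) l *: cpure (svec (S := S) s v).
Proof.
rewrite Tl_label scale_lfunE (pure_act cpureP); congr (_ *: cpure _).
apply: functional_extensionality_dep => r.
pose y0 : young (ysz mu) := ([ffun=> 0], s).
transitivity (xi ^+ (r * \sum_(i < ysz mu r) (young_block r y0).1 i) *:
   act (specht k (mu r)) (s r) (v r)); first by rewrite -scale_lfunE.
rewrite big1 ?muln0 ?expr0 ?scale1r // => i _.
by rewrite !ffunE.
Qed.

Lemma cpure_span (U : {vspace Tl xi mu}) : (forall v, cpure v \in U) -> U = fullv.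
Proof.
move=> h; apply: (pure_span cpureP (G := fun _ _ => True)) => [r U' hU'|v _]; last exact: h.
by apply/vspaceP=> w; rewrite memvf hU'.
Qed.

Lemma cell_dspan n (U : {vspace cell xi delta n mu}) :
  (forall d v, full d -> cgen delta d (cpure v) \in U) -> U = fullv.
Proof.
move=> h; apply: cell_span => d t fd; rewrite -(@clinE k m' xi delta mu) memv_preim.
suff -> : (@clin k m' xi delta mu n d @^-1: U)%VS = fullv by rewrite memvf.
by apply: cpure_span => v; rewrite -memv_preim (@clinE k m' xi delta mu); apply: h.
Qed.

Lemma cell_duniv n (X : vectType k) (beta : diag 'I_m n b -> (forall r, specht k (mu r)) -> X) :
  (forall d, mlin (beta d)) ->
  (forall d l v, full d -> beta (comp d (tl l)) v = chi xi (bcol (sz := ysz mu)) l *: beta d v) ->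
  (forall d s v, full d -> beta (comp d (pdiag (sz := ysz mu) s)) v = beta d (svec (S := S) s v)) ->
  exists f : 'Hom(cell xi delta n mu, X), forall d v, full d -> f (cgen delta d (cpure v)) = beta d v.
Proof.
move=> bl bt bs.
have /fin_all_exists[F FP] (d : diag 'I_m n b) : exists f : 'Hom(Tl xi mu, X), forall v, f (cpure v) = beta d v.
  apply: (pure_univ cpureP); split=> [v v' e|v r _]; last exact: bl.
  by congr beta; apply: functional_extensionality_dep => r; rewrite e ?mem_index_enum.
have [|f fP] := @cell_univ k m' xi delta mu n X F; last first.
  by exists f => d v fd; rewrite fP // FP.
move=> d [l s] t fd; suff -> : F (comp d (wdiag (yin ((l, s) : young (ysz mu))))) = (F d \o act (Tl xi mu) ((l, s) : young (ysz mu)))%VF.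
  by rewrite [LHS]comp_lfunE.
apply/lfunP=> w; apply/eqP; rewrite -subr_eq0.
set g1 := F _; set g2 := (_ \o _)%VF.
have <- : (g1 - g2) w = g1 w - g2 w by rewrite add_lfunE opp_lfunE.
rewrite -memv_ker (@cpure_span (lker (g1 - g2))) ?memvf // => v.
rewrite memv_ker add_lfunE opp_lfunE /g2 [X in _ - X]comp_lfunE Tl_pure linearZ /= !FP yin_pair.
by rewrite -comp_assoc bs ?full_comp_wdiagr // bt // subrr.
Qed.

Definition dcell_of : dcell xi delta S.
Proof.
refine (@Dcell k m' xi delta (ysz mu) S (fun n => cell xi delta n mu) (Tl xi mu)
  (fun n => @cgen k m' xi delta mu n) (fun a n => @cact k m' xi delta mu a n) cpure
  _ _ _ _ _ _ _ _ _ _ _ _).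
- move=> n d; exact: cgen_lin.
- move=> n d l t; pose s1 : {dffun forall r : 'I_m, 'S_(ysz mu r)} := [ffun r => 1%g].
  have E l' : comp d (wdiag (yin ((l', s1) : young (ysz mu)))) = comp d (tl l').
    congr comp; congr (wdiag (_, _)); apply/permP=> i; rewrite permE perm1 /block_fun ffunE perm1.
    exact: tagnat.sig2K.
  rewrite -E cgen_g Tl_label scale_lfunE.
  transitivity (chi xi (bcol (sz := ysz mu)) l *: cgen delta d (act (Tl xi mu) (([ffun=> 0], s1) : young (ysz mu)) t)).
    by rewrite -!(@clinE k m' xi delta mu) linearZ.
  by rewrite -cgen_g E -[tl _]/(idd _ b) comp_idr.
- move=> n d s v; have c1 : chi xi (bcol (sz := ysz mu)) [ffun=> 0] = 1.
    by apply: big1 => j _; rewrite ffunE zeta0r.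
  have := Tl_pure [ffun=> 0] s v; rewrite c1 scale1r => e.
  by rewrite -e -cgen_g.
- move=> n d t; exact: cgen_nf.
- move=> a n x d t; exact: cact_gen.
- move=> a n c x y v; exact: cactM.
- move=> n v; exact: cact_id.
- exact: cell_dspan.
- exact: cell_duniv.
- exact: cpure_span.
- by move=> v r; have [[_ pl] _ _ _] := cpureP; apply: pl; rewrite mem_index_enum.
- exact: (dim_big V).
Defined.

Lemma drep_cell n : drep dcell_of n = cell xi delta n mu.
Proof. by []. Qed.

End CellInstance.

(** * Weight spaces and the Fourier transform of the loop parameters *)

Section Fourier.
Variables (k : fieldType) (m' : nat) (xi : k) (delta : 'I_m'.+1 -> k).
Notation m := m'.+1.
Hypothesis xi_prim : m.-primitive_root xi.
Hypothesis m_unit : m%:R != 0 :> k.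
Hypothesis deltaN : forall i, delta (- i) = delta i.
Variables (sz : 'I_m -> nat) (S : forall r, rep k 'S_(sz r)) (C : dcell xi delta S).
Notation b := (\sum_(r < m) sz r)%N.
Notation cmu := (@bcol m' sz).
Notation cell n := (C n).
Notation cgen := (@dgen k m' xi delta sz S C _).
Notation cact := (@dact k m' xi delta sz S C _ _).

Section Weight.
Variables (n : nat) (om : 'I_n -> 'I_m).

Lemma dact_tl a (l : {ffun 'I_n -> 'I_m}) (x : diag 'I_m n a) v :
  cact (tl l) (cact x v) = cact (comp (tl l) x) v.
Proof. by rewrite dactM /tl loops_wdiagl scale1r. Qed.

Lemma dact_tr a (l : {ffun 'I_n -> 'I_m}) (x : diag 'I_m a n) v :
  cact x (cact (tl l) v) = cact (comp x (tl l)) v.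
Proof.
rewrite dactM.
rewrite  /tl.
rewrite loops_wdiagr.
rewrite scale1r.
by [].
Qed.

Lemma dact_tl_gen (l : {ffun 'I_n -> 'I_m}) d t :
  cact (tl l) (cgen d t) = cgen (comp (tl l) d) t.
Proof. by rewrite dact_gen /tl loops_wdiagl scale1r. Qed.

(** Maps that see only the weight space [om]: by [wt_eom] they factor through the idempotent [eom].
    Identities are stated after such a [P], so that they apply to [eom] and to the projection onto
    the corner alike. *)
Definition of_weight (Y : vectType k) (P : 'Hom(cell n, Y)) :=
  forall l v, P (cact (tl l) v) = chi xi om l *: P v.

Definition eom : 'End(cell n) :=
  (m%:R ^- n) *: \sum_(l : {ffun 'I_n -> 'I_m}) (chi xi om l)^-1 *: cact (tl l).

Lemma eomE v : eom v = (m%:R ^- n) *: \sum_(l : {ffun 'I_n -> 'I_m})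
  (chi xi om l)^-1 *: cact (tl l) v.
Proof.
rewrite scale_lfunE sum_lfunE; congr (_ *: _); apply: eq_bigr => l _.
by rewrite scale_lfunE.
Qed.

Lemma eom_wt : of_weight eom.
Proof.
move=> l v; rewrite !eomE [RHS]scalerA mulrC -scalerA; congr (_ *: _); rewrite scaler_sumr.
rewrite [RHS](reindex_inj (addrI l)) /=; apply: eq_bigr => l' _.
rewrite dact_tl tlD addrC chiD // invfM !scalerA mulrA divff ?mul1r //; exact: chi_neq0.
Qed.

Lemma act_eom l v : cact (tl l) (eom v) = chi xi om l *: eom v.
Proof.
rewrite !eomE linearZ [RHS]scalerA mulrC -scalerA; congr (_ *: _); rewrite linear_sum scaler_sumr.
rewrite [RHS](reindex_inj (addrI l)) /=; apply: eq_bigr => l' _.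
rewrite linearZ /= dact_tl tlD chiD // invfM !scalerA mulrA divff ?mul1r //; exact: chi_neq0.
Qed.

Lemma wt_eom (Y : vectType k) (P : 'Hom(cell n, Y)) v : of_weight P -> P (eom v) = P v.
Proof.
move=> hP; rewrite eomE linearZ linear_sum /=.
rewrite (eq_bigr (fun=> P v)) => [|l _]; last first.
  rewrite linearZ /= hP scalerA mulVf ?scale1r //; exact: chi_neq0.
rewrite sumr_const cardT -cardE card_ffun !card_ord -scaler_nat scalerA natrX mulVf ?scale1r //.
by rewrite expf_neq0.
Qed.

(** A label function constant on strands fixes the diagram, while its northern and southern parts
    act by scalars. *)
Lemma wt_slide (Y : vectType k) (P : 'Hom(cell n, Y)) (d : diag 'I_m n b) t g :
  of_weight P -> (forall v, g (mate d v) = g v) ->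
  P (cgen d t) = gfac xi om cmu g *: P (cgen d t).
Proof.
move=> hP h; rewrite -[in LHS](gauge_sym h) -dact_tl_gen hP dgen_tr linearZ scalerA.
by rewrite (gfacE xi_prim).
Qed.

Lemma scale_fix (Y : vectType k) (c : k) (y : Y) : c != 1 -> y = c *: y -> y = 0.
Proof.
move=> nc /eqP; rewrite -[X in X == _]scale1r -subr_eq0 -scalerBl scaler_eq0 subr_eq0 eq_sym.
by rewrite (negPf nc) => /eqP.
Qed.

Lemma wt_nc (Y : vectType k) (P : 'Hom(cell n, Y)) (d : diag 'I_m n b) t :
  of_weight P -> ~~ compat om cmu d -> P (cgen d t) = 0.
Proof.
move=> hP /(not_compat xi_prim)[g hg ng]; apply: scale_fix ng _; exact: wt_slide.
Qed.

Lemma wt_nc2 (Y : vectType k) (P : 'Hom(cell n, Y)) (z : diag 'I_m n n) v :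
  of_weight P -> ~~ compat om om z -> P (cact z (eom v)) = 0.
Proof.
move=> hP /(not_compat xi_prim)[g hg ng]; apply: scale_fix ng _.
rewrite -[in LHS](gauge_sym hg) -dact_tl hP -dact_tr act_eom !linearZ /= scalerA mulrC.
by rewrite (gfacE xi_prim).
Qed.

Lemma wt_gauge2 (Y : vectType k) (P : 'Hom(cell n, Y)) (z : diag 'I_m n n) v :
  of_weight P ->
  P (cact z (eom v)) = wt xi om om z *: P (cact (relab 'I_m z) (eom v)).
Proof.
move=> hP; rewrite -[in LHS](gauge_pot z) -dact_tl hP -dact_tr act_eom !linearZ /= scalerA mulrC.
by rewrite -(gfacE xi_prim).
Qed.

Lemma wt_gauge1 (Y : vectType k) (P : 'Hom(cell n, Y)) (d : diag 'I_m n b) t :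
  of_weight P -> P (cgen d t) = wt xi om cmu d *: P (cgen (relab 'I_m d) t).
Proof.
move=> hP; rewrite -[in LHS](gauge_pot d) -dact_tl_gen hP dgen_tr linearZ scalerA.
by rewrite -(gfacE xi_prim).
Qed.

Section Loops.
Variables (Y : vectType k) (P : 'Hom(cell n, Y)) (X : diag 'I_m n n) (d : diag 'I_m n b).
Variable t : dT C.
Hypotheses (hP : of_weight P) (uX : unl X) (ud : unl d).
Hypotheses (cX : compat om om X) (cd : compat om cmu d).
Notation phi := (cnext X d).

(** The terms of the average [eom] placed between [X] and [d]. The translations that leave all terms
    unchanged form a group; it is computed below by sliding labels along the walks. *)
Let A (l : {ffun 'I_n -> 'I_m}) : Y :=
  (chi xi om l)^-1 *: P (cact X (cact (tl l) (cgen d t))).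

Let inv g := forall l, A (l + g) = A l.

(** A label [a] put on the strand being walked at [s]. It counts positively where the walk goes down
    through the central node and negatively where it goes up. *)
Let tau a (s : ('I_n + 'I_n) + ('I_n + 'I_b)) : {ffun 'I_n -> 'I_m} :=
  match s with
  | inr (inl j) => sng j a
  | inl (inr j) => - sng j a
  | _ => 0
  end.

Let invB g g' : inv g -> inv g' -> inv (g - g').
Proof. by move=> h h' l; rewrite -[LHS]h' addrA subrK h. Qed.
Let inv0 : inv 0. Proof. by move=> l; rewrite addr0. Qed.
Let invD g g' : inv g -> inv g' -> inv (g + g').
Proof. by move=> h h' l; rewrite addrA h' h. Qed.

(** The label [a] at both ends of one strand leaves the diagram unchanged. Its outer part is
    absorbed by the weights, and as the diagram is compatible the total scalar is 1; its central
    part is the stated difference. *)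
Let inv_next a s : inv (tau a s - tau a (phi s)).
Proof.
case: s => u l.
  pose e := pairf X u a; have he : forall w, e (mate X w) = e w by exact: pairf_mate.
  have -> : tau a (inl u) - tau a (phi (inl u)) = gS e.
    have t1 w j : tau a (inl w) j = - (if inr j == w then a else 0).
      by case: w => i; rewrite !ffunE ?oppr0 //= (inj_eq (@inr_inj _ _)).
    have t2 w j : tau a (glue (inl w)) j = if inr j == w then a else 0.
      by case: w => i; rewrite !ffunE //= (inj_eq (@inr_inj _ _)).
    apply/ffunP=> j; rewrite ffunE [X in _ + X]ffunE t1 t2 ffunE /e /pairf -opprD.
    congr (- _); have [->|_] := eqVneq (inr j) u; last by rewrite add0r.
    by rewrite eq_sym (negPf (mate_neq _ _)) addr0.
  have g1 := gfac_sym xi_prim cX he; rewrite (gfacE xi_prim) in g1.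
  have cS := chi_neq0 xi_prim om (gS e).
  rewrite /A -[in RHS](gauge_sym he) -[in RHS]dact_tl hP -[in RHS]dact_tr.
  rewrite [in RHS]dact_tl tlD [gS e + l]addrC scalerA chiD // invfM -[chi xi om (gN e)](mulfK cS).
  by rewrite g1 mul1r.
pose e := pairf d u a; have he : forall w, e (mate d w) = e w by exact: pairf_mate.
have -> : tau a (inr u) - tau a (phi (inr u)) = gN e.
  have t1 w j : tau a (inr w) j = if inl j == w then a else 0.
    by case: w => i; rewrite !ffunE //= (inj_eq (@inl_inj _ _)).
  have t2 w j : tau a (glue (inr w)) j = - (if inl j == w then a else 0).
    by case: w => i; rewrite !ffunE ?oppr0 //= (inj_eq (@inl_inj _ _)).
  apply/ffunP=> j; rewrite ffunE [X in _ + X]ffunE t1 t2 opprK ffunE /e /pairf.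
  have [->|_] := eqVneq (inl j) u; last by rewrite add0r.
  by rewrite eq_sym (negPf (mate_neq _ _)) addr0.
have g1 := gfac_sym xi_prim cd he; rewrite (gfacE xi_prim) in g1.
have cN := chi_neq0 xi_prim om (gN e).
rewrite /A -[in RHS](gauge_sym he) -[in RHS]dact_tl_gen [in RHS]dact_tl tlD dgen_tr !linearZ /=.
rewrite scalerA; congr (_ *: _).
by rewrite (chiD xi_prim) invfM -[chi xi cmu (gS e)](mulKf cN) g1 mulr1 mulrC.
Qed.

Let inv_connect a s s' : fconnect phi s s' -> inv (tau a s - tau a s').
Proof.
move=> /iter_findex <-; elim: (findex _ _ _) => [|i IHi]; first by rewrite subrr.
have := invD IHi (inv_next a (iter i phi s)).
by rewrite addrA subrK.
Qed.

(* Every translation is equivalent, modulo the invariance of [A], to one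
   supported at the roots of the loops. *)
Let rsup (l : {ffun 'I_n -> 'I_m}) := forall j, ~~ loop_root X d j -> l j = 0.

Let inv_sng j a : exists2 r, rsup r & inv (sng j a - r).
Proof.
have [|nc] := pselect (closed_at phi (@glue n n b) (inr (inl j))).
  move=> /loop_root_ex[i ri /orP[]] /(inv_connect a) h.
    exists (sng i a) => [i' ni'|].
      by rewrite ffunE; case: eqP ni' => // ->; rewrite ri.
    by have := invB inv0 h; rewrite sub0r opprB.
  exists (sng i (- a)) => [i' ni'|].
    by rewrite ffunE; case: eqP ni' => // ->; rewrite ri.
  by have := h; rewrite sngN opprK /= opprK addrC.
exists 0; first by move=> i _; rewrite ffunE.
have [s [js gs]] : exists s, fconnect phi (inr (inl j)) s /\ glue s = s.
  apply: contrapT => /asboolPn/forallp_asboolPn h; apply: nc => s js.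
  by apply/eqP=> gs; apply: (h s).
have := inv_connect a js; suff -> : tau a s = 0 by [].
by case: (s) gs => -[] i.
Qed.

Let inv_all l : exists2 r, rsup r & inv (l - r).
Proof.
rewrite [l]sng_sum; elim/big_rec: _ => [|j g _ [r hr ir]].
  by exists 0; [move=> i _; rewrite ffunE|rewrite subr0].
have [r' hr' ir'] := inv_sng j (l j); exists (r' + r).
  by move=> i ni; rewrite ffunE hr ?hr' ?addr0.
by rewrite opprD addrACA; apply: invD.
Qed.

Notation Rs := (pffun_on (0 : 'I_m) (fun j => loop_root X d j) (predT : pred 'I_m)).

Let RsP l : reflect (rsup l) (l \in Rs).
Proof.
apply: (iffP pfamilyP) => [[/fintype.subsetP h _] j nj|h].
  by apply/eqP; apply: contraR nj => /h.
split=> //; apply/fintype.subsetP=> j; rewrite !inE; apply: contraR => nj.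
by rewrite h.
Qed.

(** Every label vector is congruent, modulo the translations fixing [A], to one supported at the
    roots. Averaging over all such vectors therefore gives the same result from every starting
    point; cardinalities replace the choice of representatives. *)
Let sum_A : #|Rs|%:R *: (\sum_l A l) = (m%:R ^+ n) *: \sum_(r in Rs) A r.
Proof.
transitivity (\sum_(l : {ffun 'I_n -> 'I_m}) \sum_(r in Rs) A (l + r)).
  rewrite exchange_big /= scaler_nat -sumr_const; apply: eq_bigr => r _.
  by rewrite [RHS](reindex_inj (addIr (- r))) /=; apply: eq_bigr => l _; rewrite subrK.
transitivity (\sum_(l : {ffun 'I_n -> 'I_m}) \sum_(r in Rs) A r); last first.
  by rewrite sumr_const cardT -cardE card_ffun !card_ord -natrX scaler_nat.
apply: eq_bigr => l _; have [r hr ir] := inv_all l.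
rewrite [RHS](reindex_inj (addrI r)) /=; apply: eq_big => [r'|r' _].
  apply/RsP/RsP=> h j nj; first by rewrite ffunE h // hr // addr0.
  by have := h j nj; rewrite ffunE hr // add0r.
by rewrite -[RHS]ir [r + r' + _]addrC addrA subrK.
Qed.
Section Value.
Variable r : {ffun 'I_n -> 'I_m}.
Hypothesis hr : rsup r.

Let phir : cnext X (comp (tl r) d) = phi.
Proof.
by apply/funext=> s; rewrite /cnext /across; case: s => u //; rewrite mate_tl.
Qed.

Let q (s : ('I_n + 'I_n) + ('I_n + 'I_b)) : 'I_m := if s is inr u then tnorth r u else 0.

Let slabr s : slab X (comp (tl r) d) s = q s - q (across X d s).
Proof.
case: s => u /=; first by rewrite (unlP _ uX) subrr.
by rewrite lab_tl (unlP _ ud) add0r.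
Qed.

Let q_root s : q s != 0 -> exists2 j, s = inr (inl j) & loop_root X d j.
Proof.
case: s => [u|[j|j]]; rewrite /q /= ?eqxx // => nr; exists j => //.
by apply: contraR nr => /hr ->.
Qed.

(** The added labels sit on closed loops, and a strand that ends at outer nodes never meets a closed
    loop. *)
Let comp_r : comp X (comp (tl r) d) = comp X d.
Proof.
have H v : mate (comp X (comp (tl r) d)) v = mate (comp X d) v /\
           lab (comp X (comp (tl r) d)) v = 0.
  have [_ /(_ v)[i [Ei Ni ->]]] := comp_induced X (comp (tl r) d).
  rewrite !phir in Ei Ni *; split.
    have [|j ltj|-> //] := @compE _ _ _ _ X d i v (mate (comp X (comp (tl r) d)) v).
      by rewrite -glue_across -iterS Ei; case: (mate _ _).
    case E: outer => [w|//]; case: (Ni j.+1 w); first by rewrite /= ltj.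
    by rewrite iterS /cnext (outerK E); case: (w).
  have gi : glue (inner n v) = inner n v :> (('I_n + 'I_n) + ('I_n + 'I_b)) by case: (v).
  have ncl s : fconnect phi (inner n v) s -> ~ closed_at phi (@glue n n b) s.
    move=> vs cl; have := cl (inner n v); rewrite gi eqxx.
    by rewrite (fconnect_sym (@cnext_inj _ _ _ _ X d)) vs => /(_ isT).
  apply: big1 => j _; rewrite slabr; set s := iter j phi _.
  have vs : fconnect phi (inner n v) s by exact: fconnect_iter.
  have [->|/q_root[i' Es /loop_rootP[cl _]]] := eqVneq (q s) 0; last first.
    by case: (ncl s vs); move: cl; rewrite -Es.
  have [->|/q_root[i' Es /loop_rootP[cl _]]] := eqVneq (q (across X d s)) 0.
    by rewrite subrr.
  case: (ncl (phi s)); first by apply: connect_trans vs (fconnect1 _ _).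
  rewrite /cnext Es.
  exact: (closed_g (@cnext_inj _ _ _ _ X d) (@glueK _ _ _) (@cnext_glue _ _ _ _ X d) cl).
apply: diag_eq => v; case: (H v) => // _ ->.
by rewrite (unlP _ (unl_comp uX ud)).
Qed.

(** The loop passes its own root once in the chosen direction, never in the other by [closed_turn],
    and meets no other root. So the only contribution is the label put at the root. *)
Let label_r j : loop_root X d j -> loop_label X (comp (tl r) d) j = r j.
Proof.
move=> rj; have [cl _] := loop_rootP _ _ _ rj.
rewrite loop_labelE phir walk_labelE.
have turn : ~~ fconnect phi (inr (inl j)) (glue (inr (inl j))).
  have := closed_turn (@cnext_inj _ _ _ _ X d) (@cnext_glue _ _ _ _ X d) _ cl.
  rewrite glue_across (same_connect_r (fconnect_sym (@cnext_inj _ _ _ _ X d)) (fconnect1 phi _)).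
  have -> : phi (across X d (inr (inl j))) = glue (inr (inl j)) by rewrite /cnext acrossK.
  by apply=> s; rewrite glue_across across_neq.
have q1 s : fconnect phi (inr (inl j)) s -> s != inr (inl j) -> q s = 0.
  move=> js ns; apply/eqP; apply: contraR ns => /q_root[i Es ri].
  rewrite Es; apply/eqP; congr (inr (inl _)); apply: (loop_root_inj ri rj).
  by rewrite sl_sym /same_loop -Es js.
have q2 s : fconnect phi (inr (inl j)) s -> q (across X d s) = 0.
  move=> js; apply/eqP; apply: contraR turn => /q_root[i Es ri].
  have js' : fconnect phi (inr (inl j)) (glue (inr (inl i))).
    by rewrite -Es; apply: connect_trans js (fconnect1 _ _).
  by rewrite [in X in glue X](loop_root_inj rj ri) // /same_loop js' orbT.
rewrite (bigD1 (inr (inl j))) ?connect0 //= [X in _ + X]big1 => [|s /andP[js ns]].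
  rewrite addr0; transitivity (slab X (comp (tl r) d) (inr (inl j))); first by [].
  by rewrite slabr (q2 _ (connect0 _ _)) subr0.
by rewrite slabr q1 // q2 // subrr.
Qed.

Let loops_r : loops X (comp (tl r) d) delta = \prod_(j | loop_root X d j) delta (r j).
Proof.
apply: eq_big => [j|j]; rewrite {1}/loop_root phir // => rj.
by rewrite label_r.
Qed.

Lemma value_r : A r = (\prod_(j | loop_root X d j) (zeta xi (om j) (- r j) * delta (r j)))
  *: P (cgen (comp X d) t).
Proof.
rewrite /A dact_tl_gen dact_gen linearZ /= comp_r loops_r scalerA; congr (_ *: _).
rewrite big_split; congr (_ * _) => /=.
rewrite /chi (bigID (loop_root X d)) /= [X in _ * X]big1 => [|j nj]; last first.
  by rewrite hr // zeta0r.
by rewrite mulr1 -prodfV; apply: eq_bigr => j _; rewrite zetaNr.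
Qed.

End Value.

Let cardR : #|Rs|%:R = \prod_(j | loop_root X d j) m%:R :> k.
Proof.
transitivity (\sum_(f in Rs) \prod_(j | loop_root X d j) (1 : k)).
  by rewrite sumr_const [X in _ = X *+ _]big1.
rewrite -(big_distr_big (0 : 'I_m) (fun j => loop_root X d j) predT (fun _ _ => 1)).
by apply: eq_bigr => j _; rewrite sumr_const card_ord.
Qed.

(** With labels supported at the roots, the sum over labels of a product over loops becomes a
    product of sums over Z/m. Each is m times [dbar] at the colour of its loop, and the powers of m
    cancel against the normalisation of [eom]. *)
Lemma wt_loops : P (cact X (eom (cgen d t))) =
  (\prod_(j | loop_root X d j) dbar xi delta (om j)) *: P (cgen (comp X d) t).
Proof.
have nz : \prod_(j | loop_root X d j) m%:R != 0 :> k by apply/prodf_neq0.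
rewrite eomE !linearZ !linear_sum /=.
have -> : \sum_l P (cact X ((chi xi om l)^-1 *: cact (tl l) (cgen d t))) = \sum_l A l.
  by apply: eq_bigr => l _; rewrite !linearZ.
apply: (scalerI nz); rewrite -[in LHS]cardR scalerA mulrC -scalerA sum_A.
rewrite scalerA mulVf ?scale1r ?expf_neq0 //.
transitivity ((\sum_(r in Rs) \prod_(j | loop_root X d j) (zeta xi (om j) (- r j) * delta (r j)))
  *: P (cgen (comp X d) t)).
  by rewrite scaler_suml; apply: eq_bigr => r /RsP hr; rewrite value_r.
rewrite -(big_distr_big (0 : 'I_m) (fun j => loop_root X d j) predT
  (fun j a => zeta xi (om j) (- a) * delta a)) scalerA -big_split.
congr (_ *: _); apply: eq_bigr => j _; rewrite /= /dbar mulrA divff // mul1r.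
(* The idempotent carries the inverse character, so the Fourier sum is brought to the form of [dbar]
   by a |-> - a and the symmetry of delta. *)
rewrite (reindex_inj oppr_inj) /=; apply: eq_bigr => a _.
by rewrite opprK deltaN /zeta mulnC.
Qed.

End Loops.
End Weight.
End Fourier.

(** * Subdiagrams, their products and their assembly *)

Section Emb.
Variables (a b p q : nat) (f : 'I_p -> 'I_a) (h : 'I_q -> 'I_b).

Definition emb (u : 'I_p + 'I_q) : 'I_a + 'I_b :=
  match u with inl i => inl (f i) | inr j => inr (h j) end.

Lemma emb_inj : injective f -> injective h -> injective emb.
Proof. by move=> fi hi [u|u] [v|v] // [] => [/fi|/hi] ->. Qed.

(** Only matchings are compared: the part may be unlabelled while the whole is labelled, labels
    having been turned into scalars beforehand. *)
Definition is_part (Z Z' : finZmodType) (x : diag Z a b) (y : diag Z' p q) :=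
  [forall u, emb (mate y u) == mate x (emb u)].

Lemma is_partP (Z Z' : finZmodType) (x : diag Z a b) (y : diag Z' p q) :
  reflect (forall u, emb (mate y u) = mate x (emb u)) (is_part x y).
Proof. exact: 'forall_eqP. Qed.

Lemma is_part_mate (Z Z1 Z' : finZmodType) (x : diag Z a b) (x1 : diag Z1 a b)
  (y : diag Z' p q) : mate x =1 mate x1 -> is_part x y = is_part x1 y.
Proof. by move=> e; apply: eq_forallb => u; rewrite e. Qed.

Lemma eq_diag1 (y y' : diag 'I_1 p q) : mate y =1 mate y' -> y = y'.
Proof. by move=> e; apply: diag_eq => // u; rewrite [LHS]ord1 [RHS]ord1. Qed.

Hypotheses (fi : injective f) (hi : injective h).

Lemma part_uniq (Z : finZmodType) (x : diag Z a b) (y y' : diag 'I_1 p q) :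
  is_part x y -> is_part x y' -> y = y'.
Proof.
move=> /is_partP e /is_partP e'; apply: eq_diag1 => u.
by apply: (emb_inj fi hi); rewrite e e'.
Qed.

Lemma part_ex (Z Z' : finZmodType) (x : diag Z a b) :
  (forall u, exists u', emb u' = mate x (emb u)) -> exists y : diag Z' p q, is_part x y.
Proof.
move=> /fin_all_exists[g gP].
have P : @is_diag Z' p q [ffun u => (g u, 0)].
  apply/forallP=> u; rewrite !ffunE /= oppr0 eqxx andbT; apply/andP; split.
    by apply/eqP=> e; have := mate_neq x (emb u); rewrite -gP e eqxx.
  by apply/eqP; apply: (emb_inj fi hi); rewrite !gP mateK.
by exists (Sub _ P); apply/is_partP=> u; rewrite {1}/mate /= ffunE gP.
Qed.

Lemma part_full (Z Z' : finZmodType) (x : diag Z a b) (y : diag Z' p q) :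
  is_part x y -> full x -> full y.
Proof.
move=> /is_partP e /fullP fx; apply/fullP=> j; have := e (inr j); have [i /= ->] := fx (h j).
by case: (mate y _) => // i' _; exists i'.
Qed.

End Emb.

Section PartComp.
Variables (Z Z' : finZmodType) (a b c p q s : nat).
Variables (f : 'I_p -> 'I_a) (h : 'I_q -> 'I_b) (g : 'I_s -> 'I_c).
Variables (x : diag Z a b) (x' : diag Z b c) (y : diag Z' p q) (y' : diag Z' q s).
Hypotheses (xy : is_part f h x y) (xy' : is_part h g x' y').

Let se (t : ('I_p + 'I_q) + ('I_q + 'I_s)) : ('I_a + 'I_b) + ('I_b + 'I_c) :=
  match t with inl u => inl (emb f h u) | inr u => inr (emb h g u) end.

Let se_across t : across x x' (se t) = se (across y y' t).
Proof. by case: t => u /=; rewrite -?(is_partP _ _ _ _ xy) -?(is_partP _ _ _ _ xy'). Qed.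

Let se_glue t : glue (se t) = se (glue t).
Proof. by case: t => -[]. Qed.

Let se_next t : cnext x x' (se t) = se (cnext y y' t).
Proof. by rewrite /cnext se_across se_glue. Qed.

Let se_iter i t : iter i (cnext x x') (se t) = se (iter i (cnext y y') t).
Proof. by elim: i => //= i ->; rewrite se_next. Qed.

Let se_outer t : outer (se t) = omap (emb f g) (outer t).
Proof. by case: t => -[]. Qed.

Let se_inner u : se (inner q u) = inner b (emb f g u).
Proof. by case: u. Qed.

(** The walk on the stacked parts embeds into the walk on the stacked wholes and reaches outer nodes
    at the same times. *)
Lemma part_comp : is_part f g (comp x x') (comp y y').
Proof.
apply/is_partP=> u; have [_ /(_ u)[i [Ei Ni _]]] := comp_induced y y'.
have [|j ltj|-> //] := @compE _ _ _ _ x x' i (emb f g u) (emb f g (mate (comp y y') u)).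
  rewrite -se_inner se_iter se_across -se_inner; congr se.
  by rewrite -glue_across -iterS Ei; case: (mate _ _).
rewrite -se_inner se_iter se_across se_outer.
case E: outer => [w|//]; case: (Ni j.+1 w); first by rewrite /= ltj.
by rewrite iterS /cnext (outerK E); case: (w).
Qed.

Hypothesis h_mono : forall i j : 'I_q, (i < j)%N -> (h i < h j)%N.

Let h_inj : injective h.
Proof.
move=> i j e; apply: ord_inj; case: (ltngtP i j) => // /h_mono; by rewrite e ltnn.
Qed.

Let connect_se t w : fconnect (cnext x x') (se t) w ->
  exists2 t', w = se t' & fconnect (cnext y y') t t'.
Proof.
by move=> /iter_findex <-; rewrite se_iter; eexists; [reflexivity|apply: fconnect_iter].
Qed.

Let se_connect t t' : fconnect (cnext y y') t t' -> fconnect (cnext x x') (se t) (se t').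
Proof. by move=> /iter_findex <-; rewrite -se_iter fconnect_iter. Qed.

Let closed_se t : closed_at (cnext x x') (@glue a b c) (se t) <->
  closed_at (cnext y y') (@glue p q s) t.
Proof.
have o t' : (outer (se t') = None) <-> (outer t' = None).
  by rewrite se_outer; case: outer.
split=> cl w.
  by move=> /se_connect/cl/glue_outer/o/glue_outer.
by case/connect_se=> t' -> /cl/glue_outer/o/glue_outer.
Qed.

(** The embedding of the central nodes is monotone, so the leftmost node of a loop is the same in
    the part and in the whole. *)
Lemma part_loop_root j : loop_root x x' (h j) = loop_root y y' j.
Proof.
apply/loop_rootP/loop_rootP => -[cl mn].
  split=> [|j']; first by apply/closed_se.
  move=> sl; have : (h j <= h j')%N.
    apply: mn; case/orP: sl => /se_connect sl; rewrite /same_loop -[inr (inl (h j))]/(se (inr (inl j))).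
      by rewrite -[inr (inl (h j'))]/(se (inr (inl j'))) sl.
    by rewrite -[inr (inl (h j'))]/(se (inr (inl j'))) se_glue sl orbT.
  by case: (ltnP j' j) => // /h_mono; rewrite ltnNge => /negP.
split=> [|j']; first by apply/(closed_se (inr (inl j))).
rewrite /same_loop -[inr (inl (h j))]/(se (inr (inl j))) => /orP[]/connect_se[[]].
- by case.
- case=> // i [->] ji; suff : (j <= i)%N.
    by rewrite leq_eqVlt => /orP[/eqP/ord_inj-> //|/h_mono/ltnW].
  by apply: mn; rewrite /same_loop ji.
- case=> // i [->] ji; suff : (j <= i)%N.
    by rewrite leq_eqVlt => /orP[/eqP/ord_inj-> //|/h_mono/ltnW].
  by apply: mn; rewrite /same_loop [glue _]/= ji orbT.
- by case.
Qed.

End PartComp.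

Section Assemble.
Variables (Z Z' : finZmodType) (R : finType) (a b : nat) (p q : R -> nat).
Variables (f : forall r, 'I_(p r) -> 'I_a) (h : forall r, 'I_(q r) -> 'I_b).

Definition tagf (p' : R -> nat) a' (f' : forall r, 'I_(p' r) -> 'I_a')
  (t : {r : R & 'I_(p' r)}) : 'I_a' := f' (tag t) (tagged t).

Hypotheses (fB : bijective (tagf f)) (hB : bijective (tagf h)).

Lemma tagf_inj p' a' (f' : forall r, 'I_(p' r) -> 'I_a') r : bijective (tagf f') ->
  injective (@f' r).
Proof.
move=> /bij_inj i u v e.
have := i (Tagged (fun r => 'I_(p' r)) u) (Tagged (fun r => 'I_(p' r)) v) e.
by move/eqP; rewrite eq_Tagged => /eqP.
Qed.

Lemma emb_onto v : exists r u, v = emb (@f r) (@h r) u.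
Proof.
have [f' _ fK] := fB; have [h' _ hK] := hB; case: v => i.
  by exists (tag (f' i)), (inl (tagged (f' i))); rewrite -[in LHS](fK i).
by exists (tag (h' i)), (inr (tagged (h' i))); rewrite -[in LHS](hK i).
Qed.

Lemma emb_tag r r' u u' : emb (@f r) (@h r) u = emb (@f r') (@h r') u' ->
  existT (fun r => ('I_(p r) + 'I_(q r))%type) r u = existT _ r' u'.
Proof.
case: u u' => u [] u' //= [].
  move=> e; have := bij_inj fB (_ : tagf f (existT _ r u) = tagf f (existT _ r' u')) => /(_ e) E.
  have Er : r = r' := congr1 tag E; subst r'.
  by move/eqP: E; rewrite eq_Tagged => /eqP /= ->.
move=> e; have := bij_inj hB (_ : tagf h (existT _ r u) = tagf h (existT _ r' u')) => /(_ e) E.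
have Er : r = r' := congr1 tag E; subst r'.
by move/eqP: E; rewrite eq_Tagged => /eqP /= ->.
Qed.

Lemma assemble (y : forall r, diag Z' (p r) (q r)) : exists X : diag Z a b,
  (forall v, lab X v = 0) /\ forall r, is_part (@f r) (@h r) X (y r).
Proof.
have /fin_all_exists[L LP] v : exists t : {r & ('I_(p r) + 'I_(q r))%type},
    v = emb (@f (tag t)) (@h (tag t)) (tagged t).
  by have [r [u e]] := emb_onto v; exists (existT _ r u).
pose M v := emb (@f (tag (L v))) (@h (tag (L v))) (mate (y (tag (L v))) (tagged (L v))).
have ME r u : M (emb (@f r) (@h r) u) = emb (@f r) (@h r) (mate (y r) u).
  have /emb_tag E := LP (emb (@f r) (@h r) u).
  exact: (esym (congr1 (fun t => emb (@f (tag t)) (@h (tag t)) (mate (y (tag t)) (tagged t))) E)).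
have P : @is_diag Z a b [ffun v => (M v, 0)].
  apply/forallP=> v; have [r [u ->]] := emb_onto v; rewrite !ffunE /= oppr0 eqxx andbT !ME mateK.
  rewrite eqxx andbT; apply/eqP=> /(emb_inj (tagf_inj fB) (tagf_inj hB)).
  by apply/eqP; apply: mate_neq.
exists (Sub _ P); split=> [v|r]; first by rewrite /lab /= ffunE.
by apply/is_partP=> u; rewrite [in RHS]/mate /= ffunE ME.
Qed.

Lemma parts_det (x x' : diag Z a b) (y : forall r, diag Z' (p r) (q r)) :
  (forall v, lab x v = 0) -> (forall v, lab x' v = 0) ->
  (forall r, is_part (@f r) (@h r) x (y r)) -> (forall r, is_part (@f r) (@h r) x' (y r)) ->
  x = x'.
Proof.
move=> l l' e e'; apply: diag_eq => v; last by rewrite l l'.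
have [r [u ->]] := emb_onto v.
by rewrite -(is_partP _ _ _ _ (e r)) -(is_partP _ _ _ _ (e' r)).
Qed.

Lemma prod_tagf (K : comPzSemiRingType) (P : pred 'I_a) (F : 'I_a -> K) :
  \prod_(j | P j) F j = \prod_r \prod_(i | P (@f r i)) F (@f r i).
Proof.
rewrite [RHS]sig_big_dep /= (reindex (tagf f)); last exact: onW_bij.
by apply: eq_big => -[r i].
Qed.

End Assemble.

Lemma linZ (k : fieldType) (U V : vectType k) (g : U -> V) : linear g ->
  forall c u, g (c *: u) = c *: g u.
Proof. by move=> l c u; rewrite -!(lin_ofE l) linearZ. Qed.

Section MultilinFacts.
Variables (k : fieldType) (D I : finType) (V : I -> rep k D) (X : vectType k) (s : seq I).
Variable p : (forall r, V r) -> X.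
Hypothesis pM : multilin s p.

Lemma multilin0 v r : r \in s -> v r = 0 -> p v = 0.
Proof.
move=> rs v0; have [pext plin] := pM.
have -> : p v = p (dfwith v (0 : V r)).
  by apply: pext => r' _; rewrite -v0 dfwith_id.
by rewrite -(scale0r (0 : V r)) (linZ (plin v r rs)) scale0r.
Qed.

Lemma multilin_scale v (c : I -> k) : uniq s ->
  p (fun r => c r *: v r) = (\prod_(r <- s) c r) *: p v.
Proof.
have [pext plin] := pM => us.
suff H (s' : seq I) : uniq s' -> {subset s' <= s} ->
    p (fun r => (if r \in s' then c r else 1) *: v r) = (\prod_(r <- s') c r) *: p v.
  rewrite -H //; apply: pext => r rs; by rewrite rs.
elim: s' => [_ _|r s' IHs /= /andP[rs us'] sub].
  by rewrite big_nil scale1r; apply: pext => r _; rewrite scale1r.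
have rs0 : r \in s by apply: sub; rewrite mem_head.
rewrite big_cons -scalerA -IHs //; last by move=> r' h; apply: sub; rewrite inE h orbT.
pose w r' := (if r' \in s' then c r' else 1) *: v r'.
transitivity (p (dfwith w (c r *: v r))).
  apply: pext => r' _; have [<-|ne] := eqVneq r r'.
    by rewrite dfwith_in mem_head.
  by rewrite dfwith_out // inE eq_sym (negPf ne).
rewrite (linZ (plin w r rs0)).
congr (_ *: _); apply: pext => r' _; have [<-|ne] := eqVneq r r'.
  by rewrite dfwith_in (negPf rs) scale1r.
by rewrite dfwith_out.
Qed.

End MultilinFacts.

(** * Decomposition of compatible diagrams by classes of colours *)

Section ClassParts.
Variables (m' : nat) (a b : nat) (ca : 'I_a -> 'I_m'.+1) (cb : 'I_b -> 'I_m'.+1).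
Notation m := m'.+1.
Variables (p q : 'I_m -> nat).
Variables (f : forall r, 'I_(p r) -> 'I_a) (h : forall r, 'I_(q r) -> 'I_b).
Hypotheses (fB : bijective (tagf f)) (hB : bijective (tagf h)).
Variable cls : 'I_m -> 'I_m.
Hypothesis clsN : forall c, cls (- c) = cls c.
Hypothesis f_cls : forall r i, cls (ca (@f r i)) = r.
Hypothesis h_cls : forall r i, cls (cb (@h r i)) = r.

Definition pcompat r (Z : finZmodType) (y : diag Z (p r) (q r)) :=
  compat (ca \o @f r) (cb \o @h r) y.

Lemma colour_emb r u : colour (ca \o @f r) (cb \o @h r) u = colour ca cb (emb (@f r) (@h r) u).
Proof. by case: u. Qed.

Lemma ncls_emb r u : cls (colour ca cb (emb (@f r) (@h r) u)) = r.
Proof. by case: u => i /=; rewrite ?clsN ?f_cls ?h_cls. Qed.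

Lemma part_compat (Z Z' : finZmodType) r (x : diag Z a b) (y : diag Z' (p r) (q r)) :
  is_part (@f r) (@h r) x y -> compat ca cb x -> pcompat y.
Proof.
move=> /is_partP e /compatP cx; apply/compatP=> u.
by rewrite !colour_emb e cx.
Qed.

Lemma parts_compat (Z Z' : finZmodType) (x : diag Z a b) (y : forall r, diag Z' (p r) (q r)) :
  (forall r, is_part (@f r) (@h r) x (y r)) -> (forall r, pcompat (y r)) -> compat ca cb x.
Proof.
move=> e cy; apply/compatP=> v; have [r [u ->]] := emb_onto fB hB v.
by rewrite -(is_partP _ _ _ _ (e r)) -!colour_emb (compatP _ _ _ (cy r)).
Qed.

(** The two ends of a strand have opposite signed colours, hence the same class, so no strand leaves
    the nodes of its class. *)
Lemma part_exists (Z Z' : finZmodType) r (x : diag Z a b) : compat ca cb x ->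
  exists y : diag Z' (p r) (q r), is_part (@f r) (@h r) x y.
Proof.
move=> /compatP cx; apply: part_ex; [exact: tagf_inj|exact: tagf_inj|move=> u].
have [r' [u' e]] := emb_onto fB hB (mate x (emb (@f r) (@h r) u)).
have E : r' = r by rewrite -(ncls_emb u') -e cx clsN ncls_emb.
by subst r'; exists u'.
Qed.

Lemma parts_full (Z Z' : finZmodType) (x : diag Z a b) (y : forall r, diag Z' (p r) (q r)) :
  (forall r, is_part (@f r) (@h r) x (y r)) -> (forall r, full (y r)) -> full x.
Proof.
move=> e fy; apply/fullP=> j; have [h' _ hK] := hB.
rewrite -(hK j); move: (h' j) => -[r u]; rewrite /tagf /=.
have /fullP/(_ u)[i Ei] := fy r; exists (@f r i).
by have := is_partP _ _ _ _ (e r) (inr u); rewrite Ei /= => <-.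
Qed.

End ClassParts.

(** * The weight space as a tensor product over the classes of colours *)

Section PiMap.
Variables (k : closedFieldType) (m' : nat) (xi : k) (delta : 'I_m'.+1 -> k).
Notation m := m'.+1.
Hypothesis xi_prim : m.-primitive_root xi.
Hypothesis m_unit : m%:R != 0 :> k.
Hypothesis deltaN : forall i, delta (- i) = delta i.
Variable cls : 'I_m -> 'I_m.
Hypothesis clsN : forall c, cls (- c) = cls c.
Variables (N : nat) (om : 'I_N -> 'I_m) (p : 'I_m -> nat) (f : forall r, 'I_(p r) -> 'I_N).
Hypothesis fB : bijective (tagf f).
Hypothesis f_mono : forall r (i j : 'I_(p r)), (i < j)%N -> (@f r i < @f r j)%N.
Hypothesis f_cls : forall r i, cls (om (@f r i)) = r.
Hypothesis dbarf : forall r i, dbar xi delta (om (@f r i)) = dbar xi delta r.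

(** The diagram basis of one factor algebra: all Brauer diagrams for a self-opposite colour, the
    walled ones for a pair of distinct opposite colours. *)
Definition ddiag p1 (f1 : 'I_p1 -> 'I_N) : finType :=
  {x : diag 'I_1 p1 p1 | compat (om \o f1) (om \o f1) x}.
Definition DD r : finType := ddiag (@f r).
Definition DD' : finType := {dffun forall r, DD r}.

Lemma DD_id r : pcompat om om f f (idd 'I_1 (p r)).
Proof. by apply/compatP=> -[] i; rewrite ?mate_wdl ?mate_wdr ?invg1 perm1 /= ?opprK. Qed.

Definition DD1 r : DD r := Sub _ (DD_id r).

Section OneCell.
Variables (sz : 'I_m -> nat) (S : forall r, rep k 'S_(sz r)) (C : dcell xi delta S).
Notation b := (\sum_(r < m) sz r)%N.
Notation cmu := (@bcol m' sz).
Variables (q : 'I_m -> nat) (h : forall r, 'I_(q r) -> 'I_b).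
Hypothesis hB : bijective (tagf h).
Hypothesis h_cls : forall r j, cls (cmu (@h r j)) = r.

(* The same for the cell modules of the Brauer and the walled Brauer algebras:
   the generators [pB d v] for the class [r] of colours. *)
Record pcell r p1 q1 (f1 : 'I_p1 -> 'I_N) (h1 : 'I_q1 -> 'I_b) (M : rep k (ddiag f1)) := Pcell {
  pE : finType;
  pe : pE -> diag 'I_1 p1 q1;
  pB : diag 'I_1 p1 q1 -> (forall r, S r) -> M;
  pB_ext : forall d v v', (forall r', cls r' = r -> v r' = v' r') -> pB d v = pB d v';
  pB_lin : forall d v r', cls r' = r -> linear (fun u : S r' => pB d (dfwith v u));
  pB_nf : forall d v, ~~ full d -> pB d v = 0;
  pB_s : forall d v s g, compat (om \o f1) (cmu \o h1) d -> full d ->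
    is_part h1 h1 (pdiag s) g -> pB (comp d g) v = pB d (svec s v);
  pB_act : forall (x : ddiag f1) d v, compat (om \o f1) (cmu \o h1) d ->
    act M x (pB d v) =
    (\prod_(j | loop_root (val x) d j) dbar xi delta r) *: pB (comp (val x) d) v;
  pB_span : forall U : {vspace M}, (forall d v, compat (om \o f1) (cmu \o h1) d -> full d ->
    pB d v \in U) -> U = fullv;
  pe_compat : forall e, compat (om \o f1) (cmu \o h1) (pe e);
  pe_fac : forall d, compat (om \o f1) (cmu \o h1) d -> full d -> exists e s g,
    is_part h1 h1 (pdiag s) g /\ d = comp (pe e) g;
  pdim : (#|pE| * \prod_(r' | cls r' == r) dim (S r') <= dim M)%N }.

Variables (M : forall r, rep k (DD r)) (P : forall r, pcell r (@h r) (M r)).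

Definition Vrep r : rep k DD' := pull (fun y : DD' => y r) (M r).
Definition NN : rep k DD' := bigtens Vrep (index_enum 'I_m).
Definition pN : (forall r, Vrep r) -> NN := sval (purev Vrep).
Let pNP : is_pure (index_enum 'I_m) pN := svalP (purev Vrep).

Definition Bp r (d : diag 'I_m N b) v : M r :=
  if [pick y | is_part (@f r) (@h r) d y] is Some y then pB (P r) y v else 0.

Lemma BpE r d y v : is_part (@f r) (@h r) d y -> Bp r d v = pB (P r) y v.
Proof.
move=> e; rewrite /Bp; case: pickP => [y' e'|/(_ y)]; last by rewrite e.
by rewrite (part_uniq (tagf_inj fB) (tagf_inj hB) e e').
Qed.

Lemma Bp_mate r d d' v : mate d =1 mate d' -> Bp r d v = Bp r d' v.
Proof. by move=> e; rewrite /Bp; under eq_pick => y do rewrite (is_part_mate _ _ _ e). Qed.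

(** The candidate image of a generator: its labels become the scalar [wt], its matching becomes the
    tensor product of its parts, and incompatible diagrams go to 0. *)
Definition beta d v : NN :=
  if compat om cmu d then wt xi om cmu d *: pN (fun r => Bp r d v) else 0.

Lemma beta_lin d : mlin (beta d).
Proof.
move=> v r c u u'; rewrite /beta; case: ifP => _; last by rewrite scaler0 addr0.
have [[pext plin] _ _ _] := pNP.
have E (w : S r) : pN (fun r' => Bp r' d (dfwith v w)) =
    pN (dfwith (fun r' => Bp r' d v) (Bp (cls r) d (dfwith v w) : Vrep (cls r))).
  apply: pext => r' _; have [e|ne] := eqVneq (cls r) r'.
    by case: _ / e; rewrite dfwith_in.
  rewrite dfwith_out // /Bp; case: pickP => // y _; apply: pB_ext => r'' e.
  have ne' : r != r'' by apply: contraNneq ne => Er; rewrite Er e.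
  by rewrite dfwith_out.
have L : linear (fun w : S r => Bp (cls r) d (dfwith v w)).
  rewrite /Bp; case: pickP => [y _|_]; first exact: pB_lin.
  by move=> c' w w'; rewrite scaler0 addr0.
rewrite !E L plin ?mem_index_enum // scalerDr !scalerA.
by rewrite mulrC.
Qed.

Lemma bperm_Rank (s : {dffun forall r : 'I_m, 'S_(sz r)}) r (j : 'I_(sz r)) :
  bperm s (tagnat.Rank r j) = tagnat.Rank r (s r j).
Proof.
pose G (t : {r : 'I_m & 'I_(sz r)}) := tagnat.Rank (tag t) (s (tag t) (tagged t)).
by rewrite permE -[LHS]/(G (tagnat.sig (tagnat.rank (Tagged _ j)))) tagnat.rankK.
Qed.

Lemma compat_perm n' (c' : 'I_n' -> 'I_m) (d : diag 'I_m n' b) s :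
  compat c' cmu (comp d (pdiag s)) = compat c' cmu d.
Proof.
have col t j : cmu (bperm t j) = cmu j.
  by rewrite permE /block_fun /bcol tagnat.Rank1K.
have cp t : compat cmu cmu (wdiag (([ffun=> 0], bperm t) : wreath 'I_m b)).
  apply/compatP=> -[] j; rewrite ?mate_wdl ?mate_wdr /= ?opprK ?col //.
  by rewrite -[in RHS](permKV (bperm t) j) col.
pose s' : {dffun forall r : 'I_m, 'S_(sz r)} := [ffun r => (s r)^-1%g].
have ss' : comp (comp d (pdiag s)) (pdiag s') = d.
  rewrite comp_assoc /pdiag comp_wdiag -[RHS]comp_idr; congr comp; congr (wdiag (_, _)).
    by apply/ffunP=> j; rewrite !ffunE addr0.
  apply/permP=> j; rewrite permM perm1 /= -[j](tagnat.sig2K (p_ := sz)).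
  by rewrite !bperm_Rank ffunE permK.
apply/idP/idP=> h'; last exact: (compat_comp h' (cp s)).
by rewrite -ss'; exact: (compat_comp h' (cp s')).
Qed.

Lemma wt_perm (d : diag 'I_m N b) s : compat om cmu d ->
  wt xi om cmu (comp d (pdiag s)) = wt xi om cmu d.
Proof.
move=> cd; set g := ([ffun=> 0], bperm s) : wreath 'I_m b.
pose wi (v : 'I_N + 'I_b) : 'I_N + 'I_b := match v with inl i => inl i | inr j => inr (((bperm s)^-1)%g j) end.
have wiK : cancel (wpr g) wi by case=> j //=; rewrite permK.
have wKi : cancel wi (wpr g) by case=> j //=; rewrite permKV.
have w0 (u : 'I_N + 'I_b) : wsr g u = 0 by case: u => j //=; rewrite ffunE.
have -> : wt xi om cmu (comp d (pdiag s)) = gfac xi om cmu (pot d \o wi).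
  apply: (wtE xi_prim); first by rewrite compat_perm.
  move=> v; rewrite -[v]wKi; have [-> ->] := comp_wdiagr d g (wi v).
  by rewrite !w0 addr0 subr0 /= !wiK -potE.
rewrite /wt /gfac (reindex (wpr g)) /=; last by exists wi => u _; [apply: wiK|apply: wKi].
apply: eq_bigr => u _; rewrite wiK; congr zeta; case: u => //= j.
rewrite -{1}[j](tagnat.sig2K (p_ := sz)) bperm_Rank.
by rewrite /bcol tagnat.Rank1K.
Qed.

Lemma part_pdiag r (s : {dffun forall r : 'I_m, 'S_(sz r)}) :
  exists g : diag 'I_1 (q r) (q r), is_part (@h r) (@h r) (pdiag s) g.
Proof.
apply: (part_exists hB hB clsN h_cls h_cls).
rewrite -[pdiag s]comp_idl compat_perm.
by apply/compatP=> -[] i; rewrite ?mate_wdl ?mate_wdr ?invg1 perm1 /= ?opprK.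
Qed.

Lemma pi_ex : exists f : 'Hom(C N, NN), forall d v, full d ->
  f (dgen d (dpure C v)) = beta d v.
Proof.
apply: d_univ => [d|d l v _|d s v fd]; first exact: beta_lin.
  rewrite /beta (compat_mate om cmu (mate_tr d l)); case: ifP => cd; last by rewrite scaler0.
  rewrite (wt_tr xi_prim) // scalerA; congr (_ *: pN _); apply: functional_extensionality_dep => r.
  exact/Bp_mate/mate_tr.
rewrite /beta compat_perm; case: ifP => // cd; rewrite wt_perm //.
congr (_ *: pN _); apply: functional_extensionality_dep => r.
have [y yP] := part_exists fB hB clsN f_cls h_cls 'I_1 r cd.
have [g gP] := part_pdiag r s.
rewrite (BpE _ yP) (BpE _ (part_comp yP gP)); apply: pB_s gP.
  exact: part_compat yP cd.
exact: part_full yP fd.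
Qed.

Definition ppi : 'Hom(C N, NN) := sval (cid pi_ex).
Lemma ppiE d v : full d -> ppi (dgen d (dpure C v)) = beta d v.
Proof. exact: (svalP (cid pi_ex)). Qed.

Lemma dC_ext n (X : vectType k) (g g' : 'Hom(C n, X)) :
  (forall d v, full d -> g (dgen d (dpure C v)) = g' (dgen d (dpure C v))) -> g = g'.
Proof.
move=> e; apply/lfunP=> w; apply/eqP; rewrite -subr_eq0.
have <- : (g - g') w = g w - g' w by rewrite add_lfunE opp_lfunE.
rewrite -memv_ker (@d_span _ _ _ _ _ _ C n (lker (g - g'))) ?memvf // => u v fu.
by rewrite memv_ker add_lfunE opp_lfunE e ?subrr.
Qed.

Lemma ppi_wt : of_weight om ppi.
Proof.
move=> l w; suff E : (ppi \o dact C (tl l))%VF = chi xi om l *: ppi.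
  by have := congr1 (fun g : 'Hom(C N, NN) => g w) E; rewrite [LHS]comp_lfunE scale_lfunE.
apply: dC_ext => d v fd; rewrite [LHS]comp_lfunE scale_lfunE dact_tl_gen.
rewrite !ppiE ?full_comp_wdiagl // /beta (compat_mate om cmu (mate_tl d l)).
case: ifP => cd; last by rewrite scaler0.
rewrite (wt_tl xi_prim) // scalerA; congr (_ *: pN _); apply: functional_extensionality_dep => r.
exact/Bp_mate/mate_tl.
Qed.

Lemma ppi_parts d v (y : forall r, diag 'I_1 (p r) (q r)) : unl d -> compat om cmu d ->
  (forall r, is_part (@f r) (@h r) d (y r)) ->
  ppi (dgen d (dpure C v)) = pN (fun r => pB (P r) (y r) v).
Proof.
move=> ud cd yP; have [fd|nf] := boolP (full d).
  rewrite ppiE // /beta cd wt_unl // scale1r.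
  by congr pN; apply: functional_extensionality_dep => r; apply: BpE.
rewrite dgen_nf // linear0.
have [r nr] : exists r, ~~ full (y r).
  by apply/existsP; apply: contraR nf => /existsPn nn; apply: (parts_full hB yP) => r; apply/negPn.
by apply/esym/(multilin0 (pure_multilin pNP) (mem_index_enum r)); rewrite pB_nf.
Qed.

(** Generators may be taken unlabelled. Then [wt_loops] produces one [dbar] for each loop of the
    whole stack, and these loops are distributed among the classes, where the factor algebras
    produce the same parameters. *)
Lemma ppi_act X (y : DD') v : unl X -> compat om om X ->
  (forall r, is_part (@f r) (@f r) X (val (y r))) ->
  ppi (dact C X (eom C om v)) = act NN y (ppi v).
Proof.
move=> uX cX yP.
suff E : (ppi \o (dact C X \o eom C om))%VF = (act NN y \o ppi)%VF.
  have := congr1 (fun g : 'Hom(C N, NN) => g v) E.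
  by rewrite [LHS]comp_lfunE [in LHS]comp_lfunE [RHS]comp_lfunE.
apply: dC_ext => d w fd; rewrite [LHS]comp_lfunE [in LHS]comp_lfunE [RHS]comp_lfunE.
have [cd|nc] := boolP (compat om cmu d); last first.
  rewrite (wt_nc xi_prim _ (@eom_wt _ _ _ _ xi_prim _ _ C _ om)) // (wt_nc xi_prim _ ppi_wt) //.
  by rewrite !linear0.
rewrite (wt_gauge1 xi_prim _ _ (@eom_wt _ _ _ _ xi_prim _ _ C _ om)).
rewrite (wt_gauge1 xi_prim _ _ ppi_wt) !linearZ; congr (_ *: _).
set d0 := relab _ d.
have ud : unl d0 by apply/unlP=> u; rewrite lab_relab.
have cd0 : compat om cmu d0 by rewrite (compat_mate om cmu (mate_relab _ d)).
have /fin_all_exists[z zP] r := part_exists fB hB clsN f_cls h_cls 'I_1 r cd0.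
rewrite /= (wt_loops xi_prim m_unit deltaN) //; last exact: ppi_wt.
rewrite (ppi_parts w ud cd0 zP).
rewrite (ppi_parts (y := fun r => comp (val (y r)) (z r)) w (unl_comp uX ud) (compat_comp cX cd0));
  last by move=> r; apply: part_comp.
rewrite (pure_act pNP) (prod_tagf fB).
rewrite -(multilin_scale (pure_multilin pNP)) ?index_enum_uniq //.
congr pN; apply: functional_extensionality_dep => r.
rewrite /= pB_act; last exact: part_compat (zP r) cd0.
congr (_ *: _); apply: eq_big => [i|i _]; last exact: dbarf.
exact: (part_loop_root (yP r) (zP r) (@f_mono r)).
Qed.

Lemma NN_1 : forall n : NN, act NN [ffun r => DD1 r] n = n.
Proof.
suff E r : act (Vrep r) [ffun r => DD1 r] = \1%VF.
  by move=> n; rewrite /NN bigtens_act_id ?id_lfunE.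
pose U := lker (act (M r) (DD1 r) - \1%VF).
have EU : U = fullv.
  apply: (pB_span (p := P r)) => d v cd fd; rewrite memv_ker add_lfunE opp_lfunE id_lfunE.
  rewrite pB_act // comp_idl.
  rewrite -[X in X *: _]/(loops (idd 'I_1 (p r)) d (fun=> dbar xi delta r)) /idd loops_wdiagl.
  by rewrite scale1r subrr.
apply/lfunP=> n; rewrite id_lfunE; apply/eqP; rewrite -subr_eq0 /= ffunE.
have := memvf n; rewrite -EU memv_ker add_lfunE opp_lfunE id_lfunE.
by [].
Qed.

Lemma Vspan r : spans (fun w : Vrep r =>
  exists d v, [/\ pcompat om cmu f h d, full d & w = pB (P r) d v]).
Proof.
by move=> U hU; apply: (pB_span (p := P r)) => d v cd fd; apply: hU; exists d, v.
Qed.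

Lemma ppi_onto : limg ppi = fullv.
Proof.
apply: (pure_span pNP Vspan) => w wP.
have /fin_all_exists[d dP] r : exists d, exists v,
    [/\ pcompat om cmu f h d, full d & w r = pB (P r) d v].
  by apply: wP; rewrite mem_index_enum.
have /fin_all_exists[v vP] := dP.
have [X [X0 XP]] := assemble 'I_m fB hB d.
have cX : compat om cmu X by apply: (parts_compat fB hB XP) => r; case: (vP r).
have uX : unl X by apply/unlP.
(* One tuple serves all classes at once: the vector for the colour r' is taken from the data of the
   class of r'. *)
have -> : pN w = ppi (dgen X (dpure C (fun r' => v (cls r') r'))).
  rewrite (ppi_parts _ uX cX XP); congr pN; apply: functional_extensionality_dep => r.
  by have [_ _ ->] := vP r; apply: pB_ext => r' <-.
by rewrite memv_img ?memvf.
Qed.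

Lemma dim_sumv (I : finType) (W : vectType k) (U : I -> {vspace W}) n :
  (forall i, \dim (U i) <= n)%N -> (\dim (\sum_i U i)%VS <= #|I| * n)%N.
Proof.
move=> hU; rewrite -sum_nat_const.
elim/big_rec2: _ => [|i U' x _ IH]; first by rewrite dimv0.
by apply: leq_trans (dimv_add_leqif _ _) _; rewrite leq_add.
Qed.

(** Each compatible unlabelled full diagram is one of the [X e], assembled from dangles of the
    classes, followed by a permutation within the blocks. So the weight space is spanned by the
    images of [dT] under these finitely many diagrams; the bounds [pdim] then multiply up to the
    dimension of [NN]. *)
Lemma dim_eom : (\dim (limg (eom C om)) <= dim NN)%N.
Proof.
pose EE : finType := {dffun forall r, pE (P r)}.
have /fin_all_exists[X XP] (e : EE) : exists X : diag 'I_m N b,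
    (forall v, lab X v = 0) /\ forall r, is_part (@f r) (@h r) X (@pe r _ _ _ _ (M r) (P r) (e r)).
  exact: assemble.
pose L e : 'Hom(dT C, C N) := (eom C om \o lin_of (@dgen_lin _ _ _ _ _ _ C N (X e)))%VF.
have LE e t : L e t = eom C om (dgen (X e) t) by rewrite comp_lfunE lin_ofE.
pose U := (\sum_(e : EE) limg (L e))%VS.
have sub : (limg (eom C om) <= U)%VS.
  apply/subvP=> _ /memv_imgP[w _ ->].
  suff EU : (eom C om @^-1: U)%VS = fullv by have := memvf w; rewrite -EU -memv_preim.
  apply: (@d_span _ _ _ _ _ _ C) => d v fd; rewrite -memv_preim.
  have [cd|nc] := boolP (compat om cmu d); last first.
    by rewrite (wt_nc xi_prim _ (@eom_wt _ _ _ _ xi_prim _ _ C _ om)) // mem0v.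
  rewrite (wt_gauge1 xi_prim _ _ (@eom_wt _ _ _ _ xi_prim _ _ C _ om)) memvZ //.
  set d0 := relab _ d.
  have cd0 : compat om cmu d0 by rewrite (compat_mate om cmu (mate_relab _ d)).
  have fd0 : full d0.
    by apply/fullP=> j; have [i Ei] := fullP _ fd j; exists i; rewrite mate_relab.
  have /fin_all_exists[z zP] r := part_exists fB hB clsN f_cls h_cls 'I_1 r cd0.
  have /fin_all_exists[e eP] r : exists e : pE (P r), exists s g,
      is_part (@h r) (@h r) (pdiag s) g /\ z r = comp (@pe r _ _ _ _ (M r) (P r) e) g.
    by apply: pe_fac; [exact: part_compat (zP r) cd0|exact: part_full (zP r) fd0].
  have /fin_all_exists[s sP] := eP; have /fin_all_exists[g gP] := sP.
  (* Each class supplies permutations of all blocks, of which only those of its own colours are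
     kept. *)
  pose s0 : {dffun forall r : 'I_m, 'S_(sz r)} := [ffun r => s (cls r) r].
  pose e0 : EE := [ffun r => e r].
  have [X0 X0P] := XP e0.
  have bs r j : bperm s0 (@h r j) = bperm (s r) (@h r j).
    have := h_cls j; rewrite -[@h r j](tagnat.sig2K (p_ := sz)) /bcol tagnat.Rank1K => cr.
    by rewrite !bperm_Rank ffunE cr.
  have gP0 r : is_part (@h r) (@h r) (pdiag s0) (g r).
    have [/is_partP gp _] := gP r; apply/is_partP=> u; rewrite gp.
    case: u => j; first by rewrite !mate_wdl /= bs.
    have [i Ei] : exists i, mate (pdiag (s r)) (inr (@h r j)) = inl (@h r i).
      have /= := gp (inr j); rewrite !mate_wdr; case: (mate (g r) _) => i //= [<-]; by exists i.
    rewrite /= Ei; apply: (can_inj (mateK (pdiag s0))); rewrite mateK mate_wdl /= bs.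
    by have := congr1 (mate (pdiag (s r))) Ei; rewrite mateK mate_wdl /= => ->.
  have -> : d0 = comp (X e0) (pdiag s0).
    apply: (parts_det (y := z) fB hB) => // [u|u|r].
    - exact: lab_relab.
    - apply/unlP/unl_comp; apply/unlP=> // -[] j; rewrite ?lab_wdl ?lab_wdr ffunE //.
      exact: oppr0.
    - by have [_ ->] := gP r; apply: part_comp => //; have := X0P r; rewrite ffunE.
  rewrite dgen_s -LE.
  apply: (subvP (sumv_sup e0 _ (subvv _))) => //.
  by rewrite memv_img ?memvf.
apply: leq_trans (dimvS sub) _; apply: leq_trans (dim_sumv (n := dim (dT C)) _) _.
  move=> e; rewrite -dimvf; have := limg_ker_dim (L e) fullv.
  by move=> <-; apply: leq_addl.
rewrite dim_dT /NN dim_big card_dep_ffun foldrE big_map enumT /=.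
rewrite [X in (_ * X <= _)%N](partition_big cls predT) //=.
rewrite [X in (X * _ <= _)%N](eq_big_seq (fun r => #|pE (P r)|)) // -[Finite.enum _]/(index_enum _) -big_split /=.
by apply: leq_prod => r _; exact: (pdim (P r)).
Qed.

(** Since [ppi] maps the weight space onto [NN], and the weight space is not larger, [ppi] is
    injective there. Any preimage, projected by [eom], is then the inverse. *)
Lemma sec_ex : exists i : 'Hom(NN, C N),
  (forall n, ppi (i n) = n) /\ forall w, i (ppi w) = eom C om w.
Proof.
exists (eom C om \o ppi^-1)%VF.
have K n : ppi ((ppi^-1)%VF n) = n by apply: limg_lfunVK; rewrite ppi_onto memvf.
have pe v : ppi (eom C om v) = ppi v by apply: (wt_eom xi_prim m_unit); exact: ppi_wt.
split=> [n|w]; rewrite comp_lfunE /= ?pe //.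
apply/eqP; rewrite -subr_eq0 -linearB /=; set u := _ - w.
have pu : ppi (eom C om u) = 0 by rewrite pe linearB /= K subrr.
have inter : (limg (eom C om) :&: lker ppi)%VS = 0%VS.
  apply/eqP; rewrite -dimv_eq0 -leqn0 -(leq_add2r (dim NN)) add0n.
  apply: leq_trans dim_eom; rewrite -(limg_ker_dim ppi (limg (eom C om))) leq_add2l.
  rewrite -dimvf -ppi_onto; apply: dimvS; apply/subvP=> _ /memv_imgP[v _ ->].
  by rewrite -pe !memv_img ?memvf.
rewrite -memv0 -inter memv_cap memv_img ?memvf //= memv_ker pu.
by [].
Qed.
End OneCell.
End PiMap.

(** * Diagrams with arcs factor through a cap and a cup *)

Section Surgery.
Variable Z : finZmodType.

Section Mk.
Variables (a b : nat) (M : 'I_a + 'I_b -> 'I_a + 'I_b) (L : 'I_a + 'I_b -> Z).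
Hypotheses (MK : involutive M) (Mn : forall v, M v != v) (LM : forall v, L (M v) = - L v).

Lemma mk_is_diag : is_diag [ffun v => (M v, L v)].
Proof. by apply/forallP=> v; rewrite !ffunE /= Mn MK LM !eqxx. Qed.

Definition mk : diag Z a b := Sub _ mk_is_diag.
Lemma mate_mk v : mate mk v = M v. Proof. by rewrite /mate /= ffunE. Qed.
Lemma lab_mk v : lab mk v = L v. Proof. by rewrite /lab /= ffunE. Qed.
End Mk.

Section Swap.
Variables (a b : nat) (d : diag Z a b) (w w' : 'I_a + 'I_b).
Let s v := tperm w w' v.

Lemma swapK : involutive (fun v => s (mate d (s v))).
Proof. by move=> v; rewrite /s tpermK mateK tpermK. Qed.
Lemma swapn v : s (mate d (s v)) != v.
Proof. by rewrite -(inj_eq (@perm_inj _ (tperm w w'))) tpermK mate_neq. Qed.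
Lemma swapL v : lab d (s (s (mate d (s v)))) = - lab d (s v).
Proof. by rewrite /s tpermK lab_mate. Qed.

Definition swap : diag Z a b := mk swapK swapn swapL.
Lemma mate_swap v : mate swap v = tperm w w' (mate d (tperm w w' v)).
Proof. exact: mate_mk. Qed.
Lemma lab_swap v : lab swap v = lab d (tperm w w' v).
Proof. exact: lab_mk. Qed.
End Swap.

(* The identity, except for a southern and a northern arc at i and j. *)
Definition capcup N (i j : 'I_N) (c : Z) : diag Z N N :=
  swap (wdiag ([ffun x => if (x == i) || (x == j) then c else 0], 1%g)) (inl j) (inr i).

Section CapCup.
Variables (N : nat) (i j : 'I_N) (c : Z).
Hypothesis ij : i != j.
Notation q := (capcup i j c).

Lemma cc_ni : mate q (inl i) = inl j /\ lab q (inl i) = c.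
Proof.
have ti : tperm (inl j) (inr i) (inl i) = inl i :> 'I_N + 'I_N.
  by rewrite tpermD // (inj_eq (@inl_inj _ _)) eq_sym.
by rewrite mate_swap lab_swap ti mate_wdl perm1 tpermR lab_wdl ffunE eqxx.
Qed.
Lemma cc_nj : mate q (inl j) = inl i /\ lab q (inl j) = - c.
Proof. by have [e l] := cc_ni; rewrite -e mateK lab_mate l. Qed.
Lemma cc_si : mate q (inr i) = inr j /\ lab q (inr i) = c.
Proof.
rewrite mate_swap lab_swap tpermR mate_wdl perm1 lab_wdl ffunE eqxx orbT.
by rewrite tpermD.
Qed.
Lemma cc_sj : mate q (inr j) = inr i /\ lab q (inr j) = - c.
Proof. by have [e l] := cc_si; rewrite -e mateK lab_mate l. Qed.
Lemma cc_n x : x != i -> x != j -> mate q (inl x) = inr x /\ lab q (inl x) = 0.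
Proof.
move=> xi xj; have tx : tperm (inl j) (inr i) (inl x) = inl x :> 'I_N + 'I_N.
  by rewrite tpermD // (inj_eq (@inl_inj _ _)) eq_sym.
rewrite mate_swap lab_swap tx mate_wdl lab_wdl perm1 ffunE (negPf xi) (negPf xj) tpermD //.
by rewrite (inj_eq (@inr_inj _ _)) eq_sym.
Qed.
Lemma cc_s x : x != i -> x != j -> mate q (inr x) = inl x /\ lab q (inr x) = 0.
Proof. by move=> xi xj; have [e l] := cc_n xi xj; rewrite -e mateK lab_mate l oppr0. Qed.

Lemma cc_nf : ~~ full q.
Proof. by apply/fullP=> /(_ i)[x]; have [-> _] := cc_si. Qed.
End CapCup.

(** A southern arc forces a northern one, because there are at least as many northern as southern
    nodes. Opening both arcs and joining their ends across gives [z'], and the cap and cup at i and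
    j restore them without closing a loop. *)
Lemma surgery a N (z : diag Z a N) : (N <= a)%N -> ~~ full z ->
  exists z' : diag Z a N, exists i j c, [/\ i != j, z = comp z' (capcup i j c) &
    forall (k : pzSemiRingType) (delta : Z -> k), loops z' (capcup i j c) delta = 1].
Proof.
move=> Na nf.
have [i [j Eij]] : exists i j, mate z (inr i) = inr j.
  move: nf; rewrite negb_forall => /existsP[i]; case E: (mate z _) => [//|j] _.
  by exists i, j.
have ij : i != j.
  by have := mate_neq z (inr i); rewrite Eij (inj_eq (@inr_inj _ _)) eq_sym.
have [x [y Exy]] : exists x y, mate z (inl x) = inl y.
  apply: contrapT => nx.
  have /fin_all_exists[f fP] x : exists w, mate z (inl x) = inr w.
    by case E: (mate z (inl x)) => [y|w]; [case: nx; exists x, y|exists w].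
  have f_inj : injective f.
    by move=> x x' e; have := fP x; rewrite e -fP => /(can_inj (mateK z)) [].
  have : (a < N)%N.
    rewrite -[a]card_ord -[X in (_ < X)%N](card_ord N) -(card_codom f_inj).
    apply: proper_card; apply/properP; split; first exact/subsetP.
    exists i => //; apply/codomP => -[x xi]; have := fP x.
    by rewrite -xi => /(congr1 (mate z)); rewrite mateK Eij.
  by rewrite ltnNge Na.
have xy : x != y by have := mate_neq z (inl x); rewrite Exy (inj_eq (@inl_inj _ _)) eq_sym.
(* In [z'] the arcs x - y and i - j become the through strands x - i and y - j; the label [c] of the
   southern arc is what passing through the cup must compensate. *)
pose c := lab z (inr i); pose z' := swap z (inl y) (inr i).
have Exy' : mate z (inl y) = inl x by rewrite -Exy mateK.
have Eij' : mate z (inr j) = inr i by rewrite -Eij mateK.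
have tx : tperm (inl y) (inr i) (inl x) = inl x :> 'I_a + 'I_N.
  by rewrite tpermD // (inj_eq (@inl_inj _ _)) eq_sym.
have tj : tperm (inl y) (inr i) (inr j) = inr j :> 'I_a + 'I_N.
  by rewrite tpermD.
have zx : mate z' (inl x) = inr i /\ lab z' (inl x) = lab z (inl x).
  by rewrite mate_swap lab_swap tx Exy tpermL.
have zj : mate z' (inr j) = inl y /\ lab z' (inr j) = - c.
  by rewrite mate_swap lab_swap tj Eij' tpermR -Eij lab_mate.
have zo v : v \notin [:: inl x; inl y; inr i; inr j] ->
    mate z' v = mate z v /\ lab z' v = lab z v.
  rewrite !inE !negb_or => /and4P[vx vy vi vj].
  have tv : tperm (inl y) (inr i) v = v by rewrite tpermD // eq_sym.
  rewrite mate_swap lab_swap tv; split=> //.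
  rewrite tpermD //; apply/eqP=> /(congr1 (mate z)); rewrite mateK ?Exy' ?Eij => e.
    by rewrite -e eqxx in vx.
  by rewrite -e eqxx in vj.
exists z', i, j, c; split=> //; last first.
  move=> k delta; apply: loops1 => w.
  have [->|wi] := eqVneq w i.
    exists 2; left; rewrite /= /cnext /= (proj1 (cc_ni c ij)) /= (proj1 zj).
    by [].
  have [->|wj] := eqVneq w j.
    exists 2; left; rewrite /= /cnext /= (proj1 (cc_nj c ij)) /= -(proj1 zx) mateK.
    by [].
  exists 1%N; left; by rewrite /= /cnext /= (proj1 (cc_n c wi wj)).
suff H v : mate (comp z' (capcup i j c)) v = mate z v /\ lab (comp z' (capcup i j c)) v = lab z v.
  by apply: diag_eq => v; case: (H v) => e l; rewrite ?e ?l.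
have half v' : (mate (comp z' (capcup i j c)) v' = mate z v' /\
    lab (comp z' (capcup i j c)) v' = lab z v') ->
    mate (comp z' (capcup i j c)) (mate z v') = mate z (mate z v') /\
    lab (comp z' (capcup i j c)) (mate z v') = lab z (mate z v').
  by case=> e l; rewrite -{1 3}e !lab_mate l !mateK.
have Hx : mate (comp z' (capcup i j c)) (inl x) = mate z (inl x) /\
    lab (comp z' (capcup i j c)) (inl x) = lab z (inl x).
  apply: walk_comp; have [e1 l1] := zx; have [e2 l2] := cc_ni c ij; have [e3 l3] := zj.
  have -> : lab z (inl x) = lab z' (inl x) + (lab (capcup i j c) (inl i) + lab z' (inr j)).
    by rewrite l1 l2 l3 subrr addr0.
  apply: WalkStep; rewrite /cnext /= ?e1 //=.
  apply: WalkStep; rewrite /cnext /= ?e2 //=.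
  by apply: WalkEnd; rewrite /= e3 Exy.
have Hi : mate (comp z' (capcup i j c)) (inr i) = mate z (inr i) /\
    lab (comp z' (capcup i j c)) (inr i) = lab z (inr i).
  apply: walk_comp; have [e2 l2] := cc_si c ij.
  have -> : lab z (inr i) = lab (capcup i j c) (inr i) by rewrite l2.
  by apply: WalkEnd; rewrite /= e2 Eij.
have [|vo] := boolP (v \in [:: inl x; inl y; inr i; inr j]).
  rewrite !inE => /or4P[]/eqP-> //.
    by rewrite -Exy; apply: half.
  by rewrite -Eij; apply: half.
have mo : mate z v \notin [:: inl x; inl y; inr i; inr j].
  apply: contra vo; rewrite !inE => /or4P[]/eqP/(congr1 (mate z)); rewrite mateK => ->;
    by rewrite ?Exy ?Exy' ?Eij ?Eij' eqxx ?orbT.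
have tail s v0 : across z' (capcup i j c) s = inl v0 -> v0 \notin [:: inl x; inl y; inr i; inr j] ->
    walk_to z' (capcup i j c) s v0 (slab z' (capcup i j c) s).
  move=> e; case: v0 e => w e nw; first exact: WalkEnd.
  move: nw; rewrite !inE !negb_or => /and4P[_ _ wi wj]; rewrite -[slab _ _ s]addr0.
  have [e0 l0] := cc_n c wi wj.
  have -> : 0 = lab (capcup i j c) (inl w) by rewrite l0.
  apply: WalkStep; first by rewrite e.
  have -> : cnext z' (capcup i j c) s = inr (inl w) by rewrite /cnext e.
  have := @WalkEnd _ _ _ _ z' (capcup i j c) (inr (inl w)) (inr w); apply.
  by rewrite /= e0.
apply: walk_comp; have [e1 l1] := zo v vo; rewrite -l1.
case: v vo mo e1 l1 => w vo mo e1 l1; first by apply: tail; rewrite //= e1.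
move: (vo); rewrite !inE !negb_or => /and4P[_ _ wi wj]; have [e0 l0] := cc_s c wi wj.
rewrite -[lab z' _]add0r; have -> : 0 = lab (capcup i j c) (inr w) by rewrite l0.
apply: WalkStep; first by rewrite /= e0.
have -> : cnext z' (capcup i j c) (inner N (inr w)) = inl (inr w) by rewrite /cnext /= e0.
by apply: tail; rewrite //= e1.
Qed.

End Surgery.

(** * Cutting down the number of nodes *)

Section Chain.
Variables (Z : finZmodType) (k : fieldType) (delta : Z -> k).
Hypothesis deltaN : forall i, delta (- i) = delta i.

(** The diagrams needed for an idempotent cutting a nodes down to b: the stack of [v] above [u] is
    the identity times a non-zero loop scalar. *)
Definition linked a b := exists u : diag Z a b, exists v : diag Z b a,
  comp v u = idd Z b /\ loops v u delta != 0.

Lemma linked_refl a : linked a a.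
Proof.
by exists (idd Z a), (idd Z a); rewrite comp_idl /idd loops_wdiagl oner_neq0.
Qed.

Lemma linked_trans a b c : linked a b -> linked b c -> linked a c.
Proof.
move=> [u1 [v1 [e1 n1]]] [u0 [v0 [e0 n0]]]; exists (comp u1 u0), (comp v0 v1).
have e : comp (comp v0 v1) u1 = v0 by rewrite comp_assoc e1 comp_idr.
split; first by rewrite -comp_assoc e.
have h1 := loops_assoc v0 v1 u1 deltaN; rewrite e1 /idd loops_wdiagr mulr1 in h1.
have {}h1 : loops (comp v0 v1) u1 delta != 0.
  by apply: contraNneq n1 => h; rewrite -h1 h mulr0.
have h2 := loops_assoc (comp v0 v1) u1 u0 deltaN; rewrite e in h2.
have : loops (comp v0 v1) u1 delta * loops v0 u0 delta != 0 by rewrite mulf_neq0.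
by rewrite h2 mulf_eq0 negb_or => /andP[].
Qed.

(** The last three nodes carry a zigzag: a northern arc of [u] and a southern arc of [w], shifted
    against each other by one node, straighten out when stacked. No loop arises, so the scalar is
    1. *)
Lemma linked_step a : linked a.+3 a.+1.
Proof.
pose Mu (v : 'I_a.+3 + 'I_a.+1) : 'I_a.+3 + 'I_a.+1 :=
  match v with
  | inl x => if (x < a)%N then inr (inord x) else if x == a :> nat then inl (inord a.+1)
             else if x == a.+1 :> nat then inl (inord a) else inr (inord a)
  | inr y => if (y < a)%N then inl (inord y) else inl (inord a.+2)
  end.
pose Mv (v : 'I_a.+1 + 'I_a.+3) : 'I_a.+1 + 'I_a.+3 :=
  match v with
  | inl x => inr (inord x)
  | inr y => if (y <= a)%N then inl (inord y) else if y == a.+1 :> nat then inr (inord a.+2)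
             else inr (inord a.+1)
  end.
have MuK : involutive Mu.
  case=> x; have ltx := ltn_ord x; rewrite {2}/Mu; do ?[case: ifP => ?];
    rewrite /Mu ?inordK; try (exfalso; lia); try lia; do ?[case: ifP => ?];
    try (exfalso; lia); congr (_ _); apply: ord_inj; rewrite inordK; lia.
have Mun v : Mu v != v.
  case: v => x; rewrite /Mu; have := ltn_ord x; do ?[case: ifP => ?] => //= ?;
    apply/eqP=> -[] /(congr1 val) /=; rewrite inordK; lia.
have MvK : involutive Mv.
  case=> x; have ltx := ltn_ord x; rewrite {2}/Mv; do ?[case: ifP => ?];
    rewrite /Mv ?inordK; try (exfalso; lia); try lia; do ?[case: ifP => ?];
    try (exfalso; lia); congr (_ _); apply: ord_inj; rewrite inordK; lia.
have Mvn v : Mv v != v.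
  case: v => x; rewrite /Mv; have := ltn_ord x; do ?[case: ifP => ?] => //= ?;
    apply/eqP=> -[] /(congr1 val) /=; rewrite inordK; lia.
have L0 (T : Type) (M : T -> T) (v : T) : 0 = - 0 :> Z by rewrite oppr0.
pose u := mk MuK Mun (L0 _ Mu); pose w := mk MvK Mvn (L0 _ Mv).
exists u, w.
have w1 (x : 'I_a.+1) : Mv (inl x) = inr (inord x) by [].
have u1 (x : 'I_a.+1) : (x < a)%N -> Mu (inl (inord x)) = inr x.
  move=> lt; rewrite /Mu inordK ?lt; last by lia.
  by congr inr; apply: ord_inj; rewrite inordK; lia.
have u2 : Mu (inl (inord a)) = inl (inord a.+1).
  by rewrite /Mu inordK ?ltnn ?eqxx //; lia.
have v2 : Mv (inr (inord a.+1)) = inr (inord a.+2).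
  by rewrite /Mv inordK ?ltnn ?eqxx //; lia.
have u3 (x : 'I_a.+1) : x = a :> nat -> Mu (inl (inord a.+2)) = inr x.
  move=> xa; rewrite /Mu inordK; last by lia.
  do 3![case: ifP; first by lia]; move=> _ _ _.
  by congr inr; apply: ord_inj; rewrite inordK; lia.
have lu v : lab u v = 0 by exact: lab_mk.
have lw v : lab w v = 0 by exact: lab_mk.
have H x : mate (comp w u) (inl x) = inr x /\ lab (comp w u) (inl x) = 0.
  have st : 0 = slab w u (inl (inl x)) + 0 by rewrite /= lw addr0.
  apply: walk_comp; rewrite st; apply: WalkStep; rewrite /cnext /= mate_mk //=.
  have [lt|ge] := ltnP x a.
    have -> : 0 = slab w u (inr (inl (inord x))) by rewrite /= lu.
    by apply: WalkEnd; rewrite /= mate_mk u1.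
  have xa : x = a :> nat by have := ltn_ord x; lia.
  rewrite xa; have -> : 0 = slab w u (inr (inl (inord a))) + 0 by rewrite /= lu addr0.
  apply: WalkStep; rewrite /cnext /= mate_mk u2 //=.
  have -> : 0 = slab w u (inl (inr (inord a.+1))) + 0 by rewrite /= lw addr0.
  apply: WalkStep; rewrite /cnext /= mate_mk v2 //=.
  have -> : 0 = slab w u (inr (inl (inord a.+2))) by rewrite /= lu.
  by apply: WalkEnd; rewrite /= mate_mk (u3 x).
split.
  have e x : mate (comp w u) (inr x) = inl x by rewrite -(proj1 (H x)) mateK.
  have e0 x : lab (comp w u) (inr x) = 0 by rewrite -(proj1 (H x)) lab_mate (proj2 (H x)) oppr0.
  apply: diag_eq => -[] x.
  - by rewrite mate_wdl perm1; case: (H x).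
  - by rewrite e mate_wdr invg1 perm1.
  - by rewrite lab_wdl ffunE; case: (H x).
  - by rewrite e0 lab_wdr ffunE oppr0.
suff -> : loops w u delta = 1 by exact: oner_neq0.
apply: loops1 => j; have ltj := ltn_ord j.
have [le|gt] := leqP j a.
  by exists 1%N; right; rewrite /= /cnext /= mate_mk /Mv le.
have [ja|ja] := eqVneq (j : nat) a.+1.
  exists 2; left; rewrite /= /cnext /= mate_mk /Mu.
  do 2![case: ifP; first by lia]; move=> _ _; rewrite ja eqxx /= mate_mk /Mv.
  by rewrite inordK ?leqnn //; lia.
exists 1%N; left; rewrite /= /cnext /= mate_mk /Mu.
by do 3![case: ifP; first by lia].
Qed.

(** Without through strands the two arcs must close up. Labelling one of them by [i] makes the
    scalar delta i, up to the direction of the loop. *)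
Lemma linked0 i : delta i != 0 -> linked 2 0.
Proof.
move=> ni; pose Mu (v : 'I_2 + 'I_0) : 'I_2 + 'I_0 :=
  match v with inl x => inl (rev_ord x) | inr y => inr y end.
pose Mw (v : 'I_0 + 'I_2) : 'I_0 + 'I_2 :=
  match v with inr x => inr (rev_ord x) | inl y => inl y end.
pose Lu (v : 'I_2 + 'I_0) : Z :=
  match v with inl x => if x == 0 :> nat then i else - i | inr y => 0 end.
have r2 (x : 'I_2) : rev_ord x != x by apply/eqP=> /(congr1 val) /=; have := ltn_ord x; lia.
have MuK : involutive Mu by move=> [x|[]] //=; rewrite rev_ordK.
have Mun v : Mu v != v by case: v => [x|[]] //=; rewrite (inj_eq (@inl_inj _ _)) r2.
have MwK : involutive Mw by move=> [[]|x] //=; rewrite rev_ordK.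
have Mwn v : Mw v != v by case: v => [[]|x] //=; rewrite (inj_eq (@inr_inj _ _)) r2.
have LuM v : Lu (Mu v) = - Lu v.
  case: v => [x|[]//] /=; have := ltn_ord x; case: (x : nat) => [|[|//]] _ //=.
  by rewrite opprK.
have L0 (v : 'I_0 + 'I_2) : 0 = - 0 :> Z by rewrite oppr0.
pose u := mk MuK Mun LuM; pose w : diag Z 0 2 := mk (L := fun=> 0) MwK Mwn L0.
exists u, w; split; first by apply: diag_eq => -[] [].
apply/prodf_neq0 => j _; rewrite loop_labelE walk_labelE.
have phij (x : 'I_2) : cnext w u (inr (inl x)) = inl (inr (rev_ord x)) by rewrite /cnext /= mate_mk.
have phi2 (x : 'I_2) : cnext w u (inl (inr x)) = inr (inl (rev_ord x)) by rewrite /cnext /= mate_mk.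
have E t : fconnect (cnext w u) (inr (inl j)) t = (t == inr (inl j)) || (t == inl (inr (rev_ord j))).
  apply/idP/orP=> [/iter_findex <-|[/eqP->|/eqP->]].
  - elim: (findex _ _ _) => [|n [/eqP e|/eqP e]]; first by left.
      by right; rewrite /= e phij.
    by left; rewrite /= e phi2 rev_ordK.
  - exact: connect0.
  - by rewrite -phij fconnect1.
have -> : \sum_(t | fconnect (cnext w u) (inr (inl j)) t) slab w u t
    = lab u (inl j) + lab w (inr (rev_ord j)).
  rewrite (eq_bigl _ _ E) (bigD1 (inr (inl j))) ?eqxx //; congr (_ + _).
  rewrite (big_pred1 (inl (inr (rev_ord j)))) // => t /=.
  by have [->|nt] := eqVneq t (inr (inl j)); rewrite ?andbT.
by rewrite !lab_mk addr0 /Lu; case: ifP => _ //; rewrite deltaN.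
Qed.

(** Pairs of nodes are removed by zigzags as long as a node remains; a loop is used only for the
    last step from 2 nodes to 0. *)
Lemma linkedE N t :
  (N = 0%N -> exists i, delta i != 0) -> linked (N + t.*2) N.
Proof.
move=> h; elim: t => [|t IHt]; first by rewrite addn0; apply: linked_refl.
apply: linked_trans IHt; rewrite doubleS !addnS.
case E: (N + t.*2)%N => [|a]; last exact: linked_step.
have [|i] := h; first by lia.
exact: linked0.
Qed.

End Chain.

Lemma sum_fibre (k : fieldType) (T D : finType) (V : vectType k) (g : T -> D)
  (a : T -> k) (F : D -> V) :
  \sum_t a t *: F (g t) = \sum_x (\sum_(t | g t == x) a t) *: F x.
Proof.
rewrite (partition_big g predT) //=; apply: eq_bigr => x _.
by rewrite scaler_suml; apply: eq_bigr => t /eqP->.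
Qed.

(** * The corner of a cell module at a weight *)

Section CornerOf.
Variables (k : closedFieldType) (m' : nat) (xi : k) (delta : 'I_m'.+1 -> k).
Notation m := m'.+1.
Hypothesis xi_prim : m.-primitive_root xi.
Hypothesis m_unit : m%:R != 0 :> k.
Hypothesis deltaN : forall i, delta (- i) = delta i.
Variable cls : 'I_m -> 'I_m.
Hypothesis clsN : forall c, cls (- c) = cls c.
Variables (N : nat) (om : 'I_N -> 'I_m) (p : 'I_m -> nat) (f : forall r, 'I_(p r) -> 'I_N).
Hypothesis fB : bijective (tagf f).
Hypothesis f_mono : forall r (i j : 'I_(p r)), (i < j)%N -> (@f r i < @f r j)%N.
Hypothesis f_cls : forall r i, cls (om (@f r i)) = r.
Hypothesis dbarf : forall r i, dbar xi delta (om (@f r i)) = dbar xi delta r.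
Variables (n : nat) (u : diag 'I_m n N) (v : diag 'I_m N n).
Hypothesis vu : comp v u = idd _ N.
Hypothesis c_neq0 : loops v u delta != 0.
Notation c := (loops v u delta).
Notation Dp := (DD' om f).
Notation y1 := ([ffun r => DD1 om f r] : Dp).
Notation parts X y := (forall r, is_part (@f r) (@f r) X (val ((y : Dp) r))).

Lemma parts_ex (X : diag 'I_m N N) : compat om om X -> exists y : Dp, parts X y.
Proof.
move=> cX; have /fin_all_exists[y yP] r : exists y : @DD m' N om p f r, is_part (@f r) (@f r) X (val y).
  have [y yP] := part_exists fB fB clsN f_cls f_cls 'I_1 r cX.
  by exists (Sub y (part_compat yP cX)).
by exists [ffun r => y r] => r; rewrite ffunE.
Qed.

Lemma asm_ex (y : Dp) : exists X : diag 'I_m N N, [/\ unl X, compat om om X & parts X y].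
Proof.
have [X [X0 XP]] := assemble 'I_m fB fB (fun r => val (y r)).
exists X; split=> //; first exact/unlP.
by apply: (parts_compat fB fB XP) => r; apply: (valP (y r)).
Qed.

(** The default concerns only diagrams incompatible with the colours, to which [kapC] gives the
    coefficient 0. *)
Definition partsY (z : diag 'I_m N N) : Dp :=
  odflt y1 [pick y : Dp | [forall r, is_part (@f r) (@f r) z (val (y r))]].

Lemma partsYP z : compat om om z -> parts z (partsY z).
Proof.
move=> cz; rewrite /partsY; case: pickP => [y /forallP //|no].
by have [y yP] := parts_ex cz; case/negP: (negbT (no y)); apply/forallP.
Qed.

Definition asmX (y : Dp) : diag 'I_m N N := sval (cid (asm_ex y)).
Lemma asmXP y : [/\ unl (asmX y), compat om om (asmX y) & parts (asmX y) y].
Proof. exact: (svalP (cid (asm_ex y))). Qed.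

(** The coefficient of [y] in c^-1 e v x u e, for e the weight idempotent: the scalars of the two
    stackings, times the gauge weight of the resulting diagram on N nodes. *)
Definition kapC (x : diag 'I_m n n) (y : Dp) : k :=
  let z := comp (comp v x) u in
  c^-1 * (loops v x delta * loops (comp v x) u delta) *
    (if compat om om z && (y == partsY z) then wt xi om om z else 0).

(** The terms of c^-1 u e X e v with both idempotents expanded over label vectors, where X is
    assembled from [y]; [cyS] holds the scalars and [cyC] collects equal diagrams. *)
Definition cyD (y : Dp) (l : {ffun 'I_N -> 'I_m} * {ffun 'I_N -> 'I_m}) : diag 'I_m n n :=
  comp (comp u (comp (tl l.1) (comp (asmX y) (tl l.2)))) v.

Definition cyS (y : Dp) (l : {ffun 'I_N -> 'I_m} * {ffun 'I_N -> 'I_m}) : k :=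
  let Q := comp (tl l.1) (comp (asmX y) (tl l.2)) in
  c^-1 * (m%:R ^- N * (chi xi om l.1)^-1) * (m%:R ^- N * (chi xi om l.2)^-1) *
  (loops u Q delta * loops (comp u Q) v delta).

Definition cyC (y : Dp) (x : diag 'I_m n n) : k := \sum_(l | cyD y l == x) cyS y l.

Definition stC (x x' z : diag 'I_m n n) : k :=
  if comp x x' == z then loops x x' delta else 0.

(** The weight space identified with a module over the product of the factor algebras. All that
    follows depends on the cell module only through this record, so the same structure constants
    serve for lam and mu. *)
Record fourier (sz : 'I_m -> nat) (S : forall r, rep k 'S_(sz r)) (C : dcell xi delta S)
    (Y : rep k Dp) := Fourier {
  fpi : 'Hom(C N, Y);
  fi : 'Hom(Y, C N);
  f_wt : of_weight om fpi;
  f_act : forall X (y : Dp) w, unl X -> compat om om X -> parts X y ->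
    fpi (dact C X (eom C om w)) = act Y y (fpi w);
  f_pi : forall z, fpi (fi z) = z;
  f_ip : forall w, fi (fpi w) = eom C om w;
  f_1 : forall z, act Y y1 z = z }.

Section OneCell.
Variables (sz : 'I_m -> nat) (S : forall r, rep k 'S_(sz r)) (C : dcell xi delta S).
Variables (Y : rep k Dp) (F : fourier C Y).
Notation eC := (eom C om).

Lemma fi_e z : eC (fi F z) = fi F z. Proof. by rewrite -(f_ip F) f_pi. Qed.

Lemma f_unl z w : compat om om z -> fpi F (dact C z (eC w)) =
  wt xi om om z *: act Y (partsY z) (fpi F w).
Proof.
move=> cz; rewrite (wt_gauge2 xi_prim _ _ (f_wt F)).
rewrite (f_act F (y := partsY z)) //.
- by apply/unlP=> w'; rewrite lab_relab.
- by rewrite (compat_mate om om (mate_relab _ z)).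
by move=> r; rewrite (is_part_mate _ _ _ (mate_relab _ z)) partsYP.
Qed.

Lemma f_any z w : fpi F (dact C z (eC w)) =
  if compat om om z then wt xi om om z *: act Y (partsY z) (fpi F w) else 0.
Proof.
case: ifP => [|/negbT]; first exact: f_unl.
by apply: (wt_nc2 xi_prim); apply: f_wt.
Qed.

Definition cornerI : 'Hom(Y, drep C n) := (dact C u \o fi F)%VF.
Definition cornerP : 'Hom(drep C n, Y) := c^-1 *: (fpi F \o dact C v)%VF.

Lemma cornerIE z : cornerI z = dact C u (fi F z). Proof. exact: comp_lfunE. Qed.
Lemma cornerPE w : cornerP w = c^-1 *: fpi F (dact C v w).
Proof. by rewrite scale_lfunE comp_lfunE. Qed.

Lemma eomeom X w : eC (dact C X (eC w)) = \sum_l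
  ((m%:R ^- N * (chi xi om l.1)^-1) * (m%:R ^- N * (chi xi om l.2)^-1)) *:
    dact C (comp (tl l.1) (comp X (tl l.2))) w.
Proof.
rewrite -(pair_bigA _ (fun l l' => ((m%:R ^- N * (chi xi om l)^-1) * (m%:R ^- N * (chi xi om l')^-1)) *:
    dact C (comp (tl l) (comp X (tl l'))) w)) /=.
rewrite eomE scaler_sumr; apply: eq_bigr => l _.
rewrite eomE !linearZ !linear_sum /= !scaler_sumr; apply: eq_bigr => l' _.
rewrite !linearZ /= dact_tr dact_tl !scalerA; congr (_ *: _).
by rewrite !mulrA [RHS](ACl (1*3*4*2)).
Qed.

Lemma cornerC : corner kapC cyC stC y1 cornerI cornerP.
Proof.
split.
- move=> z; rewrite cornerPE cornerIE dactM vu dact_id linearZ /= f_pi scalerA mulVf //.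
  by rewrite scale1r.
- move=> x z; rewrite cornerPE cornerIE -[act _ x]/(dact C x) -[fi F z]fi_e.
  rewrite dactM dactM !linearZ /= !scalerA f_any f_pi.
  rewrite (bigD1 (partsY (comp (comp v x) u))) //= big1 => [|y ny].
    rewrite addr0 /kapC eqxx andbT; case: ifP => _; last by rewrite !scaler0 mulr0 scale0r.
    rewrite scalerA !mulrA.
    by rewrite [X in X *: _ = _](ACl (3*1*2*4)).
  by rewrite /kapC (negPf ny) andbF mulr0 scale0r.
- move=> y w; have [uX cX yX] := asmXP y.
  rewrite cornerPE cornerIE -[act _ _]/(act Y y).
  rewrite -sum_fibre [act Y y _]linearZ /= -(f_act F _ uX cX yX) [fi F _]linearZ /= f_ip eomeom !linearZ /= !linear_sum /=.
  apply: eq_bigr => l _; rewrite !linearZ /= dactM !linearZ /= dactM !scalerA.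
  rewrite /cyS /cyD /= ?mulrA.
  by rewrite [X in _ = X *: _](ACl (1*6*2*3*4*5*7)).
- move=> x x' w; rewrite (bigD1 (comp x x')) //= big1 => [|z nz].
    by rewrite /stC eqxx addr0; apply: dactM.
  by rewrite /stC eq_sym (negPf nz) scale0r.
exact: (f_1 F).
Qed.

End OneCell.

End CornerOf.

(** * The cell module of lam in the corner of its own weight *)

Section OwnWeight.
Variables (k : closedFieldType) (m' : nat) (xi : k) (delta : 'I_m'.+1 -> k).
Notation m := m'.+1.
Hypothesis xi_prim : m.-primitive_root xi.
Hypothesis m_unit : m%:R != 0 :> k.
Hypothesis deltaN : forall i, delta (- i) = delta i.
Variable cls : 'I_m -> 'I_m.
Hypothesis clsN : forall c, cls (- c) = cls c.
Variables (lsz : 'I_m -> nat) (SL : forall r, rep k 'S_(lsz r)) (CL : dcell xi delta SL).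
Notation N := (\sum_(r < m) lsz r)%N.
Notation om := (@bcol m' lsz).
Variables (p : 'I_m -> nat) (f : forall r, 'I_(p r) -> 'I_N).
Hypothesis fB : bijective (tagf f).
Hypothesis f_cls : forall r i, cls (om (@f r i)) = r.
Notation Dp := (DD' om f).
Variables (YL : rep k Dp) (FL : fourier CL YL).
Notation w0 t := (dgen (idd 'I_m N) (dpure CL t)).

Lemma dgen_w0 a (d : diag 'I_m a N) t : dact CL d (w0 t) = dgen d (dpure CL t).
Proof. by rewrite dact_gen /idd loops_wdiagr scale1r -/(idd _ _) comp_idr. Qed.

Lemma eom_fix sz (S : forall r, rep k 'S_(sz r)) (D : dcell xi delta S) w :
  (forall l, dact D (tl l) w = chi xi om l *: w) -> eom D om w = w.
Proof.
move=> hw; rewrite eomE (eq_bigr (fun=> w)) => [|l _]; last first.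
  by rewrite hw scalerA mulVf ?scale1r //; exact: chi_neq0.
rewrite sumr_const cardT -cardE card_ffun !card_ord -scaler_nat scalerA natrX mulVf ?scale1r //.
by rewrite expf_neq0.
Qed.

(** Labels in front of the identity diagram can be moved behind it, where they act on the Specht
    part by the colours of the blocks, that is by [om]. *)
Lemma eom_w0 t : eom CL om (w0 t) = w0 t.
Proof.
apply: eom_fix => l.
by rewrite dgen_w0 -[tl l]comp_idl dgen_tr.
Qed.

Section Gen.
Variables (n : nat) (u : diag 'I_m n N) (v : diag 'I_m N n).
Hypothesis vu : comp v u = idd _ N.
Hypothesis c_neq0 : loops v u delta != 0.

(** Every generator is d applied to [w0], and [w0] lies in the weight space; passing through [u] and
    back through [v] costs only the non-zero scalar c. *)
Lemma own_gen : corner_gen (M := drep CL n) (cornerI u FL).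
Proof.
move=> U /submodP sU hU; apply: (@d_span _ _ _ _ _ _ CL) => d t fd.
have -> : dgen d (dpure CL t) =
    (loops v u delta)^-1 *: (loops d v delta *: dact CL (comp d v) (dact CL u (w0 t))).
  by rewrite -dactM [dact CL v _]dactM vu dact_id linearZ /= scalerA mulVf // scale1r dgen_w0.
rewrite !memvZ // (sU (comp d v)) //.
by rewrite -eom_w0 -(f_ip FL) -cornerIE.
Qed.

Section Ext.
Variables (sz : 'I_m -> nat) (S : forall r, rep k 'S_(sz r)) (C : dcell xi delta S).
Variables (Y : rep k Dp) (F : fourier C Y) (g : 'Hom(YL, Y)).
Hypothesis hg : forall y z, g (act YL y z) = act Y y (g z).
Notation v0 t := (fi F (g (fpi FL (w0 t)))).

(** The vectors [v0] are candidates for the images of the [w0] under an extension of [g]. Seen from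
    the corner, every diagram on N nodes treats them accordingly. *)
Let L1 (z : diag 'I_m N N) t :
  fpi F (dact C z (v0 t)) = g (fpi FL (dact CL z (w0 t))).
Proof.
rewrite -[in LHS](fi_e F) -[in RHS]eom_w0 (f_any xi_prim clsN fB f_cls F) (f_any xi_prim clsN fB f_cls FL).
by case: ifP; rewrite ?linear0 // linearZ /= hg f_pi.
Qed.

Let L2 (z : diag 'I_m N N) t : ~~ full z -> fpi F (dact C z (v0 t)) = 0.
Proof. by move=> nf; rewrite L1 dgen_w0 dgen_nf // !linear0. Qed.

Let act_v0 l t : dact C (tl l) (v0 t) = chi xi om l *: v0 t.
Proof. by rewrite -[in LHS](fi_e F) act_eom // fi_e. Qed.

(** From [L2] only the weight-om component of the cap-cup applied to [v0] is known to vanish. The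
    northern arc of the cap-cup carries a label, so its components of different weights can be told
    apart by reading that label, and the vanishing of one component forces the vector itself to be
    0. *)
Let L3 (i j : 'I_N) e t : i != j -> dact C (capcup i j e) (v0 t) = 0.
Proof.
move=> ij; set q := capcup i j e; set W := v0 t.
have [eqi li] := cc_ni e ij; have [eqj lj] := cc_nj e ij.
have [esi _] := cc_si e ij; have [esj _] := cc_sj e ij.
(* If the colours at i and j are not opposite, a label on the southern arc leaves the cap-cup
   unchanged but multiplies [v0] by a non-trivial root of unity. *)
have [oij|nij] := eqVneq (om i + om j) 0; last first.
  have [a na] : exists a, zeta xi (- om j - om i) a != 1.
    apply/existsP; apply: contraR nij => /existsPn h; rewrite -oppr_eq0 opprD addrC; apply/eqP.
    apply: (zeta_inj xi_prim) => l; rewrite zeta0l.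
    by have := h l; rewrite negbK => /eqP.
  pose gg := pairf q (inr i) a.
  have gN0 : gN gg = 0 by apply/ffunP=> x; rewrite !ffunE /gg /pairf esi.
  apply: (scale_fix na); have := gauge_sym (pairf_mate q (inr i) a); rewrite -/gg gN0 tl0 comp_idl => {1}<-.
  rewrite -dact_tr act_v0 linearZ; congr (_ *: _).
  by have := gfac_pairf xi_prim om om q (inr i) a; rewrite gfacE // -/gg gN0 chi0 mul1r esi.
have cq : compat om om q.
  have ojE : om j = - om i by apply/eqP; rewrite -addr_eq0 addrC oij.
  apply/compatP=> -[] x.
  - have [->|xi'] := eqVneq x i; first by rewrite eqi.
    have [->|xj] := eqVneq x j; first by rewrite eqj /= ojE opprK.
    by have [-> _] := cc_n e xi' xj.
  - have [->|xi'] := eqVneq x i; first by rewrite esi /= ojE.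
    have [->|xj] := eqVneq x j; first by rewrite esj /= ojE opprK.
    by have [-> _] := cc_s e xi' xj; rewrite /= opprK.
(* The projection onto generators whose northern nodes i and j are joined with label [e]. It
   respects the relations of the cell module because these only affect the southern side. *)
have [Om OmP] : exists Om : 'End(C N), forall d s, full d -> Om (dgen d (dpure C s)) =
    if (mate d (inl i) == inl j) && (lab d (inl i) == e) then dgen d (dpure C s) else 0.
  apply: (@d_univ _ _ _ _ _ _ C N (C N) (fun d s =>
    if (mate d (inl i) == inl j) && (lab d (inl i) == e) then dgen d (dpure C s) else 0)).
  - move=> d s r b1 x y; case: ifP => _; last by rewrite scaler0 addr0.
    by rewrite dpure_lin dgen_lin.
  - move=> d l s _; rewrite mate_tr lab_tr; have [em|] := eqVneq; last by rewrite scaler0.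
    by rewrite em /= subr0 addr0; case: ifP => _; rewrite ?scaler0 // dgen_tr.
  - move=> d s w _; have [/= -> ->] := comp_wdiagr d ([ffun=> 0], bperm s) (inl i).
    case E: (mate d (inl i)) => [x|x] //=; rewrite addr0 subr0.
    by case: ifP => // _; rewrite dgen_s.
have OmE (q' : diag 'I_m N N) w : mate q' (inl i) = inl j ->
    Om (dact C q' w) = if lab q' (inl i) == e then dact C q' w else 0.
  move=> e1; have c1 a' (d : diag 'I_m N a') :
      mate (comp q' d) (inl i) = inl j /\ lab (comp q' d) (inl i) = lab q' (inl i).
    by apply: walk_comp; apply: WalkEnd; rewrite /= e1.
  suff E : (Om \o dact C q')%VF = if lab q' (inl i) == e then dact C q' else 0.
    have := congr1 (fun h : 'End(C N) => h w) E; rewrite [LHS]comp_lfunE => ->.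
    by case: ifP => _; rewrite ?zero_lfunE.
  apply: dC_ext => d s _; rewrite [LHS]comp_lfunE dact_gen linearZ /=.
  have [fd|nf] := boolP (full (comp q' d)); last first.
    rewrite dgen_nf // !linear0 ?scaler0; case: ifP => _; rewrite ?zero_lfunE //.
    by rewrite dact_gen dgen_nf // scaler0.
  rewrite OmP // (proj1 (c1 _ d)) (proj2 (c1 _ d)) eqxx /=.
  by case: ifP => _; rewrite ?zero_lfunE ?scaler0 // dact_gen.
have e0 : eom C om (dact C q W) = 0 by rewrite -(f_ip F) L2 ?linear0 // cc_nf.
have := congr1 Om e0; rewrite eomE linearZ linear_sum linear0 /=.
(* A label vector l turns the label [e] of the northern arc into e + l i - l j, so [Om] keeps
   exactly the terms with l i = l j. Each of them equals the vector itself, and [K] is their number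
   in k. *)
pose K : k := \sum_(l : {ffun 'I_N -> 'I_m} | l i - l j == 0) 1.
have -> : \sum_(l : {ffun 'I_N -> 'I_m}) Om ((chi xi om l)^-1 *: dact C (tl l) (dact C q W))
    = K *: dact C q W.
  rewrite /K scaler_suml [RHS]big_mkcond; apply: eq_bigr => l _ /=.
  rewrite linearZ /= dact_tl OmE ?mate_tl // lab_tl eqi /= li.
  rewrite -addrA -[X in _ == X]addr0 (inj_eq (addrI _)); case: eqP => [/eqP lij|_]; last first.
    by rewrite scaler0.
  rewrite subr_eq0 in lij; move/eqP: lij => lij; rewrite scale1r.
  (* As l i = l j, the labels can be slid through the diagram to its southern side, with 0 at i and
     j; there the weight of [v0] turns them into a scalar. *)
  pose gg (x : 'I_N + 'I_N) := match x with inl x => l x | inr x => if (x == i) || (x == j) then 0 else l x end.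
  have ggq x : gg (mate q x) = gg x.
    case: x => x; have [->|xi'] := eqVneq x i; rewrite ?eqi ?esi /= ?eqxx ?orbT //.
    - have [->|xj] := eqVneq x j; first by rewrite eqj.
      by have [-> _] := cc_n e xi' xj; rewrite /= ?(negPf xi') ?(negPf xj).
    - have [->|xj] := eqVneq x j; first by rewrite esj /= !eqxx orbT.
      by have [-> _] := cc_s e xi' xj; rewrite /= ?(negPf xi') ?(negPf xj).
  have gNl : gN gg = l by apply/ffunP=> x; rewrite ffunE.
  have g1 := gfac_sym xi_prim cq ggq; rewrite (gfacE xi_prim) gNl in g1.
  have -> : (chi xi om l)^-1 = chi xi om (gS gg).
    by rewrite -[RHS](mulKf (chi_neq0 xi_prim om l)) g1 mulr1.
  rewrite -[in RHS](gauge_sym ggq) gNl -[in RHS]dact_tl -[in RHS]dact_tr act_v0 !linearZ /=.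
  by rewrite dact_tl.
(* The m fibres of l |-> l i - l j are translates of each other, so [K] cannot vanish, m being
   invertible. *)
have Km : m%:R * K = m%:R ^+ N.
  transitivity (\sum_(l : {ffun 'I_N -> 'I_m}) (1 : k)); last first.
    by rewrite sumr_const cardT -cardE card_ffun !card_ord -natrX.
  rewrite (partition_big (fun l : {ffun 'I_N -> 'I_m} => l i - l j) predT) //=.
  rewrite (eq_bigr (fun=> K)) ?sumr_const ?card_ord ?mulr_natl // => a _.
  rewrite (reindex_inj (addIr (sng i a))) /=; apply: eq_bigl => l.
  rewrite !ffunE eqxx [j == i]eq_sym (negPf ij) addr0 addrAC -[X in (_ == X) = _]add0r.
  by rewrite (inj_eq (addIr _)).
move/eqP; rewrite scalerA scaler_eq0 mulf_eq0 invr_eq0 expf_eq0 (negPf m_unit) andbF /=.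
case/orP=> /eqP // K0; move: Km; rewrite K0 mulr0 => /eqP.
by rewrite eq_sym expf_eq0 (negPf m_unit) andbF.
Qed.

Let L4 a (z : diag 'I_m a N) t : (N <= a)%N -> ~~ full z -> dact C z (v0 t) = 0.
Proof.
move=> Na /(surgery Na)[z' [i [j [e [ij -> l1]]]]].
have := dactM z' (capcup i j e) (v0 t); rewrite l1 scale1r => <-.
by rewrite L3 // linear0.
Qed.

(** Permutations within blocks preserve the weight, so the moved vector is determined by its
    projection to the corner, where [L1] applies. *)
Let perm_v0 s t : dact C (pdiag s) (v0 t) = v0 (svec s t).
Proof.
have -> : w0 (svec s t) = dact CL (pdiag s) (w0 t).
  by rewrite -dgen_s comp_idl dgen_w0.
rewrite -L1 f_ip; apply/esym/eom_fix => l.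
pose l' : {ffun 'I_N -> 'I_m} := [ffun x => l ((bperm s)^-1%g x)].
have -> : dact C (tl l) (dact C (pdiag s) (v0 t)) = dact C (comp (pdiag s) (tl l')) (v0 t).
  rewrite dact_tl; congr (dact C _ _); rewrite /tl /pdiag !comp_wdiag; congr (wdiag (_, _)).
    by apply/ffunP=> x; rewrite !ffunE /= ?perm1 permK addr0 add0r.
  by rewrite mul1g mulg1.
rewrite -dact_tr act_v0 linearZ; congr (_ *: _).
rewrite /chi [LHS](reindex_inj (@perm_inj _ (bperm s))); apply: eq_bigr => x _.
rewrite ffunE permK; congr zeta.
by rewrite -{1}[x](tagnat.sig2K (p_ := lsz)) bperm_Rank /bcol tagnat.Rank1K.
Qed.

(** Sending a generator to d applied to [v0] respects the relations for full diagrams; for the other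
    diagrams, whose generators are 0, [L4] is what makes the formula hold. *)
Let ext_ex a : (N <= a)%N -> exists h : 'Hom(CL a, C a),
  forall d t, h (dgen d (dpure CL t)) = dact C d (v0 t).
Proof.
move=> Na; have [|d l t _|d s t _|h hP] := @d_univ _ _ _ _ _ _ CL a (C a) (fun d t => dact C d (v0 t)).
- move=> d t r e x y; rewrite dpure_lin dgen_lin.
  by rewrite !linearP.
- by rewrite -dact_tr act_v0 linearZ.
- by rewrite -perm_v0 dactM /pdiag loops_wdiagr scale1r.
exists h => d t; have [fd|nf] := boolP (full d); first exact: hP.
by rewrite dgen_nf // linear0 L4.
Qed.

Lemma own_ext : (N <= n)%N -> exists2 h : 'Hom(drep CL n, drep C n),
  (forall x w, h (act (drep CL n) x w) = act (drep C n) x (h w))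
  & forall z, cornerP u v F (h (cornerI u FL z)) = g z.
Proof.
move=> Nn; have [h hP] := ext_ex Nn; have [h0 h0P] := ext_ex (leqnn N).
have comm a a' (h1 : 'Hom(CL a, C a)) (h2 : 'Hom(CL a', C a')) (x : diag 'I_m a' a) :
   (forall d t, h1 (dgen d (dpure CL t)) = dact C d (v0 t)) ->
   (forall d t, h2 (dgen d (dpure CL t)) = dact C d (v0 t)) ->
   forall w, h2 (dact CL x w) = dact C x (h1 w).
  move=> e1 e2 w; suff E : (h2 \o dact CL x)%VF = (dact C x \o h1)%VF.
    by have := congr1 (fun h : 'Hom(CL a, C a') => h w) E; rewrite [LHS]comp_lfunE [RHS]comp_lfunE.
  apply: dC_ext => d t _; rewrite [LHS]comp_lfunE [RHS]comp_lfunE dact_gen linearZ /= e1 e2.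
  by rewrite dactM.
exists h => [x w|z]; first exact: (comm _ _ h h x hP hP w).
have pg w : fpi F (h0 w) = g (fpi FL w).
  suff E : (fpi F \o h0)%VF = (g \o fpi FL)%VF.
    by have := congr1 (fun h : 'Hom(CL N, Y) => h w) E; rewrite [LHS]comp_lfunE [RHS]comp_lfunE.
  apply: dC_ext => d t _; rewrite [LHS]comp_lfunE [RHS]comp_lfunE h0P L1.
  by rewrite dgen_w0.
rewrite cornerIE (comm _ _ _ _ u h0P hP) cornerPE dactM vu dact_id linearZ /= pg f_pi.
by rewrite scalerA mulVf // scale1r.
Qed.

End Ext.
End Gen.
End OwnWeight.

(** * Classes of opposite colours and their blocks of nodes *)

Section Kinds.
Variable m' : nat.
Notation m := m'.+1.

Variant kind := Kself | Kpair | Ktriv.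

Definition kd (r : 'I_m) : kind :=
  if - r == r then Kself else if (r < (- r : 'I_m))%N then Kpair else Ktriv.

(** Each class {c, - c} is represented by its smaller element, so the larger colour of a pair is
    left with an empty factor, [Ktriv]. *)
Definition kcls (c : 'I_m) : 'I_m := if (c <= (- c : 'I_m))%N then c else - c.

Lemma kclsN c : kcls (- c) = kcls c.
Proof. by rewrite /kcls opprK; case: (ltngtP c (- c)) => // /ord_inj. Qed.

Variable sz : 'I_m -> nat.
Notation b := (\sum_(r < m) sz r)%N.

(** The sum over ['I_1] has exactly the form of the number of free nodes of [brauer_cell], a cell
    module for m = 1, so that no transport between sizes is needed when it is used as a factor. *)
Definition psz (K : kind) (r : 'I_m) : nat :=
  match K with
  | Kself => \sum_(i < 1) sz r
  | Kpair => sz r + sz (- r)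
  | Ktriv => 0
  end.

Definition pf K r : 'I_(psz K r) -> 'I_b :=
  match K with
  | Kself => fun j => tagnat.Rank r (tagnat.sig2 (p_ := fun=> sz r) j)
  | Kpair => fun j => match split j with
      inl x => tagnat.Rank r x | inr x => tagnat.Rank (- r) x end
  | Ktriv => fun j => False_rect _ (notF (ltn_ord j))
  end.

Lemma val_sig2 n (j : 'I_(\sum_(i < 1) n)) : tagnat.sig2 (p_ := fun=> n) j = j :> nat.
Proof.
rewrite [RHS](tagnat.rect (p_ := fun=> n)) big_pred0 // => i.
by rewrite [i]ord1 [tagnat.sig1 _]ord1.
Qed.

Lemma pf_mono K r (i j : 'I_(psz K r)) : (K = Kpair -> (r < (- r : 'I_m))%N) ->
  (i < j)%N -> (pf i < pf j)%N.
Proof.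
have blk c (x y : 'I_(sz c)) : (x < y)%N -> (tagnat.Rank c x < tagnat.Rank c y)%N.
  by move=> lt; rewrite !tagnat.RankEsum ltn_add2l.
case: K i j => i j h lt /=; first by apply: blk; rewrite !val_sig2.
  rewrite -(splitK i) -(splitK j) in lt; case: (split i) lt => x; case: (split j) => y /= lt.
  - exact: blk.
  - rewrite ltnNge; apply/negP=> le; have := @tagnat.le_sig1 _ sz (tagnat.Rank (- r) y) (tagnat.Rank r x) le.
    by rewrite !tagnat.Rank1K leEord leqNgt h.
  - by have := ltn_ord y; have := ltn_ord x; lia.
  - by apply: blk; lia.
by case: i lt.
Qed.

Lemma kdP r : [\/ kd r = Kself /\ - r = r, kd r = Kpair /\ (r < (- r : 'I_m))%N
  | kd r = Ktriv /\ ((- r : 'I_m) < r)%N].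
Proof.
rewrite /kd; case: (eqVneq (- r) r) => [|ne]; first by constructor 1.
case: ltngtP => h; [by constructor 2|by constructor 3|].
by case/eqP: ne; apply: ord_inj.
Qed.

Lemma kd_pair r : kd r = Kpair -> (r < (- r : 'I_m))%N.
Proof. by case: (kdP r) => -[-> ]. Qed.

Lemma pf_cls r (j : 'I_(psz (kd r) r)) : kcls (bcol (pf j)) = r.
Proof.
case: (kdP r) => -[E h]; move: j; rewrite E /= /bcol => j.
- by rewrite tagnat.Rank1K /kcls h leqnn.
- case: (split j) => x; rewrite tagnat.Rank1K /kcls ?opprK.
    by rewrite ltnW.
  by rewrite leqNgt h.
- by case: j.
Qed.

Lemma pf_onto c (x : 'I_(sz c)) : exists j : 'I_(psz (kd (kcls c)) (kcls c)), pf j = tagnat.Rank c x.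
Proof.
have ks r y : - r = r -> exists j : 'I_(psz Kself r), pf j = tagnat.Rank r y.
  move=> _; exists (tagnat.Rank (p_ := fun=> sz r) ord0 y); congr tagnat.Rank.
  by apply: ord_inj; rewrite val_sig2 tagnat.RankEsum big_pred0.
rewrite /kcls; case: leqP => h.
  case: (kdP c) => -[-> h']; first exact: ks.
    by exists (lshift _ x); rewrite /= (unsplitK (inl x)).
  by move: h'; rewrite ltnNge h.
case: (kdP (- c)) => -[-> h'].
- by move: h; rewrite -[X in (_ < nat_of_ord X)%N]opprK h' ltnn.
- have E : exists y : 'I_(sz (- - c)), tagnat.Rank (- - c) y = tagnat.Rank c x.
    by rewrite opprK; exists x.
  have [y <-] := E; exists (rshift _ y).
  by rewrite /= (unsplitK (inr y)).
- by move: h'; rewrite opprK ltnNge ltnW.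
Qed.

Lemma pf_bij : bijective (tagf (fun r => @pf (kd r) r)).
Proof.
have inj : injective (tagf (fun r => @pf (kd r) r)).
  move=> [r i] [r' i'] /= e; have E : r = r'.
    by rewrite -(pf_cls i) -(pf_cls i') [pf i]e.
  subst r'; congr existT; apply: ord_inj; move: e; rewrite /tagf /=.
  by case: (ltngtP i i') => // /(pf_mono (@kd_pair r)) + e; rewrite e ltnn.
have /fin_all_exists[g gP] (j : 'I_b) : exists t, tagf (fun r => @pf (kd r) r) t = j.
  rewrite -[j](tagnat.sig2K (p_ := sz)).
  have [i Ei] := pf_onto (tagnat.sig2 j).
  by exists (existT _ (kcls (tagnat.sig1 j)) i); rewrite -Ei.
by exists g => // t; apply: inj; rewrite gP.
Qed.

End Kinds.

(** By the symmetry of delta, the Fourier coefficients at c and - c agree, so both colours of a pair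
    give their loops one parameter. *)
Lemma dbar_kind (k : fieldType) m' (xi : k) (delta : 'I_m'.+1 -> k) (sz : 'I_m'.+1 -> nat) r
    (j : 'I_(psz sz (kd r) r)) : m'.+1.-primitive_root xi ->
  (forall i, delta (- i) = delta i) ->
  dbar xi delta (bcol (pf j)) = dbar xi delta r.
Proof.
move=> xi_prim dN.
have dbN c : dbar xi delta (- c : 'I_m'.+1) = dbar xi delta c.
  rewrite /dbar; congr (_ * _); rewrite (reindex_inj oppr_inj) /=; apply: eq_bigr => i _.
  by rewrite dN; congr (_ * _); exact: (zetaNN xi_prim i c).
case: (kdP r) => -[E h]; move: j; rewrite E /= /bcol => j.
- by rewrite tagnat.Rank1K.
- by case: (split j) => x; rewrite tagnat.Rank1K ?dbN.
- by case: j.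
Qed.

(** * Restriction of modules along a surjection of bases *)

Section Pull.
Variables (k : fieldType) (D E : finType) (f : E -> D).
Hypothesis f_onto : forall x, exists y, f y = x.
Implicit Types M L : rep k D.

Lemma homv_pull M L : homv (pull f M) (pull f L) = homv M L.
Proof.
apply/vspaceP=> g; apply/idP/idP.
  move=> /(@homvP k E (pull f M) (pull f L) g) h; apply/(@homvP k D M L g) => x v.
  by have [y <-] := f_onto x; apply: (h y).
move=> /(@homvP k D M L g) h; apply/(@homvP k E (pull f M) (pull f L) g) => x v.
exact: h.
Qed.

Lemma dim_Hom_pull M L : dim (Hom_rep (pull f M) (pull f L)) = dim (Hom_rep M L).
Proof. by transitivity (\dim (homv (pull f M) (pull f L))); rewrite // homv_pull. Qed.

Lemma isor_pull M L : isor (pull f M) (pull f L) <-> isor M L.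
Proof. by split=> -[g hg gb]; exists g => //; move: hg; rewrite homv_pull. Qed.

Lemma submod_pull M (U : {vspace M}) : submod (M := pull f M) U = submod U.
Proof.
apply/idP/idP.
  move=> /(@submodP k E (pull f M) U) h; apply/(@submodP k D M U) => x v vU.
  by have [y <-] := f_onto x; apply: (h y).
move=> /(@submodP k D M U) h; apply/(@submodP k E (pull f M) U) => x v vU.
exact: h.
Qed.

Lemma simple_pull M : simple (pull f M) <-> simple M.
Proof.
by split=> -[M0 h]; split=> // U sU; apply: h; move: sU; rewrite submod_pull.
Qed.

Lemma mult_pull M L : mult (pull f M) (pull f L) = mult M L.
Proof.
have E1 : @comp_series k E (pull f M) = @comp_series k D M.
  apply/funext=> s; apply/propext; split=> -[l h]; split=> // i /h[s1 s2 s3]; split=> //.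
  - by rewrite -(submod_pull (M := M)).
  - exact: ((simple_pull (comp_factor (M := M) s i)).1 s3).
  - by rewrite (submod_pull (M := M)).
  - exact: ((simple_pull (comp_factor (M := M) s i)).2 s3).
rewrite /mult E1; apply: eq_bigr => i _; congr nat_of_bool.
apply/asboolP/asboolP => h.
  exact: ((isor_pull (comp_factor (M := M) _ i) L).1 h).
exact: ((isor_pull (comp_factor (M := M) _ i) L).2 h).
Qed.

End Pull.

Lemma Rank_sig2 n (j : 'I_(\sum_(i < 1) n)) :
  tagnat.Rank (p_ := fun=> n) ord0 (tagnat.sig2 (p_ := fun=> n) j) = j.
Proof. by apply: ord_inj; rewrite tagnat.RankEsum [X in (X + _)%N]big_pred0 // val_sig2. Qed.

Lemma sig2_Rank n (x : 'I_n) :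
  tagnat.sig2 (p_ := fun=> n) (tagnat.Rank (p_ := fun=> n) (ord0 : 'I_1) x) = x.
Proof. by apply: ord_inj; rewrite val_sig2 tagnat.RankEsum [X in (X + _)%N]big_pred0. Qed.

(** * The Brauer factor of a self-opposite colour *)

Section OnePart.
Variables (k : closedFieldType) (nu : seq nat).
Notation n := (sumn nu).
Notation mu := ((fun=> nu) : 'I_1 -> seq nat).
Notation b := (\sum_(i < 1) n)%N.

(** Identifies the permutations of the single block of size [\sum_(i < 1) n] with those of n
    letters; the inverse law is spelt out because [perm] asks for injectivity. *)
Definition res1 (g : 'S_b) : 'S_n :=
  perm (can_inj (f := fun x => tagnat.sig2 (p_ := fun=> n) (g (tagnat.Rank (p_ := fun=> n) (ord0 : 'I_1) x)))
    (g := fun x => tagnat.sig2 (p_ := fun=> n) ((g^-1)%g (tagnat.Rank (p_ := fun=> n) (ord0 : 'I_1) x)))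
    (fun x => etrans (congr1 (fun j => tagnat.sig2 (p_ := fun=> n) ((g^-1)%g j)) (Rank_sig2 _))
       (etrans (congr1 (tagnat.sig2 (p_ := fun=> n)) (permK g _)) (sig2_Rank x)))).

Definition dres1 (g : 'S_b) : {dffun forall r : 'I_1, 'S_n} := [ffun=> res1 g].

Lemma bperm_const (s : {dffun forall r : 'I_1, 'S_n}) j :
  bperm (sz := fun=> n) s j = tagnat.Rank (p_ := fun=> n) ord0 (s ord0 (tagnat.sig2 (p_ := fun=> n) j)).
Proof. by rewrite -{1}[j]Rank_sig2 bperm_Rank. Qed.

Lemma bperm_dres1 g : bperm (sz := fun=> n) (dres1 g) = g.
Proof. by apply/permP=> j; rewrite bperm_const ffunE permE Rank_sig2 Rank_sig2. Qed.

Lemma wdiag1 (g : wreath 'I_1 b) : wdiag g = pdiag (sz := fun=> n) (dres1 g.2).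
Proof.
by case: g => l s; congr (wdiag (_, _)); [apply/ffunP=> j; rewrite [LHS]ord1 [RHS]ord1|rewrite bperm_dres1].
Qed.

Lemma chi1 (l : {ffun 'I_b -> 'I_1}) : chi (1 : k) (bcol (sz := fun=> n)) l = 1.
Proof. by apply: big1 => j _; rewrite /zeta expr1n. Qed.

(** For m = 1 the induction is from the whole group. A surjection of the induced module onto [Tl]
    already gives the bound on dimensions that [pdim] asks for. *)
Lemma mspecht_dim : (dim (specht k nu) <= dim (mspecht (1 : k) mu))%N.
Proof.
pose y0 (g : 'S_b) : young (ysz mu) := ([ffun=> 0], dres1 g).
have Tp (y : young (ysz mu)) v : act (Tl (1 : k) mu) y (@cpure k 0 1 mu v) = @cpure k 0 1 mu (svec (S := fun=> specht k nu) y.2 v).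
  by case: y => l s; rewrite Tl_pure chi1 scale1r.
have [|f fP] := @mspecht_univ k 0 1 mu (Tl (1 : k) mu) (fun g => act (Tl (1 : k) mu) (y0 g.2)).
  move=> g y t; suff -> : act (Tl (1 : k) mu) (y0 (wmul g (yin y)).2) =
     (act (Tl (1 : k) mu) (y0 g.2) \o act (Tl (1 : k) mu) y)%VF by rewrite comp_lfunE.
  apply/lfunP=> w; apply/eqP; rewrite -subr_eq0.
  set g1 := act _ (y0 (wmul g (yin y)).2); set g2 := (_ \o _)%VF.
  have <- : (g1 - g2) w = g1 w - g2 w by rewrite add_lfunE opp_lfunE.
  rewrite -memv_ker (@cpure_span _ _ _ _ (lker (g1 - g2))) ?memvf // => v.
  rewrite memv_ker add_lfunE opp_lfunE /g2 [X in _ - X]comp_lfunE /g1 !Tp subr_eq0; apply/eqP.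
  congr (@cpure k 0 1 mu _); apply: functional_extensionality_dep => r.
  rewrite /svec !ffunE -specht_actM; congr (act _ _ _).
  have e2 : (wmul g (yin y)).2 = (g.2 * bperm (sz := fun=> n) y.2)%g by [].
  apply/permP=> x; rewrite e2 permM [LHS]permE permM bperm_const sig2_Rank [r]ord1.
  by rewrite [in RHS]/res1 [in RHS]permE.
have onto : limg f = fullv.
  apply: cpure_span => v; have := fP (wone _ _) (@cpure k 0 1 mu v); rewrite Tp mact1 => e.
  have -> : @cpure k 0 1 mu v = f (mvec (@cpure k 0 1 mu v)).
    rewrite e; congr (@cpure k 0 1 mu _); apply: functional_extensionality_dep => r.
    rewrite /svec ffunE (_ : res1 1 = 1%g) ?specht_act1 //.
    by apply/permP=> x; rewrite permE !perm1 sig2_Rank.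
  by rewrite memv_img ?memvf.
have dT : dim (Tl (1 : k) mu) = dim (specht k nu) by rewrite [LHS](dim_big (Yrep (1 : k) mu)) big_ord1.
by rewrite -dT -dimvf -onto -[X in (_ <= X)%N]dimvf -(limg_ker_dim f fullv) leq_addl.
Qed.

End OnePart.

Lemma dgen_eq (k : fieldType) m' (xi : k) delta sz (S : forall r, rep k 'S_(sz r))
    (C : @dcell k m' xi delta sz S) n (d : diag 'I_m'.+1 n _) v v' :
  (forall r, v r = v' r) -> dgen d (dpure C v) = dgen d (dpure C v').
Proof. by move=> e; congr (dgen d (dpure C _)); exact: functional_extensionality_dep. Qed.

Section SelfCell.
Variables (k : closedFieldType) (m' : nat) (xi : k) (delta : 'I_m'.+1 -> k).
Notation m := m'.+1.
Variables (lsz : 'I_m -> nat) (mu : 'I_m -> seq nat) (r : 'I_m).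
Hypothesis rr : - r = r.
Notation sz := (fun c => sumn (mu c)).
Notation S := (fun c => specht k (mu c)).
Notation f1 := (@pf m' lsz Kself r).
Notation h1 := (@pf m' sz Kself r).
Notation dd := (dbar xi delta r).
Notation n1 := (sumn (mu r)).

Lemma kcls_self c : kcls c = r -> c = r.
Proof. by rewrite /kcls; case: leqP => // _ /(congr1 -%R); rewrite opprK rr. Qed.

Definition selfM : rep k (ddiag (@bcol m' lsz) f1) :=
  pull (fun x : ddiag (@bcol m' lsz) f1 => val x) (brauer_cell (\sum_(i < 1) lsz r) dd (mu r)).

Definition C0 : dcell (1 : k) ((fun=> dd) : 'I_1 -> k) (fun _ : 'I_1 => specht k (mu r)) :=
  @dcell_of k 0 1 (fun=> dd) (fun=> erefl) (fun=> mu r).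

Definition selfB (d : diag 'I_1 (\sum_(i < 1) lsz r) (\sum_(i < 1) n1)) (v : forall c, S c) : selfM :=
  dgen (d0 := C0) d (dpure C0 (fun=> v r)).

(** All nodes have the signed colour r = - r, so the colours impose no condition and the factor is
    the full Brauer algebra. *)
Lemma self_compat d : compat (@bcol m' lsz \o f1) (@bcol m' sz \o h1) (d : diag 'I_1 _ _).
Proof.
have col u : colour (@bcol m' lsz \o f1) (@bcol m' sz \o h1) u = r.
  by case: u => i; rewrite /= /bcol tagnat.Rank1K.
by apply/compatP=> u; rewrite !col rr.
Qed.

Lemma self_part (s : {dffun forall c : 'I_m, 'S_(sz c)}) (s' : {dffun forall c : 'I_1, 'S_n1}) :
  s' ord0 = s r -> is_part h1 h1 (pdiag s) (pdiag (sz := fun=> n1) s').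
Proof.
move=> e; have col j : h1 (bperm (sz := fun=> n1) s' j) = bperm s (h1 j).
  by rewrite /= bperm_const bperm_Rank sig2_Rank e.
apply/is_partP=> -[] j /=; first by rewrite !mate_wdl /= -col.
apply: (can_inj (mateK (pdiag s))); rewrite mateK !mate_wdr mate_wdl /=.
by have /= := col (((bperm (sz := fun=> n1) s')^-1)%g j); rewrite permKV => <-.
Qed.

(** The Brauer cell module is itself a cyclotomic cell module for m = 1, so its generators and
    relations are those of [C0]. *)
Definition selfP : pcell xi delta (@kcls m') S r h1 selfM.
Proof.
refine (@Pcell k m' xi delta (@kcls m') _ _ sz S r _ _ f1 h1 selfM
  (cdangle (fun _ : 'I_1 => mu r) (\sum_(i < 1) lsz r)) (fun e => val e) selfB
  _ _ _ _ _ _ _ _ _).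
- move=> d v v' e; have kr : kcls r = r by rewrite /kcls rr leqnn.
  exact: (@dgen_eq _ _ _ _ _ _ C0 _ d (fun=> v r) (fun=> v' r) (fun _ => e r kr)).
- move=> d v c /kcls_self E; subst c => a x y.
  have E' w : selfB d (dfwith v w) = dgen (d0 := C0) d (dpure C0 (@dfwith 'I_1 (fun _ => specht k (mu r)) (fun _ => v r) ord0 w)).
    apply: (@dgen_eq _ _ _ _ _ _ C0 _ d) => i.
    have -> : i = ord0 by exact: ord1.
    transitivity w; first exact: dfwith_in.
    by rewrite /dfwith; case: eqP => // e; rewrite (eq_irrelevance e (erefl _)).
  by rewrite !E' dpure_lin dgen_lin.
- by move=> d v nf; exact: (@dgen_nf _ _ _ _ _ _ C0 _ d (dpure C0 (fun=> v r)) nf).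
- move=> d v s g _ _ gP; pose s' : {dffun forall c : 'I_1, 'S_n1} := [ffun=> s r].
  have hi : injective h1.
    by move=> i j e; apply: ord_inj; case: (ltngtP i j) => // /(pf_mono (K := Kself)) => /(_ (fun h => match h with end)); rewrite e ltnn.
  have -> : g = pdiag (sz := fun=> n1) s'.
    by apply: (part_uniq hi hi gP); apply: self_part; rewrite ffunE.
  rewrite /selfB dgen_s; apply: (@dgen_eq _ _ _ _ _ _ C0 _ d) => i.
  by rewrite /svec ffunE.
- by move=> x d v _; exact: (@dact_gen _ _ _ _ _ _ C0 _ _ (val x) d (dpure C0 (fun=> v r))).
- move=> U hU; apply: (@d_span _ _ _ _ _ _ C0) => d v fd.
  have := hU d (dfwith (fun c => 0 : S c) (v ord0)) (self_compat d) fd.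
  rewrite /selfB dfwith_in (@dgen_eq _ _ _ _ _ _ C0 _ d (fun=> v ord0) v) // => i.
  by rewrite [i]ord1.
- move=> e; exact: self_compat.
- move=> d _ fd; have [e [g [de E]]] := dangle_factor fd.
  exists (Sub e de), [ffun c => dfwith (fun c => 1%g : 'S_(sz c)) (res1 g.2 : 'S_(sz r)) c], (wdiag g).
  split=> //; rewrite wdiag1; apply: self_part.
  by rewrite !ffunE dfwith_in.
- rewrite (big_pred1 r) => [|c]; last first.
    by apply/eqP/eqP => [/kcls_self //|->]; rewrite /kcls rr leqnn.
  rewrite -[X in (_ <= X)%N]/(dim {ffun cdangle (fun _ : 'I_1 => mu r) (\sum_(i < 1) lsz r) -> mspecht (1 : k) (fun=> mu r)}).
  by rewrite dim_ffun leq_mul // mspecht_dim.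
Defined.

End SelfCell.

(** * The walled Brauer factor of a pair of opposite colours *)

Section SumIn.
Variables (p q : nat).

Definition smul (g h : 'S_p * 'S_q) : 'S_p * 'S_q := ((g.1 * h.1)%g, (g.2 * h.2)%g).
Definition sinv (g : 'S_p * 'S_q) : 'S_p * 'S_q := ((g.1^-1)%g, (g.2^-1)%g).
Definition sone : 'S_p * 'S_q := (1%g, 1%g).
Definition sperm (g : 'S_p * 'S_q) : 'S_(p + q) := perm (@sum_fun_inj p q g).

Lemma sperm_l g x : sperm g (lshift q x) = lshift q (g.1 x).
Proof. by rewrite permE /sum_fun (unsplitK (inl x)). Qed.
Lemma sperm_r g x : sperm g (rshift p x) = rshift p (g.2 x).
Proof. by rewrite permE /sum_fun (unsplitK (inr x)). Qed.

Lemma spermM g h : (sperm g * sperm h)%g = sperm (smul g h).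
Proof.
apply/permP=> i; rewrite permM; case: (split_ordP i) => x ->.
  by rewrite !sperm_l permM.
by rewrite !sperm_r permM.
Qed.

Lemma sperm1 : sperm sone = 1%g.
Proof.
apply/permP=> i; rewrite perm1; case: (split_ordP i) => x ->.
  by rewrite sperm_l perm1.
by rewrite sperm_r perm1.
Qed.

Lemma sperm_inj g h : sperm g = sperm h -> g = h.
Proof.
move=> e; rewrite [g]surjective_pairing [h]surjective_pairing; congr (_, _).
  apply/permP=> x; apply: (@lshift_inj p q); by rewrite -!sperm_l e.
apply/permP=> x; apply: (@rshift_inj p q); by rewrite -!sperm_r e.
Qed.

Lemma sum_inM g h : comp (sum_in g) (sum_in h) = sum_in (smul g h).
Proof.
rewrite /sum_in comp_wdiag; congr (wdiag (_, _)); last exact: spermM.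
by apply/ffunP=> j; rewrite [LHS]ord1 [RHS]ord1.
Qed.

Lemma sum_in1 : sum_in sone = idd 'I_1 (p + q).
Proof. by rewrite /sum_in; congr (wdiag (_, _)); exact: sperm1. Qed.

Lemma wdiag_eq1 N (g g' : wreath 'I_1 N) : g.2 = g'.2 -> wdiag g = wdiag g'.
Proof.
case: g g' => l s [l' s'] /= ->; congr (wdiag (_, _)).
by apply/ffunP=> j; rewrite [LHS]ord1 [RHS]ord1.
Qed.

Lemma sperm_ex (s : 'S_(p + q)) : (forall i : 'I_(p + q), (s i < p)%N = (i < p)%N) ->
  exists g, sperm g = s.
Proof.
move=> h.
have /fin_all_exists[a aP] (x : 'I_p) : exists y, s (lshift q x) = lshift q y.
  have lt : (s (lshift q x) < p)%N by rewrite h /= ltn_ord.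
  by exists (Ordinal lt); apply: ord_inj.
have /fin_all_exists[c cP] (x : 'I_q) : exists y, s (rshift p x) = rshift p y.
  have : ~~ (s (rshift p x) < p)%N by rewrite h /= -leqNgt leq_addr.
  case: (split_ordP (s (rshift p x))) => y ->; last by exists y.
  by [].
have ai : injective a by move=> x y e; apply: (@lshift_inj p q); apply: (@perm_inj _ s); rewrite !aP e.
have ci : injective c by move=> x y e; apply: (@rshift_inj p q); apply: (@perm_inj _ s); rewrite !cP e.
exists (perm ai, perm ci); apply/permP=> i; case: (split_ordP i) => x ->.
  by rewrite sperm_l /= permE aP.
by rewrite sperm_r /= permE cP.
Qed.

End SumIn.

(** A subset closed under passing to smaller elements is an initial segment, determined by its
    size. *)
Lemma initial_card b B (P : pred 'I_b) : (forall i j : 'I_b, (i < j)%N -> P j -> P i) ->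
  #|P| = B -> forall i, P i = (i < B)%N.
Proof.
move=> mono cP.
have card_lt n : (n <= b)%N -> #|[pred i : 'I_b | (i < n)%N]| = n.
  move=> le; rewrite -sum1_card (eq_bigl (fun i : 'I_b => (i < n)%N)); last by move=> i; rewrite inE.
  by rewrite (big_ord_narrow le) /= sum1_card card_ord.
move=> i; apply/idP/idP=> h.
  rewrite -cP; apply: leq_trans (_ : (i.+1 <= #|[pred j : 'I_b | (j < i.+1)%N]|)%N) _.
    by rewrite card_lt.
  apply: subset_leq_card; apply/fintype.subsetP=> j; rewrite !inE ltnS leq_eqVlt.
  by case/orP=> [/eqP/ord_inj-> //|lt]; apply: mono lt h.
apply: contraLR h => nP; rewrite -leqNgt -cP -[X in (_ <= X)%N](card_lt i (ltnW (ltn_ord i))).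
apply: subset_leq_card; apply/fintype.subsetP=> j Pj; rewrite inE ltnNge; apply: contra nP.
by rewrite leq_eqVlt => /orP[/eqP/ord_inj-> //|lt]; apply: mono lt Pj.
Qed.

Section WalledFactor.
Variables (A A' B B' : nat).

(* A walled diagram without southern arcs is a walled dangle followed by a
   permutation respecting the wall, as its southern nodes on the left of the
   wall are the first ones in the order of their northern ends. *)
Lemma walled_factor (d : diag 'I_1 (A + A') (B + B')) : walled A B d -> full d ->
  exists e g, [/\ is_dangle e, walled A B e & comp e (sum_in g) = d].
Proof.
move=> /forallP wd fd; have [e [g [de E]]] := dangle_factor fd.
have fe := full_dangle de.
have Em j : mate d (inr (g.2 j)) = mate e (inr j).
  have [/= h _] := comp_wdiagr e g (inr j); rewrite -E h.
  by have [i ->] := fullP _ fe j.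
have En i : isnorth (mate d (inl i)) = isnorth (mate e (inl i)).
  have [/= h _] := comp_wdiagr e g (inl i); rewrite -E h.
  by case: (mate e _).
pose P (j : 'I_(B + B')) := if mate e (inr j) is inl i then (i < A)%N else false.
have PE j : P j = (g.2 j < B)%N.
  have := wd (inr (g.2 j)); rewrite Em /P; have [i ->] := fullP _ fe j.
  by rewrite /=; case: (i < A)%N; case: (g.2 j < B)%N.
have cP : #|P| = B.
  rewrite -(card_image (@perm_inj _ g.2)) -[RHS](card_ord B) -(card_image (@lshift_inj B B')).
  apply: eq_card => j; apply/fintype.imageP/fintype.imageP.
    case=> i Pi ->; move: Pi; rewrite -topredE /= PE => lt.
    by exists (Ordinal lt) => //; apply: ord_inj.
  case=> i _ ->; exists ((g.2^-1)%g (lshift B' i)); last by rewrite permKV.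
  by rewrite -topredE /= PE permKV /= ltn_ord.
have PB := initial_card (P := P) _ cP.
have {}PB j : P j = (j < B)%N.
  apply: PB => i j' lt; rewrite /P; have [x Ex] := fullP _ fe i; have [y Ey] := fullP _ fe j'.
  by rewrite Ex Ey; apply: ltn_trans; apply: (dangle_mono de Ex Ey).
have [s Es] := sperm_ex (s := g.2) (fun j => etrans (esym (PE j)) (PB j)).
exists e, s; split=> //; last first.
  by rewrite -E; congr comp; apply: wdiag_eq1; exact: Es.
have south (j : 'I_(B + B')) : (true == ((j < B)%N == (if mate e (inr j) is inl i then (i < A)%N else false))) .
  by rewrite -PB /P eqxx.
apply/forallP=> -[i|j].
  case Ei : (mate e (inl i)) => [i'|j].
    have := wd (inl i); have := comp_wdiagr e g (inl i); rewrite E Ei => -[/= -> _].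
    by [].
  have := south j; rewrite -Ei mateK /= => /eqP.
  by case: (i < A)%N; case: (j < B)%N.
have := south j; have [i ->] := fullP _ fe j.
by rewrite /=; case: (i < A)%N; case: (j < B)%N.
Qed.

End WalledFactor.

Section PairCell.
Variables (k : closedFieldType) (m' : nat) (xi : k) (delta : 'I_m'.+1 -> k).
Notation m := m'.+1.
Variables (lsz : 'I_m -> nat) (mu : 'I_m -> seq nat) (r : 'I_m).
Hypothesis rlt : (r < (- r : 'I_m))%N.
Notation sz := (fun c => sumn (mu c)).
Notation S := (fun c => specht k (mu c)).
Notation f1 := (@pf m' lsz Kpair r).
Notation h1 := (@pf m' sz Kpair r).
Notation dd := (dbar xi delta r).
Notation A := (lsz r).
Notation A' := (lsz (- r)).
Notation B := (sumn (mu r)).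
Notation B' := (sumn (mu (- r))).

Let rn : - r != r.
Proof. by apply/eqP=> e; move: rlt; rewrite e ltnn. Qed.

Lemma kcls_pair c : kcls c = r -> c = r \/ c = - r.
Proof. by rewrite /kcls; case: leqP => _ e; [left|right; rewrite -e opprK]. Qed.

Lemma kcls_r : kcls r = r. Proof. by rewrite /kcls ltnW. Qed.
Lemma kcls_nr : kcls (- r) = r. Proof. by rewrite kclsN kcls_r. Qed.

Section Colour.
Variables (s1 s2 : 'I_m -> nat).
Notation g1 := (@pf m' s1 Kpair r).
Notation g2 := (@pf m' s2 Kpair r).

Let side a a' b b' (v : 'I_(a + a') + 'I_(b + b')) :=
  match v with inl i => (i < a)%N | inr j => ~~ (j < b)%N end.

Lemma pf_col s (i : 'I_(s r + s (- r))) :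
  bcol (@pf m' s Kpair r i) = if (i < s r)%N then r else - r.
Proof.
have [x E|x E] := split_ordP i; subst i; rewrite /bcol /pf.
  by rewrite (unsplitK (inl x)) tagnat.Rank1K.
by rewrite (unsplitK (inr x)) tagnat.Rank1K.
Qed.

Lemma pair_colour v : colour (@bcol m' s1 \o g1) (@bcol m' s2 \o g2) v =
  if side v then r else - r.
Proof.
case: v => i; first exact: pf_col.
transitivity (- bcol (@pf m' s2 Kpair r i)); first by [].
by rewrite pf_col /side; case: ltnP; rewrite /= ?opprK.
Qed.

(** The signed colour is r on the northern nodes left of the wall and on the southern ones right of
    it, and - r elsewhere. As r and - r differ, opposite values at the ends of a strand mean that
    arcs cross the wall and through strands do not. *)
Lemma pair_compat (d : diag 'I_1 (s1 r + s1 (- r)) (s2 r + s2 (- r))) :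
  compat (@bcol m' s1 \o g1) (@bcol m' s2 \o g2) d = walled (s1 r) (s2 r) d.
Proof.
apply: eq_forallb => v; rewrite !pair_colour.
case: (mate d v) => i'; case: v => i; rewrite /side /= ?eqbF_neg ?eqb_id ?negbK;
  do 2![case: ltnP => _]; rewrite /= ?opprK ?eqxx ?(negPf rn) 1?eq_sym ?(negPf rn) //.
Qed.

End Colour.

Definition wsub (x : ddiag (@bcol m' lsz) f1) : wb_diag A A' :=
  Sub (val x) (etrans (esym (pair_compat (s1 := lsz) (s2 := lsz) (val x))) (valP x)).

Lemma wsub_onto y : exists x, wsub x = y.
Proof.
have P : compat (@bcol m' lsz \o f1) (@bcol m' lsz \o f1) (val y) by rewrite pair_compat (valP y).
by exists (Sub (val y) P : ddiag (@bcol m' lsz) f1); apply: val_inj.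
Qed.

Definition pairM : rep k (ddiag (@bcol m' lsz) f1) :=
  pull wsub (wb_cell A A' dd (mu r) (mu (- r))).

Notation Tw := (tens_rep (pull fst (specht k (mu r))) (pull snd (specht k (mu (- r))))
  : rep k ('S_B * 'S_B')%type).
Notation We := (wb_dangle A A' (mu r) (mu (- r))).
Notation ofE := (fun e : We => val e).
Notation ofG := (@sum_in B B').

Lemma wb_uniq : fac_uniq ofG ofE.
Proof.
move=> e e' g g' h; have /andP[de _] := valP e; have /andP[de' _] := valP e'.
by have [/val_inj -> /(congr1 snd)/sperm_inj ->] := dangle_uniq de de' h.
Qed.

Lemma Tw_lin (X : vectType k) (g g' : 'Hom(Tw, X)) :
  (forall u w, g (pure_tensv u w) = g' (pure_tensv u w)) -> g = g'.
Proof.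
move=> e; apply/lfunP=> t; apply/eqP; rewrite -subr_eq0.
have <- : (g - g') t = g t - g' t by rewrite add_lfunE opp_lfunE.
rewrite -memv_ker (_ : lker (g - g') = fullv) ?memvf //.
apply: (@tens_full k _ (pull fst (specht k (mu r))) (pull snd (specht k (mu (- r))))) => u w.
by rewrite memv_ker add_lfunE opp_lfunE e subrr.
Qed.

Lemma Tw_pure (g : 'S_B * 'S_B') u w :
  act Tw g (pure_tensv u w) = pure_tensv (act (specht k (mu r)) g.1 u) (act (specht k (mu (- r))) g.2 w).
Proof. exact: (@tens_act_pure k _ (pull fst (specht k (mu r))) (pull snd (specht k (mu (- r))))). Qed.

Lemma TwM g h t : act Tw (smul g h) t = act Tw g (act Tw h t).
Proof.
suff -> : act Tw (smul g h) = (act Tw g \o act Tw h)%VF by rewrite [LHS]comp_lfunE.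
by apply: Tw_lin => u w; rewrite [RHS]comp_lfunE !Tw_pure /= !specht_actM.
Qed.

Lemma Tw1 t : act Tw (sone B B') t = t.
Proof.
suff -> : act Tw (sone B B') = \1%VF by rewrite id_lfunE.
by apply: Tw_lin => u w; rewrite id_lfunE !Tw_pure /= !specht_act1.
Qed.

Lemma smulV (g : 'S_B * 'S_B') : smul g (sinv g) = sone B B'.
Proof. by rewrite /smul /= !mulgV. Qed.

(** One direction is [walled_factor]; conversely a permutation respecting the wall preserves the
    walled condition when put below a walled dangle. *)
Lemma wb_factors d : factors ofG ofE d <-> walled A B d /\ full d.
Proof.
split=> [[e [g <-]]|[wd fd]]; last first.
  have [e [g [de we E]]] := walled_factor wd fd.
  have P : is_dangle e && walled A B e by rewrite de we.
  by exists (Sub e P), g.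
have /andP[de we] := valP e; rewrite full_comp_wdiagr full_dangle //; split=> //.
apply/forallP=> v.
pose gw : wreath 'I_1 (B + B') := ([ffun=> 0], sperm g).
have [u ->] := wprK gw v; have [Em _] := comp_wdiagr (val e) gw u.
rewrite -[ofG g]/(wdiag gw) Em.
have sl j : (sperm g j < B)%N = (j < B)%N.
  by case: (split_ordP j) => x ->; rewrite ?sperm_l ?sperm_r /= ?ltn_ord // !(ltnNge _ B) !leq_addr.
have := forallP we u; case: (mate (val e) u) => j; case: u {Em} => j'; rewrite /= ?sl //.
Qed.

Definition pairB (d : diag 'I_1 (A + A') (B + B')) (v : forall c, S c) : pairM :=
  igen (M := Tw) ofG ofE d (pure_tensv (v r) (v (- r))).

Lemma pair_part (s : {dffun forall c : 'I_m, 'S_(sz c)}) :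
  is_part h1 h1 (pdiag s) (sum_in (s r, s (- r))).
Proof.
have col j : h1 (sperm (s r, s (- r)) j) = bperm s (h1 j).
  case: (split_ordP j) => x ->; rewrite ?sperm_l ?sperm_r /=.
    by rewrite !(unsplitK (inl _)) bperm_Rank.
  by rewrite !(unsplitK (inr _)) bperm_Rank.
pose gw : wreath 'I_1 (B + B') := ([ffun=> 0], sperm (s r, s (- r))).
rewrite -[sum_in _]/(wdiag gw).
apply/is_partP=> -[] j.
  by rewrite mate_wdl [RHS]mate_wdl -[RHS]/(inr (bperm s (h1 j))) -col.
apply: (can_inj (mateK (pdiag s))); rewrite mateK mate_wdr [LHS]mate_wdl.
by rewrite -[LHS]/(inr (bperm s (h1 ((gw.2^-1)%g j)))) -col permKV.
Qed.

Lemma pairB_act (x : ddiag (@bcol m' lsz) f1) d v : compat (@bcol m' lsz \o f1) (@bcol m' sz \o h1) d ->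
  act pairM x (pairB d v) = loops (val x) d (fun=> dd) *: pairB (comp (val x) d) v.
Proof.
move=> cd; have [fd|nf] := boolP (full d); last first.
  rewrite /pairB !igen0 ?linear0 ?scaler0 // => /wb_factors[_]; last by move=> h; rewrite h in nf.
  by move=> /full_comp h; rewrite h in nf.
have fac : factors ofG ofE d by apply/wb_factors; split=> //; rewrite -pair_compat.
transitivity (iact (fun=> dd) ofG Tw ofE ofE (val x) (pairB d v)); first by [].
rewrite /pairB (iact_gen (mulG := @smul B B') (oneG := sone B B') (invG := @sinv B B')) //.
- exact: sum_inM.
- exact: sum_in1.
- exact: smulV.
- exact: TwM.
- by move=> g; exists ([ffun=> 0], sperm g).
- exact: wb_uniq.
- exact: wb_uniq.
Qed.

Lemma pairB_s d v s g : compat (@bcol m' lsz \o f1) (@bcol m' sz \o h1) d ->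
  is_part h1 h1 (pdiag s) g -> pairB (comp d g) v = pairB d (svec (S := S) s v).
Proof.
move=> cd gP.
have hi : injective h1.
  by move=> i j e; apply: ord_inj; case: (ltngtP i j) => // /(pf_mono (K := Kpair) (fun _ => rlt)); rewrite e ltnn.
have -> : g = sum_in (s r, s (- r)) by apply: (part_uniq hi hi gP); apply: pair_part.
rewrite /pairB (igen_g (mulG := @smul B B') (oneG := sone B B') (invG := @sinv B B')).
- by rewrite Tw_pure.
- exact: sum_inM.
- exact: sum_in1.
- exact: smulV.
- exact: TwM.
- exact: wb_uniq.
Qed.

Lemma pairB_lin d v c : kcls c = r -> linear (fun u : S c => pairB d (dfwith v u)).
Proof.
case/kcls_pair=> E; subst c => a u u'.
  have e (w : S r) : pairB d (dfwith v w) = igen (M := Tw) ofG ofE d (pure_tensv w (v (- r))).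
    by rewrite /pairB dfwith_in dfwith_out // eq_sym.
  by rewrite !e (pure_linl (v (- r))) igen_lin.
have e (w : S (- r)) : pairB d (dfwith v w) = igen (M := Tw) ofG ofE d (pure_tensv (v r) w).
  by rewrite /pairB dfwith_in dfwith_out.
by rewrite !e (pure_linr (v r)) igen_lin.
Qed.

Lemma pairB_span (U : {vspace pairM}) : (forall d v,
   compat (@bcol m' lsz \o f1) (@bcol m' sz \o h1) d -> full d -> pairB d v \in U) -> U = fullv.
Proof.
move=> hU; apply: (igen_span (ofG := ofG) (oneG := sone B B') (@sum_in1 B B') Tw1 wb_uniq) => e t.
have /andP[de we] := valP e.
pose F := lin_of (igen_lin (M := Tw) ofG ofE (val e)).
suff EU : (F @^-1: U)%VS = fullv by have := memvf t; rewrite -EU -memv_preim lin_ofE.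
apply: (@tens_full k _ (pull fst (specht k (mu r))) (pull snd (specht k (mu (- r))))) => u w.
rewrite -memv_preim lin_ofE.
pose v := dfwith (dfwith (fun c => 0 : S c) (u : S r)) (w : S (- r)).
have -> : igen (M := Tw) ofG ofE (val e) (pure_tensv u w) = pairB (val e) v.
  by rewrite /pairB /v dfwith_in dfwith_out // dfwith_in.
by apply: hU; [rewrite pair_compat|apply: full_dangle].
Qed.

Lemma pair_dim : (#|We| * \prod_(c | kcls c == r) dim (S c) <= dim pairM)%N.
Proof.
rewrite -[X in (_ <= X)%N]/(dim {ffun We -> Tw}) dim_ffun.
have -> : dim Tw = (dim (S r) * dim (S (- r)))%N by exact: dim_tensv.
suff -> : (\prod_(c | kcls c == r) dim (S c) = dim (S r) * dim (S (- r)))%N by [].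
rewrite (bigD1 r) ?kcls_r ?eqxx //; congr (_ * _)%N.
rewrite (bigD1 (- r)) ?kcls_nr ?eqxx ?rn //= big1 ?muln1 // => c.
by case/andP=> /andP[/eqP/kcls_pair[->|->]]; rewrite eqxx.
Qed.

Definition pairP : pcell xi delta (@kcls m') S r h1 pairM.
Proof.
refine (@Pcell k m' xi delta (@kcls m') _ _ sz S r _ _ f1 h1 pairM We (fun e => val e) pairB
  _ _ _ _ _ _ _ _ pair_dim).
- by move=> d v v' e; rewrite /pairB (e r kcls_r) (e (- r) kcls_nr).
- exact: pairB_lin.
- move=> d v nf; apply: igen0 => /wb_factors[_ fd]; by rewrite fd in nf.
- by move=> d v s g cd _; apply: pairB_s.
- exact: pairB_act.
- exact: pairB_span.
- by move=> e; rewrite pair_compat; have /andP[] := valP e.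
- move=> d cd fd; have /wb_factors[e [g E]] : walled A B d /\ full d by rewrite -pair_compat.
  exists e, [ffun c => dfwith (dfwith (fun c => 1%g : 'S_(sz c)) (g.1 : 'S_(sz r))) (g.2 : 'S_(sz (- r))) c], (sum_in g).
  split=> //; have := pair_part [ffun c => dfwith (dfwith (fun c => 1%g : 'S_(sz c)) (g.1 : 'S_(sz r))) (g.2 : 'S_(sz (- r))) c].
  by rewrite !ffunE dfwith_in dfwith_out // dfwith_in -surjective_pairing.
Defined.

End PairCell.

(** * The empty factor of a redundant colour *)

Section TrivCell.
Variables (k : closedFieldType) (m' : nat) (xi : k) (delta : 'I_m'.+1 -> k).
Notation m := m'.+1.
Variables (lsz : 'I_m -> nat) (mu : 'I_m -> seq nat) (r : 'I_m).
Hypothesis rgt : ((- r : 'I_m) < r)%N.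
Notation sz := (fun c => sumn (mu c)).
Notation f1 := (@pf m' lsz Ktriv r).
Notation h1 := (@pf m' sz Ktriv r).

(** No colour has its class represented by [r], as - r is smaller. The factor has no nodes and is
    the trivial module, neutral for tensor products. *)
Definition trivP : pcell xi delta (@kcls m') (fun c => specht k (mu c)) r h1 (triv_rep k (ddiag (@bcol m' lsz) f1)).
Proof.
have nk c : kcls c <> r.
  rewrite /kcls; case: leqP => h e.
    by move: rgt; rewrite -e ltnNge h.
  by move: rgt; rewrite -e opprK ltnNge ltnW.
refine (@Pcell k m' xi delta (@kcls m') _ _ sz (fun c => specht k (mu c)) r _ _ f1 h1 (triv_rep k _)
  unit (fun=> idd 'I_1 0) (fun _ _ => (1 : k^o)) _ _ _ _ _ _ _ _ _).
- by [].
- by move=> d v c /nk.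
- by move=> d v /negP[]; apply/forallP=> -[].
- by [].
- by move=> x d v _; rewrite id_lfunE big_pred0 ?scale1r // => -[].
- move=> U hU; apply/vspaceP=> c; rewrite memvf.
  have f0 : full (idd 'I_1 0) by apply/forallP=> -[].
  have h := hU (idd 'I_1 0) (fun _ => 0) _ f0.
  have -> : c = (c : k) *: (1 : k^o) by apply/esym; apply: mulr1.
  by rewrite memvZ // h //; apply/forallP=> -[] [].
- by move=> e; apply/forallP=> -[] [].
- move=> d _ _; exists tt, [ffun=> 1%g], (idd 'I_1 0); split; first by apply/forallP=> -[] [].
  by apply: eq_diag1 => -[] [].
- by rewrite big_pred0 ?muln1 ?card_unit // => c; apply/eqP; apply: nk.
Defined.

End TrivCell.

(** * Simplicity of the factors of the corner of lam *)

Lemma full_perm N (d : diag 'I_1 N N) : full d -> exists s : 'S_N, d = wdiag ([ffun=> 0], s).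
Proof.
move=> /fullP/fin_all_exists[f fP].
have fi : injective f by move=> i j e; have := fP i; rewrite e -fP => /(can_inj (mateK d))[].
pose s := perm fi; exists (s^-1)%g; apply: eq_diag1 => -[] i.
  rewrite mate_wdl /= -[in LHS](permKV s i) permE -fP mateK.
  by congr (inr _); rewrite -permE.
by rewrite mate_wdr /= invgK permE fP.
Qed.

Lemma simple_image (k : fieldType) (D G : finType) (T : rep k G) (M : rep k D)
    (th : 'Hom(T, M)) (x : G -> D) :
  simple T -> (0 < dim M)%N -> (forall g t, act M (x g) (th t) = th (act T g t)) ->
  limg th = fullv -> simple M.
Proof.
move=> [_ sT] M0 hx onto; split; first by rewrite -dimv_eq0 dimvf -lt0n.
move=> U /submodP sU.
have sP : submod (th @^-1: U)%VS.
  by apply/submodP=> g t; rewrite -!memv_preim -hx => /sU.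
have UE : (th @: (th @^-1: U) = U)%VS.
  apply/vspaceP=> w; apply/memv_imgP/idP=> [[t tU ->]|wU]; first by rewrite memv_preim.
  have /memv_imgP[t _ E] : w \in limg th by rewrite onto memvf.
  by exists t => //; rewrite -memv_preim -E.
by have [E|E] := sT _ sP; [left|right]; rewrite -UE E ?limg0.
Qed.

Lemma pcell_dim_gt0 (k : closedFieldType) m' (xi : k) delta cls N (om : 'I_N -> 'I_m'.+1) sz
    (S : forall r, rep k 'S_(sz r)) r p1 (f1 : 'I_p1 -> 'I_N) (h1 : 'I_p1 -> 'I_(\sum_c sz c))
    (M : rep k (ddiag om f1)) (P : pcell xi delta cls S r h1 M) :
  compat (om \o f1) (bcol (sz := sz) \o h1) (idd 'I_1 p1) -> (forall c, simple (S c)) -> (0 < dim M)%N.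
Proof.
move=> ci sS; apply: leq_trans (pdim P).
have [|e _] := pe_fac P ci; first by apply/fullP=> j; exists j; rewrite mate_wdr invg1 perm1.
rewrite muln_gt0; apply/andP; split; first by apply/card_gt0P; exists e.
by rewrite prodn_gt0 // => c; have [s0 _] := sS c; rewrite -dimvf lt0n dimv_eq0.
Qed.

(** With as many free nodes as strands, diagrams without southern arcs are permutations. So the cell
    module is the image of its simple Specht module, and permutation diagrams act on it
    accordingly. *)
Lemma simple_specht_dim (k : closedFieldType) m' (xi : k) delta (mu : 'I_m'.+1 -> seq nat) (r : 'I_m'.+1)
    (rr : - r = r) : (forall c, simple (specht k (mu c))) ->
  simple (@selfM k m' xi delta (fun c => sumn (mu c)) mu r).
Proof.
move=> sS; set M := selfM _ _ _ _ _.
have l : linear (fun u : specht k (mu r) => dgen (d0 := C0 xi delta mu r) (idd 'I_1 _) (dpure (C0 xi delta mu r) (fun=> u))).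
  move=> a x y.
  have E w : dgen (d0 := C0 xi delta mu r) (idd 'I_1 _) (dpure (C0 xi delta mu r) (fun=> w)) =
      dgen (d0 := C0 xi delta mu r) (idd 'I_1 _) (dpure (C0 xi delta mu r) (@dfwith 'I_1 (fun _ => specht k (mu r)) (fun=> 0) ord0 w)).
    apply: (@dgen_eq _ _ _ _ _ _ (C0 xi delta mu r) _ _) => i; have -> : i = ord0 by exact: ord1.
    by rewrite (@dfwith_in 'I_1 (fun _ => specht k (mu r))).
  by rewrite (E (a *: x + y)) (E x) (E y) dpure_lin dgen_lin.
pose th : 'Hom(specht k (mu r), M) := lin_of l.
have thE u : th u = dgen (d0 := C0 xi delta mu r) (idd 'I_1 _) (dpure (C0 xi delta mu r) (fun=> u)).
  exact: lin_ofE.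
have gE (g : 'S_(\sum_(i < 1) sumn (mu r))) u :
    dgen (d0 := C0 xi delta mu r) (wdiag ([ffun=> 0], g)) (dpure (C0 xi delta mu r) (fun=> u)) = th (act (specht k (mu r)) (res1 g) u).
  rewrite lin_ofE -[wdiag _]comp_idl wdiag1 dgen_s; apply: dgen_eq => i.
  by rewrite /svec ffunE.
pose xg (g : 'S_(sumn (mu r))) : ddiag (@bcol m' (fun c => sumn (mu c))) (@pf m' (fun c => sumn (mu c)) Kself r) :=
  Sub (pdiag (sz := fun=> sumn (mu r)) [ffun _ : 'I_1 => g]) (self_compat rr _).
apply: (simple_image (T := specht k (mu r)) (th := th) (x := xg)) => //.
- exact: pcell_dim_gt0 (@selfP k m' xi delta (fun c => sumn (mu c)) mu r rr) (self_compat rr _) sS.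
- move=> g u; rewrite !thE.
  transitivity (dact (C0 xi delta mu r) (pdiag (sz := fun=> sumn (mu r)) [ffun _ : 'I_1 => g])
    (dgen (d0 := C0 xi delta mu r) (idd 'I_1 _) (dpure (C0 xi delta mu r) (fun=> u)))); first by [].
  rewrite dact_gen /idd loops_wdiagr scale1r -/(idd _ _) comp_idr -[pdiag _]comp_idl dgen_s.
  by apply: (@dgen_eq _ _ _ _ _ _ (C0 xi delta mu r)) => i; rewrite /svec ffunE.
apply: (@d_span _ _ _ _ _ _ (C0 xi delta mu r)) => d v fd.
have [s ->] := full_perm fd.
rewrite (@dgen_eq _ _ _ _ _ _ (C0 xi delta mu r) _ _ v (fun=> v ord0)) => [|i]; last by rewrite [i]ord1.
by rewrite gE memv_img ?memvf.
Qed.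

(** As in the Brauer case, now with the outer tensor product of two Specht modules; it is simple
    over the product group because the field is algebraically closed. *)
Lemma simple_pair (k : closedFieldType) m' (xi : k) delta (mu : 'I_m'.+1 -> seq nat) (r : 'I_m'.+1)
    (rlt : (r < (- r : 'I_m'.+1))%N) : (forall c, simple (specht k (mu c))) ->
  simple (@pairM k m' xi delta (fun c => sumn (mu c)) mu r rlt).
Proof.
move=> sS; set M := pairM _ _ _ _ _.
pose T : rep k ('S_(sumn (mu r)) * 'S_(sumn (mu (- r))))%type :=
  tens_rep (pull fst (specht k (mu r))) (pull snd (specht k (mu (- r)))).
pose ofE (e : wb_dangle (sumn (mu r)) (sumn (mu (- r))) (mu r) (mu (- r))) := val e.
pose th : 'Hom(T, M) := lin_of (igen_lin (M := T) (@sum_in _ _) ofE (idd 'I_1 _)).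
have thE t : th t = igen (M := T) (@sum_in _ _) ofE (idd 'I_1 _) t by exact: lin_ofE.
have igg d g t : igen (M := T) (@sum_in _ _) ofE (comp d (sum_in g)) t = igen (M := T) (@sum_in _ _) ofE d (act T g t).
  apply: (igen_g (mulG := @smul _ _) (oneG := sone _ _) (invG := @sinv _ _)).
  - exact: sum_inM.
  - exact: sum_in1.
  - exact: smulV.
  - exact: TwM.
  - first [exact: (wb_uniq (lsz := fun c => sumn (mu c)) (mu := mu) (r := r)) | exact: (@wb_uniq m' (fun c => sumn (mu c)) mu r) | exact: (@wb_uniq k m' (fun c => sumn (mu c)) mu r)].
have cg g : compat (@bcol m' (fun c => sumn (mu c)) \o @pf m' (fun c => sumn (mu c)) Kpair r)
    (@bcol m' (fun c => sumn (mu c)) \o @pf m' (fun c => sumn (mu c)) Kpair r) (sum_in g).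
  rewrite (pair_compat rlt (s1 := fun c => sumn (mu c)) (s2 := fun c => sumn (mu c))).
  apply/forallP=> -[] j; rewrite /sum_in ?mate_wdl ?mate_wdr /=.
    by case: (split_ordP j) => x ->; rewrite -/(sperm g) ?sperm_l ?sperm_r /= ?ltn_ord // !(ltnNge _ (sumn (mu r))) !leq_addr.
  rewrite -/(sperm g) -{1}[j](permKV (sperm g)); move: ((sperm g)^-1%g j) => {}j.
  by case: (split_ordP j) => x ->; rewrite ?sperm_l ?sperm_r /= ?ltn_ord // !(ltnNge _ (sumn (mu r))) !leq_addr.
have sT : simple T.
  apply: (simple_tens (p1 := fun g => (g.1, 1%g)) (p2 := fun g => (1%g, g.2))).
  - move=> g; split=> //.
    + by apply/lfunP=> w; rewrite id_lfunE /= specht_act1.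
    + by apply/lfunP=> w; rewrite id_lfunE /= specht_act1.
  - have fo (s : 'S_(sumn (mu r))) : exists y : 'S_(sumn (mu r)) * 'S_(sumn (mu (- r))), fst y = s by exists (s, 1%g).
    exact: (simple_pull fo (specht k (mu r))).2 (sS r).
  - have fo (s : 'S_(sumn (mu (- r)))) : exists y : 'S_(sumn (mu r)) * 'S_(sumn (mu (- r))), snd y = s by exists (1%g, s).
    exact: (simple_pull fo (specht k (mu (- r)))).2 (sS (- r)).
pose xg g : ddiag (@bcol m' (fun c => sumn (mu c))) (@pf m' (fun c => sumn (mu c)) Kpair r) := Sub (sum_in g) (cg g).
apply: (simple_image (T := T) (th := th) (x := xg)) => //.
- apply: pcell_dim_gt0 (@pairP k m' xi delta (fun c => sumn (mu c)) mu r rlt) _ sS.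
  by rewrite -sum_in1; apply: cg.
- move=> g t; pose F : 'Hom(T, M) := lin_of (igen_lin (M := T) (@sum_in _ _) ofE (sum_in g)).
  have FE t' : F t' = igen (M := T) (@sum_in _ _) ofE (sum_in g) t' by exact: lin_ofE.
  rewrite [RHS]thE -[RHS]igg comp_idl -FE.
  suff EF : (act M (xg g) \o th)%VF = F.
    by have := congr1 (fun h : 'Hom(T, M) => h t) EF; rewrite [LHS]comp_lfunE.
  apply: Tw_lin => u w; rewrite [LHS]comp_lfunE thE FE.
  pose v := dfwith (dfwith (fun c => 0 : specht k (mu c)) (u : specht k (mu r))) (w : specht k (mu (- r))).
  have vE d : igen (M := T) (@sum_in _ _) ofE d (pure_tensv u w) = @pairB k m' xi delta (fun c => sumn (mu c)) mu r rlt d v.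
    rewrite /pairB /v dfwith_in dfwith_out ?dfwith_in //.
    by apply/eqP=> e; have := rlt; rewrite e ltnn.
  rewrite !vE pairB_act; last by rewrite -sum_in1; apply: cg.
  by rewrite /idd loops_wdiagr scale1r -/(idd _ _) comp_idr.
apply: (@pairB_span k m' xi delta (fun c => sumn (mu c)) mu r rlt) => d v cd fd.
have [s Es] := full_perm fd.
have [g Eg] : exists g, sperm g = s.
  apply: sperm_ex => i; move: cd; rewrite (pair_compat rlt (s1 := fun c => sumn (mu c)) (s2 := fun c => sumn (mu c))).
  move=> /forallP/(_ (inl i)); rewrite Es mate_wdl /=.
  by case: (s i < _)%N; case: (i < _)%N.
have -> : d = comp (idd 'I_1 _) (sum_in g) by rewrite comp_idl Es; apply: wdiag_eq1; rewrite -Eg.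
rewrite -[X in X \in _]/(igen (M := T) (@sum_in _ _) ofE (comp (idd 'I_1 _) (sum_in g)) (pure_tensv (v r) (v (- r)))).
by rewrite igg -thE memv_img ?memvf.
Qed.

(** * Symmetry of the loop parameters from associativity *)

Section LoopOnce.
Variables (Z : finZmodType) (R : pzSemiRingType) (delta : Z -> R).

(** The arcs at p and q form the only loop. It is read downwards at p, its leftmost node, hence
    along [z] first and back along [x]. *)
Lemma loops_once a n c (x : diag Z a n) (z : diag Z n c) (p q : 'I_n) :
  (p < q)%N -> mate x (inr p) = inr q -> mate z (inl p) = inl q ->
  (forall j, j != p -> j != q -> isnorth (mate x (inr j))) ->
  loops x z delta = delta (lab z (inl p) - lab x (inr p)).
Proof.
move=> pq ex ez oth; set phi := cnext x z.
have ex' : mate x (inr q) = inr p by rewrite -ex mateK.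
have ez' : mate z (inl q) = inl p by rewrite -ez mateK.
have p1 : phi (inr (inl p)) = inl (inr q) by rewrite /phi /cnext /= ez.
have p2 : phi (inl (inr q)) = inr (inl p) by rewrite /phi /cnext /= ex'.
have E t : fconnect phi (inr (inl p)) t = (t == inr (inl p)) || (t == inl (inr q)).
  apply/idP/orP=> [/iter_findex <-|[/eqP->|/eqP->]].
  - elim: (findex _ _ _) => [|i [/eqP e|/eqP e]]; first by left.
      by right; rewrite /= e p1.
    by left; rewrite /= e p2.
  - exact: connect0.
  - by rewrite -p1 fconnect1.
have cl : closed_at phi (@glue a n c) (inr (inl p)).
  by move=> t; rewrite E => /orP[]/eqP->.
have root j : loop_root x z j = (j == p).
  apply/loop_rootP/eqP=> [[cj mj]|->]; last first.
    split=> // j'; rewrite /same_loop !E => /orP[]/orP[]/eqP;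
      [by case=> ->|by []|by []|by case=> ->; exact: ltnW].
  have [//|jp] := eqVneq j p; have [jq|jq] := eqVneq j q.
    suff : (q <= p)%N by rewrite leqNgt pq.
    rewrite -jq; apply: mj; rewrite jq sl_sym /same_loop -/phi; apply/orP; right.
    by rewrite E eqxx orbT.
  have := closed_g (@cnext_inj _ _ _ _ x z) (@glueK _ _ _) (@cnext_glue _ _ _ _ x z) cj.
  move=> /(_ _ (fconnect1 _ _))/glue_outer; rewrite /cnext outer_glue /=.
  by have := oth j jp jq; case: (mate x _).
rewrite /loops (eq_bigl _ _ root) big_pred1_eq loop_labelE walk_labelE; congr delta.
rewrite (eq_bigl _ _ E) (bigD1 (inr (inl p))) ?eqxx //; congr (_ + _).
rewrite (big_pred1 (inl (inr q))) => [|t /=]; last first.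
  by have [->|nt] := eqVneq t (inr (inl p)); rewrite ?andbT.
by rewrite /= -ex lab_mate.
Qed.

Lemma loops_small a c (x : diag Z a 1) (z : diag Z 1 c) : loops x z delta = 1.
Proof.
apply: loops1 => j; exists 1%N; left; rewrite /= /cnext /=.
case E: (mate z (inl j)) => [i|i] //=.
by have := mate_neq z (inl j); rewrite E [i]ord1 [j]ord1 eqxx.
Qed.

(** A closed loop passes through at least two central nodes. *)
Lemma loops_le1 a n c (x : diag Z a n) (z : diag Z n c) : (n <= 1)%N -> loops x z delta = 1.
Proof.
case: n x z => [|[|//]] x z _; last exact: loops_small.
by apply: big1 => -[].
Qed.

End LoopOnce.

Section FromAssoc.
Variables (k : fieldType) (Z : finZmodType) (delta : Z -> k) (n : nat).
Hypothesis B_assoc : associative (@dmul k Z delta n).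

Definition dirac (c : k) (x : diag Z n n) : {ffun diag Z n n -> k} :=
  [ffun z => if z == x then c else 0].

Lemma dmul_dirac c e x y :
  dmul delta (dirac c x) (dirac e y) = dirac (loops x y delta * c * e) (comp x y).
Proof.
apply/ffunP=> z; rewrite !ffunE (bigD1 x) //= [X in _ + X]big1 => [|x' nx]; last first.
  by apply: big1 => y' _; rewrite !ffunE (negPf nx) mulr0 mul0r.
rewrite addr0 big_mkcond (bigD1 y) //= [X in _ + X]big1 => [|y' ny]; last first.
  by rewrite !ffunE (negPf ny) mulr0; case: ifP.
by rewrite addr0 !ffunE !eqxx eq_sym.
Qed.

Lemma assoc_loops (x y z : diag Z n n) : loops x y delta * loops (comp x y) z delta = loops y z delta * loops x (comp y z) delta.
Proof.
have := B_assoc (dirac 1 x) (dirac 1 y) (dirac 1 z); rewrite !dmul_dirac !mulr1.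
move=> /ffunP/(_ (comp x (comp y z))); rewrite !ffunE comp_assoc eqxx => e.
by rewrite [LHS]mulrC -e mulrC.
Qed.

(** An arc labelled i stands above a crossing, and the crossing above an unlabelled arc. The
    crossing reverses whichever arc it is multiplied with first, so the two bracketings read the
    same loop in opposite directions. *)
Lemma delta_sym : (1 < n)%N -> forall i, delta (- i) = delta i.
Proof.
case: n B_assoc assoc_loops => [|[|n']] // _ al _ i.
pose p : 'I_n'.+2 := ord0; pose q : 'I_n'.+2 := lift ord0 ord0.
have pq : p != q by [].
pose x := capcup p q i; pose z := capcup p q (0 : Z).
pose g : wreath Z n'.+2 := ([ffun=> 0], tperm p q).
have [xp lx] := cc_si i pq; have [xq lx'] := cc_sj i pq.
have [zp lz] := cc_ni (0 : Z) pq; have [zq lz'] := cc_nj (0 : Z) pq.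
have oth j : j != p -> j != q -> isnorth (mate x (inr j)).
  by move=> jp jq; have [-> _] := cc_s i jp jq.
have [c1 c2] := comp_wdiagr x g (inr q); have [d1 d2] := comp_wdiagl z g (inl q).
rewrite xq /= tpermR tpermL in c1; rewrite xq lx' /= tpermR !ffunE subr0 addr0 in c2.
rewrite zq /= tpermV tpermR tpermL in d1.
rewrite zq lz' /= tpermV tpermR !ffunE subr0 addr0 oppr0 in d2.
have oth' j : j != p -> j != q -> isnorth (mate (comp x (wdiag g)) (inr j)).
  move=> jp jq; have [/= + _] := comp_wdiagr x g (inr j).
  by rewrite tpermD 1?eq_sym // => ->; have := oth j jp jq; case: (mate x _).
have := al x (wdiag g) z; rewrite loops_wdiagr loops_wdiagl !mul1r.
rewrite (loops_once _ (p := p) (q := q) _ c1 zp oth') //.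
rewrite (loops_once _ (p := p) (q := q) _ xp d1 oth) // c2 d2 lz lx.
by rewrite sub0r opprK sub0r => ->.
Qed.

End FromAssoc.

Lemma pull_head (k : fieldType) (D E : finType) (f : E -> D) (A B : rep k D) :
  (forall x, exists y, f y = x) -> simple (pull f A) ->
  mult (pull f B) (pull f A) = mult B (rep_head A).
Proof.
move=> fo sA; have sA' : simple A by apply: (simple_pull fo A).1.
rewrite mult_pull //; apply: mult_isoL => //.
exact: isor_sym (head_simple sA').
Qed.

(** * The Brauer and walled Brauer factors of the formulas *)

Section Factors.
Variables (k : closedFieldType) (m' : nat) (xi : k) (delta : 'I_m'.+1 -> k).
Notation m := m'.+1.
Variables lam mu : 'I_m -> seq nat.
Notation lsz := (fun c => sumn (lam c)).
Notation msz := (fun c => sumn (mu c)).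
Hypothesis sS : forall c, simple (specht k (lam c)).

Definition DBr (nu : 'I_m -> seq nat) (r : 'I_m) := brauer_cell (lsz r) (dbar xi delta r) (nu r).
Definition DWBr (nu : 'I_m -> seq nat) (r : 'I_m) :=
  wb_cell (lsz r) (lsz (- r)) (dbar xi delta r) (nu r) (nu (- r)).

Definition hom_factor K r : nat :=
  match K with
  | Kself => dim (Hom_rep (DBr lam r) (DBr mu r))
  | Kpair => dim (Hom_rep (DWBr lam r) (DWBr mu r))
  | Ktriv => 1
  end.

Definition mult_factor K r : nat :=
  match K with
  | Kself => mult (DBr mu r) (rep_head (DBr lam r))
  | Kpair => mult (DWBr mu r) (rep_head (DWBr lam r))
  | Ktriv => 1
  end.

(** Two modules over one factor algebra, for lam and mu, together with the identification of their
    Hom space and multiplicity with the classical ones. The factor for lam is simple, hence its own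
    head. *)
Record factor_data K r := Factors {
  fl : rep k (ddiag (@bcol m' lsz) (@pf m' lsz K r));
  fm : rep k (ddiag (@bcol m' lsz) (@pf m' lsz K r));
  f_pl : pcell xi delta (@kcls m') (fun c => specht k (lam c)) r (@pf m' lsz K r) fl;
  f_pm : pcell xi delta (@kcls m') (fun c => specht k (mu c)) r (@pf m' msz K r) fm;
  f_simple : simple fl;
  f_hom : dim (Hom_rep fl fm) = hom_factor K r;
  f_mult : mult fm fl = mult_factor K r }.

Lemma sum_ord1 n : (\sum_(i < 1) n = n)%N. Proof. exact: big_ord1. Qed.

Lemma self_onto r (rr : - r = r) (x : diag 'I_1 (\sum_(i < 1) lsz r) (\sum_(i < 1) lsz r)) :
  exists y : ddiag (@bcol m' lsz) (@pf m' lsz Kself r), val y = x.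
Proof. by exists (Sub x (self_compat rr x)). Qed.

Lemma factors_ex r : exists X : factor_data (kd r) r, True.
Proof.
case: (kdP r) => -[-> h].
- have s1 : simple (@selfM k m' xi delta lsz lam r) := simple_specht_dim xi delta h sS.
  unshelve refine (ex_intro _ (@Factors Kself r (@selfM k m' xi delta lsz lam r) (@selfM k m' xi delta lsz mu r)
    (@selfP k m' xi delta lsz lam r h) (@selfP k m' xi delta lsz mu r h) s1 _ _) I).
  + transitivity (dim (Hom_rep (brauer_cell (\sum_(i < 1) lsz r) (dbar xi delta r) (lam r))
      (brauer_cell (\sum_(i < 1) lsz r) (dbar xi delta r) (mu r)))).
      exact: dim_Hom_pull (self_onto h) _ _.
    (* The number of strands changes from a sum over ['I_1] to its value inside a function of that
       number, so no module has to be transported. *)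
    exact: (congr1 (fun a => dim (Hom_rep (brauer_cell a (dbar xi delta r) (lam r))
      (brauer_cell a (dbar xi delta r) (mu r)))) (sum_ord1 _)).
  + transitivity (mult (brauer_cell (\sum_(i < 1) lsz r) (dbar xi delta r) (mu r))
      (rep_head (brauer_cell (\sum_(i < 1) lsz r) (dbar xi delta r) (lam r)))).
      exact: pull_head (self_onto h) s1.
    exact: (congr1 (fun a => mult (brauer_cell a (dbar xi delta r) (mu r))
      (rep_head (brauer_cell a (dbar xi delta r) (lam r)))) (sum_ord1 _)).
- have s1 : simple (@pairM k m' xi delta lsz lam r h) := simple_pair xi delta h sS.
  unshelve refine (ex_intro _ (@Factors Kpair r (@pairM k m' xi delta lsz lam r h) (@pairM k m' xi delta lsz mu r h)
    (@pairP k m' xi delta lsz lam r h) (@pairP k m' xi delta lsz mu r h) s1 _ _) I).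
  + exact: dim_Hom_pull (wsub_onto h) _ _.
  + exact: pull_head (wsub_onto h) s1.
- unshelve refine (ex_intro _ (@Factors Ktriv r (triv_rep k _) (triv_rep k _)
    (@trivP k m' xi delta lsz lam r h) (@trivP k m' xi delta lsz mu r h) (triv_simple k _) _ _) I).
  + exact: dim_hom_triv.
  + rewrite mult_simple ?asboolT //; first [exact: isor_refl | exact: triv_simple].
Qed.

End Factors.

Section ProdKind.
Variable m' : nat.
Notation m := m'.+1.

Lemma val_oppr (r : 'I_m) : (- r : 'I_m) = (if r == 0 :> nat then 0 else m - r)%N :> nat.
Proof.
rewrite -[LHS]/((m - r) %% m)%N; case: eqP => [->|r0]; first by rewrite subn0 modnn.
by rewrite modn_small //; have := ltn_ord r; lia.
Qed.

Lemma inord_opp (r : 'I_m) : (0 < r)%N -> inord (m - r) = - r.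
Proof.
move=> r0; have lr := ltn_ord r; apply: ord_inj; rewrite val_oppr inordK; last by lia.
by case: eqP => // e; move: r0; rewrite e.
Qed.

Lemma kdE (r : 'I_m) : kd r =
  if (r == 0 :> nat) || (r.*2 == m) then Kself else if (r.*2 < m)%N then Kpair else Ktriv.
Proof.
have lr := ltn_ord r; rewrite /kd; have [r0|r0] := eqVneq (r : nat) 0%N.
  by have -> : - r == r by apply/eqP/ord_inj; rewrite val_oppr r0.
have vr : (- r : 'I_m) = (m - r)%N :> nat by rewrite val_oppr (negPf r0).
have -> : (- r == r) = (r.*2 == m).
  apply/eqP/eqP => [/(congr1 (@nat_of_ord m))|e]; first by rewrite vr; lia.
  by apply: ord_inj; rewrite vr; lia.
have -> : (r < (- r : 'I_m))%N = (r.*2 < m)%N by rewrite vr; apply/idP/idP; lia.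
by [].
Qed.

(** The self-opposite colours are 0 and, for even m, m/2; those strictly between 0 and m/2 represent
    the pairs, and the others contribute 1. *)
Lemma prod_kind (A B : 'I_m -> nat) :
  (\prod_(r < m) (match kd r with Kself => A r | Kpair => B r | Ktriv => 1 end) =
   A ord0 * (\prod_(r < m | (0 < r) && (r.*2 < m)) B r) *
   (if odd m then 1 else A (inord m./2)))%N.
Proof.
rewrite (bigD1 ord0) // {1}kdE eqxx orTb -mulnA; congr (_ * _)%N.
transitivity ((\prod_(r < m | r != ord0) (if r.*2 < m then B r else 1)) *
   (\prod_(r < m | r != ord0) (if r.*2 == m then A r else 1)))%N.
  rewrite -big_split; apply: eq_bigr => r r0; rewrite kdE.
  have -> : (r == 0 :> nat) = false by apply: negbTE; rewrite -(inj_eq val_inj) in r0.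
  by rewrite orFb; case: (ltngtP r.*2 m) => _ /=; rewrite ?muln1 ?mul1n.
congr (_ * _)%N.
  rewrite [RHS]big_mkcondr; apply: eq_bigl => r.
  by rewrite -(inj_eq val_inj) lt0n.
case: ifP => om.
  by apply: big1 => r _; case: eqP => // e; move: om; rewrite -e odd_double.
have hm : (m./2).*2 = m by have := odd_double_half m; rewrite om add0n.
have hlt : (m./2 < m)%N by lia.
rewrite (bigD1 (inord m./2)); last first.
  by rewrite -(inj_eq val_inj) [val (inord _)]inordK //; apply/eqP => e; move: hm; rewrite e.
rewrite inordK // hm eqxx big1 => [|r /andP[_ rn]]; first exact: muln1.
case: eqP => // e.
by case/eqP: rn; apply: ord_inj; rewrite inordK //; move: e hm; lia.
Qed.

End ProdKind.

(** Part (i) asserts an isomorphism of vector spaces, so it reduces to this and a computation of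
    dimensions. *)
Lemma isov_dim (k : fieldType) (U V : vectType k) : dim U = dim V -> isov U V.
Proof.
move=> e; pose X := vbasis {:U}; pose Y := vbasis {:V}.
have [f fP] := linear_of_free X Y.
have fXY : map f X = Y.
  by apply: fP; [exact: basis_free (vbasisP _)|rewrite !size_tuple !dimvf e].
have onto : limg (linfun f) = fullv.
  rewrite -(span_basis (vbasisP {:U})) limg_span (eq_map (lfunE f)) fXY.
  exact: span_basis (vbasisP _).
have inj : lker (linfun f) == 0%VS.
  rewrite -dimv_eq0; have := limg_ker_dim (linfun f) fullv; rewrite onto capfv !dimvf e.
  by move/eqP; rewrite -[X in _ == X]add0n eqn_add2r.
exists (linfun f); apply: bij_lker0; first exact/lker0P.
by move=> v; have /memv_imgP[u _ ->] : v \in limg (linfun f) by [rewrite onto memvf]; exists u.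
Qed.

Lemma dim_big_tensv (k : fieldType) (I : Type) (s : seq I) (P : pred I) (F : I -> vectType k) :
  dim (\big[@tensv k/unitv k]_(i <- s | P i) F i) = (\prod_(i <- s | P i) dim (F i))%N.
Proof. by elim/big_rec2: _ => [|i x U _ <-]; rewrite ?dim_tensv. Qed.

(** On at most one node no closed loop can arise, so the module does not depend on the loop
    parameters. *)
Lemma inflate_le1 (k : fieldType) (Z : finZmodType) (delta delta' : Z -> k) n b (D E G : finType)
    (ofD : D -> diag Z n n) (ofE : E -> diag Z n b) (ofG : G -> diag Z b b) (M : rep k G) :
  (n <= 1)%N -> inflate delta ofD ofE ofG M = inflate delta' ofD ofE ofG M.
Proof.
move=> n1; rewrite /inflate; congr (@Rep _ _ _ _); apply: functional_extensionality_dep => x.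
congr (linfun _); apply: functional_extensionality_dep => f.
by apply: eq_bigr => d _; apply: eq_bigr => eg _; rewrite !loops_le1.
Qed.

Lemma cell_le1 (k : fieldType) m' (xi : k) (delta delta' : 'I_m'.+1 -> k) n lam :
  (n <= 1)%N -> cell xi delta n lam = cell xi delta' n lam.
Proof. exact: inflate_le1. Qed.

Section Small.
Variables (k : closedFieldType) (m' : nat) (xi : k) (delta delta' : 'I_m'.+1 -> k).
Variables lam mu : 'I_m'.+1 -> seq nat.
Hypothesis small : (msize lam <= 1)%N.

Lemma DBr_le1 nu r : DBr xi delta lam nu r = DBr xi delta' lam nu r.
Proof.
apply: cell_le1; apply: leq_trans small.
by rewrite /msize (bigD1 r) //= leq_addr.
Qed.

Lemma DWBr_le1 nu (r : 'I_m'.+1) : (r < (- r : 'I_m'.+1))%N -> DWBr xi delta lam nu r = DWBr xi delta' lam nu r.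
Proof.
move=> lt; apply: inflate_le1; apply: leq_trans small.
rewrite /msize (bigD1 r) //= (bigD1 (- r)) /= ?addnA ?leq_addr //.
by apply/eqP=> e; rewrite e ltnn in lt.
Qed.

Lemma hom_factor_le1 r : hom_factor xi delta lam mu (kd r) r = hom_factor xi delta' lam mu (kd r) r.
Proof.
case: (kdP r) => -[-> h]; last by [].
  exact: (f_equal2 (fun U V : rep k _ => dim (Hom_rep U V)) (DBr_le1 lam r) (DBr_le1 mu r)).
exact: (f_equal2 (fun U V : rep k _ => dim (Hom_rep U V)) (DWBr_le1 lam h) (DWBr_le1 mu h)).
Qed.

Lemma mult_factor_le1 r : mult_factor xi delta lam mu (kd r) r = mult_factor xi delta' lam mu (kd r) r.
Proof.
case: (kdP r) => -[-> h]; last by [].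
  exact: (f_equal2 (fun U V : rep k _ => mult V (rep_head U)) (DBr_le1 lam r) (DBr_le1 mu r)).
exact: (f_equal2 (fun U V : rep k _ => mult V (rep_head U)) (DWBr_le1 lam h) (DWBr_le1 mu h)).
Qed.

End Small.

(** * Assembly of the factorisation *)

Section Core.
Variables (k : closedFieldType) (m' : nat) (xi : k) (delta : 'I_m'.+1 -> k).
Notation m := m'.+1.
Hypothesis xi_prim : m.-primitive_root xi.
Hypothesis m_unit : m%:R != 0 :> k.
Hypothesis deltaN : forall i, delta (- i) = delta i.
Variables lam mu : 'I_m -> seq nat.
Notation lsz := (fun c => sumn (lam c)).
Notation om := (@bcol m' lsz).
Notation f := (fun r : 'I_m => @pf m' lsz (kd r) r).
Notation Dp := (DD' om f).

Let fB : bijective (tagf f) := pf_bij lsz.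
Let f_cls r (i : 'I_(psz lsz (kd r) r)) : kcls (om (pf i)) = r := pf_cls i.

Section OneCell.
Variables (nu : 'I_m -> seq nat) (M : forall r, rep k (DD om f r)).
Variable P : forall r, pcell xi delta (@kcls m') (fun c => specht k (nu c)) r
  (@pf m' (fun c => sumn (nu c)) (kd r) r) (M r).

Lemma fourier_ex : exists F : fourier (dcell_of xi deltaN nu) (NN M), True.
Proof.
have hB := pf_bij (fun c => sumn (nu c)).
have h_cls r (i : 'I_(psz (fun c => sumn (nu c)) (kd r) r)) : kcls (bcol (pf i)) = r := pf_cls i.
have f_mono r (i j : 'I_(psz lsz (kd r) r)) : (i < j)%N -> (pf i < pf j)%N.
  by apply: pf_mono; apply: kd_pair.
have dbarf r (i : 'I_(psz lsz (kd r) r)) : dbar xi delta (om (pf i)) = dbar xi delta r.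
  exact: dbar_kind.
have [i [ipi ii]] := sec_ex xi_prim m_unit (@kclsN m') fB f_cls (dcell_of xi deltaN nu) hB h_cls P.
unshelve refine (ex_intro _ (Fourier (ppi_wt xi_prim (@kclsN m') fB f_cls hB h_cls P) _ ipi ii (NN_1 P)) I).
move=> X y w uX cX yP.
exact: (ppi_act xi_prim m_unit deltaN (@kclsN m') fB f_mono f_cls dbarf hB h_cls P w uX cX yP).
Qed.

Lemma pcell_act1 r : act (M r) (DD1 om f r) = \1%VF.
Proof.
suff EU : lker (act (M r) (DD1 om f r) - \1%VF) = fullv.
  apply/lfunP=> v; apply/eqP; rewrite -subr_eq0.
  have := memvf v; rewrite -EU memv_ker add_lfunE opp_lfunE.
  by [].
apply: (pB_span (p := P r)) => d v cd fd; rewrite memv_ker add_lfunE opp_lfunE id_lfunE.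
rewrite pB_act // comp_idl.
rewrite -[X in X *: _]/(loops (idd 'I_1 (psz lsz (kd r) r)) d (fun=> dbar xi delta r)) /idd loops_wdiagl.
by rewrite scale1r subrr.
Qed.

(** The identity diagram acts trivially on every factor, so overwriting coordinates by it isolates
    one factor or removes it. *)
Definition keepD (r : 'I_m) (y : Dp) : Dp := [ffun r' => if r' == r then y r' else DD1 om f r'].
Definition killD (r : 'I_m) (y : Dp) : Dp := [ffun r' => if r' == r then DD1 om f r' else y r'].

Lemma Vrep_indep : indep_family keepD killD (Vrep M).
Proof.
have E r (y : Dp) : act (Vrep M r) y = act (M r) (y r) by [].
move=> r x; split.
- by rewrite !E ffunE eqxx.
- by rewrite E ffunE eqxx pcell_act1.
- by move=> r' ne; rewrite !E !ffunE (negPf ne) pcell_act1.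
Qed.

End OneCell.

Lemma Dp_onto r (x : DD om f r) : exists y : Dp, y r = x.
Proof. by exists [ffun r' => dfwith (fun r' => DD1 om f r') x r']; rewrite ffunE dfwith_in. Qed.

Hypothesis sS : forall c, simple (specht k (lam c)).
Variables (n : nat) (u : diag 'I_m n (msize lam)) (v : diag 'I_m (msize lam) n).
Hypotheses (vu : comp v u = idd 'I_m (msize lam)) (c_neq0 : loops v u delta != 0).
Hypothesis Nn : (msize lam <= n)%N.

(** The corner at the weight of lam has a simple module on the lam side, so heads and multiplicities
    pass to it; Hom spaces pass by [own_ext]. In the corner both modules are tensor products over
    the colours with independent factors, where Hom dimensions and multiplicities multiply. *)
Lemma cell_factors :
  dim (Hom_rep (cell xi delta n lam) (cell xi delta n mu)) =
    (\prod_(r < m) hom_factor xi delta lam mu (kd r) r)%N /\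
  mult (cell xi delta n mu) (rep_head (cell xi delta n lam)) =
    (\prod_(r < m) mult_factor xi delta lam mu (kd r) r)%N.
Proof.
pose X r : factor_data xi delta lam mu (kd r) r := sval (cid (@factors_ex k m' xi delta lam mu sS r)).
pose Ml r : rep k (DD om f r) := fl (X r).
pose Mm r : rep k (DD om f r) := fm (X r).
have PL r : pcell xi delta (@kcls m') (fun c => specht k (lam c)) r (@pf m' lsz (kd r) r) (Ml r) := f_pl (X r).
have PM r : pcell xi delta (@kcls m') (fun c => specht k (mu c)) r
   (@pf m' (fun c => sumn (mu c)) (kd r) r) (Mm r) := f_pm (X r).
have [FL _] := fourier_ex PL; have [FM _] := fourier_ex PM.
have IL := Vrep_indep PL; have IM := Vrep_indep PM.
have CL := cornerC xi_prim (@kclsN m') fB f_cls vu c_neq0 FL.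
have CM := cornerC xi_prim (@kclsN m') fB f_cls vu c_neq0 FM.
have gen : corner_gen (M := drep (dcell_of xi deltaN lam) n) (cornerI u FL).
  exact: (own_gen xi_prim m_unit vu c_neq0).
have sV r : simple (Vrep Ml r) by apply: (simple_pull (@Dp_onto r) (Ml r)).2 (f_simple (X r)).
have sN : simple (NN Ml).
  by apply: (simple_big IL (index_enum_uniq _)) => r _; apply: sV.
split.
- transitivity (dim (Hom_rep (drep (dcell_of xi deltaN lam) n) (drep (dcell_of xi deltaN mu) n))).
    by rewrite !drep_cell.
  have -> := corner_Hom CL gen CM (fun g hg => own_ext xi_prim m_unit (@kclsN m') fB f_cls FL vu c_neq0 FM hg Nn).
  transitivity (\prod_(r <- index_enum 'I_m) dim (Hom_rep (Vrep Ml r) (Vrep Mm r)))%N.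
    exact: dim_hom_big IM IL (index_enum_uniq _).
  apply: eq_bigr => r _; rewrite -(f_hom (X r)).
  exact: dim_Hom_pull (@Dp_onto r) (Ml r) (Mm r).
transitivity (mult (drep (dcell_of xi deltaN mu) n) (rep_head (drep (dcell_of xi deltaN lam) n))).
  by rewrite !drep_cell.
have [_ ->] := corner_mult_head CL gen sN CM.
transitivity (\prod_(r <- index_enum 'I_m) mult (Vrep Mm r) (Vrep Ml r))%N.
  by apply: (mult_big IM IL (index_enum_uniq _)) => r _; apply: sV.
apply: eq_bigr => r _; rewrite -(f_mult (X r)).
exact: mult_pull (@Dp_onto r) (Mm r) (Ml r).
Qed.

End Core.

(* m = m'.+1; the three groups of factors are indexed by 0, by 0 < r < m / 2 and,
   for even m only, by m / 2.  B_assoc says that B_n^m(delta) is an algebra, which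
   for n >= 2 forces delta i = delta (- i). *)
Theorem corollary5p5p2 (k : closedFieldType) (m' n : nat) (xi : k)
    (delta : 'I_m'.+1 -> k) (lam mu : 'I_m'.+1 -> seq nat)
    (m_unit : m'.+1%:R != 0 :> k)
    (xi_prim : m'.+1.-primitive_root xi)
    (B_assoc : associative (@dmul k 'I_m'.+1 delta n))
    (n_gt0 : (0 < n)%N)
    (char_gtn : forall p : nat, p \in [pchar k] -> (n < p)%N)
    (delta_neq0 : ~~ odd n -> exists i, delta i != 0)
    (lamP : Lambda n lam) (muP : Lambda n mu) :
  let m := m'.+1 in
  let omega (r : 'I_m) := sumn (lam r) in
  let h : 'I_m := inord m./2 in
  let neg (r : 'I_m) : 'I_m := inord (m - r) in
  let DB (nu : 'I_m -> seq nat) (r : 'I_m) :=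
    brauer_cell (omega r) (dbar xi delta r) (nu r) in
  let DWB (nu : 'I_m -> seq nat) (r : 'I_m) :=
    wb_cell (omega r) (omega (neg r)) (dbar xi delta r) (nu r) (nu (neg r)) in
  isov (Hom_rep (cell xi delta n lam) (cell xi delta n mu))
       (tensv (Hom_rep (DB lam ord0) (DB mu ord0))
          (tensv (\big[@tensv k/unitv k]_(r < m | (0 < r)%N && (r.*2 < m)%N)
                     Hom_rep (DWB lam r) (DWB mu r))
             (if odd m then unitv k else Hom_rep (DB lam h) (DB mu h))))
  /\
  mult (cell xi delta n mu) (rep_head (cell xi delta n lam)) =
    (mult (DB mu ord0) (rep_head (DB lam ord0))
     * \prod_(r < m | (0 < r)%N && (r.*2 < m)%N) mult (DWB mu r) (rep_head (DWB lam r))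
     * (if odd m then 1 else mult (DB mu h) (rep_head (DB lam h))))%N.
Proof.
move=> m omega h neg DB DWB.
have [/andP[/forallP lamPart /andP[Nn ev]]] := conj lamP I; move=> _.
have sS c : simple (specht k (lam c)).
  apply: specht_simple => // p /char_gtn; apply: leq_ltn_trans; apply: leq_trans Nn.
  by rewrite /msize (bigD1 c) //= leq_addr.
(* Stated for an arbitrary symmetric parameter, since for n <= 1 it will be applied to a constant
   one instead of delta. *)
have main delta' : (forall i, delta' (- i) = delta' i) -> (~~ odd n -> exists i, delta' i != 0) ->
  dim (Hom_rep (cell xi delta' n lam) (cell xi delta' n mu)) =
    (\prod_(r < m) hom_factor xi delta' lam mu (kd r) r)%N /\
  mult (cell xi delta' n mu) (rep_head (cell xi delta' n lam)) =
    (\prod_(r < m) mult_factor xi delta' lam mu (kd r) r)%N.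
  move=> dN d0; have nE : (msize lam + ((n - msize lam)./2).*2 = n)%N.
    by rewrite -[in RHS](subnKC Nn); congr addn; have := odd_double_half (n - msize lam); rewrite (negPf ev).
  have [|u [v [vu c0]]] := linkedE dN ((n - msize lam)./2) (N := msize lam).
    (* If lam is empty then n is even, and the assumption provides a non-zero parameter for closing
       the last loop. *)
    by move=> N0; apply: d0; rewrite -nE N0 add0n odd_double.
  rewrite nE in u v vu c0; exact: (cell_factors xi_prim m_unit dN mu sS vu c0 Nn).
have {main} [Hhom Hmult] :
  dim (Hom_rep (cell xi delta n lam) (cell xi delta n mu)) =
    (\prod_(r < m) hom_factor xi delta lam mu (kd r) r)%N /\
  mult (cell xi delta n mu) (rep_head (cell xi delta n lam)) =
    (\prod_(r < m) mult_factor xi delta lam mu (kd r) r)%N.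
  (* For n >= 2 associativity makes delta symmetric. For n <= 1 nothing changes on either side when
     delta is replaced by the constant 1, which is symmetric and non-zero. *)
  have [n1|n1] := leqP n 1; last first.
    by apply: main delta_neq0; apply: (delta_sym B_assoc n1).
  have [|E1 E2] := main (fun=> 1) (fun=> erefl).
    by move=> _; exists ord0; rewrite oner_eq0.
  have small := leq_trans Nn n1.
  rewrite !(cell_le1 xi delta (fun=> 1) _ n1) E1 E2; split; apply: eq_bigr => r _.
    exact: hom_factor_le1.
  exact: mult_factor_le1.
have Hhom' := etrans Hhom (prod_kind (fun r => dim (Hom_rep (DBr xi delta lam lam r) (DBr xi delta lam mu r)))
  (fun r => dim (Hom_rep (DWBr xi delta lam lam r) (DWBr xi delta lam mu r)))).
have Hmult' := etrans Hmult (prod_kind (fun r => mult (DBr xi delta lam mu r) (rep_head (DBr xi delta lam lam r)))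
  (fun r => mult (DWBr xi delta lam mu r) (rep_head (DWBr xi delta lam lam r)))).
have negE (r : 'I_m) : (0 < r)%N -> neg r = - r by exact: inord_opp.
split.
  apply: isov_dim; rewrite Hhom' !dim_tensv dim_big_tensv -mulnA; congr (_ * (_ * _))%N.
    by apply: eq_bigr => r /andP[r0 _]; rewrite /DWB (negE r r0).
  by case: (odd m).
rewrite Hmult'; congr (_ * _ * _)%N.
by apply: eq_bigr => r /andP[r0 _]; rewrite /DWB (negE r r0).
Qed.
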